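(* Let $M$ be a smooth manifold and let $\varphi$ be a generalized polynomial structure on $M$. The following are equivalent: (1) the semisimple part $\varphi_s$ of $\varphi$ is a weak generalized Nijenhuis operator; (2) $(\mu+\nu)[\![L_\mu,L_\nu]\!]\subseteq L_\mu+L_\nu$ for all $\mu,\nu\in\Sigma(\varphi)$; (3) there exists a decomposition of the de Rham operator $d=\sum_{\lambda\in\Sigma(\varphi)}\delta_\lambda$ such that for every $\lambda\in\Sigma(\varphi)\setminus\{0\}$, $\delta_\lambda$ is of degree $1$ with respect to the $(L_\lambda,L_{-\lambda})$-grading and of degree $0$ with respect to the $(L_\mu,L_{-\mu})$-grading whenever $\mu\in\Sigma(\varphi)$ and $\mu\notin\{0,\lambda,-\lambda\}$.
   Context: $\mathbb{T}M=TM\oplus T^*M$ carries the tautological inner product $\langle X+\alpha,Y+\beta\rangle=\frac12(\alpha(Y)+\beta(X))$, and the Dorfman bracket $[\![X+\alpha,Y+\beta]\!]=[X,Y]+\mathcal{L}_X\beta-\iota_Yd\alpha$ on sections; both are extended $\mathbb{C}$-bilinearly to $\mathbb{T}M\otimes\mathbb{C}$. $\Omega_M$ is the sheaf of differential forms and $\mathcal{E}_M$ the sheaf of $\mathbb{R}$-linear endomorphisms of $\Omega_M$; the operators $\delta_\lambda$ are sections of $\mathcal{E}_M\otimes\mathbb{C}$. A generalized polynomial structure is a $C^\infty$-linear endomorphism $\varphi$ of $\mathbb{T}M$, skew-symmetric for $\langle\cdot,\cdot\rangle$, for which there is a monic polynomial $P(x)\in\mathbb{R}[x]$ of positive degree that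 is the minimal polynomial of $\varphi_p$ on $\mathbb{T}_pM$ for every $p\in M$. $\Sigma(\varphi)\subset\mathbb{C}$ is the set of eigenvalues of $\varphi$ (it is symmetric about $0$), $m(\lambda)$ is the multiplicity of $\lambda$ as a root of $P$, and $L_\lambda={\rm Ker}((\varphi-\lambda I)^{m(\lambda)})\subseteq\mathbb{T}M\otimes\mathbb{C}$. The semisimple part $\varphi_s$ is the semisimple endomorphism whose $\lambda$-eigenbundle is $L_\lambda$ for each $\lambda\in\Sigma(\varphi)$ (fiberwise, the semisimple part in the Jordan–Chevalley decomposition). For an endomorphism $\psi$ of $\mathbb{T}M$, the Courant–Nijenhuis torsion is $\mathcal{T}_\psi(\mathbf{x},\mathbf{y})=\psi^2[\![\mathbf{x},\mathbf{y}]\!]+[\![\psi(\mathbf{x}),\psi(\mathbf{y})]\!]-\psi([\![\psi(\mathbf{x}),\mathbf{y}]\!]+[\![\mathbf{x},\psi(\mathbf{y})]\!])$ and the shifted Courant–Nijenhuis torsion is $\mathcal{S}_\psi(\mathbf{x},\mathbf{y})=\mathcal{T}_\psi(\psi(\mathbf{x}),\mathbf{y})+\mathcal{T}_\psi(\mathbf{x},\psi(\mathbf{y}))$. $\psi$ is a weak generalized Nijenhuis operator if $\mathcal{S}_\psi=0$. Gradings: sections of $\mathbb{T}M\otimes\mathbb{C}$ act on $\Omega_M\otimes\mathbb{C}$ by $(X+\alpha)\omega=\iota_X\omega+\alpha\wedge\omega$. For $\lambda\ne0$, $L_\lambda$ and $L_{-\lambda}$ are isotropic of the same rank $k$, and the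 inner product is non-degenerate on $L_\lambda\oplus L_{-\lambda}$. For $L=L_\lambda$, $L'=L_{-\lambda}$, let $K_L\subseteq\Omega_M\otimes\mathbb{C}$ be the subsheaf of all $\rho$ with $l\rho=0$ for all $l\in L$. The $(L,L')$-grading is $\Omega_M\otimes\mathbb{C}=\bigoplus_{r=0}^k(\bigwedge^rL')\otimes K_L$, where the degree $r$ piece is the span of the forms $l'_1\cdots l'_r\rho$ with $l'_i\in L'$, $\rho\in K_L$. An operator has degree $a$ with respect to this grading if it maps the degree $r$ piece into the degree $r+a$ piece for every $r$.
   Formalization: In (3), δ_0 too must have degree 0 for the (L_μ,L_{-μ})-grading for every μ∈Σ(φ)\{0}; as printed δ_0 is unconstrained, so if 0∈Σ(φ) taking δ_0=d and other δ_λ=0 makes (3) always true although (2) can fail. *)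

(* Defs.v *)
From HB Require Import structures.
From mathcomp Require Import all_boot all_order all_algebra.
From mathcomp Require Import complex.
From mathcomp Require Import all_classical all_reals all_analysis.

Set Implicit Arguments.
Unset Strict Implicit.
Unset Printing Implicit Defensive.

Import Order.TTheory GRing.Theory Num.Theory.
Import numFieldNormedType.Exports.

Local Open Scope classical_set_scope.
Local Open Scope complex_scope.
Local Open Scope ring_scope.

Section Dual.
Variables (R : realType) (V : lmodType R).

Definition is_linform : {pred V -> R^o} := fun f => `[< linear f >].

Fact is_linform_submod : submod_closed is_linform.
Proof.
split=> [|a f g /asboolP lf /asboolP lg]; apply/asboolP.
  move=> b x y; have E z : (0 : V -> R^o) z = 0 by [].
  by rewrite !E scaler0 addr0.
move=> b x y.
have E z : (a *: f + g) z = a *: f z + g z by [].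
by rewrite !E lf lg !scalerDr !scalerA [b * a]mulrC -!addrA; congr (_ + _); rewrite addrCA.
Qed.

HB.instance Definition _ :=
  GRing.isSubmodClosed.Build R (V -> R^o) is_linform is_linform_submod.

Record dual := Dual { dual_fun :> V -> R^o; _ : dual_fun \in is_linform }.

HB.instance Definition _ := [isSub for dual_fun].
HB.instance Definition _ := [Choice of dual by <:].
HB.instance Definition _ := [SubChoice_isSubLmodule of dual by <:].

End Dual.

Section Exterior.
Variables (R : realType) (V : lmodType R).

(* An element of the exterior algebra of V^* is a function on finite lists of *)
(* vectors whose restriction to lists of length k is its component in degree  *)
(* k, an alternating k-linear form.  When V is finite dimensional, components *)
(* of large degree vanish, so this is the (finite) direct sum.                *)
Definition multilinear_form (w : seq V -> R^o) : Prop :=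
  forall (s1 : seq V) (a : R) (x y : V) (s2 : seq V),
    w (s1 ++ (a *: x + y) :: s2) = a * w (s1 ++ x :: s2) + w (s1 ++ y :: s2).

Definition alternating_form (w : seq V -> R^o) : Prop :=
  forall (s1 : seq V) (x : V) (s2 : seq V), w (s1 ++ x :: x :: s2) = 0.

Definition is_extform : {pred seq V -> R^o} :=
  fun w => `[< multilinear_form w /\ alternating_form w >].

Fact is_extform_submod : submod_closed is_extform.
Proof.
split=> [|a f g /asboolP [mf af] /asboolP [mg ag]]; apply/asboolP; split.
- move=> s1 b x y s2; have E z : (0 : seq V -> R^o) z = 0 by [].
  by rewrite !E mulr0 addr0.
- by [].
- move=> s1 b x y s2.
  have E z : (a *: f + g) z = a * f z + g z by [].
  rewrite !E mf mg !mulrDr !mulrA [b * a]mulrC -!addrA; congr (_ + _).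
  by rewrite addrCA.
- move=> s1 x s2.
  have E z : (a *: f + g) z = a * f z + g z by [].
  by rewrite E af ag mulr0 addr0.
Qed.

HB.instance Definition _ :=
  GRing.isSubmodClosed.Build R (seq V -> R^o) is_extform is_extform_submod.

Record extform :=
  ExtForm { extform_fun :> seq V -> R^o; _ : extform_fun \in is_extform }.

HB.instance Definition _ := [isSub for extform_fun].
HB.instance Definition _ := [Choice of extform by <:].
HB.instance Definition _ := [SubChoice_isSubLmodule of extform by <:].

Lemma extformP (w : extform) : multilinear_form w /\ alternating_form w.
Proof. by case: w => w /= wP; apply/asboolP. Qed.

Definition contract_fun (x : V) (w : seq V -> R^o) : seq V -> R^o :=
  fun s => w (x :: s).

Fact contract_subproof (x : V) (w : extform) : contract_fun x w \in is_extform.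
Proof.
have [mw aw] := extformP w; apply/asboolP; split.
- by move=> s1 a y z s2; apply: (mw (x :: s1)).
- by move=> s1 y s2; apply: (aw (x :: s1)).
Qed.

Definition contract (x : V) (w : extform) : extform :=
  ExtForm (contract_subproof x w).

Definition omit (T : Type) (i : nat) (s : seq T) : seq T :=
  take i s ++ drop i.+1 s.

Definition wedge1_fun (a : V -> R^o) (w : seq V -> R^o) : seq V -> R^o :=
  fun s => \sum_(i < size s) (-1) ^+ i * (a (nth 0 s i) * w (omit i s)).

Lemma wedge1_nil a w : wedge1_fun a w [::] = 0.
Proof. by rewrite /wedge1_fun big_ord0. Qed.

Lemma wedge1_cons a w x s :
  wedge1_fun a w (x :: s) = a x * w s - wedge1_fun a (contract_fun x w) s.
Proof.
rewrite /wedge1_fun big_ord_recl /= expr0 mul1r /omit /= drop0; congr (_ + _).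
rewrite -sumrN; apply: eq_bigr => i _.
by rewrite /bump /= add1n exprS mulN1r mulNr /contract_fun.
Qed.

Lemma wedge1_lin a (b : R) (f g : seq V -> R^o) (h : seq V -> R^o) s :
  (forall s, h s = b * f s + g s) ->
  wedge1_fun a h s = b * wedge1_fun a f s + wedge1_fun a g s.
Proof.
move=> hE; rewrite /wedge1_fun mulr_sumr -big_split /=; apply: eq_bigr => i _.
rewrite hE !mulrDr !mulrA; congr (_ + _); congr (_ * _).
by rewrite -!mulrA [RHS]mulrCA; congr (_ * _); rewrite mulrC.
Qed.

Lemma wedge1_eq0 a (w : seq V -> R^o) s :
  (forall s, w s = 0) -> wedge1_fun a w s = 0.
Proof. by move=> w0; apply: big1 => i _; rewrite w0 !mulr0. Qed.

Fact wedge1_subproof (a : dual V) (w : extform) :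
  wedge1_fun a w \in is_extform.
Proof.
have la : linear a by case: a => a /= aP; apply/asboolP.
apply/asboolP; split.
- move=> s1; have := extformP w; move: (extform_fun w) => {w} w [+ _].
  elim: s1 w => [|z s1 IH] w mw b x y s2 /=.
    rewrite !wedge1_cons la.
    rewrite (@wedge1_lin a b (contract_fun x w) (contract_fun y w));
      last by move=> s; apply: (mw [::]).
    have -> : b *: a x = b * a x by [].
    by rewrite mulrDl mulrBr opprD mulrA addrACA.
  rewrite !wedge1_cons mw IH; last by move=> t1 c u v t2; apply: (mw (z :: t1)).
  by rewrite mulrDr mulrBr opprD addrACA mulrCA.
- move=> s1; have := extformP w; move: (extform_fun w) => {w} w [_ +].
  elim: s1 w => [|z s1 IH] w aw x s2 /=.
    rewrite !wedge1_cons wedge1_eq0 ?subr0 ?subrr //.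
    by move=> s; apply: (aw [::]).
  rewrite wedge1_cons IH ?subr0; first by rewrite (aw s1) mulr0.
  by move=> t1 u t2; apply: (aw (z :: t1)).
Qed.

Definition wedge1 (a : dual V) (w : extform) : extform :=
  ExtForm (wedge1_subproof a w).

End Exterior.

Section OneForms.
Variables (R : realType) (V : lmodType R).

Definition form1_fun (a : V -> R^o) : seq V -> R^o :=
  fun s => if s is [:: v] then a v else 0.

Fact form1_subproof (a : dual V) : form1_fun a \in is_extform (V := V).
Proof.
have la : linear a by case: a => a /= aP; apply/asboolP.
apply/asboolP; split.
- case=> [|z [|z' s1]] b x y [|u s2] //=; rewrite ?mulr0 ?addr0 //.
  exact: la.
- by case=> [|z [|z' s1]].
Qed.

Definition form1 (a : dual V) : extform V := ExtForm (form1_subproof a).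

Fact deg1_subproof (w : extform V) : (fun v => w [:: v]) \in is_linform (V := V).
Proof. by apply/asboolP => a x y; have [mw _] := extformP w; apply: (mw [::]). Qed.

Definition deg1 (w : extform V) : dual V := Dual (deg1_subproof w).

End OneForms.

Section Endomorphisms.
Variables (R : realType) (V : lmodType R).

Definition poly_end (Q : {poly R}) (f : V -> V) (x : V) : V :=
  \sum_(i < size Q) Q`_i *: iter i f x.

Definition is_minpoly (f : V -> V) (P : {poly R}) : Prop :=
  [/\ P \is monic, forall x, poly_end P f x = 0
    & forall Q : {poly R}, (forall x, poly_end Q f x = 0) -> P %| Q].

End Endomorphisms.

Section Complexification.
Variable R : realType.

(* (x, y) stands for x + i y *)
Definition cpx (V : lmodType R) : Type := (V * V)%type.

HB.instance Definition _ (V : lmodType R) := GRing.Zmodule.copy (cpx V) (V * V)%type.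

Definition cpx_scale (V : lmodType R) (c : R[i]) (x : cpx V) : cpx V :=
  (complex.Re c *: x.1 - complex.Im c *: x.2,
   complex.Re c *: x.2 + complex.Im c *: x.1).

Section Scaling.
Variable V : lmodType R.

Fact cpx_scaleA (a b : R[i]) (x : cpx V) :
  cpx_scale a (cpx_scale b x) = cpx_scale (a * b) x.
Proof.
case: a b x => [a a'] [b b'] [x y]; rewrite /cpx_scale /=; congr (_, _).
  rewrite !scalerBr !scalerDr !scalerBl !scalerDl !scalerA !opprD -!addrA.
  by congr (_ + _); rewrite [RHS]addrC -addrA.
rewrite !scalerBr !scalerDr !scalerBl !scalerDl !scalerA -!addrA.
by congr (_ + _); rewrite [RHS]addrC -addrA.
Qed.

Fact cpx_scale1 : left_id 1 (@cpx_scale V).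
Proof. by case=> x y; rewrite /cpx_scale /= !scale1r !scale0r subr0 addr0. Qed.

Fact cpx_scaleDr : right_distributive (@cpx_scale V) +%R.
Proof.
move=> c [x y] [z t]; rewrite /cpx_scale /=; congr (_, _) => /=.
  by rewrite !scalerDr opprD addrACA.
by rewrite !scalerDr addrACA.
Qed.

Fact cpx_scaleDl (x : cpx V) : {morph (@cpx_scale V)^~ x : a b / a + b}.
Proof.
case: x => [x y] [a a'] [b b']; rewrite /cpx_scale /=; congr (_, _) => /=.
  by rewrite !scalerDl opprD addrACA.
by rewrite !scalerDl addrACA.
Qed.

HB.instance Definition _ := GRing.Zmodule_isLmodule.Build R[i] (cpx V)
  cpx_scaleA cpx_scale1 cpx_scaleDr cpx_scaleDl.

End Scaling.

Definition cpx_lin (V W : lmodType R) (f : V -> W) (x : cpx V) : cpx W :=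
  (f x.1, f x.2).

Definition cpx_bilin (U V W : lmodType R) (B : U -> V -> W)
    (x : cpx U) (y : cpx V) : cpx W :=
  (B x.1 y.1 - B x.2 y.2, B x.1 y.2 + B x.2 y.1).

End Complexification.

Fixpoint Ck (R : realType) (n k : nat) (O : set 'rV[R]_n) (f : 'rV[R]_n -> R) : Prop :=
  (forall x, O x -> {for x, continuous f}) /\
  (if k is k'.+1 then
     forall i : 'I_n, (forall x, O x -> derivable f x (delta_mx 0 i)) /\
                      Ck k' O (fun x => 'D_(delta_mx 0 i) f x)
   else True).

Definition Cinfty (R : realType) (n : nat) (O : set 'rV[R]_n) (f : 'rV[R]_n -> R) :=
  forall k, Ck k O f.

(* Values of [chart_map] outside [chart_dom], and of [chart_inv] outside its  *)
(* image, are irrelevant.                                                     *)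
Record chart (R : realType) (n : nat) (T : topologicalType) := Chart {
  chart_dom : set T;
  chart_map : T -> 'rV[R]_n;
  chart_inv : 'rV[R]_n -> T;
  chart_open_dom : open chart_dom;
  chart_open_img : open (chart_map @` chart_dom);
  chart_mapK : forall p, chart_dom p -> chart_inv (chart_map p) = p;
  chart_map_continuous : {within chart_dom, continuous chart_map};
  chart_inv_continuous : {within chart_map @` chart_dom, continuous chart_inv}
}.

Record smooth_manifold (R : realType) (n : nat) := SmoothManifold {
  carrier :> topologicalType;
  carrier_hausdorff : hausdorff_space carrier;
  carrier_second_countable : @second_countable carrier;
  atlas : set (chart R n carrier);
  atlas_cover : forall p, exists2 c, atlas c & chart_dom c p;
  atlas_compat : forall c e, atlas c -> atlas e -> forall j : 'I_n,
    Cinfty (chart_map c @` (chart_dom c `&` chart_dom e))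
           (fun x => chart_map e (chart_inv c x) 0 j)
}.

Section Geometry.
Variables (R : realType) (n : nat) (M : smooth_manifold R n).

Definition smooth_fun (U : set M) (f : M -> R) : Prop :=
  forall c, atlas c ->
    Cinfty (chart_map c @` (U `&` chart_dom c)) (f \o chart_inv c).

Definition smooth_at (p : M) (f : M -> R) : Prop :=
  exists U, [/\ open U, U p & smooth_fun U f].

(* Tangent vectors at p are the derivations of the algebra of germs at p of   *)
(* smooth functions.  They are presented as functionals on all functions      *)
(* M -> R, with value 0 on functions which are not smooth near p.             *)
Definition derivation_at (p : M) (v : (M -> R^o) -> R^o) : Prop :=
  [/\ forall f g, smooth_at p f -> (\near p, f p = g p) -> v f = v g,
      forall (a : R) f g, smooth_at p f -> smooth_at p g ->
        v (fun q => a * f q + g q) = a * v f + v g,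
      forall f g, smooth_at p f -> smooth_at p g ->
        v (fun q => f q * g q) = v f * g p + f p * v g
    & forall f, ~ smooth_at p f -> v f = 0].

Definition is_tangent (p : M) : {pred (M -> R^o) -> R^o} :=
  fun v => `[< derivation_at p v >].

Fact is_tangent_submod (p : M) : submod_closed (is_tangent p).
Proof.
split=> [|a v w /asboolP [v1 v2 v3 v4] /asboolP [w1 w2 w3 w4]]; apply/asboolP.
  have E z : (0 : (M -> R^o) -> R^o) z = 0 by [].
  by split=> *; rewrite !E ?mulr0 ?mul0r ?addr0.
have E z : (a *: v + w) z = a * v z + w z by [].
split=> [f g sf fg|b f g sf sg|f g sf sg|f nf]; rewrite !E.
- by rewrite (v1 f g) // (w1 f g).
- by rewrite v2 // w2 // !mulrDr addrACA mulrCA.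
- rewrite v3 // w3 // mulrDl !mulrDr addrACA mulrA.
  by congr (_ + _ + (_ + _)); rewrite mulrCA.
- by rewrite v4 // w4 // mulr0 addr0.
Qed.

HB.instance Definition _ (p : M) :=
  GRing.isSubmodClosed.Build R ((M -> R^o) -> R^o) (is_tangent p) (is_tangent_submod p).

Record tangent (p : M) := Tangent {
  tangent_fun :> (M -> R^o) -> R^o;
  _ : tangent_fun \in is_tangent p
}.

HB.instance Definition _ (p : M) := [isSub for @tangent_fun p].
HB.instance Definition _ (p : M) := [Choice of tangent p by <:].
HB.instance Definition _ (p : M) := [SubChoice_isSubLmodule of tangent p by <:].

(* The fibres at p of TM (+) T^*M and of the bundle of differential forms. *)
Definition gtan (p : M) : lmodType R := (tangent p * dual (tangent p))%type.
Definition forms_at (p : M) : lmodType R := extform (tangent p).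

(* Not necessarily smooth sections.  A section over an open set U is given by *)
(* a global one which is smooth on U; its values outside U are irrelevant.    *)
Definition vfield := forall p : M, tangent p.
Definition gfield := forall p : M, gtan p.
Definition form := forall p : M, forms_at p.
Definition cgfield := forall p : M, cpx (gtan p).
Definition cform := forall p : M, cpx (forms_at p).

Definition smooth_vfield (U : set M) (X : vfield) : Prop :=
  forall V f, open V -> V `<=` U -> smooth_fun V f -> smooth_fun V (fun q => X q f).

Definition smooth_vfields (U : set M) (s : seq vfield) : Prop :=
  forall i, (i < size s)%N -> smooth_vfield U (nth (fun=> 0) s i).

Definition smooth_form (U : set M) (w : form) : Prop :=
  forall V s, open V -> V `<=` U -> smooth_vfields V s ->
    smooth_fun V (fun q => extform_fun (w q) [seq (X : vfield) q | X <- s]).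

Definition smooth_gfield (U : set M) (x : gfield) : Prop :=
  smooth_vfield U (fun p => (x p).1) /\ smooth_form U (fun p => form1 (x p).2).

Definition smooth_cgfield (U : set M) (x : cgfield) : Prop :=
  smooth_gfield U (fun p => (x p).1) /\ smooth_gfield U (fun p => (x p).2).

Definition smooth_cform (U : set M) (w : cform) : Prop :=
  smooth_form U (fun p => (w p).1) /\ smooth_form U (fun p => (w p).2).

(* If X and Y are smooth near p, then f |-> X_p (Y f) - Y_p (X f) is a        *)
(* derivation at p, and it is the value at p of the bracket; the default      *)
(* value 0 of [insubd] is only used for non-smooth fields.                    *)
Definition lie_bracket (X Y : vfield) : vfield := fun p =>
  insubd (0 : tangent p) (fun f : M -> R^o =>
    if `[< smooth_at p f >] then X p (fun q => Y q f) - Y p (fun q => X q f)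
    else 0).

(* Cartan's formula:                                                          *)
(*   dw(X_0,...,X_k) = \sum_i (-1)^i X_i (w(X_0,..^i..,X_k))                  *)
(*          + \sum_(i < j) (-1)^(i+j) w([X_i,X_j],X_0,..^i..^j..,X_k)         *)
Definition cartan_formula (w : form) (s : seq vfield) (p : M) : R :=
  let X i : vfield := nth (fun=> 0) s i in
  let ev (q : M) (t : seq vfield) := [seq (Y : vfield) q | Y <- t] in
  \sum_(i < size s)
     (-1) ^+ i * X i p (fun q => extform_fun (w q) (ev q (omit i s)))
  + \sum_(j < size s) \sum_(i < j)
     (-1) ^+ (i + j)
       * extform_fun (w p) (lie_bracket (X i) (X j) p :: ev p (omit i (omit j s))).

(* For w smooth near p, there is exactly one such element. *)
Definition exterior_d (w : form) : form := fun p =>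
  xget (0 : forms_at p) [set e : forms_at p |
    forall U s, open U -> U p -> smooth_vfields U s ->
      extform_fun e [seq (X : vfield) p | X <- s] = cartan_formula w s p].

Definition exterior_dC (w : cform) : cform := fun p =>
  (exterior_d (fun q => (w q).1) p, exterior_d (fun q => (w q).2) p).

(* Cartan's L_X = i_X d + d i_X *)
Definition lie_derivative (X : vfield) (w : form) : form := fun p =>
  contract (X p) (exterior_d w p) + exterior_d (fun q => contract (X q) (w q)) p.

Definition inner (p : M) (x y : gtan p) : R :=
  2^-1 * (x.2 y.1 + y.2 x.1).

Definition dorfman (x y : gfield) : gfield := fun p =>
  let X : vfield := fun q => (x q).1 in
  let Y : vfield := fun q => (y q).1 in
  let a : form := fun q => form1 (x q).2 in
  let b : form := fun q => form1 (y q).2 in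
  (lie_bracket X Y p,
   deg1 (lie_derivative X b p - contract (Y p) (exterior_d a p))).

Definition dorfmanC (x y : cgfield) : cgfield := fun p =>
  let xr : gfield := fun q => (x q).1 in let xi : gfield := fun q => (x q).2 in
  let yr : gfield := fun q => (y q).1 in let yi : gfield := fun q => (y q).2 in
  (dorfman xr yr p - dorfman xi yi p, dorfman xr yi p + dorfman xi yr p).

Definition clifford (p : M) (x : gtan p) (w : forms_at p) : forms_at p :=
  contract x.1 w + wedge1 x.2 w.

Definition cliffordC (p : M) : cpx (gtan p) -> cpx (forms_at p) -> cpx (forms_at p) :=
  cpx_bilin (@clifford p).

Definition gendo := forall p : M, {linear gtan p -> gtan p}.

Definition smooth_gendo (phi : gendo) : Prop :=
  forall U x, open U -> smooth_gfield U x -> smooth_gfield U (fun p => phi p (x p)).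

Definition gen_poly_structure (phi : gendo) (P : {poly R}) : Prop :=
  [/\ smooth_gendo phi,
      forall p (x y : gtan p), inner (phi p x) y = - inner x (phi p y),
      P \is monic, (1 < size P)%N
    & forall p, is_minpoly (phi p) P].

Definition spectrum (phi : gendo) : set R[i] :=
  [set lam | exists p, exists2 x : cpx (gtan p), x <> 0 &
    cpx_lin (phi p) x = lam *: x].

Definition subbundle := forall p : M, set (cpx (gtan p)).

(* L_lam = Ker (phi - lam)^m(lam) *)
Definition geigen (phi : gendo) (P : {poly R}) (lam : R[i]) : subbundle := fun p =>
  [set x | iter (mup lam (map_poly (real_complex R) P))
             (fun y : cpx (gtan p) => cpx_lin (phi p) y - lam *: y) x = 0].
Arguments geigen : clear implicits.

Definition is_semisimple_at (p : M) (f : gtan p -> gtan p) : Prop :=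
  forall x : cpx (gtan p), exists (N : nat) (a : 'I_N -> R[i]) (y : 'I_N -> cpx (gtan p)),
    (forall i, cpx_lin f (y i) = a i *: y i) /\ x = \sum_(i < N) y i.

Definition is_semisimple_part (phi : gendo) (P : {poly R}) (phis : gendo) : Prop :=
  [/\ smooth_gendo phis,
      forall p, is_semisimple_at (phis p)
    & forall p lam, spectrum phi lam -> forall x : cpx (gtan p),
        cpx_lin (phis p) x = lam *: x <-> geigen phi P lam p x].

Definition CN_torsion (psi : gendo) (x y : gfield) : gfield := fun p =>
  let psi' (z : gfield) : gfield := fun q => psi q (z q) in
  psi p (psi p (dorfman x y p)) + dorfman (psi' x) (psi' y) p
  - psi p (dorfman (psi' x) y p + dorfman x (psi' y) p).

Definition shifted_CN_torsion (psi : gendo) (x y : gfield) : gfield := fun p =>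
  CN_torsion psi (fun q => psi q (x q)) y p + CN_torsion psi x (fun q => psi q (y q)) p.

Definition weak_gen_Nijenhuis (psi : gendo) : Prop :=
  forall U x y, open U -> smooth_gfield U x -> smooth_gfield U y ->
    forall p, U p -> shifted_CN_torsion psi x y p = 0.

Definition is_section (L : subbundle) (U : set M) (x : cgfield) : Prop :=
  smooth_cgfield U x /\ forall p, U p -> L p (x p).

Definition annihilated (L : subbundle) (U : set M) (rho : cform) : Prop :=
  smooth_cform U rho /\
  forall V l, open V -> V `<=` U -> is_section L V l ->
    forall p, V p -> cliffordC (l p) (rho p) = 0.

(* The sections over U of the subsheaf spanned by the l'_1 ... l'_r rho.  As  *)
(* L' has rank k and is isotropic, this is 0 for r > k.                       *)
Definition graded_piece (L L' : subbundle) (r : nat) (U : set M) (w : cform) : Prop :=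
  smooth_cform U w /\
  forall p, U p -> exists (V : set M) (N : nat)
      (l : 'I_N -> r.-tuple cgfield) (rho : 'I_N -> cform),
    [/\ open V, V p & V `<=` U] /\
    [/\ forall j i, is_section L' V (tnth (l j) i),
        forall j, annihilated L V (rho j)
      & forall q, V q -> w q =
          \sum_(j < N) foldr (fun (x : cgfield) => cliffordC (x q)) (rho j q) (l j)].

(* A global section of the sheaf of C-linear endomorphisms of the sheaf of    *)
(* complex differential forms, that is, of E_M (x) C: a C-linear map on       *)
(* sections over U for each open U, compatible with restrictions.             *)
Record sheaf_endo := SheafEndo {
  sheaf_op :> set M -> cform -> cform;
  sheaf_op_smooth : forall U w, open U -> smooth_cform U w ->
    smooth_cform U (sheaf_op U w);
  sheaf_op_linear : forall U (c : R[i]) w e, open U ->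
    smooth_cform U w -> smooth_cform U e -> forall p, U p ->
    sheaf_op U (fun q => c *: w q + e q) p = c *: sheaf_op U w p + sheaf_op U e p;
  sheaf_op_restrict : forall U V w e, open U -> open V -> V `<=` U ->
    smooth_cform U w -> smooth_cform V e -> (forall p, V p -> w p = e p) ->
    forall p, V p -> sheaf_op U w p = sheaf_op V e p
}.

Definition has_degree (L L' : subbundle) (a : nat) (D : sheaf_endo) : Prop :=
  forall U r w, open U -> graded_piece L L' r U w -> graded_piece L L' (r + a) U (D U w).

End Geometry.

Arguments geigen {R n M} phi P lam p _.

(* Main.v *)
(** Let pi_l be the projection onto L_l, let e_a be a local frame of TM + T*M
    with dual frame e^a for the pairing 2<.,.>, and put
    N_l = sum_a (pi_(-l) e_a)(pi_l e^a) in the Clifford algebra. For l <> 0 the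
    degree r piece of the (L_l, L_(-l))-grading is the eigenspace of N_l for the
    eigenvalue r, so D has degree a iff [N_l, D] = a D. The Dorfman bracket is a
    derived bracket: [x, y] acts on forms as [{d, x}, y].

    (1) <-> (2): on sections of L_m and L_k the shifted torsion of phi_s is
    (m + k) (phi_s - m) (phi_s - k) [x, y].

    (2) -> (3): write ad_l = [N_l, -]. Integrability, and the fact that
    pi (D pi) pi = 0 for an idempotent pi and a derivation D, give
    ad_l^3 d = ad_l d for l <> 0 and ad_m ad_l d = 0 for m <> l, -l. Take
    delta_l = (ad_l^2 + ad_l) d / 2 for l <> 0 and let delta_0 be the remainder.
    When 0 is not an eigenvalue, delta_0 is a cubic Clifford element. Choosing
    one label from each pair {l, -l}, the sum G of the corresponding N_l has
    [G, delta_0] = 0, whereas on vectors [G, -] has square 1, hence on cubics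
    only the eigenvalues 1, -1, 3, -3: so delta_0 = 0.

    (3) -> (2): for x, y, t in L_m, L_k, L_(-j) with m + k <> 0 and j <> m, k,
    let S be the set of nonzero elements of {m, k, -j} and N_S the sum of N_l
    over S. The function {[{d, x}, y], t} has weight 0 for N_S, but x, y, t
    have total weight at least 2 in absolute value while d splits into pieces
    of weight -1, 0, 1; hence the function vanishes. *)

From HB Require Import structures.
From mathcomp Require Import all_boot all_order all_algebra.
From mathcomp Require Import complex.
From mathcomp Require Import all_classical all_reals all_analysis.
From mathcomp Require Import ring lra.
Require Import Defs.

Set Implicit Arguments.
Unset Strict Implicit.
Unset Printing Implicit Defensive.

Import Order.TTheory GRing.Theory Num.Theory.
Import numFieldNormedType.Exports.

Local Open Scope classical_set_scope.
Local Open Scope complex_scope.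
Local Open Scope ring_scope.


(** * Differential calculus of functions of class C^k *)

(** The manifold enters through a few facts about a chart domain V. Sections over V, cut off to zero
    outside V, form abelian groups; vectors and d act as elements of the ring of additive
    endomorphisms of the local forms. In that ring the theorem is noncommutative algebra with
    integer coefficients, built on a derived bracket, central pairings, orthogonal idempotents and a
    dual frame. Local bases of L_l are never chosen: projecting a full frame gives an over-complete
    family, and the frame expansions survive the projection. The projections are polynomials in phi
    whose coefficients are constant along M, because the minimal polynomial is; this makes them
    smooth. That degrees are eigenvalues of N_l also has to be seen without bases: N (N - 1) ... (N
    - 2n) = 0 holds for N = N_l, as a product of more than 2n anticommuting vectors taken from a
    family of 2n vanishes. Tangent vectors are derivations of germs, so coordinate expansions rest
    on Hadamard's lemma, which accounts for the calculus of the first sections. *)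

Section CkCalculus.
Variables (R : realType) (n : nat).
Implicit Types (O : set 'rV[R]_n) (f g : 'rV[R]_n -> R).

Local Notation e_ i := (delta_mx 0 i : 'rV[R]_n).

Lemma open_near_eq (T : topologicalType) (U : Type) (A : set T) (f g : T -> U) x :
  open A -> A x -> (forall y, A y -> f y = g y) -> \near x, f x = g x.
Proof.
move=> oA Ax fg; have : nbhs x A by apply: open_nbhs_nbhs.
by apply: filterS.
Qed.

Lemma continuous_at_ext O f g x : open O -> O x -> (forall y, O y -> f y = g y) ->
  {for x, continuous f} -> {for x, continuous g}.
Proof.
move=> oO Ox fg cf; have fgx : \forall y \near x, f y = g y by exact: open_near_eq Ox fg.
by apply: cvg_trans (near_eq_cvg fgx) _; rewrite -fg.
Qed.

Lemma Ck_ext k O f g : open O -> (forall x, O x -> f x = g x) ->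
  Ck k O f -> Ck k O g.
Proof.
move=> oO; elim: k f g => [|k IH] f g fg /= [cf df]; split=> //.
- by move=> x Ox; apply: continuous_at_ext fg (cf x Ox).
- by move=> x Ox; apply: continuous_at_ext fg (cf x Ox).
move=> i; have [d1 d2] := df i; split.
  move=> x Ox; apply: near_eq_derivable (d1 x Ox).
  exact: open_near_eq Ox fg.
apply: IH d2 => x Ox; apply: near_eq_derive.
exact: open_near_eq Ox fg.
Qed.

Lemma CkW k O f : Ck k.+1 O f -> Ck k O f.
Proof.
elim: k f => [|k IH] f /= [cf df]; split=> // i.
by have [d1 d2] := df i; split=> //; apply: IH.
Qed.

Lemma Ck_le k l O f : (k <= l)%N -> Ck l O f -> Ck k O f.
Proof.
move=> /subnK <-; elim: (l - k)%N => // m IH.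
by rewrite addSn => /CkW; exact: IH.
Qed.

Lemma Ck_sub k O Q f : Q `<=` O -> Ck k O f -> Ck k Q f.
Proof.
move=> OO; elim: k f => [|k IH] f /= [cf df]; split=> //.
- by move=> x /OO; exact: cf.
- by move=> x /OO; exact: cf.
move=> i; have [d1 d2] := df i; split; last exact: IH.
by move=> x /OO; exact: d1.
Qed.

(** Both clauses of [Ck] are pointwise, with derivatives of the function on the whole space, so
    nothing has to be glued. *)
Lemma Ck_local k O f : (forall x, O x -> exists2 Q, Q x & Ck k Q f) -> Ck k O f.
Proof.
elim: k f => [|k IH] f H /=; split=> //.
- by move=> x /H [Q Qx [cf _]]; exact: cf.
- by move=> x /H [Q Qx [cf _]]; exact: cf.
move=> i; split; first by move=> x /H [Q Qx [_ /(_ i) [d1 _]]]; exact: d1.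
by apply: IH => x /H [Q Qx [_ /(_ i) [_ d2]]]; exists Q.
Qed.

Lemma Ck_cst k O (a : R) : open O -> Ck k O (fun=> a).
Proof.
move=> oO; elim: k a => [|k IH] a /=; split=> //.
- by move=> x _; exact: cst_continuous.
- by move=> x _; exact: cst_continuous.
move=> i; split=> [x _|]; first exact: derivable_cst.
by apply: Ck_ext (IH 0) => // x _; rewrite derive_cst.
Qed.

Lemma Ck_D k O f g : open O -> Ck k O f -> Ck k O g -> Ck k O (fun x => f x + g x).
Proof.
move=> oO; elim: k f g => [|k IH] f g /= [cf df] [cg dg]; split=> //.
- by move=> x Ox; exact: continuousD (cf x Ox) (cg x Ox).
- by move=> x Ox; exact: continuousD (cf x Ox) (cg x Ox).
move=> i; have [df1 df2] := df i; have [dg1 dg2] := dg i; split.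
  by move=> x Ox; apply: derivableD; [exact: df1|exact: dg1].
apply: Ck_ext (IH _ _ df2 dg2) => // x Ox.
by rewrite [RHS]deriveD; [|exact: df1|exact: dg1].
Qed.

Lemma Ck_M k O f g : open O -> Ck k O f -> Ck k O g -> Ck k O (fun x => f x * g x).
Proof.
move=> oO; elim: k f g => [|k IH] f g /= [cf df] [cg dg]; split=> //.
- by move=> x Ox; exact: continuousM (cf x Ox) (cg x Ox).
- by move=> x Ox; exact: continuousM (cf x Ox) (cg x Ox).
move=> i; have [df1 df2] := df i; have [dg1 dg2] := dg i; split.
  by move=> x Ox; apply: derivableM; [exact: df1|exact: dg1].
have Cf : Ck k O f by apply: CkW; split.
have Cg : Ck k O g by apply: CkW; split.
apply: Ck_ext (Ck_D oO (IH _ _ Cf dg2) (IH _ _ Cg df2)) => // x Ox.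
by rewrite [RHS]deriveM; [|exact: df1|exact: dg1].
Qed.

Lemma Ck_sum k O (I : Type) (r : seq I) (F : I -> 'rV[R]_n -> R) : open O ->
  (forall i, Ck k O (F i)) -> Ck k O (fun x => \sum_(i <- r) F i x).
Proof.
move=> oO H; elim: r => [|i r IH].
  by apply: Ck_ext (Ck_cst k 0 oO) => // x _; rewrite big_nil.
by apply: Ck_ext (Ck_D oO (H i) IH) => // x _; rewrite big_cons.
Qed.

Lemma coord_is_derive (i j : 'I_n) (x : 'rV[R]_n) :
  is_derive x (e_ i) (fun y => y 0 j : R) ((i == j)%:R).
Proof.
have d : differentiable (fun y : 'rV[R]_n => y 0 j : R) x by exact: differentiable_coord.
have := derivableP (diff_derivable (v := e_ i) d).
rewrite deriveE //.
have -> : 'd (fun y : 'rV[R]_n => y 0 j : R) x (e_ i) = (i == j)%:R; last by [].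
pose L := (fun y : 'rV[R]_n => y 0 j : R).
have lL : linear L by move=> a y z; rewrite /L !mxE.
pose LM := GRing.isLinear.Build _ _ _ _ L lL.
pose LL : {linear 'rV[R]_n -> R} := HB.pack L LM.
have cL : continuous LL by exact: coord_continuous.
have -> := @diff_lin _ _ _ LL x cL.
by rewrite /= /L mxE eqxx eq_sym.
Qed.

Lemma Ck_coord k O (j : 'I_n) : open O -> Ck k O (fun x => x 0 j).
Proof.
move=> oO; have cc x : O x -> {for x, continuous (fun x : 'rV[R]_n => x 0 j : R)}.
  by move=> _; exact: coord_continuous.
case: k => [|k] /=; split=> // i; split.
  by move=> x _; have [] := coord_is_derive i j x.
apply: Ck_ext (Ck_cst k (i == j)%:R oO) => // x _.
by have := coord_is_derive i j x => H; rewrite derive_val.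
Qed.

End CkCalculus.

(** * Mean value theorem along a line *)

Section DirectionalDerivatives.
Variables (R : realType) (V : normedModType R).
Implicit Types (f : V -> R) (x v : V).

Lemma is_derive_line f x v (s : R) : derivable f (s *: v + x) v ->
  is_derive s 1 (fun s => f (s *: v + x)) ('D_v f (s *: v + x)).
Proof.
move=> df.
have E : (fun h : R => h^-1 *: (((fun s => f (s *: v + x)) \o shift s) (h *: 1)
             - f (s *: v + x))) =
         (fun h : R => h^-1 *: ((f \o shift (s *: v + x)) (h *: v) - f (s *: v + x))).
  apply/funext => h /=; congr (_ *: (f _ - _)).
  by have -> : h *: (1 : R) = h; [rewrite /GRing.scale /= mulr1|rewrite scalerDl addrA].
have d : derivable (fun s : R => f (s *: v + x)) s 1 by rewrite /derivable E.
have := derivableP d.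
by have -> : 'D_1 (fun s : R => f (s *: v + x)) s = 'D_v f (s *: v + x) by rewrite /derive E.
Qed.

(** The one-variable theorem wants ordered endpoints, so the two signs of t are treated separately.
    The intermediate point is recorded only through its absolute value, which suits a displacement
    by a coordinate of either sign. *)
Lemma MVT_line f x v (t : R) :
  (forall s : R, `|s| <= `|t| -> derivable f (s *: v + x) v) ->
  exists2 s : R, `|s| <= `|t| & f (t *: v + x) - f x = t * 'D_v f (s *: v + x).
Proof.
move=> H; pose u s := f (s *: v + x).
have u0 : u 0 = f x by rewrite /u scale0r add0r.
have [t0|t0] := leP 0 t.
  have Hd s : s \in `[0, t] -> is_derive s 1 u ('D_v f (s *: v + x)).
    rewrite in_itv /= => /andP[s0 st]; apply: is_derive_line; apply: H.
    by rewrite !ger0_norm.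
  have Hd' s (sI : s \in `]0, t[) := Hd s (subset_itv_oo_cc sI).
  have Hc : {within `[0, t], continuous u}.
    by apply: derivable_within_continuous => s /Hd [].
  have [c] := MVT_segment t0 Hd' Hc; rewrite in_itv /= => /andP[c0 ct] E; exists c; first by rewrite !ger0_norm.
  by rewrite -u0 -/(u t) E subr0 mulrC.
have Hd s : s \in `[t, 0] -> is_derive s 1 u ('D_v f (s *: v + x)).
  rewrite in_itv /= => /andP[s0 st]; apply: is_derive_line; apply: H.
  by rewrite !ler0_norm ?lerN2 // ltW.
have Hd' s (sI : s \in `]t, 0[) := Hd s (subset_itv_oo_cc sI).
have Hc : {within `[t, 0], continuous u}.
  by apply: derivable_within_continuous => s /Hd [].
have [c] := MVT_segment (ltW t0) Hd' Hc; rewrite in_itv /= => /andP[c0 ct] E; exists c.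
  by rewrite !ler0_norm ?lerN2 // ltW.
by rewrite -u0 -/(u t) -opprB E sub0r mulrN opprK mulrC.
Qed.

End DirectionalDerivatives.

Lemma differentiable_of_bound (R : realType) (V W : normedModType R) (f : V -> W)
    (df : {linear V -> W}) (a : V) : continuous df ->
  (forall eps : R, 0 < eps -> \forall h \near (0 : V), `|f (h + a) - f a - df h| <= eps * `|h|) ->
  differentiable f a.
Proof.
move=> cdf H; suff E : f \o shift a = cst (f a) + df +o_ 0 id.
  by apply/diff_locallyP; rewrite (diff_unique cdf E).
apply/eqaddoP => eps eps0; apply: filterS (H _ eps0) => h /=.
by rewrite opprD addrA.
Qed.

(** * Continuous partial derivatives imply differentiability *)

Section ContinuouslyDifferentiable.
Variables (R : realType) (n : nat).
Implicit Types (O : set 'rV[R]_n) (f g : 'rV[R]_n -> R).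

Local Notation e_ i := (delta_mx 0 i : 'rV[R]_n).

Lemma norm_coord_le (h : 'rV[R]_n) (i : 'I_n) : `|h 0 i| <= `|h|.
Proof.
rewrite [`|h|]mx_normrE.
by apply: (bigmax_sup (0, i)).
Qed.

Lemma norm_row_le (h : 'rV[R]_n) (r : R) : 0 <= r -> (forall i, `|h 0 i| <= r) -> `|h| <= r.
Proof.
move=> r0 H; rewrite [`|h|]mx_normrE; apply/bigmax_leP; split=> // -[i j] _ /=.
by rewrite ord1.
Qed.

(** The increment from a to a + h is walked one coordinate at a time; on each leg the mean value
    theorem compares with the partial derivative at a. *)
Lemma C1_differentiable O f (a : 'rV[R]_n) : open O -> O a ->
  (forall i x, O x -> derivable f x (e_ i)) ->
  (forall i, {for a, continuous (fun x => 'D_(e_ i) f x)}) ->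
  differentiable f a.
Proof.
move=> oO Oa df cdf.
pose L (h : 'rV[R]_n) : R := \sum_(i < n) h 0 i * 'D_(e_ i) f a.
have lL : linear L.
  move=> c x y; rewrite /L scaler_sumr -big_split /=; apply: eq_bigr => i _.
  by rewrite !mxE mulrDl -mulrA.
pose LM := GRing.isLinear.Build _ _ _ _ L lL.
pose LL : {linear 'rV[R]_n -> R} := HB.pack L LM.
have cL : continuous LL.
  have oT : open [set: 'rV[R]_n] by exact: openT.
  have [cL _] : Ck 0 setT L.
    by apply: Ck_sum => // i; apply: Ck_M (Ck_coord _ _ oT) (Ck_cst _ _ oT).
  by move=> x; exact: cL.
apply: (@differentiable_of_bound R 'rV[R]_n R f LL a cL) => eps eps0.
(* Each of the n legs may contribute ep times the norm of h; dividing by n + 1 instead of n also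
   covers n = 0. *)
pose ep := eps / n.+1%:R.
have ep0 : 0 < ep by rewrite divr_gt0.
have [r r0 Hr] : exists2 r : R, 0 < r & forall y, `|y - a| < r ->
    O y /\ forall i, `|'D_(e_ i) f y - 'D_(e_ i) f a| <= ep.
  have : \forall y \near a, O y /\ forall i, `|'D_(e_ i) f y - 'D_(e_ i) f a| <= ep.
    apply: filterI; first exact: open_nbhs_nbhs.
    have H i : \forall y \near a, `|'D_(e_ i) f y - 'D_(e_ i) f a| <= ep.
      have /cvgrPdist_le /(_ ep ep0) := cdf i.
      by apply: filterS => y; rewrite distrC.
    exact: filter_forall H.
  move/nbhs_normP => [r /= r0 Hr]; exists r => // y yr; apply: Hr => /=.
  by rewrite /ball_ /= distrC.
have H0 : \forall h \near (0 : 'rV[R]_n), `|h| < r by exact: nbhs0_lt.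
apply: filterS H0 => h hr.
(* The corners of the path: h with all coordinates from k on set to 0. *)
pose hk k : 'rV[R]_n := \row_j (if (j < k)%N then h 0 j else 0).
have hk0 : hk 0%N = 0 by apply/rowP => j; rewrite !mxE.
have hkn : hk n = h by apply/rowP => j; rewrite !mxE ltn_ord.
have hkS (i : 'I_n) : hk i.+1 = h 0 i *: e_ i + hk i.
  apply/rowP => j; rewrite !mxE eqxx ltnS /= leq_eqVlt.
  case: (eqVneq i j) => [<-|ij].
    by rewrite eqxx /= ltnn mulr1 addr0.
  have -> : (j == i :> nat) = false by apply/negbTE; rewrite eq_sym.
  by rewrite mulr0 add0r.
have step (i : 'I_n) : `|f (hk i.+1 + a) - f (hk i + a) - h 0 i * 'D_(e_ i) f a| <= ep * `|h|.
  have Hs (s : R) : `|s| <= `|h 0 i| -> `|(s *: e_ i + (hk i + a)) - a| < r.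
    move=> sh; apply: le_lt_trans hr; rewrite addrA addrK.
    apply: norm_row_le => // j; rewrite !mxE eqxx /=.
    case: (eqVneq j i) => [->|ji]; first by rewrite ltnn addr0 mulr1 (le_trans sh) ?norm_coord_le.
    rewrite mulr0 add0r; case: ifP => _; rewrite ?normr0 //; exact: norm_coord_le.
  have [s sh] := @MVT_line R _ f (hk i + a) (e_ i) (h 0 i) (fun s sh => df i _ (Hr _ (Hs s sh)).1).
  rewrite addrA -hkS => ->; rewrite -mulrBr normrM mulrC.
  apply: ler_pM => //; last exact: norm_coord_le.
  exact: (Hr _ (Hs s sh)).2.
have -> : f (h + a) - f a - LL h =
    \sum_(i < n) (f (hk i.+1 + a) - f (hk i + a) - h 0 i * 'D_(e_ i) f a).
  rewrite sumrB -/(L h).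
  have -> : \sum_(i < n) (f (hk i.+1 + a) - f (hk i + a)) = f (h + a) - f a.
    rewrite -(big_mkord xpredT (fun i => f (hk i.+1 + a) - f (hk i + a))).
    by rewrite telescope_sumr // hkn hk0 add0r.
  by [].
apply: le_trans (ler_norm_sum _ _ _) _.
apply: le_trans (ler_sum _ (fun i _ => step i)) _.
rewrite sumr_const card_ord -mulrnAl; apply: ler_wpM2r => //.
by rewrite /ep -mulr_natr mulrAC ler_pdivrMr // ler_wpM2l ?ler_nat // ltW.
Qed.

Lemma Ck1_differentiable O f (a : 'rV[R]_n) : open O -> O a -> Ck 1 O f ->
  differentiable f a.
Proof.
move=> oO Oa [cf df]; apply: (C1_differentiable oO Oa).
  by move=> i x Ox; have [d1 _] := df i; exact: d1.
by move=> i; have [_ [c1 _]] := df i; exact: c1.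
Qed.

Lemma continuous_row (T : topologicalType) (tau : T -> 'rV[R]_n) (x : T) :
  (forall j, {for x, continuous (fun y => tau y 0 j)}) -> {for x, continuous tau}.
Proof.
move=> H; apply/cvgrPdist_le => eps eps0.
have Hj j : \forall y \near x, `|tau x 0 j - tau y 0 j| <= eps.
  have /cvgrPdist_le := H j; exact.
have Hall : \forall y \near x, forall j, `|tau x 0 j - tau y 0 j| <= eps.
  exact: filter_forall Hj.
apply: filterS Hall => y Hy.
by apply: norm_row_le; [exact: ltW|move=> j; rewrite !mxE].
Qed.

Lemma diff_rowE f (a v : 'rV[R]_n) : differentiable f a ->
  'd f a v = \sum_j v 0 j * 'D_(e_ j) f a.
Proof.
move=> df; rewrite {1}(row_sum_delta v) linear_sum; apply: eq_bigr => j _.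
by rewrite linearZ /= -deriveE.
Qed.

End ContinuouslyDifferentiable.

(** * Chain rule *)

Section Composition.
Variables (R : realType) (m n : nat).
Variables (O : set 'rV[R]_m) (Q : set 'rV[R]_n).
Hypotheses (oO : open O) (oQ : open Q).

Local Notation e_ i := (delta_mx 0 i).

(** As tau is only derivable along one direction, it is replaced by the curve through x in that
    direction; in one variable derivability is differentiability, and the chain rule for
    differentials applies. *)
Lemma derive_comp (g : 'rV[R]_n -> R) (tau : 'rV[R]_m -> 'rV[R]_n) x i :
  differentiable g (tau x) -> derivable tau x (e_ i) ->
  derivable (g \o tau) x (e_ i) /\
  'D_(e_ i) (g \o tau) x = \sum_j 'D_(e_ j) g (tau x) * 'D_(e_ i) (fun y => tau y 0 j) x.
Proof.
move=> dg dt.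
pose gam (s : R) := tau (s *: e_ i + x).
have gam0 : gam 0 = tau x by rewrite /gam scale0r add0r.
have dgam1 : derivable gam 0 1 := (derivable1P tau x (e_ i)).1 dt.
have dgam : differentiable gam 0 := (derivable1_diffP gam 0).1 dgam1.
have dgg : differentiable g (gam 0) by rewrite gam0.
have dcomp := differentiable_comp dgam dgg.
have D1 : derivable (g \o tau) x (e_ i).
  exact: (derivable1P _ _ _).2 ((derivable1_diffP _ _).2 dcomp).
split=> //.
have x0 : 0 *: e_ i + x = x :> 'rV_m by rewrite scale0r add0r.
have := @is_derive_line _ _ (g \o tau) x (e_ i) 0; rewrite x0 => /(_ D1) [_ <-].
rewrite deriveE // -[X in 'd X _ _]/(g \o gam) diff_comp //= gam0 diff_rowE //.
apply: eq_bigr => j _; rewrite mulrC; congr (_ * _).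
rewrite -deriveE // derive_mx //.
rewrite mxE; have dtj := (derivable_mxP _ _ _).1 dt 0 j.
by have := @is_derive_line _ _ (fun y => tau y 0 j) x (e_ i) 0; rewrite x0 => /(_ dtj) [_ <-].
Qed.

Lemma Ck_comp k (g : 'rV[R]_n -> R) (tau : 'rV[R]_m -> 'rV[R]_n) :
  (forall x, O x -> Q (tau x)) -> Ck k Q g ->
  (forall j, Ck k O (fun x => tau x 0 j)) -> Ck k O (g \o tau).
Proof.
move=> OQ; elim: k g => [|k IH] g Cg Ct /=.
  split=> // x Ox; apply: continuous_comp; last by apply: Cg.1; exact: OQ.
  by apply: continuous_row => j; apply: (Ct j).1.
split=> [x Ox|i].
  apply: continuous_comp; last by apply: Cg.1; exact: OQ.
  by apply: continuous_row => j; apply: (Ct j).1.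
have H x : O x -> derivable (g \o tau) x (e_ i) /\
  'D_(e_ i) (g \o tau) x = \sum_j 'D_(e_ j) g (tau x) * 'D_(e_ i) (fun y => tau y 0 j) x.
  move=> Ox; apply: derive_comp.
    by apply: (Ck1_differentiable oQ (OQ _ Ox)); apply: Ck_le Cg.
  apply/derivable_mxP => i0 j; rewrite ord1.
  by have [_ /(_ i) [d _]] := Ct j; exact: d.
split; first by move=> x Ox; exact: (H x Ox).1.
apply: Ck_ext (oO) _ _; first by move=> x Ox; rewrite (H x Ox).2.
apply: Ck_sum => // j; apply: Ck_M => //.
  apply: (IH ('D_(e_ j) g)); first by have [_ /(_ j) [_ d]] := Cg.
  by move=> j'; apply: CkW.
by have [_ /(_ i) [_ d]] := Ct j.
Qed.

End Composition.

(** * Hadamard's lemma *)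

Lemma open_norm_ball (R : realType) (n : nat) (a : 'rV[R]_n) (r : R) :
  open [set x : 'rV[R]_n | `|x - a| < r].
Proof.
have -> : [set x : 'rV[R]_n | `|x - a| < r] = ball a r; last exact: ball_open.
by rewrite -ball_normE; apply/seteqP; split=> x /=; rewrite /ball_ /= distrC.
Qed.

Section RadialAverage.
Variables (R : realType) (n : nat) (a : 'rV[R]_n) (r : R).
Hypothesis r0 : 0 < r.

Local Notation e_ i := (delta_mx 0 i : 'rV[R]_n).
Local Notation mu := (@lebesgue_measure R).
Local Notation I01 := (`[0, 1]%classic : set R).

Let B : set 'rV[R]_n := [set x | `|x - a| < r].

Lemma continuous_at_dist (T : topologicalType) (f : T -> R) (x : T) :
  (forall eps : R, 0 < eps -> \forall y \near x, `|f x - f y| <= eps) ->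
  {for x, continuous f}.
Proof. by move=> H; apply/cvgrPdist_le. Qed.

(** Differentiating under the integral sign brings out one more factor t, so the powers of t make
    the family stable under partial derivatives. Hadamard's functions are those with m = 0. *)
Definition radial_avg (m : nat) (F : 'rV[R]_n -> R) (x : 'rV[R]_n) : R :=
  \int[mu]_(t in I01) (t ^+ m * F (t *: (x - a) + a)).

Let oB : open B := @open_norm_ball R n a r.

Lemma radial_norm x t : I01 t -> `|t *: (x - a) + a - a| <= `|x - a|.
Proof.
rewrite /= in_itv /= => /andP[t0 t1]; rewrite addrK normrZ ger0_norm //.
by rewrite ler_piMl.
Qed.

Lemma radial_in x t : B x -> I01 t -> B (t *: (x - a) + a).
Proof. by move=> Bx tI; apply: le_lt_trans Bx; exact: radial_norm. Qed.

Lemma line_continuous (v w : 'rV[R]_n) (t : R) : {for t, continuous (fun t : R => t *: v + w)}.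
Proof.
apply: continuous_row => j.
have -> : (fun t : R => (t *: v + w) 0 j) = (fun t => t * v 0 j + w 0 j).
  by apply/funext => s; rewrite !mxE.
apply: (@continuousD _ R^o); last exact: cst_continuous.
by apply: continuousM; [exact: cvg_id|exact: cst_continuous].
Qed.

Lemma radial_continuous m F x : (forall y, B y -> {for y, continuous F}) -> B x ->
  {within I01, continuous (fun t => t ^+ m * F (t *: (x - a) + a))}.
Proof.
move=> cF Bx; apply: continuous_in_subspaceT => t /set_mem It.
have c1 : {for t, continuous (fun t : R => t ^+ m)} by exact: exprn_continuous.
have c2 : {for t, continuous (fun t : R => F (t *: (x - a) + a))}.
  apply: (@continuous_comp _ _ _ (fun t : R => t *: (x - a) + a) F).
    exact: line_continuous.
  by apply: cF; exact: radial_in.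
exact: continuousM c1 c2.
Qed.

Lemma radial_integrable m F x : (forall y, B y -> {for y, continuous F}) -> B x ->
  mu.-integrable I01 (EFin \o (fun t => t ^+ m * F (t *: (x - a) + a))).
Proof.
move=> cF Bx; apply: continuous_compact_integrable; first exact: segment_compact.
exact: radial_continuous.
Qed.

(** A closed ball of the sup norm is a product of segments, hence compact. *)
Lemma bounded_smaller_ball (F : 'rV[R]_n -> R) (s : R) : (forall y, B y -> {for y, continuous F}) -> 0 < s -> s < r ->
  exists2 C, 0 <= C & forall y : 'rV[R]_n, `|y - a| <= s -> `|F y| <= C.
Proof.
move=> cF s0 sr.
pose K : set 'rV[R]_n := [set v | forall i, (`[a 0 i - s, a 0 i + s]%classic : set R) (v ord0 i)].
have KP y : `|y - a| <= s <-> K y.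
  split=> [H i|H].
    rewrite /= in_itv /= -ler_distlC distrC; apply: le_trans H.
    by have := norm_coord_le (y - a) i; rewrite !mxE.
  apply: norm_row_le => [|i]; first exact: ltW.
  by have := H i; rewrite /= in_itv /= -ler_distlC distrC !mxE.
have cK : compact K by apply: (@rV_compact R n (fun i => `[a 0 i - s, a 0 i + s]%classic)) => i; exact: segment_compact.
have [] := @EVT_max_rV R n (fun y => `|F y|) K _ cK.
- by exists a; apply/KP; rewrite subrr normr0 ltW.
- apply: continuous_in_subspaceT => y /set_mem /KP yK.
  apply: (@continuous_comp _ _ _ F (fun z : R => `|z|)); last exact: norm_continuous.
  by apply: cF; exact: le_lt_trans yK sr.
move=> c _ Hc; exists `|F c| => // y /KP yK; apply: Hc; exact/mem_set.
Qed.

Lemma MVT_segment_line (V : normedModType R) (f : V -> R) x v :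
  (forall t : R, I01 t -> derivable f (t *: v + x) v) ->
  exists2 t : R, I01 t & f (v + x) - f x = 'D_v f (t *: v + x).
Proof.
move=> H; pose u t := f (t *: v + x).
have Hd (s : R) : s \in `[0, 1] -> is_derive s 1 u ('D_v f (s *: v + x)).
  by move=> sI; apply: is_derive_line; apply: H.
have Hd' (s : R) (sI : s \in `]0, 1[) := Hd s (subset_itv_oo_cc sI).
have Hc : {within `[0, 1], continuous u}.
  by apply: derivable_within_continuous => s /Hd [].
have [c cI E] := MVT_segment ler01 Hd' Hc; exists c => //.
by move: E; rewrite /u scale0r add0r scale1r subr0 mulr1.
Qed.

Lemma C1_lipschitz (F : 'rV[R]_n -> R) (s : R) : Ck 1 B F -> 0 < s -> s < r ->
  exists2 C, 0 <= C & forall y z : 'rV[R]_n, `|y - a| <= s -> `|z - a| <= s -> `|F y - F z| <= C * `|y - z|.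
Proof.
move=> CF s0 sr.
have H j : {C | 0 <= C & forall y, `|y - a| <= s -> `|'D_(e_ j) F y| <= C}.
  apply: cid2; have [_ /(_ j) [_ [cj _]]] := CF.
  exact: bounded_smaller_ball.
pose Cj j := let: exist2 C _ _ := H j in C.
have Cj0 j : 0 <= Cj j by rewrite /Cj; case: (H j).
have CjP j y : `|y - a| <= s -> `|'D_(e_ j) F y| <= Cj j by rewrite /Cj; case: (H j) => C ? /= HC; exact: HC.
exists (\sum_j Cj j); first by rewrite sumr_ge0.
move=> y z ya za.
have conv t : I01 t -> `|t *: (y - z) + z - a| <= s.
  rewrite /= in_itv /= => /andP[t0 t1].
  have -> : t *: (y - z) + z - a = t *: (y - a) + (1 - t) *: (z - a).
    by apply/rowP => j; rewrite !mxE; ring.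
  apply: le_trans (ler_normD _ _) _; rewrite !normrZ !ger0_norm ?subr_ge0 //.
  have -> : s = t * s + (1 - t) * s by ring.
  by apply: lerD; apply: ler_wpM2l => //; rewrite subr_ge0.
have dF w : `|w - a| <= s -> differentiable F w.
  by move=> ws; apply: (Ck1_differentiable oB) => //; exact: le_lt_trans ws sr.
have [t tI] := @MVT_segment_line 'rV[R]_n F z (y - z) (fun t tI => diff_derivable (dF _ (conv t tI))).
rewrite subrK => ->; rewrite deriveE; last exact: dF (conv t tI).
rewrite diff_rowE; last exact: dF (conv t tI).
rewrite mulr_suml; apply: le_trans (ler_norm_sum _ _ _) _; apply: ler_sum => j _.
rewrite normrM mulrC; apply: ler_pM => //; first exact: CjP (conv t tI).
exact: norm_coord_le.
Qed.

Lemma mu_I01 : fine (mu I01) = 1.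
Proof. by rewrite lebesgue_measure_itv /= lte_fin ltr01 oppr0 adde0. Qed.

Lemma le_Rintegral01 (f g : R -> R) : mu.-integrable I01 (EFin \o f) ->
  mu.-integrable I01 (EFin \o g) -> (forall t, I01 t -> f t <= g t) ->
  \int[mu]_(t in I01) f t <= \int[mu]_(t in I01) g t.
Proof. by move=> intf intg fg; apply: le_Rintegral => // t; exact: fg. Qed.

Lemma integrable_cst01 (c : R) : mu.-integrable I01 (EFin \o (fun=> c)).
Proof.
apply: continuous_compact_integrable; first exact: segment_compact.
by apply: continuous_subspaceT => t; exact: cst_continuous.
Qed.

Lemma radial_avg_continuous m (F : 'rV[R]_n -> R) x : Ck 1 B F -> B x -> {for x, continuous (radial_avg m F)}.
Proof.
(* The radius s lies halfway between x and the boundary of the ball: a neighbourhood of x stays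
   within radius s, where F is Lipschitz. *)
move=> CF Bx; pose s := (`|x - a| + r) / 2.
have xs : `|x - a| < s by move: Bx; rewrite /B /s /= => Bx; lra.
have s0 : 0 < s by apply: le_lt_trans xs.
have sr : s < r by move: Bx; rewrite /B /s /= => Bx; lra.
have [C C0 HC] := C1_lipschitz CF s0 sr.
have cF : forall y, B y -> {for y, continuous F} := CF.1.
apply: continuous_at_dist => eps eps0.
have H1 : \forall y \near x, `|y - a| < s by apply: open_nbhs_nbhs; split => //; exact: open_norm_ball.
pose C' := C + 1.
have C'0 : 0 < C' by rewrite /C'; lra.
have H2 : \forall y \near x, `|y - x| < eps / C'.
  apply: open_nbhs_nbhs; split; first exact: open_norm_ball.
  by rewrite /= subrr normr0 divr_gt0.
apply: filterS2 H1 H2 => y ys yx.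
have By : B y by exact: lt_trans ys sr.
rewrite /radial_avg -RintegralB //; [|exact: radial_integrable|exact: radial_integrable].
have int1 : mu.-integrable I01 (EFin \o (fun t =>
    t ^+ m * F (t *: (x - a) + a) - t ^+ m * F (t *: (y - a) + a))).
  have := integrableB _ (radial_integrable m cF Bx) (radial_integrable m cF By).
  exact.
apply: le_trans (le_normr_Rintegral _ int1) _ => //.
have -> : eps = \int[mu]_(t in I01) eps.
  by rewrite Rintegral_cst // mu_I01 mulr1.
apply: le_Rintegral01.
- exact: integrable_norm int1.
- exact: integrable_cst01.
move=> t tI; rewrite -mulrBr normrM.
have t01 : 0 <= t <= 1 by move: tI; rewrite /= in_itv.
have /andP[t0 t1] := t01.
have tm : `|t ^+ m| <= 1 by rewrite ger0_norm ?exprn_ge0 // exprn_ile1.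
have : `|F (t *: (x - a) + a) - F (t *: (y - a) + a)| <= eps.
  apply: le_trans (HC _ _ _ _) _.
  - apply: le_trans (radial_norm _ tI) _; exact: ltW.
  - apply: le_trans (radial_norm _ tI) _; exact: ltW.
  have -> : t *: (x - a) + a - (t *: (y - a) + a) = t *: (x - y).
    by apply/rowP => j; rewrite !mxE; ring.
  rewrite normrZ ger0_norm //.
  have xyC : `|x - y| * C' < eps by rewrite -ltr_pdivlMr // distrC.
  have : t * `|x - y| <= `|x - y| by rewrite ler_piMl.
  have := normr_ge0 (x - y); rewrite /C' in xyC.
  move=> n0 tn; apply: le_trans (ler_wpM2l C0 tn) _; nra.
by move=> H; rewrite -[eps]mul1r ler_pM.
Qed.

(** Differentiation under the integral sign along h -> x + h e_i. A constant dominates: the partial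
    derivative is bounded on the ball of radius s, and the powers of t are at most 1. *)
Lemma radial_avg_derive m (F : 'rV[R]_n -> R) x i : Ck 1 B F -> B x ->
  derivable (radial_avg m F) x (e_ i) /\
  'D_(e_ i) (radial_avg m F) x = radial_avg m.+1 ('D_(e_ i) F) x.
Proof.
move=> CF Bx; pose s := (`|x - a| + r) / 2.
have xs : `|x - a| < s by move: Bx; rewrite /B /s /= => Bx; lra.
have s0 : 0 < s by apply: le_lt_trans xs.
have sr : s < r by move: Bx; rewrite /B /s /= => Bx; lra.
have cF : forall y, B y -> {for y, continuous F} := CF.1.
have [_ /(_ i) [_ [cD _]]] := CF.
have [C C0 HC] := bounded_smaller_ball cD s0 sr.
pose d := s - `|x - a|.
have d0 : 0 < d by rewrite /d subr_gt0.
have hB h : `|h| < d -> `|h *: e_ i + x - a| <= s.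
  move=> hd; rewrite -addrA; apply: le_trans (ler_normD _ _) _.
  have : `|h *: e_ i| <= `|h|.
    apply: norm_row_le => // j; rewrite !mxE /=.
    by case: (j == i); rewrite ?mulr1 ?mulr0 ?normr0.
  by move: hd; rewrite /d => hd H; lra.
have IP h : (`](- d), d[%classic : set R) h -> `|h| < d by rewrite /= in_itv /= ltr_norml.
pose f (h t : R) := t ^+ m * F (t *: (h *: e_ i + x - a) + a).
have fE h t : f h t = t ^+ m * F (h *: (t *: e_ i) + (t *: (x - a) + a)).
  rewrite /f; congr (_ * F _); apply/rowP => j; rewrite !mxE; ring.
have dft (h t : R) : `|h| < d -> I01 t -> is_derive h 1 (f ^~ t)
    (t ^+ m.+1 * 'D_(e_ i) F (t *: (h *: e_ i + x - a) + a)).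
  move=> hd tI; have -> : f ^~ t = (fun h => t ^+ m *: F (h *: (t *: e_ i) + (t *: (x - a) + a))).
    by apply/funext => h'; rewrite fE.
  pose z := t *: (h *: e_ i + x - a) + a.
  have zE : h *: (t *: e_ i) + (t *: (x - a) + a) = z by apply/rowP => j; rewrite !mxE; ring.
  have Bz : B z.
    apply: le_lt_trans sr; apply: le_trans (radial_norm _ tI) _.
    exact: hB.
  have dFz : differentiable F z by exact: (Ck1_differentiable oB).
  have := @is_derive_line _ _ F (t *: (x - a) + a) (t *: e_ i) h.
  rewrite zE => /(_ (diff_derivable dFz)) H.
  have := is_deriveZ (t ^+ m) H.
  by rewrite deriveE // linearZ /= -deriveE // exprS mulrC => K; apply: is_derive_eq K _; rewrite /GRing.scale /=; ring.
have F0 : (`](- d), d[%classic : set R) 0 by rewrite /= in_itv /= oppr_lt0 d0.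
have intf (h : R) : (`](- d), d[%classic : set R) h -> mu.-integrable I01 (EFin \o f h).
  move=> /IP hd; apply: radial_integrable => //.
  by apply: le_lt_trans sr; exact: hB.
have der (h t : R) : (`](- d), d[%classic : set R) h -> I01 t -> derivable (f ^~ t) h 1.
  by move=> /IP hd tI; have [] := dft _ _ hd tI.
have p1 (h t : R) : `|h| < d -> I01 t -> partial1of2 f h t =
    t ^+ m.+1 * 'D_(e_ i) F (t *: (h *: e_ i + x - a) + a).
  by move=> hd tI; rewrite partial1of2E; have [_ ->] := dft _ _ hd tI.
have ub (h t : R) : (`](- d), d[%classic : set R) h -> I01 t -> `|partial1of2 f h t| <= C.
  move=> /IP hd tI; rewrite p1 //.
  have /andP[t0 t1] : 0 <= t <= 1 by move: tI; rewrite /= in_itv.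
  have tm : `|t ^+ m.+1| <= 1 by rewrite ger0_norm ?exprn_ge0 // exprn_ile1.
  rewrite normrM -[C]mul1r ler_pM //; apply: HC.
  by apply: le_trans (radial_norm _ tI) _; exact: hB.
have mI : measurable (I01 : set (measurableTypeR R)) by [].
have dF1 := @derivable_under_integral R _ _ mu f I01 mI 0 (- d) d F0 intf der (fun=> C) (fun=> C0) (integrable_cst01 C) ub.
have dF2 := @differentiation_under_integral R _ _ mu f I01 mI 0 (- d) d F0 intf der (fun=> C) (fun=> C0) (integrable_cst01 C) ub.
have E : (fun h : R => \int[mu]_(t in I01) f h t) = (fun h => radial_avg m F (h *: e_ i + x)).
  by apply/funext.
rewrite E in dF1 dF2.
have D1 : derivable (radial_avg m F) x (e_ i) by exact: (derivable1P _ _ _).2 dF1.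
split=> //.
have x0 : 0 *: e_ i + x = x by rewrite scale0r add0r.
have := @is_derive_line _ _ (radial_avg m F) x (e_ i) 0; rewrite x0 => /(_ D1) [_ <-].
rewrite -derive1E dF2; apply: eq_Rintegral => t /set_mem tI.
by rewrite p1 ?normr0 // x0.
Qed.

Lemma Ck_radial_avg k m (F : 'rV[R]_n -> R) : Cinfty B F -> Ck k B (radial_avg m F).
Proof.
elim: k m F => [|k IH] m F CF /=.
  by split=> // x Bx; apply: radial_avg_continuous.
split=> [x Bx|i]; first by apply: radial_avg_continuous.
have H x (Bx : B x) := @radial_avg_derive m F x i (CF 1%N) Bx.
split=> [x Bx|]; first exact: (H x Bx).1.
apply: Ck_ext oB _ (IH m.+1 ('D_(e_ i) F) _) => [x Bx|l]; first by rewrite (H x Bx).2.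
by have [_ /(_ i) [_]] := CF l.+1.
Qed.

(** f x - f a is the integral over t in [0, 1] of the derivative of f (a + t (x - a)), which is
    linear in x - a with coefficients the radial averages of the partial derivatives. *)
Lemma hadamard (f : 'rV[R]_n -> R) : Cinfty B f ->
  exists g : 'I_n -> 'rV[R]_n -> R, [/\ forall i, Cinfty B (g i),
    forall i, g i a = 'D_(e_ i) f a
    & forall x, B x -> f x = f a + \sum_i (x 0 i - a 0 i) * g i x].
Proof.
move=> Cf; exists (fun i => radial_avg 0 ('D_(e_ i) f)).
have CD i : Cinfty B ('D_(e_ i) f) by move=> l; have [_ /(_ i) [_]] := Cf l.+1.
have Ba : B a by rewrite /B /= subrr normr0.
split=> [i k|i|x Bx]; first exact: Ck_radial_avg.
  rewrite /radial_avg; have -> : (fun t => t ^+ 0 * 'D_(e_ i) f (t *: (a - a) + a)) = (fun=> 'D_(e_ i) f a).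
    by apply/funext => t; rewrite subrr scaler0 add0r mul1r.
  by rewrite Rintegral_cst // mu_I01 mulr1.
pose u (t : R) := f (t *: (x - a) + a).
pose h (y : 'rV[R]_n) := \sum_i (x 0 i - a 0 i) * 'D_(e_ i) f y.
have dfB t : I01 t -> differentiable f (t *: (x - a) + a).
  by move=> tI; apply: (Ck1_differentiable oB) => //; exact: radial_in.
have Ch : Ck 0 B h.
  by apply: Ck_sum => // i; apply: Ck_M (Ck_cst _ _ oB) (CD i 0%N).
pose Df (t : R) := h (t *: (x - a) + a).
have du (t : R) : I01 t -> is_derive t 1 u (Df t).
  move=> tI; have := is_derive_line (diff_derivable (v := x - a) (dfB _ tI)).
  rewrite deriveE; last exact: dfB.
  rewrite diff_rowE; last exact: dfB.
  by under eq_bigr do rewrite !mxE.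
have cDi i y : B y -> {for y, continuous ('D_(e_ i) f)} by exact: (CD i 0%N).1.
have cDf : {within I01, continuous Df}.
  apply: continuous_in_subspaceT => t /set_mem tI.
  apply: (@continuous_comp _ _ _ (fun t : R => t *: (x - a) + a) h).
    exact: line_continuous.
  by apply: Ch.1; exact: radial_in.
have duc (t : R) : I01 t -> {for t, continuous u}.
  by move=> /du [d _]; apply: differentiable_continuous; exact: (derivable1_diffP _ _).1 d.
have I0 : I01 0 by rewrite /= in_itv /= lexx ler01.
have I1 : I01 1 by rewrite /= in_itv /= lexx ler01.
have LR : derivable_oo_LRcontinuous u 0 1.
  split=> [t tI||].
  - by have [] := du t (subset_itv_oo_cc tI).
  - by apply: cvg_at_right_filter; exact: duc.
  - by apply: cvg_at_left_filter; exact: duc.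
have dE : {in `]0, 1[, derive1 u =1 Df}.
  by move=> t tI; rewrite derive1E; have [_ ->] := du t (subset_itv_oo_cc tI).
have := continuous_FTC2 (@ltr01 R) cDf LR dE.
rewrite {1}/u scale1r subrK /u scale0r add0r => FTC.
have -> : f x = f a + \int[mu]_(t in I01) Df t by rewrite /Rintegral FTC /= [RHS]addrC subrK.
congr (_ + _).
rewrite (@eq_Rintegral _ _ _ mu I01 (fun t => \sum_i (x 0 i - a 0 i) * (t ^+ 0 * 'D_(e_ i) f (t *: (x - a) + a))));
  last by move=> t _; rewrite /Df /h; apply: eq_bigr => i _; rewrite mul1r.
have mI : measurable (I01 : set (measurableTypeR R)) by [].
have int0 i : mu.-integrable I01 (EFin \o (fun t => t ^+ 0 * 'D_(e_ i) f (t *: (x - a) + a))).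
  exact: (@radial_integrable 0 _ x (@cDi i) Bx).
have int1 i : mu.-integrable I01 (EFin \o (fun t => (x 0 i - a 0 i) * (t ^+ 0 * 'D_(e_ i) f (t *: (x - a) + a)))).
  by have := integrableZl mI (x 0 i - a 0 i) (int0 i).
(* Splitting off a term of the integral requires the remaining sum to be integrable, so both facts
   go through one induction over the list of indices. *)
suff H : forall s : seq 'I_n, mu.-integrable I01 (EFin \o (fun t => \sum_(i <- s) (x 0 i - a 0 i) * (t ^+ 0 * 'D_(e_ i) f (t *: (x - a) + a)))) /\
   \int[mu]_(t in I01) (\sum_(i <- s) (x 0 i - a 0 i) * (t ^+ 0 * 'D_(e_ i) f (t *: (x - a) + a))) = \sum_(i <- s) (x 0 i - a 0 i) * radial_avg 0 ('D_(e_ i) f) x by exact: (H (index_enum _)).2.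
elim=> [|j s [IH1 IH2]].
  have -> : (fun t => \sum_(i <- [::]) (x 0 i - a 0 i) * (t ^+ 0 * 'D_(e_ i) f (t *: (x - a) + a))) = (fun=> 0).
    by apply/funext => t; rewrite big_nil.
  by split; [exact: integrable_cst01|rewrite Rintegral_cst // mul0r big_nil].
have -> : (fun t => \sum_(i <- j :: s) (x 0 i - a 0 i) * (t ^+ 0 * 'D_(e_ i) f (t *: (x - a) + a))) =
  (fun t => (x 0 j - a 0 j) * (t ^+ 0 * 'D_(e_ j) f (t *: (x - a) + a)) + \sum_(i <- s) (x 0 i - a 0 i) * (t ^+ 0 * 'D_(e_ i) f (t *: (x - a) + a))).
  by apply/funext => t; rewrite big_cons.
split; first by have := integrableD mI (int1 j) IH1.
by rewrite RintegralD // IH2 big_cons RintegralZl.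
Qed.

End RadialAverage.

(** * Coordinates on a manifold *)

Section ManifoldCalculus.
Variables (R : realType) (n : nat) (M : smooth_manifold R n).
Implicit Types (U V : set M) (p q : M) (f g : M -> R) (c e : chart R n M).

Lemma chart_inv_continuous_at c x : (chart_map c @` chart_dom c) x ->
  {for x, continuous (chart_inv c)}.
Proof.
move=> Dx; have := @chart_inv_continuous _ _ _ c.
rewrite continuous_open_subspace; last exact: chart_open_img.
by apply; apply/mem_set.
Qed.

Lemma chart_map_continuous_at c p : chart_dom c p -> {for p, continuous (chart_map c)}.
Proof.
move=> Dp; have := @chart_map_continuous _ _ _ c.
rewrite continuous_open_subspace; last exact: chart_open_dom.
by apply; apply/mem_set.
Qed.

Lemma open_chart_img c U : open U -> open (chart_map c @` (U `&` chart_dom c)).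
Proof.
move=> oU; rewrite openE => x [p [Up Dp] <-]; rewrite /interior.
have Ip : (chart_map c @` chart_dom c) (chart_map c p) by exists p.
have N1 : nbhs (chart_map c p) (chart_map c @` chart_dom c).
  by apply: open_nbhs_nbhs; split => //; exact: chart_open_img.
have N2 : nbhs (chart_map c p) (chart_inv c @^-1` U).
  apply: (chart_inv_continuous_at Ip).
  by apply: open_nbhs_nbhs; split => //; rewrite chart_mapK.
apply: filterS2 N1 N2 => y [q Dq <-] /=; rewrite chart_mapK // => Uq.
by exists q.
Qed.

Lemma open_chart_preimage c (O : set 'rV[R]_n) U : open O -> open U ->
  open [set p | [/\ chart_dom c p, U p & O (chart_map c p)]].
Proof.
move=> oO oU; rewrite openE => p [Dp Up Op]; rewrite /interior.
have N1 : nbhs p (chart_dom c) by apply: open_nbhs_nbhs; split => //; exact: chart_open_dom.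
have N2 : nbhs p U by apply: open_nbhs_nbhs.
have N3 : nbhs p (chart_map c @^-1` O).
  by apply: (chart_map_continuous_at Dp); apply: open_nbhs_nbhs.
by apply: filterS3 N1 N2 N3 => q.
Qed.

Lemma smooth_fun_sub U V f : V `<=` U -> smooth_fun U f -> smooth_fun V f.
Proof.
move=> VU sf c hc k; apply: Ck_sub (sf c hc k).
by move=> x [p [Vp Dp] <-]; exists p => //; split=> //; exact: VU.
Qed.

Lemma smooth_fun_local U f :
  (forall p, U p -> exists2 V, V p & smooth_fun V f) -> smooth_fun U f.
Proof.
move=> H c hc k; apply: Ck_local => x [p [Up Dp] <-].
have [V Vp sV] := H p Up; exists (chart_map c @` (V `&` chart_dom c)); last exact: sV.
by exists p.
Qed.

Lemma smooth_fun_ext U f g : open U -> (forall p, U p -> f p = g p) ->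
  smooth_fun U f -> smooth_fun U g.
Proof.
move=> oU fg sf c hc k; apply: Ck_ext (sf c hc k); first exact: open_chart_img.
by move=> x [p [Up Dp] <-] /=; rewrite chart_mapK // fg.
Qed.

Lemma smooth_fun_cst U (a : R) : open U -> smooth_fun U (fun=> a).
Proof. by move=> oU c hc k; apply: Ck_cst; exact: open_chart_img. Qed.

Lemma smooth_fun_D U f g : open U -> smooth_fun U f -> smooth_fun U g ->
  smooth_fun U (fun p => f p + g p).
Proof.
by move=> oU sf sg c hc k; apply: Ck_D (sf c hc k) (sg c hc k); exact: open_chart_img.
Qed.

Lemma smooth_fun_M U f g : open U -> smooth_fun U f -> smooth_fun U g ->
  smooth_fun U (fun p => f p * g p).
Proof.
by move=> oU sf sg c hc k; apply: Ck_M (sf c hc k) (sg c hc k); exact: open_chart_img.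
Qed.

Lemma smooth_fun_Z U (a : R) f : open U -> smooth_fun U f -> smooth_fun U (fun p => a * f p).
Proof. by move=> oU sf; apply: smooth_fun_M => //; exact: smooth_fun_cst. Qed.

Lemma smooth_fun_N U f : open U -> smooth_fun U f -> smooth_fun U (fun p => - f p).
Proof.
move=> oU sf; apply: (smooth_fun_ext oU _ (smooth_fun_Z (-1) oU sf)) => p _.
by rewrite mulN1r.
Qed.

Lemma smooth_fun_B U f g : open U -> smooth_fun U f -> smooth_fun U g ->
  smooth_fun U (fun p => f p - g p).
Proof. by move=> oU sf sg; apply: smooth_fun_D => //; exact: smooth_fun_N. Qed.

Lemma smooth_fun_sum U (I : Type) (r : seq I) (F : I -> M -> R) : open U ->
  (forall i, smooth_fun U (F i)) -> smooth_fun U (fun p => \sum_(i <- r) F i p).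
Proof.
move=> oU H; elim: r => [|i r IH].
  by apply: (smooth_fun_ext oU _ (smooth_fun_cst 0 oU)) => p _; rewrite big_nil.
by apply: (smooth_fun_ext oU _ (smooth_fun_D oU (H i) IH)) => p _; rewrite big_cons.
Qed.

Lemma smooth_fun_at U f p : open U -> U p -> smooth_fun U f -> smooth_at p f.
Proof. by move=> oU Up sf; exists U. Qed.

Section AtlasChart.
Variable c : chart R n M.
Hypothesis hc : atlas c.

Definition chart_coord (i : 'I_n) (p : M) : R := chart_map c p 0 i.

Definition chart_partial (i : 'I_n) (f : M -> R) (p : M) : R :=
  'D_(delta_mx 0 i) (f \o chart_inv c) (chart_map c p).

(** Smoothness has to be checked in every chart e of the atlas; there the function is g composed
    with the transition map from e to c. *)
Lemma smooth_chart_comp U (g : 'rV[R]_n -> R) : open U -> U `<=` chart_dom c ->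
  Cinfty (chart_map c @` U) g -> smooth_fun U (g \o chart_map c).
Proof.
move=> oU UD Cg e he k.
have cU : U `&` chart_dom c = U by apply/seteqP; split=> [p []|p Up] //; split=> //; exact: UD.
have oI : open (chart_map c @` U) by rewrite -cU; exact: open_chart_img.
have maps x : (chart_map e @` (U `&` chart_dom e)) x ->
    (chart_map c @` U) ((chart_map c \o chart_inv e) x).
  by move=> [p [Up Dp] <-] /=; rewrite chart_mapK //; exists p.
have Ct j : Ck k (chart_map e @` (U `&` chart_dom e))
    (fun x => (chart_map c \o chart_inv e) x 0 j).
  apply: Ck_sub (atlas_compat he hc j k) => x [p [Up Dp] <-].
  by exists p => //; split=> //; exact: UD.
by have := Ck_comp (@open_chart_img e U oU) oI maps (Cg k) Ct.
Qed.

Lemma smooth_chart_coord i : smooth_fun (chart_dom c) (chart_coord i).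
Proof.
move=> e he k; apply: Ck_sub (atlas_compat he hc i k) => x [p [Dp Ep] <-].
by exists p.
Qed.

Lemma smooth_chart_partial U i f : open U -> U `<=` chart_dom c ->
  smooth_fun U f -> smooth_fun U (chart_partial i f).
Proof.
move=> oU UD sf; apply: (smooth_chart_comp (g := 'D_(delta_mx 0 i) (f \o chart_inv c)) oU UD) => k.
have [_ /(_ i) [_ H]] := sf c hc k.+1.
apply: Ck_sub H => x [p Up <-]; exists p => //; split=> //; exact: UD.
Qed.

Lemma smooth_at_derivable p f i : chart_dom c p -> smooth_at p f ->
  derivable (f \o chart_inv c) (chart_map c p) (delta_mx 0 i).
Proof.
move=> Dp [U [oU Up sf]]; have [_ /(_ i) [d _]] := sf c hc 1%N.
by apply: d; exists p.
Qed.

Lemma chart_partial_near p f g i : chart_dom c p -> (\near p, f p = g p) ->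
  chart_partial i f p = chart_partial i g p.
Proof.
move=> Dp fg; apply: near_eq_derive.
have Ip : (chart_map c @` chart_dom c) (chart_map c p) by exists p.
have H : chart_inv c y @[y --> chart_map c p] --> chart_inv c (chart_map c p).
  exact: chart_inv_continuous_at.
by rewrite chart_mapK // in H; exact: H fg.
Qed.

Lemma chart_partialD p f g i : chart_dom c p -> smooth_at p f -> smooth_at p g ->
  chart_partial i (fun q => f q + g q) p = chart_partial i f p + chart_partial i g p.
Proof.
move=> Dp sf sg; rewrite /chart_partial -deriveD //; exact: smooth_at_derivable.
Qed.

Lemma chart_partialM p f g i : chart_dom c p -> smooth_at p f -> smooth_at p g ->
  chart_partial i (fun q => f q * g q) p = chart_partial i f p * g p + f p * chart_partial i g p.
Proof.
move=> Dp sf sg.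
have := @deriveM _ _ (f \o chart_inv c) (g \o chart_inv c) _ _
  (@smooth_at_derivable p f i Dp sf) (@smooth_at_derivable p g i Dp sg).
rewrite /chart_partial => ->; rewrite /= chart_mapK //.
by rewrite /GRing.scale /= addrC mulrC.
Qed.

Lemma chart_partial_cst p (a : R) i : chart_partial i (fun=> a) p = 0.
Proof. by rewrite /chart_partial; exact: derive_cst. Qed.

Lemma chart_partial_coord p i j : chart_dom c p ->
  chart_partial i (chart_coord j) p = (i == j)%:R.
Proof.
move=> Dp; have [_ <-] := coord_is_derive i j (chart_map c p).
have Ip : (chart_map c @` chart_dom c) (chart_map c p) by exists p.
apply: near_eq_derive; apply: (open_near_eq (@chart_open_img _ _ _ c) Ip).
by move=> x [q Dq <-] /=; rewrite /chart_coord chart_mapK.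
Qed.

(** The coordinate vector field. The value 0 on functions that are not smooth at p is forced by the
    last clause of [derivation_at]; the default of [insubd] is irrelevant in the chart domain
    ([chart_vecE]). *)
Definition chart_vec (i : 'I_n) (p : M) : tangent p :=
  insubd (0 : tangent p) (fun f : M -> R^o =>
    if `[< smooth_at p f >] then chart_partial i f p else 0).

End AtlasChart.

Lemma tangentP p (v : tangent p) : derivation_at p v.
Proof. by case: v => v /= /asboolP. Qed.

Lemma tangent_eq p (v w : tangent p) : (forall f, v f = w f) -> v = w.
Proof. by move=> vw; apply: val_inj; apply/funext. Qed.

Lemma tangent_near p (v : tangent p) f g : smooth_at p f -> (\near p, f p = g p) -> v f = v g.
Proof. by have [H _ _ _] := tangentP v; exact: H. Qed.

Lemma tangent_ext U p (v : tangent p) f g : open U -> U p -> smooth_fun U f ->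
  (forall q, U q -> f q = g q) -> v f = v g.
Proof.
move=> oU Up sf fg; apply: tangent_near; first by exists U.
exact: open_near_eq Up fg.
Qed.

Lemma smooth_at_cst p (a : R) : smooth_at p (fun=> a).
Proof. by exists setT; split=> //; [exact: openT|apply: smooth_fun_cst; exact: openT]. Qed.

Lemma smooth_at2 p f g : smooth_at p f -> smooth_at p g ->
  exists U, [/\ open U, U p, smooth_fun U f & smooth_fun U g].
Proof.
move=> [U [oU Up sf]] [V [oV Vp sg]]; exists (U `&` V); split=> //.
- exact: openI.
- by apply: smooth_fun_sub sf => q [].
- by apply: smooth_fun_sub sg => q [].
Qed.

Lemma smooth_at_D p f g : smooth_at p f -> smooth_at p g -> smooth_at p (fun q => f q + g q).
Proof.
by move=> sf sg; have [U [oU Up sf' sg']] := smooth_at2 sf sg; exists U; split=> //; exact: smooth_fun_D.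
Qed.

Lemma smooth_at_M p f g : smooth_at p f -> smooth_at p g -> smooth_at p (fun q => f q * g q).
Proof.
by move=> sf sg; have [U [oU Up sf' sg']] := smooth_at2 sf sg; exists U; split=> //; exact: smooth_fun_M.
Qed.

Lemma tangent_cst p (v : tangent p) (a : R) : v (fun=> a) = 0.
Proof.
have [_ v2 v3 _] := tangentP v; have s1 := smooth_at_cst p 1.
have v1 : v (fun=> 1) = 0.
  have := v3 _ _ s1 s1.
  have -> : (fun=> 1 * 1) = (fun=> 1) :> (M -> R) by apply/funext => q; rewrite mulr1.
  by rewrite mulr1 mul1r => /eqP; rewrite -subr_eq0 opprD addrA subrr sub0r oppr_eq0 => /eqP.
have := v2 a _ _ s1 (smooth_at_cst p 0).
have -> : (fun q : M => a * 1 + 0) = (fun=> a) by apply/funext => q; rewrite mulr1 addr0.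
have v0 : v (fun=> 0) = 0.
  have := v2 1 _ _ (smooth_at_cst p 0) (smooth_at_cst p 0).
  have -> : (fun q : M => 1 * 0 + 0 : R) = (fun=> 0) by apply/funext => q; rewrite mulr0 addr0.
  by rewrite mul1r => /eqP; rewrite -subr_eq0 opprD addrA subrr sub0r oppr_eq0 => /eqP.
by move=> ->; rewrite v1 v0 mulr0 addr0.
Qed.

Lemma tangentD p (v : tangent p) f g : smooth_at p f -> smooth_at p g ->
  v (fun q => f q + g q) = v f + v g.
Proof.
move=> sf sg; have [_ v2 _ _] := tangentP v; have := v2 1 _ _ sf sg.
by rewrite mul1r => <-; congr (v _); apply/funext => q; rewrite mul1r.
Qed.

Lemma tangentM p (v : tangent p) f g : smooth_at p f -> smooth_at p g ->
  v (fun q => f q * g q) = v f * g p + f p * v g.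
Proof. by move=> sf sg; have [_ _ v3 _] := tangentP v; exact: v3. Qed.

Lemma tangentZ p (v : tangent p) (a : R) f : smooth_at p f -> v (fun q => a * f q) = a * v f.
Proof.
by move=> sf; rewrite tangentM ?tangent_cst ?mul0r ?add0r //; exact: smooth_at_cst.
Qed.

Lemma tangent_sum p (v : tangent p) (I : Type) (r : seq I) (F : I -> M -> R) :
  (forall i, smooth_at p (F i)) ->
  smooth_at p (fun q => \sum_(i <- r) F i q) /\
  v (fun q => \sum_(i <- r) F i q) = \sum_(i <- r) v (F i).
Proof.
move=> H; elim: r => [|i r [IH1 IH2]].
  have -> : (fun q => \sum_(i <- [::]) F i q) = (fun=> 0) by apply/funext => q; rewrite big_nil.
  by rewrite big_nil tangent_cst; split=> //; exact: smooth_at_cst.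
have -> : (fun q => \sum_(j <- i :: r) F j q) = (fun q => F i q + \sum_(j <- r) F j q).
  by apply/funext => q; rewrite big_cons.
by split; [exact: smooth_at_D|rewrite big_cons tangentD // IH2].
Qed.

Section ChartFrame.
Variable c : chart R n M.
Hypothesis hc : atlas c.

Local Notation xc := (chart_coord c).

Lemma smooth_at_coord p i : chart_dom c p -> smooth_at p (xc i).
Proof.
move=> Dp; apply: smooth_fun_at (smooth_chart_coord hc i) => //.
exact: chart_open_dom.
Qed.

(** Near p, Hadamard writes f as f p plus the sum of (x_i - x_i p) g_i. By the Leibniz rule v sees
    only v x_i times g_i p, and g_i p is the partial derivative. Hence the coordinate vectors span
    the derivations at p. *)
Lemma tangent_chartE p (v : tangent p) f : chart_dom c p -> smooth_at p f ->
  v f = \sum_i v (xc i) * chart_partial c i f p.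
Proof.
move=> Dp [U [oU Up sf]].
have oI := @open_chart_img c U oU.
have Ip : (chart_map c @` (U `&` chart_dom c)) (chart_map c p) by exists p.
have : nbhs (chart_map c p) (chart_map c @` (U `&` chart_dom c)) by apply: open_nbhs_nbhs.
move/nbhs_normP => [r /= r0 Hr].
pose a := chart_map c p; pose B : set 'rV[R]_n := [set x | `|x - a| < r].
have BI : B `<=` chart_map c @` (U `&` chart_dom c).
  by move=> x Bx; apply: Hr; rewrite /ball_ /= distrC.
have CB : Cinfty B (f \o chart_inv c) by move=> k; apply: Ck_sub BI (sf c hc k).
have [g [Cg ga fg]] := hadamard r0 CB.
(* The ball of Hadamard's lemma, pulled back to a neighbourhood of p where the expansion becomes an
   identity of smooth functions on M. *)
pose V : set M := [set q | [/\ chart_dom c q, U q & B (chart_map c q)]].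
have oV : open V by apply: open_chart_preimage => //; exact: open_norm_ball.
have Vp : V p by split=> //; rewrite /B /= subrr normr0.
have VD : V `<=` chart_dom c by move=> q [].
have sg i : smooth_fun V (g i \o chart_map c).
  apply: smooth_chart_comp => // k; apply: Ck_sub (Cg i k).
  by move=> x [q [_ _ Bq] <-].
have sx i : smooth_at p (fun q => xc i q + - a 0 i).
  by apply: smooth_at_D; [exact: smooth_at_coord|exact: smooth_at_cst].
have sga i : smooth_at p (g i \o chart_map c) by exists V.
have sF i : smooth_at p (fun q => (xc i q + - a 0 i) * (g i \o chart_map c) q).
  exact: smooth_at_M.
have [sS vS] := tangent_sum v (index_enum 'I_n) sF.
have -> : v f = v (fun q => f p + \sum_i (xc i q + - a 0 i) * (g i \o chart_map c) q).
  apply: (tangent_ext v oV Vp); first by apply: smooth_fun_sub sf => q [].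
  move=> q [Dq Uq Bq]; have := fg _ Bq; rewrite /= /a !chart_mapK // => ->.
rewrite tangentD //; last exact: smooth_at_cst.
rewrite tangent_cst add0r vS; apply: eq_bigr => i _.
rewrite tangentM // tangentD //; [|exact: smooth_at_coord|exact: smooth_at_cst].
rewrite tangent_cst addr0 /= -/a ga.
by rewrite /chart_coord -/a subrr mul0r addr0.
Qed.

Lemma chart_vecE i p f : chart_dom c p -> smooth_at p f ->
  chart_vec c i p f = chart_partial c i f p.
Proof.
move=> Dp sf; rewrite /chart_vec val_insubd.
suff -> : (fun f : M -> R^o => if `[< smooth_at p f >] then chart_partial c i f p else 0)
   \in is_tangent p by rewrite asboolT.
apply/asboolP; split.
- move=> f1 f2 s1 f12.
  have s2 : smooth_at p f2.
    have [U [oU Up sU]] := s1; have := f12 : nbhs p [set q | f1 q = f2 q].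
    rewrite nbhsE => -[V [oV Vp] VE].
    exists (U `&` V); split; [exact: openI|by []|].
    apply: (smooth_fun_ext (openI oU oV) _ (smooth_fun_sub _ sU)) => [q [_ /VE]|q []] //.
  by rewrite !asboolT //; exact: chart_partial_near.
- move=> a f1 f2 s1 s2.
  have s1a : smooth_at p (fun q => a * f1 q) by apply: smooth_at_M => //; exact: smooth_at_cst.
  rewrite !asboolT //; last exact: smooth_at_D.
  rewrite chart_partialD // chart_partialM //; last exact: smooth_at_cst.
  by rewrite chart_partial_cst mul0r add0r.
- by move=> f1 f2 s1 s2; rewrite !asboolT; [exact: chart_partialM| | |exact: smooth_at_M].
- by move=> f1 n1; rewrite asboolF.
Qed.

Lemma chart_vec_coord i j p : chart_dom c p -> chart_vec c i p (xc j) = (i == j)%:R.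
Proof. by move=> Dp; rewrite chart_vecE ?chart_partial_coord //; exact: smooth_at_coord. Qed.

Lemma tangent_sumE p (I : Type) (r : seq I) (F : I -> tangent p) f :
  (\sum_(i <- r) F i) f = \sum_(i <- r) F i f.
Proof. by elim: r => [|i r IH]; rewrite ?big_nil // !big_cons -IH. Qed.

Lemma tangent_decomp p (v : tangent p) : chart_dom c p ->
  v = \sum_i v (xc i) *: chart_vec c i p.
Proof.
move=> Dp; apply: tangent_eq => f; rewrite tangent_sumE.
have [sf|nsf] := pselect (smooth_at p f).
  rewrite tangent_chartE //; apply: eq_bigr => i _.
  by rewrite -chart_vecE.
have v4 (w : tangent p) : w f = 0 by have [_ _ _ H] := tangentP w; exact: H.
by rewrite v4 big1 // => i _; rewrite v4.
Qed.

Lemma tangent_coord_eq p (v w : tangent p) : chart_dom c p ->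
  (forall i, v (xc i) = w (xc i)) -> v = w.
Proof.
move=> Dp vw; rewrite (tangent_decomp v Dp) (tangent_decomp w Dp).
by apply: eq_bigr => i _; rewrite vw.
Qed.

Lemma smooth_vfield_coord U (X : vfield M) i : U `<=` chart_dom c -> open U ->
  smooth_vfield U X -> smooth_fun U (fun q => X q (xc i)).
Proof.
move=> UD oU sX; apply: sX => //; apply: smooth_fun_sub UD _.
exact: smooth_chart_coord.
Qed.

Lemma smooth_vfieldP U (X : vfield M) : U `<=` chart_dom c -> open U ->
  (forall i, smooth_fun U (fun q => X q (xc i))) -> smooth_vfield U X.
Proof.
move=> UD oU sX V f oV VU sf.
have VD : V `<=` chart_dom c by exact: subset_trans UD.
have H : smooth_fun V (fun q => \sum_i X q (xc i) * chart_partial c i f q).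
  apply: smooth_fun_sum => // i; apply: smooth_fun_M => //.
    exact: smooth_fun_sub (sX i).
  exact: smooth_chart_partial.
apply: (smooth_fun_ext oV _ H) => q Vq; rewrite -tangent_chartE //; first exact: VD.
by exists V.
Qed.

Lemma smooth_chart_vec i : smooth_vfield (chart_dom c) (chart_vec c i).
Proof.
apply: smooth_vfieldP => //; first exact: chart_open_dom.
move=> j; apply: (smooth_fun_ext (chart_open_dom c) _ (smooth_fun_cst (i == j)%:R (chart_open_dom c))).
by move=> q Dq; rewrite chart_vec_coord.
Qed.

End ChartFrame.

Lemma smooth_vfield_sub U V (X : vfield M) : V `<=` U -> smooth_vfield U X -> smooth_vfield V X.
Proof. by move=> VU sX W f oW WV; apply: sX => //; exact: subset_trans VU. Qed.

Lemma smooth_vfield_ext U (X Y : vfield M) : open U -> (forall q, U q -> X q = Y q) ->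
  smooth_vfield U X -> smooth_vfield U Y.
Proof.
move=> oU XY sX W f oW WU sf; apply: (smooth_fun_ext oW _ (sX W f oW WU sf)) => q Wq.
by rewrite XY //; exact: WU.
Qed.

End ManifoldCalculus.

(** * Clifford action and exterior derivative in coordinates *)

Section ExtformAlgebra.
Variables (R : realType) (V : lmodType R).
Implicit Types (w : extform V) (a b : dual V) (x y : V).

Lemma extform_eq w w' : (forall s, w s = w' s) -> w = w'.
Proof. by move=> H; apply: val_inj; apply/funext. Qed.

Lemma dual_eq a b : (forall v, a v = b v) -> a = b.
Proof. by move=> H; apply: val_inj; apply/funext. Qed.

Lemma dual_linear a : linear a.
Proof. by case: a => a /= aP; apply/asboolP. Qed.

Lemma dualD a x y : a (x + y) = a x + a y.
Proof. by have := dual_linear a 1 x y; rewrite !scale1r. Qed.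

Lemma dual0 a : a 0 = 0.
Proof. by apply: (addIr (a 0)); rewrite -dualD !add0r. Qed.

Lemma dualZ a (c : R) x : a (c *: x) = c * a x.
Proof. by have := dual_linear a c x 0; rewrite addr0 dual0 addr0. Qed.

Lemma dual_sum a (I : Type) (r : seq I) (F : I -> V) : a (\sum_(i <- r) F i) = \sum_(i <- r) a (F i).
Proof. by elim: r => [|i r IH]; rewrite ?big_nil ?dual0 // !big_cons dualD IH. Qed.

Lemma ext_lin w s1 (c : R) x y s2 :
  w (s1 ++ (c *: x + y) :: s2) = c * w (s1 ++ x :: s2) + w (s1 ++ y :: s2).
Proof. by have [H _] := extformP w. Qed.

Lemma extD w s1 x y s2 : w (s1 ++ (x + y) :: s2) = w (s1 ++ x :: s2) + w (s1 ++ y :: s2).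
Proof. by have := ext_lin w s1 1 x y s2; rewrite scale1r mul1r. Qed.

Lemma ext0 w s1 s2 : w (s1 ++ 0 :: s2) = 0.
Proof. by apply: (addIr (w (s1 ++ 0 :: s2))); rewrite -extD !add0r. Qed.

Lemma extZ w s1 (c : R) x s2 : w (s1 ++ (c *: x) :: s2) = c * w (s1 ++ x :: s2).
Proof. by have := ext_lin w s1 c x 0 s2; rewrite ext0 !addr0. Qed.

Lemma ext_sum w s1 (I : Type) (r : seq I) (F : I -> V) s2 :
  w (s1 ++ (\sum_(i <- r) F i) :: s2) = \sum_(i <- r) w (s1 ++ F i :: s2).
Proof. by elim: r => [|i r IH]; rewrite ?big_nil ?ext0 // !big_cons extD IH. Qed.

Lemma ext_alt w s1 x s2 : w (s1 ++ x :: x :: s2) = 0.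
Proof. by have [_ H] := extformP w. Qed.

Lemma ext_swap w s1 x y s2 : w (s1 ++ x :: y :: s2) = - w (s1 ++ y :: x :: s2).
Proof.
have := ext_alt w s1 (x + y) s2; rewrite (extD w s1).
have E z : w (s1 ++ z :: (x + y) :: s2) = w (s1 ++ z :: x :: s2) + w (s1 ++ z :: y :: s2).
  by rewrite -!(cat_rcons z); exact: extD.
rewrite !E.
rewrite (ext_alt w s1 x) (ext_alt w s1 y) add0r addr0.
by move/eqP; rewrite addr_eq0 => /eqP.
Qed.

Lemma ext_front w s1 x s2 : w (s1 ++ x :: s2) = (-1) ^+ size s1 * w (x :: s1 ++ s2).
Proof.
elim/last_ind: s1 s2 => [|s1 y IH] s2; first by rewrite mul1r.
rewrite cat_rcons (ext_swap w s1) (IH (y :: s2)) size_rcons exprS mulN1r mulNr; congr (- (_ * w (_ :: _))).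
by rewrite cat_rcons.
Qed.

Lemma extform_addE w w' s : (w + w') s = w s + w' s. Proof. by []. Qed.
Lemma extform_scaleE (c : R) w s : (c *: w) s = c * w s. Proof. by []. Qed.
Lemma extform_oppE w s : (- w) s = - w s.
Proof. by rewrite -scaleN1r extform_scaleE mulN1r. Qed.
Lemma extform_sumE (I : Type) (r : seq I) (F : I -> extform V) s :
  (\sum_(i <- r) F i) s = \sum_(i <- r) F i s.
Proof. by elim: r => [|i r IH]; rewrite ?big_nil // !big_cons -IH. Qed.
Definition extform_valE := (extform_addE, extform_oppE, extform_scaleE).
Lemma dual_addE a b x : (a + b) x = a x + b x. Proof. by []. Qed.
Lemma dual_scaleE (c : R) a x : (c *: a) x = c * a x. Proof. by []. Qed.
Lemma dual_sumE (I : Type) (r : seq I) (F : I -> dual V) x :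
  (\sum_(i <- r) F i) x = \sum_(i <- r) F i x.
Proof. by elim: r => [|i r IH]; rewrite ?big_nil // !big_cons -IH. Qed.

Lemma contract_linl (c : R) x y w : contract (c *: x + y) w = c *: contract x w + contract y w.
Proof. by apply: extform_eq => s; exact: (ext_lin w [::]). Qed.

Lemma contract_linr (c : R) x w w' : contract x (c *: w + w') = c *: contract x w + contract x w'.
Proof. exact: extform_eq. Qed.

Lemma wedge1_linr a (c : R) w w' : wedge1 a (c *: w + w') = c *: wedge1 a w + wedge1 a w'.
Proof. by apply: extform_eq => s; apply: wedge1_lin. Qed.

Lemma wedge1_linl (c : R) a b w : wedge1 (c *: a + b) w = c *: wedge1 a w + wedge1 b w.
Proof.
apply: extform_eq => s; rewrite /= /wedge1_fun.
rewrite -[RHS]/(c * wedge1_fun a w s + wedge1_fun b w s) /wedge1_fun mulr_sumr -big_split /=.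
apply: eq_bigr => i _.
rewrite [LHS](_ : _ = (-1) ^+ i * ((c * a (nth 0 s i) + b (nth 0 s i)) * w (omit i s))) //.
by rewrite mulrDl mulrDr; congr (_ + _); rewrite -!mulrA mulrCA.
Qed.

Lemma contract_wedge1 x a w : contract x (wedge1 a w) = a x *: w - wedge1 a (contract x w).
Proof.
apply: extform_eq => s; rewrite extform_addE extform_oppE extform_scaleE.
exact: wedge1_cons.
Qed.

Lemma contract_contract x y w : contract x (contract y w) = - contract y (contract x w).
Proof. by apply: extform_eq => s; rewrite extform_oppE; exact: (ext_swap w [::]). Qed.

(** Forms are compared on lists of vectors, so the induction is on the list: contraction with its
    first vector passes through both wedges by [contract_wedge1], and what remains is the same claim
    for the contracted form. *)
Lemma wedge1_wedge1 a b w : wedge1 a (wedge1 b w) = - wedge1 b (wedge1 a w).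
Proof.
apply: extform_eq => s; rewrite extform_oppE; elim: s w => [|x s IH] w.
  by rewrite /= /wedge1_fun !big_ord0 oppr0.
have E (u v : dual V) : wedge1 u (wedge1 v w) (x :: s) =
    u x * wedge1 v w s - v x * wedge1 u w s + wedge1 u (wedge1 v (contract x w)) s.
  rewrite -[LHS]/(contract x (wedge1 u (wedge1 v w)) s) !contract_wedge1.
  rewrite extform_addE extform_oppE extform_scaleE -addrA; congr (_ + _).
  have -> : v x *: w - wedge1 v (contract x w) = v x *: w + (-1) *: wedge1 v (contract x w).
    by rewrite scaleN1r.
  rewrite wedge1_linr extform_addE extform_scaleE opprD; congr (_ + _).
  have -> : -1 *: wedge1 v (contract x w) = -1 *: wedge1 v (contract x w) + 0 by rewrite addr0.
  rewrite wedge1_linr extform_addE extform_scaleE mulN1r opprD opprK.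
  rewrite [X in _ - X](_ : _ = 0) ?subr0 //.
  by rewrite /= /wedge1_fun big1 // => i _; rewrite !mulr0.
by rewrite !E IH opprD opprB.
Qed.

End ExtformAlgebra.

Section CliffordAlgebra.
Variables (R : realType) (n : nat) (M : smooth_manifold R n) (p : M).
Implicit Types (x y : gtan p) (w : forms_at p).

Lemma clifford_linr x (c : R) w w' : clifford x (c *: w + w') = c *: clifford x w + clifford x w'.
Proof.
by rewrite /clifford contract_linr wedge1_linr scalerDr addrACA.
Qed.

Lemma clifford_linl (c : R) x y w : clifford (c *: x + y) w = c *: clifford x w + clifford y w.
Proof.
by rewrite /clifford contract_linl wedge1_linl scalerDr addrACA.
Qed.

Lemma cliffordDr x w w' : clifford x (w + w') = clifford x w + clifford x w'.
Proof. by have := clifford_linr x 1 w w'; rewrite !scale1r. Qed.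

Lemma clifford0r x : clifford x 0 = 0.
Proof. by apply: (addIr (clifford x 0)); rewrite -cliffordDr !add0r. Qed.

Lemma cliffordZr x (c : R) w : clifford x (c *: w) = c *: clifford x w.
Proof. by have := clifford_linr x c w 0; rewrite clifford0r !addr0. Qed.

Lemma cliffordDl x y w : clifford (x + y) w = clifford x w + clifford y w.
Proof. by have := clifford_linl 1 x y w; rewrite !scale1r. Qed.

Lemma clifford0l w : clifford (0 : gtan p) w = 0.
Proof. by apply: (addIr (clifford (0 : gtan p) w)); rewrite -cliffordDl !add0r. Qed.

Lemma cliffordZl (c : R) x w : clifford (c *: x) w = c *: clifford x w.
Proof. by have := clifford_linl c x 0 w; rewrite clifford0l !addr0. Qed.

Lemma cliffordNl x w : clifford (- x) w = - clifford x w.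
Proof. by rewrite -scaleN1r cliffordZl scaleN1r. Qed.

Lemma cliffordNr x w : clifford x (- w) = - clifford x w.
Proof. by rewrite -scaleN1r cliffordZr scaleN1r. Qed.

Lemma clifford_suml (I : Type) (r : seq I) (F : I -> gtan p) w :
  clifford (\sum_(i <- r) F i) w = \sum_(i <- r) clifford (F i) w.
Proof. by elim: r => [|i r IH]; rewrite ?big_nil ?clifford0l // !big_cons cliffordDl IH. Qed.

Lemma clifford_sumr (I : Type) (r : seq I) x (F : I -> forms_at p) :
  clifford x (\sum_(i <- r) F i) = \sum_(i <- r) clifford x (F i).
Proof. by elim: r => [|i r IH]; rewrite ?big_nil ?clifford0r // !big_cons cliffordDr IH. Qed.

Lemma clifford_rel x y w :
  clifford x (clifford y w) + clifford y (clifford x w) = (2 * inner x y) *: w.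
Proof.
have H (u v : gtan p) : clifford u (clifford v w) =
    contract u.1 (contract v.1 w) + wedge1 u.2 (wedge1 v.2 w)
    + (v.2 u.1 *: w + (wedge1 u.2 (contract v.1 w) - wedge1 v.2 (contract u.1 w))).
  rewrite {1}/clifford.
  have -> : contract u.1 (clifford v w) = contract u.1 (contract v.1 w) + contract u.1 (wedge1 v.2 w).
    by have := contract_linr 1 u.1 (contract v.1 w) (wedge1 v.2 w); rewrite !scale1r.
  have -> : wedge1 u.2 (clifford v w) = wedge1 u.2 (contract v.1 w) + wedge1 u.2 (wedge1 v.2 w).
    by have := wedge1_linr u.2 1 (contract v.1 w) (wedge1 v.2 w); rewrite !scale1r.
  rewrite contract_wedge1; apply: extform_eq => s; rewrite !extform_valE; ring.
rewrite !H (contract_contract y.1) (wedge1_wedge1 y.2).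
apply: extform_eq => s; rewrite !extform_valE /inner mulrA mulfV ?pnatr_eq0 // mul1r; ring.
Qed.

End CliffordAlgebra.

(** * The flat connection of a chart *)

Section CoordinateConnection.
Variables (R : realType) (n : nat) (M : smooth_manifold R n) (c : chart R n M).
Hypothesis hc : atlas c.
Implicit Types (p q : M) (U V : set M) (S : seq (vfield M)) (w : form M) (X Y : vfield M).

Local Notation xc := (chart_coord c).
Local Notation ev q S := [seq (X : vfield M) q | X <- S].

Lemma form_vals_smooth U w S : open U -> smooth_form U w -> smooth_vfields U S ->
  smooth_fun U (fun q => w q (ev q S)).
Proof. by move=> oU sw sS; exact: sw. Qed.

Lemma smooth_vfields_sub U V S : V `<=` U -> smooth_vfields U S -> smooth_vfields V S.
Proof. by move=> VU H i iS; apply: smooth_vfield_sub VU (H i iS). Qed.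

Lemma smooth_vfields_cons U X S : smooth_vfields U (X :: S) <-> smooth_vfield U X /\ smooth_vfields U S.
Proof.
split=> [H|[H1 H2] [|i]] //; last exact: H2.
by split=> [|i iS]; [exact: (H 0%N)|exact: (H i.+1)].
Qed.

Lemma smooth_vfields_cat U S T : smooth_vfields U S -> smooth_vfields U T -> smooth_vfields U (S ++ T).
Proof.
move=> sS sT; elim: S sS => // X S IH /smooth_vfields_cons [sX sS].
by apply/smooth_vfields_cons; split=> //; exact: IH.
Qed.

(** The extension of v with constant coordinates, that is, parallel for the flat connection of the
    chart ([nabla_const_ext]). *)
Definition const_ext p (v : tangent p) : vfield M := fun q => \sum_i v (xc i) *: chart_vec c i q.

Lemma const_ext_at p (v : tangent p) : chart_dom c p -> const_ext v p = v.
Proof. by move=> Dp; rewrite [RHS](tangent_decomp hc v Dp). Qed.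

Lemma const_ext_coord p (v : tangent p) q j : chart_dom c q -> const_ext v q (xc j) = v (xc j).
Proof.
move=> Dq; rewrite /const_ext tangent_sumE (bigD1 j) //= big1 ?addr0 => [|i ij].
  by rewrite -[LHS]/(v (xc j) * chart_vec c j q (xc j)) chart_vec_coord // eqxx mulr1.
rewrite -[LHS]/(v (xc i) * chart_vec c i q (xc j)) chart_vec_coord //.
by rewrite (negbTE ij) mulr0.
Qed.

Lemma smooth_const_ext p (v : tangent p) : smooth_vfield (chart_dom c) (const_ext v).
Proof.
apply: (smooth_vfieldP hc) => //; first exact: chart_open_dom.
move=> i; apply: (smooth_fun_ext (@chart_open_dom _ _ _ c) _ (smooth_fun_cst (v (xc i)) (@chart_open_dom _ _ _ c))).
by move=> q Dq; rewrite const_ext_coord.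
Qed.

Lemma smooth_const_exts p (s : seq (tangent p)) : smooth_vfields (chart_dom c) [seq const_ext v | v <- s].
Proof.
elim: s => // v s IH; apply/smooth_vfields_cons; split=> //; exact: smooth_const_ext.
Qed.

Lemma const_exts_at p (s : seq (tangent p)) : chart_dom c p -> ev p [seq const_ext v | v <- s] = s.
Proof.
by move=> Dp; rewrite -map_comp; elim: s => //= v s ->; rewrite const_ext_at.
Qed.

Lemma const_ext_lin p (a : R) (v v' : tangent p) q :
  const_ext (a *: v + v') q = a *: const_ext v q + const_ext v' q.
Proof.
rewrite /const_ext scaler_sumr -big_split; apply: eq_bigr => i _ /=.
by rewrite [X in X *: _ = _](_ : _ = a * v (xc i) + v' (xc i)) // scalerDl scalerA.
Qed.

(** The flat connection on forms: the arguments are extended to parallel fields before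
    differentiating. The default 0 only concerns forms that are not smooth near p
    ([nabla_formE]). *)
Definition nabla_form i w : form M := fun p =>
  insubd (0 : forms_at p) (fun s : seq (tangent p) =>
    chart_partial c i (fun q => w q (ev q [seq const_ext v | v <- s])) p : R^o).

Lemma form_const_smooth p U w (s : seq (tangent p)) : open U -> U p -> chart_dom c p ->
  smooth_form U w -> smooth_at p (fun q => w q (ev q [seq const_ext v | v <- s])).
Proof.
move=> oU Up Dp sw; exists (U `&` chart_dom c); split=> //.
  by apply: openI => //; exact: chart_open_dom.
have oUD : open (U `&` chart_dom c) by apply: openI => //; exact: chart_open_dom.
have UDD : U `&` chart_dom c `<=` chart_dom c by move=> q [].
have UDU : U `&` chart_dom c `<=` U by move=> q [].
have sS := smooth_vfields_sub UDD (@smooth_const_exts p s).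
exact: (sw _ _ oUD UDU sS).
Qed.

Lemma nabla_formE i w p U (s : seq (tangent p)) : open U -> U p -> chart_dom c p ->
  smooth_form U w ->
  nabla_form i w p s = chart_partial c i (fun q => w q (ev q [seq const_ext v | v <- s])) p.
Proof.
move=> oU Up Dp sw; rewrite /nabla_form /= -[LHS]/(val _ s) val_insubd.
case: ifPn => // /negP; case; apply/asboolP; split.
  move=> s1 a x y s2.
  have E : (fun q => w q (ev q [seq const_ext v | v <- s1 ++ (a *: x + y) :: s2])) =
      (fun q => a * w q (ev q [seq const_ext v | v <- s1 ++ x :: s2]) +
                w q (ev q [seq const_ext v | v <- s1 ++ y :: s2])).
    by apply/funext => q; rewrite !map_cat /= const_ext_lin; exact: ext_lin.
  rewrite E chart_partialD //; last 2 first.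
  - by apply: smooth_at_M; [exact: smooth_at_cst|exact: form_const_smooth sw].
  - exact: form_const_smooth sw.
  rewrite chart_partialM //; [|exact: smooth_at_cst|exact: form_const_smooth sw].
  by rewrite chart_partial_cst mul0r add0r.
move=> s1 x s2.
have E : (fun q => w q (ev q [seq const_ext v | v <- s1 ++ x :: x :: s2])) = (fun=> 0).
  by apply/funext => q; rewrite !map_cat /=; exact: ext_alt.
by rewrite E chart_partial_cst.
Qed.

Definition nabla_vec i X : vfield M := fun q =>
  \sum_j chart_partial c i (fun q' => X q' (xc j)) q *: chart_vec c j q.

Lemma nabla_vec_coord i X q j : chart_dom c q ->
  nabla_vec i X q (xc j) = chart_partial c i (fun q' => X q' (xc j)) q.
Proof.
move=> Dq; rewrite /nabla_vec tangent_sumE (bigD1 j) //= big1 ?addr0 => [|k kj].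
  rewrite -[LHS]/(chart_partial c i (fun q' => X q' (xc j)) q * chart_vec c j q (xc j)).
  by rewrite chart_vec_coord // eqxx mulr1.
rewrite -[LHS]/(chart_partial c i (fun q' => X q' (xc k)) q * chart_vec c k q (xc j)).
by rewrite chart_vec_coord // (negbTE kj) mulr0.
Qed.

Lemma smooth_nabla_vec i U X : open U -> U `<=` chart_dom c -> smooth_vfield U X ->
  smooth_vfield U (nabla_vec i X).
Proof.
move=> oU UD sX; apply: (smooth_vfieldP hc) => // j.
have H : smooth_fun U (chart_partial c i (fun q => X q (xc j))).
  by apply: smooth_chart_partial => //; exact: smooth_vfield_coord sX.
by apply: (smooth_fun_ext oU _ H) => q Uq; rewrite nabla_vec_coord //; exact: UD.
Qed.

Lemma nabla_const_ext i p (v : tangent p) q : chart_dom c q -> nabla_vec i (const_ext v) q = 0.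
Proof.
move=> Dq; apply: (tangent_coord_eq hc Dq) => j; rewrite nabla_vec_coord //.
transitivity (chart_partial c i (fun=> v (xc j)) q); last exact: chart_partial_cst.
apply: chart_partial_near => //.
by apply: (open_near_eq (@chart_open_dom _ _ _ c)) => // q' Dq'; rewrite const_ext_coord.
Qed.

(** The correction terms of the Leibniz rule: each entry of s pairs a vector with its derivative,
    and each term replaces one vector by its derivative. The prefix s1 holds the arguments already
    passed, which stay as they are. *)
Fixpoint deriv_sum (T : lmodType R) (w : extform T) (s1 : seq T) (s : seq (T * T)) : R :=
  if s is z :: s' then w (s1 ++ z.2 :: [seq y.1 | y <- s']) + deriv_sum w (rcons s1 z.1) s'
  else 0.

Lemma deriv_sumE (T : lmodType R) (w : extform T) s1 (s : seq (T * T)) :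
  deriv_sum w s1 s = \sum_(j < size s)
    (-1) ^+ (size s1 + j) * w ((nth 0 s j).2 :: s1 ++ omit j [seq y.1 | y <- s]).
Proof.
elim: s s1 => [|z s IH] s1 /=; first by rewrite big_ord0.
rewrite big_ord_recl /= ext_front addn0 /omit take0 drop1 /=; congr (_ + _).
rewrite IH; apply: eq_bigr => j _; rewrite size_rcons addSnnS /bump /= add1n.
by rewrite cat_rcons.
Qed.

Local Notation dpair i q S := [seq ((X : vfield M) q, nabla_vec i X q) | X <- S].

Lemma map_dpair i q S : [seq y.1 | y <- dpair i q S] = ev q S.
Proof. by rewrite -map_comp. Qed.

(** The prefix s1 makes the induction possible: one field after the other is frozen to the parallel
    extension of its value at p, and each freezing costs one term of [deriv_sum]. With s1 empty this
    is the Leibniz rule. *)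
Lemma nabla_leibniz_gen i U w p (s1 : seq (tangent p)) S : open U -> U p ->
  U `<=` chart_dom c -> smooth_form U w -> smooth_vfields U S ->
  chart_partial c i (fun q => w q (ev q ([seq const_ext v | v <- s1] ++ S))) p =
  nabla_form i w p (s1 ++ ev p S) + deriv_sum (w p) s1 (dpair i p S).
Proof.
move=> oU Up UD sw; have Dp := UD _ Up.
elim: S s1 => [|X S IH] s1 sS /=.
  by rewrite !cats0 addr0 (nabla_formE _ _ oU).
have /smooth_vfields_cons [sX sS'] := sS.
have sC (s : seq (tangent p)) : smooth_vfields U [seq const_ext v | v <- s].
  exact: (smooth_vfields_sub UD (@smooth_const_exts p s)).
have IH' := IH (rcons s1 (X p)) sS'.
rewrite map_rcons cat_rcons [rcons s1 _ ++ _]cat_rcons in IH'.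
rewrite addrCA -IH' addrC.
set A := [seq const_ext v | v <- s1] in IH' *.
have sAj Z : smooth_vfield U Z -> smooth_at p (fun q => w q (ev q (A ++ Z :: S))).
  move=> sZ; apply: (smooth_fun_at oU Up); apply: sw => //.
  by apply: smooth_vfields_cat; [exact: sC|apply/smooth_vfields_cons].
have sXj j : smooth_at p (fun q => X q (xc j)).
  by apply: (smooth_fun_at oU Up); exact: smooth_vfield_coord sX.
have svj j : smooth_vfield U (chart_vec c j).
  by apply: smooth_vfield_sub UD _; exact: smooth_chart_vec.
(* Product rule for an argument written in the coordinate frame. X and the parallel extension of X p
   have the same coefficients at p, so the two derivatives differ exactly by the term containing the
   derivative of X. *)
have expand (F : 'I_n -> M -> R) :
  (forall j, smooth_at p (F j)) ->
  chart_partial c i (fun q => \sum_j F j q * w q (ev q (A ++ chart_vec c j :: S))) p =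
  \sum_j (chart_partial c i (F j) p * w p (ev p (A ++ chart_vec c j :: S)) +
           F j p * chart_partial c i (fun q => w q (ev q (A ++ chart_vec c j :: S))) p).
  move=> sF.
  have sP j : smooth_at p (fun q => F j q * w q (ev q (A ++ chart_vec c j :: S))).
    by apply: smooth_at_M => //; exact: sAj.
  have [sS1 E] := tangent_sum (chart_vec c i p) (index_enum 'I_n) sP.
  rewrite chart_vecE // in E; rewrite E; apply: eq_bigr => j _.
  by rewrite chart_vecE // chart_partialM //; exact: sAj.
have EX (Z : vfield M) q : chart_dom c q -> w q (ev q (A ++ Z :: S)) =
    \sum_j Z q (xc j) * w q (ev q (A ++ chart_vec c j :: S)).
  move=> Dq; rewrite !map_cat /= {1}(tangent_decomp hc (Z q) Dq) ext_sum.
  by apply: eq_bigr => j _; rewrite extZ map_cat.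
have near1 (Z : vfield M) (F : 'I_n -> M -> R) : (forall q j, chart_dom c q -> Z q (xc j) = F j q) ->
   chart_partial c i (fun q => w q (ev q (A ++ Z :: S))) p =
   chart_partial c i (fun q => \sum_j F j q * w q (ev q (A ++ chart_vec c j :: S))) p.
  move=> ZF; apply: chart_partial_near => //.
  apply: (open_near_eq (@chart_open_dom _ _ _ c)) => // q Dq.
  by rewrite EX //; apply: eq_bigr => j _; rewrite ZF.
rewrite (near1 X (fun j q => X q (xc j))) // expand //.
rewrite (near1 (const_ext (X p)) (fun j _ => X p (xc j))); last by move=> q j Dq; rewrite const_ext_coord.
rewrite expand; last by move=> j; exact: smooth_at_cst.
rewrite big_split /= [RHS]addrC; congr (_ + _); last first.
  by apply: eq_bigr => j _; rewrite chart_partial_cst mul0r add0r.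
rewrite map_dpair -(const_exts_at s1 Dp) -/A.
have := EX (nabla_vec i X) p Dp; rewrite map_cat /= => ->.
by apply: eq_bigr => j _; rewrite nabla_vec_coord.
Qed.

End CoordinateConnection.

Lemma omit0 (T : Type) (x : T) (s : seq T) : omit 0 (x :: s) = s.
Proof. by rewrite /omit take0 /= drop0. Qed.

Lemma omitS (T : Type) (x : T) i (s : seq T) : omit i.+1 (x :: s) = x :: omit i s.
Proof. by []. Qed.

Lemma map_omit (T T' : Type) (f : T -> T') i (s : seq T) : map f (omit i s) = omit i (map f s).
Proof. by rewrite /omit map_cat map_take map_drop. Qed.

Section LieBracket.
Variables (R : realType) (n : nat) (M : smooth_manifold R n).
Implicit Types (p q : M) (U V : set M) (X Y : vfield M).

Lemma tangent_addE p (v w : tangent p) f : (v + w) f = v f + w f. Proof. by []. Qed.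
Lemma tangent_scaleE p (a : R) (v : tangent p) f : (a *: v) f = a * v f. Proof. by []. Qed.
Lemma tangent_oppE p (v : tangent p) f : (- v) f = - v f.
Proof. by rewrite -scaleN1r tangent_scaleE mulN1r. Qed.

Lemma lie_bracketE U X Y p f : open U -> U p -> smooth_vfield U X -> smooth_vfield U Y ->
  smooth_at p f -> lie_bracket X Y p f = X p (fun q => Y q f) - Y p (fun q => X q f).
Proof.
move=> oU Up sX sY sf.
have sat (Z : vfield M) g : smooth_vfield U Z -> smooth_at p g -> smooth_at p (fun q => Z q g).
  move=> sZ [W [oW Wp sg]]; exists (U `&` W); split=> //; first exact: openI.
  by apply: sZ; [exact: openI|by move=> q []|apply: smooth_fun_sub sg => q []].
rewrite /lie_bracket val_insubd.
suff -> : (fun f : M -> R^o => if `[< smooth_at p f >]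
     then X p (fun q => Y q f) - Y p (fun q => X q f) else 0) \in is_tangent p by rewrite asboolT.
apply/asboolP; split.
- move=> f1 f2 s1 f12.
  have := f12 : nbhs p [set q | f1 q = f2 q].
  rewrite nbhsE => -[V [oV Vp] VE].
  have [W [oW Wp sW]] := s1.
  have oVW : open (V `&` W) by exact: openI.
  have s2 : smooth_at p f2.
    exists (V `&` W); split=> //.
    apply: (smooth_fun_ext oVW _ (smooth_fun_sub _ sW)) => [q [/VE]|q []] //.
  rewrite !asboolT //.
  have H (Z Z' : vfield M) : smooth_vfield U Z' ->
      Z p (fun q => Z' q f1) = Z p (fun q => Z' q f2).
    move=> sZ'; apply: tangent_near; first exact: sat.
    apply: (open_near_eq oVW) => // q [Vq Wq]; apply: tangent_near; first by exists W.
    by apply: (open_near_eq oV) => // q' /VE.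
  by rewrite (H X Y) // (H Y X).
- move=> a f1 f2 s1 s2.
  have s1a : smooth_at p (fun q => a * f1 q) by apply: smooth_at_M => //; exact: smooth_at_cst.
  rewrite !asboolT //; last exact: smooth_at_D.
  have [W [oW Wp sW1 sW2]] := smooth_at2 s1 s2.
  have H (Z Z' : vfield M) : smooth_vfield U Z' ->
      Z p (fun q => Z' q (fun q => a * f1 q + f2 q)) =
      a * Z p (fun q => Z' q f1) + Z p (fun q => Z' q f2).
    move=> sZ'.
    have b1 := sat Z' f1 sZ' s1.
    have b2 := sat Z' f2 sZ' s2.
    have b1a : smooth_at p (fun q => a * Z' q f1) by apply: smooth_at_M => //; exact: smooth_at_cst.
    rewrite -(tangentZ (Z p) a b1) -(tangentD (Z p) b1a b2).
    apply/esym; apply: tangent_near; first exact: smooth_at_D.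
    apply: (open_near_eq oW) => // q Wq.
    have t1 : smooth_at q f1 by exists W.
    have t2 : smooth_at q f2 by exists W.
    by have [_ H _ _] := tangentP (Z' q); rewrite H.
  by rewrite (H X Y) // (H Y X) //; ring.
- move=> f1 f2 s1 s2.
  rewrite !asboolT //; last exact: smooth_at_M.
  have [W [oW Wp sW1 sW2]] := smooth_at2 s1 s2.
  have H (Z Z' : vfield M) : smooth_vfield U Z' ->
      Z p (fun q => Z' q (fun q => f1 q * f2 q)) =
      Z p (fun q => Z' q f1) * f2 p + Z' p f1 * Z p f2 +
      (Z p f1 * Z' p f2 + f1 p * Z p (fun q => Z' q f2)).
    move=> sZ'.
    have a1 : smooth_at p (fun q => Z' q f1 * f2 q) by apply: smooth_at_M => //; exact: sat.
    have a2 : smooth_at p (fun q => f1 q * Z' q f2) by apply: smooth_at_M => //; exact: sat.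
    have b1 := sat Z' f1 sZ' s1.
    have b2 := sat Z' f2 sZ' s2.
    rewrite -(tangentM (Z p) b1 s2) -(tangentM (Z p) s1 b2) -(tangentD (Z p) a1 a2).
    apply/esym; apply: tangent_near; first exact: smooth_at_D.
    apply: (open_near_eq oW) => // q Wq.
    by rewrite tangentM //; exists W.
  by rewrite (H X Y) // (H Y X) //; ring.
- by move=> f1 n1; rewrite asboolF.
Qed.

End LieBracket.

(** * The exterior derivative in coordinates *)

Section CartanFormula.
Variables (R : realType) (n : nat) (M : smooth_manifold R n) (c : chart R n M).
Hypothesis hc : atlas c.
Implicit Types (p q : M) (U V : set M) (S : seq (vfield M)) (w : form M) (X Y : vfield M).

Local Notation xc := (chart_coord c).
Local Notation ev q S := [seq (X : vfield M) q | X <- S].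
Local Notation dpair i q S := [seq ((X : vfield M) q, nabla_vec c i X q) | X <- S].

(** The flat connection has no torsion. *)
Lemma lie_bracket_nabla U X Y p : open U -> U p -> chart_dom c p ->
  smooth_vfield U X -> smooth_vfield U Y ->
  lie_bracket X Y p = \sum_i X p (xc i) *: nabla_vec c i Y p - \sum_i Y p (xc i) *: nabla_vec c i X p.
Proof.
move=> oU Up Dp sX sY; apply: (tangent_coord_eq hc Dp) => j.
rewrite (lie_bracketE oU Up) //; last exact: smooth_at_coord.
rewrite tangent_addE tangent_oppE !tangent_sumE.
have oUD : open (U `&` chart_dom c) by apply: openI => //; exact: chart_open_dom.
have UDD : U `&` chart_dom c `<=` chart_dom c by move=> q [].
have H (Z Z' : vfield M) : smooth_vfield U Z' ->
    Z p (fun q => Z' q (xc j)) = \sum_i (Z p (xc i) *: nabla_vec c i Z' p) (xc j).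
  move=> sZ'; rewrite (tangent_chartE hc) //; last first.
    apply: (smooth_fun_at oUD) => //; apply: smooth_vfield_coord => //.
    by apply: smooth_vfield_sub sZ' => q [].
  by apply: eq_bigr => i _; rewrite tangent_scaleE nabla_vec_coord.
by rewrite !H.
Qed.

Lemma smooth_deriv_sum i U w S1 S : open U -> U `<=` chart_dom c -> smooth_form U w ->
  smooth_vfields U S1 -> smooth_vfields U S ->
  smooth_fun U (fun q => deriv_sum (w q) (ev q S1) (dpair i q S)).
Proof.
move=> oU UD sw; elim: S S1 => [|X S IH] S1 sS1 sS /=; first exact: smooth_fun_cst.
have /smooth_vfields_cons [sX sS'] := sS.
have sn := smooth_nabla_vec hc i oU UD sX.
have sS1X : smooth_vfields U (rcons S1 X).
  by rewrite -cats1; apply: smooth_vfields_cat => //; apply/smooth_vfields_cons; split.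
have sA : smooth_vfields U (S1 ++ nabla_vec c i X :: S).
  by apply: smooth_vfields_cat => //; apply/smooth_vfields_cons; split.
apply: (smooth_fun_ext oU _ (smooth_fun_D oU (form_vals_smooth oU sw sA) (IH _ sS1X sS'))) => q Uq.
by rewrite map_dpair map_rcons map_cat.
Qed.

Lemma smooth_nabla_form i U w : open U -> U `<=` chart_dom c -> smooth_form U w ->
  smooth_form U (nabla_form c i w).
Proof.
move=> oU UD sw V S oV VU sS.
have VD : V `<=` chart_dom c by exact: subset_trans UD.
have swV : smooth_form V w.
  by move=> W T oW WV; apply: sw => //; exact: subset_trans VU.
have s1 := smooth_chart_partial hc i oV VD (form_vals_smooth oV swV sS).
have s2 := smooth_deriv_sum i oV VD swV (S1 := [::]) _ sS.
apply: (smooth_fun_ext oV _ (smooth_fun_B oV s1 (s2 _))) => // q Vq.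
have := nabla_leibniz_gen hc i [::] oV Vq VD swV sS.
by rewrite /= => ->; rewrite addrK.
Qed.

Lemma deriv_sum_0 (T : lmodType R) (w : extform T) s1 (s : seq T) :
  deriv_sum w s1 [seq (x, 0) | x <- s] = 0.
Proof. by elim: s s1 => //= x s IH s1; rewrite IH ext0 addr0. Qed.

Lemma dpair_const_ext i p (s : seq (tangent p)) : chart_dom c p ->
  dpair i p [seq const_ext c v | v <- s] = [seq (v, 0) | v <- s].
Proof.
move=> Dp; rewrite -map_comp; apply: eq_map => v /=.
by rewrite nabla_const_ext // const_ext_at.
Qed.

Lemma smooth_form_sub U V w : V `<=` U -> smooth_form U w -> smooth_form V w.
Proof. by move=> VU sw W T oW WV; apply: sw => //; exact: subset_trans VU. Qed.

Lemma smooth_contract U X w : smooth_vfield U X -> smooth_form U w ->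
  smooth_form U (fun q => contract (X q) (w q)).
Proof.
move=> sX sw V S oV VU sS; apply: (sw V (X :: S)) => //.
by apply/smooth_vfields_cons; split=> //; exact: smooth_vfield_sub sX.
Qed.

Lemma nabla_contract i U X w p : open U -> U p -> U `<=` chart_dom c ->
  smooth_vfield U X -> smooth_form U w ->
  nabla_form c i (fun q => contract (X q) (w q)) p =
  contract (nabla_vec c i X p) (w p) + contract (X p) (nabla_form c i w p).
Proof.
move=> oU Up UD sX sw; have Dp := UD _ Up; apply: extform_eq => s.
rewrite (nabla_formE hc _ _ oU) //; last exact: smooth_contract.
have sS : smooth_vfields U (X :: [seq const_ext c v | v <- s]).
  apply/smooth_vfields_cons; split=> //.
  by apply: (smooth_vfields_sub UD); exact: smooth_const_exts.
have := nabla_leibniz_gen hc i [::] oU Up UD sw sS.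
rewrite /= => ->; rewrite const_exts_at // dpair_const_ext // deriv_sum_0 addr0.
by rewrite -map_comp map_id_in // addrC.
Qed.

Fact chart_dual_subproof i p : (fun v : tangent p => v (xc i) : R^o) \in is_linform (V := tangent p).
Proof. by apply/asboolP => a x y. Qed.

Definition chart_dual i p : dual (tangent p) := Dual (chart_dual_subproof i p).

Definition local_d w : form M := fun p => \sum_i wedge1 (chart_dual i p) (nabla_form c i w p).

Lemma contract_sum (V : lmodType R) (x : V) (I : Type) (r : seq I) (F : I -> extform V) :
  contract x (\sum_(i <- r) F i) = \sum_(i <- r) contract x (F i).
Proof.
apply: extform_eq => s; rewrite extform_sumE -[LHS]/((\sum_(i <- r) F i) (x :: s)) extform_sumE //.
Qed.

Lemma wedge1Dr (V : lmodType R) (a : dual V) (w w' : extform V) : wedge1 a (w + w') = wedge1 a w + wedge1 a w'.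
Proof. by have := wedge1_linr a 1 w w'; rewrite !scale1r. Qed.

(** Evaluating on X first relates d w to d of the contraction of w by X. [cartan_formula_cons] is
    the same recursion for Cartan's formula, so the two agree by induction on the number of
    fields. *)
Lemma local_d_cons U X w S p : open U -> U p -> U `<=` chart_dom c ->
  smooth_vfield U X -> smooth_form U w -> smooth_vfields U S ->
  local_d w p (X p :: ev p S) = X p (fun q => w q (ev q S))
    - local_d (fun q => contract (X q) (w q)) p (ev p S)
    - \sum_(j < size S) (-1) ^+ j *
        w p (lie_bracket X (nth (fun=> 0) S j) p :: ev p (omit j S)).
Proof.
move=> oU Up UD sX sw sS; have Dp := UD _ Up.
pose s := ev p S.
have szs : size s = size S by rewrite size_map.
have -> : local_d w p (X p :: s) = \sum_i (X p (xc i) * nabla_form c i w p s)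
      - \sum_i wedge1 (chart_dual i p) (contract (X p) (nabla_form c i w p)) s.
  rewrite -[LHS]/(contract (X p) (local_d w p) s) contract_sum extform_sumE -sumrB.
  by apply: eq_bigr => i _; rewrite contract_wedge1 extform_addE extform_oppE extform_scaleE.
have -> : local_d (fun q => contract (X q) (w q)) p s =
     \sum_i wedge1 (chart_dual i p) (contract (nabla_vec c i X p) (w p)) s
   + \sum_i wedge1 (chart_dual i p) (contract (X p) (nabla_form c i w p)) s.
  rewrite extform_sumE -big_split; apply: eq_bigr => i _.
  by rewrite (nabla_contract i oU) // wedge1Dr extform_addE.
have -> : X p (fun q => w q (ev q S)) =
    \sum_i X p (xc i) * nabla_form c i w p s + \sum_i X p (xc i) * deriv_sum (w p) [::] (dpair i p S).
  rewrite (tangent_chartE hc) //; last by apply: (smooth_fun_at oU Up); exact: form_vals_smooth.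
  rewrite -big_split; apply: eq_bigr => i _ /=; rewrite -mulrDr.
  by have := nabla_leibniz_gen hc i [::] oU Up UD sw sS => /= ->.
(* By [lie_bracket_nabla] the bracket terms are the derivatives of the fields of S along X minus
   those of X along the fields of S; the two halves occur in the preceding rewritings. *)
have -> : \sum_(j < size S) (-1) ^+ j * w p (lie_bracket X (nth (fun=> 0) S j) p :: ev p (omit j S)) =
    \sum_i X p (xc i) * deriv_sum (w p) [::] (dpair i p S)
    - \sum_i wedge1 (chart_dual i p) (contract (nabla_vec c i X p) (w p)) s.
  have -> : \sum_i X p (xc i) * deriv_sum (w p) [::] (dpair i p S) =
     \sum_(j < size S) (-1) ^+ j * w p ((\sum_i X p (xc i) *: nabla_vec c i (nth (fun=> 0) S j) p) :: omit j s).
    transitivity (\sum_i \sum_(j < size S) X p (xc i) * ((-1) ^+ j * w p (nabla_vec c i (nth (fun=> 0) S j) p :: omit j s))).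
      apply: eq_bigr => i _; rewrite deriv_sumE size_map -mulr_sumr; congr (_ * _).
      apply: eq_bigr => j _; rewrite /= add0n map_dpair (nth_map (fun=> 0)) //.
    rewrite exchange_big; apply: eq_bigr => j _.
    rewrite (ext_sum (w p) [::]) mulr_sumr; apply: eq_bigr => i _.
    by rewrite (extZ (w p) [::]) mulrCA.
  have -> : \sum_i wedge1 (chart_dual i p) (contract (nabla_vec c i X p) (w p)) s =
     \sum_(j < size S) (-1) ^+ j * w p ((\sum_i nth (fun=> 0) S j p (xc i) *: nabla_vec c i X p) :: omit j s).
    transitivity (\sum_i \sum_(j < size S) (-1) ^+ j * (nth (fun=> 0) S j p (xc i) * w p (nabla_vec c i X p :: omit j s))).
      apply: eq_bigr => i _; rewrite /= /wedge1_fun szs; apply: eq_bigr => j _.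
      by rewrite /s (nth_map (fun=> 0)).
    rewrite exchange_big; apply: eq_bigr => j _.
    rewrite (ext_sum (w p) [::]) mulr_sumr; apply: eq_bigr => i _.
    by rewrite (extZ (w p) [::]).
  rewrite -sumrB; apply: eq_bigr => j _; rewrite -mulrBr; congr (_ * _).
  rewrite (lie_bracket_nabla oU Up Dp sX (sS _ (ltn_ord j))) map_omit -/s.
  rewrite (extD (w p) [::]) /= -scaleN1r (extZ (w p) [::]) mulN1r //.
ring.
Qed.

Local Arguments omit : simpl never.

(** The pairs (0, j) give the displayed brackets with X. In the pairs not involving X, moving the
    bracket behind X costs a sign and yields the double sum for the contracted form. *)
Lemma cartan_formula_cons X w S p :
  cartan_formula w (X :: S) p = X p (fun q => w q (ev q S))
    - cartan_formula (fun q => contract (X q) (w q)) S p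
    - \sum_(j < size S) (-1) ^+ j *
        w p (lie_bracket X (nth (fun=> 0) S j) p :: ev p (omit j S)).
Proof.
rewrite /cartan_formula /= big_ord_recl /= expr0 mul1r omit0.
rewrite [X in _ + X = _]big_ord_recl /= big_ord0 add0r.
rewrite opprD -!addrA; congr (_ + _).
have -> : \sum_(i < size S) (-1) ^+ bump 0 i * nth (fun=> 0) (X :: S) (bump 0 i) p
     (fun q => w q (ev q (omit (bump 0 i) (X :: S)))) =
   - \sum_(i < size S) (-1) ^+ i * nth (fun=> 0) S i p (fun q => contract (X q) (w q) (ev q (omit i S))).
  rewrite -sumrN; apply: eq_bigr => i _; rewrite /bump /= add1n exprS mulN1r mulNr.
  by [].
congr (_ + _).
transitivity (\sum_(j < size S) (- ((-1) ^+ j * w p (lie_bracket X (nth (fun=> 0) S j) p :: ev p (omit j S)))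
   - \sum_(i < j) (-1) ^+ (i + j) * w p (X p :: lie_bracket (nth (fun=> 0) S i) (nth (fun=> 0) S j) p :: ev p (omit i (omit j S))))).
  apply: eq_bigr => j _; rewrite /bump /= add1n big_ord_recl /= add0n exprS mulN1r mulNr.
  rewrite omitS omit0; congr (_ + _).
  rewrite -sumrN; apply: eq_bigr => i _; rewrite /bump /= add1n addSn addnS exprS exprS mulrA mulrNN mulr1 mul1r.
  by rewrite -mulrN (ext_swap (w p) [::]).
by rewrite big_split /= !sumrN addrC.
Qed.

Lemma cartan_local_d U w S p : open U -> U p -> U `<=` chart_dom c ->
  smooth_form U w -> smooth_vfields U S ->
  cartan_formula w S p = local_d w p (ev p S).
Proof.
move=> oU Up UD; elim: S w => [|X S IH] w sw sS.
  rewrite /cartan_formula !big_ord0 addr0 extform_sumE big1 // => i _.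
  exact: wedge1_nil.
have /smooth_vfields_cons [sX sS'] := sS.
rewrite cartan_formula_cons IH //; last exact: smooth_contract.
by rewrite [RHS](local_d_cons oU).
Qed.

(** The element selected by [xget] is unique, since parallel extensions realise every list of
    vectors at p by smooth fields; and [cartan_local_d] shows that the coordinate expression
    qualifies. *)
Lemma exterior_d_local U w p : open U -> U p -> chart_dom c p -> smooth_form U w ->
  exterior_d w p = local_d w p.
Proof.
move=> oU Up Dp sw; rewrite /exterior_d.
have oD : open (chart_dom c) by exact: chart_open_dom.
have P1 : [set e : forms_at p | forall U s, open U -> U p -> smooth_vfields U s ->
      extform_fun e [seq (X : vfield M) p | X <- s] = cartan_formula w s p] (local_d w p).
  move=> V s oV Vp ss.
  pose W := (U `&` V) `&` chart_dom c.
  have oW : open W by apply: openI => //; exact: openI.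
  have Wp : W p by [].
  have WD : W `<=` chart_dom c by move=> q [].
  rewrite (cartan_local_d oW Wp WD) //.
    by apply: smooth_form_sub sw => q [[]].
  by apply: smooth_vfields_sub ss => q [[]].
apply: xget_unique => // e' He'.
apply: extform_eq => s.
rewrite -(const_exts_at hc s Dp).
rewrite (He' (chart_dom c)) //; last exact: smooth_const_exts.
by rewrite (P1 (chart_dom c)) //; exact: smooth_const_exts.
Qed.

End CartanFormula.

Lemma sum_delta (R : pzRingType) n (F : 'I_n -> R) (j : 'I_n) : \sum_k F k * (j == k)%:R = F j.
Proof.
rewrite (bigD1 j) //= eqxx mulr1 big1 ?addr0 // => k kj.
by rewrite eq_sym (negbTE kj) mulr0.
Qed.

Section FormOperations.
Variables (R : realType) (n : nat) (M : smooth_manifold R n).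
Implicit Types (p q : M) (U V : set M) (S : seq (vfield M)) (w : form M) (X Y : vfield M)
  (al : forall q : M, dual (tangent q)) (x y : gfield M).

Local Notation ev q S := [seq (X : vfield M) q | X <- S].

Lemma smooth_form_D U w w' : open U -> smooth_form U w -> smooth_form U w' ->
  smooth_form U (fun q => w q + w' q).
Proof.
move=> oU sw sw' V S oV VU sS.
exact: (smooth_fun_D oV (sw V S oV VU sS) (sw' V S oV VU sS)).
Qed.

Lemma smooth_form_M U f w : open U -> smooth_fun U f -> smooth_form U w ->
  smooth_form U (fun q => f q *: w q).
Proof.
move=> oU sf sw V S oV VU sS.
exact: (smooth_fun_M oV (smooth_fun_sub VU sf) (sw V S oV VU sS)).
Qed.

Lemma smooth_form_Z U (a : R) w : open U -> smooth_form U w -> smooth_form U (fun q => a *: w q).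
Proof. by move=> oU; apply: smooth_form_M => //; exact: smooth_fun_cst. Qed.

Lemma smooth_form_ext U w w' : (forall q, U q -> w q = w' q) ->
  smooth_form U w -> smooth_form U w'.
Proof.
move=> E sw V S oV VU sS; apply: (smooth_fun_ext oV _ (sw V S oV VU sS)) => q Vq.
by rewrite E //; exact: VU.
Qed.

Lemma smooth_form_0 U : smooth_form U (fun=> 0).
Proof. by move=> V S oV VU sS; apply: (smooth_fun_cst 0 oV). Qed.

Lemma smooth_form_sum U (I : Type) (r : seq I) (F : I -> form M) : open U ->
  (forall i, smooth_form U (F i)) -> smooth_form U (fun q => \sum_(i <- r) F i q).
Proof.
move=> oU H; elim: r => [|i r IH].
  by apply: (smooth_form_ext _ (smooth_form_0 (U := U))) => q _; rewrite big_nil.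
by apply: (smooth_form_ext _ (smooth_form_D oU (H i) IH)) => q _; rewrite big_cons.
Qed.

Lemma smooth_form_local U w :
  (forall p, U p -> exists V, [/\ open V, V p & smooth_form V w]) -> smooth_form U w.
Proof.
move=> H W S oW WU sS; apply: smooth_fun_local => p Wp.
have [V [oV Vp sV]] := H p (WU _ Wp).
exists (W `&` V) => //; apply: sV; [exact: openI|by move=> q []|].
by apply: smooth_vfields_sub sS => q [].
Qed.

Lemma smooth_form1_eval U al X : open U -> smooth_form U (fun q => form1 (al q)) ->
  smooth_vfield U X -> smooth_fun U (fun q => al q (X q)).
Proof.
move=> oU sa sX; apply: (sa U [:: X]) => //.
by apply/smooth_vfields_cons; split.
Qed.

Lemma smooth_form1P U al :
  (forall V X, open V -> V `<=` U -> smooth_vfield V X -> smooth_fun V (fun q => al q (X q))) ->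
  smooth_form U (fun q => form1 (al q)).
Proof.
move=> H V [|X [|Y S]] oV VU sS; [exact: (smooth_fun_cst 0 oV)| |exact: (smooth_fun_cst 0 oV)].
by apply: H => //; have /smooth_vfields_cons [] := sS.
Qed.

Lemma smooth_vfields_nth U S k : smooth_vfields U S -> smooth_vfield U (nth (fun=> 0) S k).
Proof.
move=> sS; have [kS|Sk] := ltnP k (size S); first exact: sS.
rewrite nth_default // => V f oV VU sf; exact: (smooth_fun_cst 0 oV).
Qed.

Lemma smooth_vfields_omit U S k : smooth_vfields U S -> smooth_vfields U (omit k S).
Proof.
elim: S k => [|X S IH] [|k] // /smooth_vfields_cons [sX sS]; first by rewrite omit0.
by rewrite omitS; apply/smooth_vfields_cons; split=> //; exact: IH.
Qed.

Lemma wedge1_ev p al w S : wedge1 (al p) (w p) (ev p S) =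
  \sum_(k < size S) (-1) ^+ k * (al p (nth (fun=> 0) S k p) * w p (ev p (omit k S))).
Proof.
rewrite /= /wedge1_fun size_map; apply: eq_bigr => k _.
by rewrite (nth_map (fun=> 0)) // map_omit.
Qed.

Lemma smooth_wedge1 U al w : smooth_form U (fun q => form1 (al q)) -> smooth_form U w ->
  smooth_form U (fun q => wedge1 (al q) (w q)).
Proof.
move=> sa sw V S oV VU sS.
have H : smooth_fun V (fun q => \sum_(k < size S) (-1) ^+ k * (al q (nth (fun=> 0) S k q) * w q (ev q (omit k S)))).
  apply: smooth_fun_sum => // k; apply: smooth_fun_Z => //; apply: smooth_fun_M => //.
    apply: smooth_form1_eval => //; first exact: smooth_form_sub sa.
    exact: smooth_vfields_nth.
  by apply: sw => //; exact: smooth_vfields_omit.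
by apply: (smooth_fun_ext oV _ H) => q Vq; rewrite wedge1_ev.
Qed.

Lemma smooth_clifford U x w : open U -> smooth_gfield U x -> smooth_form U w ->
  smooth_form U (fun q => clifford (x q) (w q)).
Proof.
move=> oU [sX sa] sw; apply: smooth_form_D => //; first exact: smooth_contract.
exact: (smooth_wedge1 (al := fun q => (x q).2)).
Qed.

Lemma smooth_gfield_sub U V x : V `<=` U -> smooth_gfield U x -> smooth_gfield V x.
Proof.
by move=> VU [s1 s2]; split; [exact: smooth_vfield_sub s1|exact: smooth_form_sub s2].
Qed.

Lemma smooth_gfield_ext U x y : open U -> (forall q, U q -> x q = y q) ->
  smooth_gfield U x -> smooth_gfield U y.
Proof.
move=> oU xy [s1 s2]; split.
  by apply: (smooth_vfield_ext oU _ s1) => q Uq; rewrite xy.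
by apply: (smooth_form_ext _ s2) => q Uq; rewrite xy.
Qed.

Lemma gtan_fst_lin p (a : R) (u v : gtan p) : (a *: u + v).1 = a *: u.1 + v.1.
Proof. by []. Qed.

Lemma gtan_snd_lin p (a : R) (u v : gtan p) : (a *: u + v).2 = a *: u.2 + v.2.
Proof. by []. Qed.

Lemma smooth_gfield_lin U (f : M -> R) x y : open U -> smooth_fun U f -> smooth_gfield U x ->
  smooth_gfield U y -> smooth_gfield U (fun q => f q *: x q + y q).
Proof.
move=> oU sf [x1 x2] [y1 y2]; split.
  move=> V g oV VU sg.
  have H := smooth_fun_D oV (smooth_fun_M oV (smooth_fun_sub VU sf) (x1 V g oV VU sg)) (y1 V g oV VU sg).
  by apply: (smooth_fun_ext oV _ H) => q Vq; rewrite gtan_fst_lin.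
apply: smooth_form1P => V X oV VU sX.
have e1 := smooth_form1_eval (al := fun q => (x q).2) oV (smooth_form_sub VU x2) sX.
have e2 := smooth_form1_eval (al := fun q => (y q).2) oV (smooth_form_sub VU y2) sX.
have H := smooth_fun_D oV (smooth_fun_M oV (smooth_fun_sub VU sf) e1) e2.
by apply: (smooth_fun_ext oV _ H) => q Vq; rewrite gtan_snd_lin.
Qed.

Lemma smooth_gfield_0 U : open U -> smooth_gfield U (fun=> 0).
Proof.
move=> oU; split; first by move=> V f oV VU sf; exact: (smooth_fun_cst 0 oV).
by apply: smooth_form1P => V X oV VU sX; exact: (smooth_fun_cst 0 oV).
Qed.

Lemma smooth_gfield_M U (f : M -> R) x : open U -> smooth_fun U f -> smooth_gfield U x ->
  smooth_gfield U (fun q => f q *: x q).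
Proof.
move=> oU sf sx; have := smooth_gfield_lin oU sf sx (smooth_gfield_0 oU).
by apply: smooth_gfield_ext => // q _; rewrite addr0.
Qed.

Lemma smooth_gfield_D U x y : open U -> smooth_gfield U x -> smooth_gfield U y ->
  smooth_gfield U (fun q => x q + y q).
Proof.
move=> oU sx sy; have := smooth_gfield_lin oU (smooth_fun_cst 1 oU) sx sy.
by apply: smooth_gfield_ext => // q _; rewrite scale1r.
Qed.

Lemma smooth_gfield_Z U (a : R) x : open U -> smooth_gfield U x -> smooth_gfield U (fun q => a *: x q).
Proof. by move=> oU; apply: smooth_gfield_M => //; exact: smooth_fun_cst. Qed.

Lemma smooth_gfield_B U x y : open U -> smooth_gfield U x -> smooth_gfield U y ->
  smooth_gfield U (fun q => x q - y q).
Proof.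
move=> oU sx sy; have := smooth_gfield_lin oU (smooth_fun_cst (-1) oU) sy sx.
by apply: smooth_gfield_ext => // q _; rewrite scaleN1r addrC.
Qed.

Lemma smooth_gfield_sum U (I : Type) (r : seq I) (F : I -> gfield M) : open U ->
  (forall i, smooth_gfield U (F i)) -> smooth_gfield U (fun q => \sum_(i <- r) F i q).
Proof.
move=> oU H; elim: r => [|i r IH].
  by apply: (smooth_gfield_ext oU _ (smooth_gfield_0 oU)) => q _; rewrite big_nil.
by apply: (smooth_gfield_ext oU _ (smooth_gfield_D oU (H i) IH)) => q _; rewrite big_cons.
Qed.

Lemma smooth_inner U x y : open U -> smooth_gfield U x -> smooth_gfield U y ->
  smooth_fun U (fun q => inner (x q) (y q)).
Proof.
move=> oU [x1 x2] [y1 y2]; apply: smooth_fun_Z => //; apply: smooth_fun_D => //.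
  exact: (smooth_form1_eval (al := fun q => (x q).2)).
exact: (smooth_form1_eval (al := fun q => (y q).2)).
Qed.

End FormOperations.

(** * The Dorfman bracket as a derived bracket *)

Section CoordinateDorfman.
Variables (R : realType) (n : nat) (M : smooth_manifold R n) (c : chart R n M).
Hypothesis hc : atlas c.
Implicit Types (p q : M) (U V : set M) (S : seq (vfield M)) (w : form M) (X Y : vfield M)
  (al : forall q : M, dual (tangent q)) (x y : gfield M).

Local Notation xc := (chart_coord c).
Local Notation ev q S := [seq (X : vfield M) q | X <- S].

Definition chart_dx i : gfield M := fun p => (0, chart_dual c i p).
Definition chart_dv i : gfield M := fun p => (chart_vec c i p, 0).

Definition nabla_dual i al : forall q : M, dual (tangent q) := fun p =>
  \sum_j chart_partial c i (fun q => al q (chart_vec c j q)) p *: chart_dual c j p.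

Definition nabla_g i x : gfield M := fun p =>
  (nabla_vec c i (fun q => (x q).1) p, nabla_dual i (fun q => (x q).2) p).

Lemma dual_decomp p (a : dual (tangent p)) : chart_dom c p ->
  a = \sum_j a (chart_vec c j p) *: chart_dual c j p.
Proof.
move=> Dp; apply: dual_eq => v; rewrite dual_sumE {1}(tangent_decomp hc v Dp) dual_sum.
by apply: eq_bigr => j _; rewrite dualZ dual_scaleE mulrC.
Qed.

Lemma dual_chartE p (a : dual (tangent p)) v : chart_dom c p ->
  a v = \sum_j v (xc j) * a (chart_vec c j p).
Proof.
by move=> Dp; rewrite {1}(tangent_decomp hc v Dp) dual_sum; apply: eq_bigr => j _; rewrite dualZ.
Qed.

Lemma smooth_form1_chart U al : open U -> U `<=` chart_dom c ->
  (forall j, smooth_fun U (fun q => al q (chart_vec c j q))) ->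
  smooth_form U (fun q => form1 (al q)).
Proof.
move=> oU UD H; apply: smooth_form1P => V X oV VU sX.
have VD : V `<=` chart_dom c by exact: subset_trans UD.
have s : smooth_fun V (fun q => \sum_j X q (xc j) * al q (chart_vec c j q)).
  apply: smooth_fun_sum => // j; apply: smooth_fun_M => //; last exact: smooth_fun_sub (H j).
  exact: smooth_vfield_coord sX.
by apply: (smooth_fun_ext oV _ s) => q Vq; rewrite -dual_chartE //; exact: VD.
Qed.

Lemma smooth_al_chart U al j : open U -> U `<=` chart_dom c -> smooth_form U (fun q => form1 (al q)) ->
  smooth_fun U (fun q => al q (chart_vec c j q)).
Proof.
move=> oU UD sa; apply: smooth_form1_eval => //.
by apply: smooth_vfield_sub UD _; exact: smooth_chart_vec.
Qed.

Lemma nabla_dual_chart i al p j : chart_dom c p ->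
  nabla_dual i al p (chart_vec c j p) = chart_partial c i (fun q => al q (chart_vec c j q)) p.
Proof.
move=> Dp; rewrite /nabla_dual dual_sumE.
transitivity (\sum_k chart_partial c i (fun q => al q (chart_vec c k q)) p * (j == k)%:R).
  by apply: eq_bigr => k _; rewrite dual_scaleE -(chart_vec_coord hc j k Dp).
exact: sum_delta.
Qed.

Lemma smooth_nabla_g i U x : open U -> U `<=` chart_dom c -> smooth_gfield U x ->
  smooth_gfield U (nabla_g i x).
Proof.
move=> oU UD [sX sa]; split; first exact: smooth_nabla_vec.
apply: smooth_form1_chart => // j.
have H : smooth_fun U (chart_partial c i (fun q => (x q).2 (chart_vec c j q))).
  by apply: smooth_chart_partial => //; exact: (smooth_al_chart (al := fun q => (x q).2)).
by apply: (smooth_fun_ext oU _ H) => q Uq; rewrite nabla_dual_chart //; exact: UD.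
Qed.

Lemma smooth_chart_dx i : smooth_gfield (chart_dom c) (chart_dx i).
Proof.
have oD : open (chart_dom c) by exact: chart_open_dom.
split; first by move=> V f oV VU sf; exact: (smooth_fun_cst 0 oV).
apply: smooth_form1_chart => // j.
apply: (smooth_fun_ext oD _ (smooth_fun_cst (j == i)%:R oD)) => q Dq.
by rewrite /= chart_vec_coord.
Qed.

Lemma smooth_chart_dv i : smooth_gfield (chart_dom c) (chart_dv i).
Proof.
have oD : open (chart_dom c) by exact: chart_open_dom.
split; first exact: smooth_chart_vec.
apply: smooth_form1_chart => // j.
by apply: (smooth_fun_ext oD _ (smooth_fun_cst 0 oD)) => q Dq.
Qed.

Lemma chart_partial_eqD U p (I : Type) (r : seq I) (F : I -> M -> R) i : chart_dom c p -> open U -> U p ->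
  (forall k, smooth_fun U (F k)) ->
  chart_partial c i (fun q => \sum_(k <- r) F k q) p = \sum_(k <- r) chart_partial c i (F k) p.
Proof.
move=> Dp oU Up sF.
have sP k : smooth_at p (F k) by exact: (smooth_fun_at oU Up).
have [sS1 E] := tangent_sum (chart_vec c i p) r sP.
rewrite chart_vecE // in E; rewrite E; apply: eq_bigr => k _.
by rewrite chart_vecE.
Qed.

Lemma nabla_form_D i U w w' p : open U -> U p -> chart_dom c p -> smooth_form U w -> smooth_form U w' ->
  nabla_form c i (fun q => w q + w' q) p = nabla_form c i w p + nabla_form c i w' p.
Proof.
move=> oU Up Dp sw sw'; apply: extform_eq => s; rewrite extform_addE.
rewrite !(nabla_formE hc _ _ oU) //; last exact: smooth_form_D.
by rewrite chart_partialD //; exact: (form_const_smooth hc _ oU).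
Qed.

Lemma chart_partialZ p f (a : R) i : chart_dom c p -> smooth_at p f ->
  chart_partial c i (fun q => a * f q) p = a * chart_partial c i f p.
Proof.
move=> Dp sf; rewrite chart_partialM //; last exact: smooth_at_cst.
by rewrite chart_partial_cst mul0r add0r.
Qed.

Lemma nabla_dualE i U al p (v : tangent p) : open U -> U p -> U `<=` chart_dom c ->
  smooth_form U (fun q => form1 (al q)) ->
  chart_partial c i (fun q => al q (const_ext c v q)) p = nabla_dual i al p v.
Proof.
move=> oU Up UD sa; have Dp := UD _ Up.
have -> : chart_partial c i (fun q => al q (const_ext c v q)) p =
    chart_partial c i (fun q => \sum_j v (xc j) * al q (chart_vec c j q)) p.
  apply: chart_partial_near => //; apply: (open_near_eq oU) => // q Uq.
  by rewrite (dual_chartE _ _ (UD _ Uq)); apply: eq_bigr => j _; rewrite const_ext_coord //; exact: UD.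
rewrite (chart_partial_eqD _ _ Dp oU Up); last first.
  by move=> j; apply: smooth_fun_Z => //; exact: smooth_al_chart.
rewrite (dual_chartE _ _ Dp); apply: eq_bigr => j _.
rewrite nabla_dual_chart // chart_partialZ //.
by apply: (smooth_fun_at oU Up); exact: smooth_al_chart.
Qed.

Lemma nabla_wedge1 i U al w p : open U -> U p -> U `<=` chart_dom c ->
  smooth_form U (fun q => form1 (al q)) -> smooth_form U w ->
  nabla_form c i (fun q => wedge1 (al q) (w q)) p =
  wedge1 (nabla_dual i al p) (w p) + wedge1 (al p) (nabla_form c i w p).
Proof.
move=> oU Up UD sa sw; have Dp := UD _ Up; apply: extform_eq => s; rewrite extform_addE.
rewrite (nabla_formE hc _ _ oU) //; last exact: (smooth_wedge1 (al := al)).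
set S := [seq const_ext c v | v <- s].
have sS : smooth_vfields U S by apply: (smooth_vfields_sub UD); exact: smooth_const_exts.
have -> : (fun q => wedge1 (al q) (w q) (ev q S)) = (fun q =>
   \sum_(k < size S) (-1) ^+ k * (al q (nth (fun=> 0) S k q) * w q (ev q (omit k S)))).
  by apply/funext => q; rewrite wedge1_ev.
have s1 k : smooth_fun U (fun q => al q (nth (fun=> 0) S k q)).
  by apply: smooth_form1_eval => //; exact: smooth_vfields_nth.
have s2 k : smooth_fun U (fun q => w q (ev q (omit k S))).
  by apply: form_vals_smooth => //; exact: smooth_vfields_omit.
rewrite (chart_partial_eqD _ _ Dp oU Up); last first.
  by move=> k; apply: smooth_fun_Z => //; exact: smooth_fun_M.
have szS : size S = size s by rewrite size_map.
rewrite /= /wedge1_fun -big_split /= szS; apply: eq_bigr => k _.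
have at1 := smooth_fun_at oU Up (s1 k).
have at2 := smooth_fun_at oU Up (s2 k).
rewrite chart_partialZ //; last exact: smooth_at_M.
rewrite chart_partialM // mulrDr; congr (_ * _ + _ * _).
  rewrite -map_omit const_exts_at // (nth_map 0) //; congr (_ * _).
  exact: (nabla_dualE _ _ oU).
rewrite (nth_map 0) // const_ext_at // -map_omit; congr (_ * _).
by rewrite (nabla_formE hc _ _ oU).
Qed.

Lemma nabla_clifford i U x w p : open U -> U p -> U `<=` chart_dom c ->
  smooth_gfield U x -> smooth_form U w ->
  nabla_form c i (fun q => clifford (x q) (w q)) p =
  clifford (nabla_g i x p) (w p) + clifford (x p) (nabla_form c i w p).
Proof.
move=> oU Up UD [sX sa] sw; have Dp := UD _ Up.
rewrite (nabla_form_D _ oU) //; [|exact: smooth_contract|exact: (smooth_wedge1 (al := fun q => (x q).2))].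
rewrite (nabla_contract hc _ oU) // (nabla_wedge1 _ (al := fun q => (x q).2) oU) //.
by rewrite addrACA.
Qed.

Lemma local_dE w p : local_d c w p = \sum_i clifford (chart_dx i p) (nabla_form c i w p).
Proof.
apply: eq_bigr => i _; rewrite /clifford.
have -> : contract (chart_dx i p).1 (nabla_form c i w p) = 0.
  by apply: extform_eq => s; exact: (ext0 _ [::]).
by rewrite add0r.
Qed.

Lemma inner_dx i p (x : gtan p) : 2 * inner (chart_dx i p) x = x.1 (xc i).
Proof. by rewrite /inner mulrA mulfV ?pnatr_eq0 // mul1r /= dual0 addr0. Qed.

(** The anticommutator of d with x: in d = sum of dx_i nabla_i, the Leibniz rule gives dx_i (nabla_i
    x), and the Clifford relation turns the other two terms into a multiple of nabla_i. *)
Definition coord_lie x w : form M := fun p =>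
  \sum_i (clifford (chart_dx i p) (clifford (nabla_g i x p) (w p))
          + (2 * inner (chart_dx i p) (x p)) *: nabla_form c i w p).

Lemma anticomm_d U x w p : open U -> U p -> U `<=` chart_dom c ->
  smooth_gfield U x -> smooth_form U w ->
  exterior_d (fun q => clifford (x q) (w q)) p + clifford (x p) (exterior_d w p) = coord_lie x w p.
Proof.
move=> oU Up UD sx sw; have Dp := UD _ Up.
rewrite !(exterior_d_local hc oU Up Dp) //; last exact: smooth_clifford.
rewrite !local_dE clifford_sumr -big_split; apply: eq_bigr => i _ /=.
rewrite (nabla_clifford _ oU) // cliffordDr -addrA; congr (_ + _).
exact: clifford_rel.
Qed.

(** The vector whose Clifford action is the commutator of [coord_lie x] with y; [dorfman_coord]
    identifies it with the Dorfman bracket. *)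
Definition coord_dorfman x y : gfield M := fun p =>
  \sum_i ((2 * inner (nabla_g i x p) (y p)) *: chart_dx i p
          - (2 * inner (chart_dx i p) (y p)) *: nabla_g i x p
          + (2 * inner (chart_dx i p) (x p)) *: nabla_g i y p).

Lemma clifford_commutator p (a b y : gtan p) (w : forms_at p) :
  clifford a (clifford b (clifford y w)) - clifford y (clifford a (clifford b w)) =
  (2 * inner b y) *: clifford a w - (2 * inner a y) *: clifford b w.
Proof.
have E1 : clifford b (clifford y w) = (2 * inner b y) *: w - clifford y (clifford b w).
  by rewrite -clifford_rel addrK.
have E2 : clifford y (clifford a (clifford b w)) =
    (2 * inner a y) *: clifford b w - clifford a (clifford y (clifford b w)).
  by rewrite -(clifford_rel a) addrC addKr.
by rewrite E1 E2 cliffordDr cliffordZr cliffordNr opprB addrA subrK.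
Qed.

(** The terms that differentiate w cancel in the commutator. What survives is the derivative of y
    along x and the commutator of y with dx_i (nabla_i x), which is a vector by
    [clifford_commutator]. *)
Lemma coord_dorfman_clifford U x y w p : open U -> U p -> U `<=` chart_dom c ->
  smooth_gfield U x -> smooth_gfield U y -> smooth_form U w ->
  clifford (coord_dorfman x y p) (w p) =
  coord_lie x (fun q => clifford (y q) (w q)) p - clifford (y p) (coord_lie x w p).
Proof.
move=> oU Up UD sx sy sw; have Dp := UD _ Up.
rewrite /coord_lie clifford_sumr -sumrB clifford_suml; apply: eq_bigr => i _; cbv beta.
rewrite (nabla_clifford _ oU) // (cliffordDr (y p)) (cliffordZr (y p)) scalerDr.
rewrite [LHS]cliffordDl [X in X + _ = _]cliffordDl cliffordNl.
rewrite (cliffordZl _ (chart_dx i p)) (cliffordZl _ (nabla_g i x p)) (cliffordZl _ (nabla_g i y p)).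
rewrite -clifford_commutator.
have sh (Z : zmodType) (A D K1 K2 : Z) : A - D + K1 = A + (K1 + K2) - (D + K2).
  by rewrite opprD addrACA addrK.
exact: sh.
Qed.

Lemma nabla_form1 i U al p : open U -> U p -> U `<=` chart_dom c ->
  smooth_form U (fun q => form1 (al q)) ->
  nabla_form c i (fun q => form1 (al q)) p = form1 (nabla_dual i al p).
Proof.
move=> oU Up UD sa; have Dp := UD _ Up.
apply: extform_eq => s; rewrite (nabla_formE hc _ _ oU) //.
case: s => [|v [|v' s]] /=; [exact: chart_partial_cst| |exact: chart_partial_cst].
exact: (nabla_dualE _ _ oU).
Qed.

Lemma local_d_form1 U al p (u v : tangent p) : open U -> U p -> U `<=` chart_dom c ->
  smooth_form U (fun q => form1 (al q)) ->
  local_d c (fun q => form1 (al q)) p [:: u; v] =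
  \sum_i (u (xc i) * nabla_dual i al p v - v (xc i) * nabla_dual i al p u).
Proof.
move=> oU Up UD sa; rewrite extform_sumE; apply: eq_bigr => i _.
rewrite (nabla_form1 _ oU) // [LHS]wedge1_cons wedge1_cons wedge1_nil subr0 //.
Qed.

Lemma local_d_fun w p (v : tangent p) :
  local_d c w p [:: v] = \sum_i v (xc i) * nabla_form c i w p [::].
Proof.
rewrite extform_sumE; apply: eq_bigr => i _.
by rewrite [LHS]wedge1_cons wedge1_nil subr0.
Qed.

Lemma gtan_fst_sum p (I : Type) (r : seq I) (F : I -> gtan p) :
  (\sum_(i <- r) F i).1 = \sum_(i <- r) (F i).1.
Proof. by elim: r => [|i r IH]; rewrite ?big_nil // !big_cons -IH. Qed.

Lemma gtan_snd_sum p (I : Type) (r : seq I) (F : I -> gtan p) :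
  (\sum_(i <- r) F i).2 = \sum_(i <- r) (F i).2.
Proof. by elim: r => [|i r IH]; rewrite ?big_nil // !big_cons -IH. Qed.

Lemma dorfman_coord U x y p : open U -> U p -> U `<=` chart_dom c ->
  smooth_gfield U x -> smooth_gfield U y ->
  dorfman x y p = coord_dorfman x y p.
Proof.
move=> oU Up UD [sX sa] [sY sb]; have Dp := UD _ Up.
apply: injective_projections.
  rewrite gtan_fst_sum [LHS](lie_bracket_nabla hc oU Up Dp sX sY) -sumrB; apply: eq_bigr => i _.
  rewrite !inner_dx /= scaler0 add0r addrC //.
rewrite gtan_snd_sum; apply: dual_eq => v; rewrite dual_sumE.
pose X : vfield M := fun q => (x q).1.
pose Y : vfield M := fun q => (y q).1.
pose a q : dual (tangent q) := (x q).2.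
pose b q : dual (tangent q) := (y q).2.
have -> : (dorfman x y p).2 v =
    exterior_d (fun q => form1 (b q)) p [:: X p; v]
  + exterior_d (fun q => contract (X q) (form1 (b q))) p [:: v]
  - exterior_d (fun q => form1 (a q)) p [:: Y p; v].
  transitivity ((contract (X p) (exterior_d (fun q => form1 (b q)) p)
    + exterior_d (fun q => contract (X q) (form1 (b q))) p
    - contract (Y p) (exterior_d (fun q => form1 (a q)) p)) [:: v]); first by [].
  by rewrite extform_addE extform_addE extform_oppE.
rewrite !(exterior_d_local hc oU Up Dp) //; last exact: smooth_contract.
have Eb := @local_d_form1 U b p (X p) v oU Up UD sb.
have Ea := @local_d_form1 U a p (Y p) v oU Up UD sa.
have SD (F G : 'I_n -> R) : \sum_i F i + \sum_i G i = \sum_i (F i + G i) by rewrite big_split.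
rewrite Eb Ea local_d_fun SD -sumrB; apply: eq_bigr => i _; cbv beta.
have -> : nabla_form c i (fun q => contract (X q) (form1 (b q))) p [::] =
    b p (nabla_vec c i X p) + nabla_dual i b p (X p).
  have E1 := nabla_contract hc i oU Up UD sX sb.
  have E2 := @nabla_form1 i U b p oU Up UD sb.
  by rewrite [LHS](congr1 (fun w : forms_at p => w [::]) E1) extform_addE E2.
transitivity ((2 * inner (nabla_g i x p) (y p)) * v (xc i)
   - (Y p (xc i)) * nabla_dual i a p v + X p (xc i) * nabla_dual i b p v); last first.
  by rewrite -(inner_dx i (x p)) -(inner_dx i (y p)).
have -> : 2 * inner (nabla_g i x p) (y p) = nabla_dual i a p (Y p) + b p (nabla_vec c i X p).
  by rewrite /inner mulrA mulfV ?pnatr_eq0 // mul1r.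
ring.
Qed.

End CoordinateDorfman.

(** * Number operators in a Clifford algebra with derived bracket *)

Section NoncommutativeRing.

Inductive ncexpr : Type :=
  NcVar of nat | NcZero | NcOne | NcAdd of ncexpr & ncexpr | NcOpp of ncexpr | NcMul of ncexpr & ncexpr.

Definition ncpoly := seq (int * seq nat).

Fixpoint nc_insert (c : int) (m : seq nat) (p : ncpoly) : ncpoly :=
  if p is (c', m') :: p' then
    if m == m' then (c + c', m') :: p' else (c', m') :: nc_insert c m p'
  else [:: (c, m)].

Fixpoint nc_norm (e : ncexpr) : ncpoly :=
  match e with
  | NcVar i => [:: (1, [:: i])]
  | NcZero => [::]
  | NcOne => [:: (1, [::])]
  | NcAdd e1 e2 => foldr (fun t p => nc_insert t.1 t.2 p) (nc_norm e2) (nc_norm e1)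
  | NcOpp e1 => [seq (- t.1, t.2) | t <- nc_norm e1]
  | NcMul e1 e2 => foldr (fun t p => foldr (fun t' p => nc_insert (t.1 * t'.1) (t.2 ++ t'.2) p) p (nc_norm e2))
       [::] (nc_norm e1)
  end.

Variables (A : pzRingType) (env : seq A).

Fixpoint nc_eval (e : ncexpr) : A :=
  match e with
  | NcVar i => nth 0 env i
  | NcZero => 0
  | NcOne => 1
  | NcAdd e1 e2 => nc_eval e1 + nc_eval e2
  | NcOpp e1 => - nc_eval e1
  | NcMul e1 e2 => nc_eval e1 * nc_eval e2
  end.

Definition nc_mon (m : seq nat) : A := \prod_(i <- m) nth 0 env i.
Definition nc_sum (p : ncpoly) : A := \sum_(t <- p) nc_mon t.2 *~ t.1.

Lemma nc_sum_cons t p : nc_sum (t :: p) = nc_mon t.2 *~ t.1 + nc_sum p.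
Proof. exact: big_cons. Qed.

Lemma nc_sum_nil : nc_sum [::] = 0.
Proof. exact: big_nil. Qed.

Lemma nc_insertE c m p : nc_sum (nc_insert c m p) = nc_mon m *~ c + nc_sum p.
Proof.
rewrite /nc_sum; elim: p => [|[c' m'] p IH] /=; first by rewrite big_seq1 big_nil addr0.
case: eqP => [->|_]; rewrite !big_cons /=; first by rewrite mulrzDr addrA.
by rewrite IH addrCA.
Qed.

Lemma nc_normE e : nc_sum (nc_norm e) = nc_eval e.
Proof.
elim: e => [i|||e1 IH1 e2 IH2|e1 IH1|e1 IH1 e2 IH2] /=.
- by rewrite /nc_sum big_seq1 /nc_mon big_seq1.
- by rewrite /nc_sum big_nil.
- by rewrite /nc_sum big_seq1 /nc_mon big_nil.
- rewrite -IH1 -IH2; elim: (nc_norm e1) => [|[c m] p IH] /=; first by rewrite nc_sum_nil add0r.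
  by rewrite nc_insertE IH addrA nc_sum_cons.
- by rewrite -IH1 /nc_sum big_map -sumrN; apply: eq_bigr => t _ /=; rewrite mulrNz.
rewrite -IH1 -IH2; elim: (nc_norm e1) => [|[c m] p IH] /=; first by rewrite nc_sum_nil mul0r.
rewrite nc_sum_cons mulrDl -IH /=; move: (foldr _ [::] p) => P; elim: (nc_norm e2) => [|[c' m'] q IHq] /=.
  by rewrite nc_sum_nil mulr0 add0r.
rewrite nc_insertE IHq addrA nc_sum_cons mulrDr; congr (_ + _ + _).
by rewrite /nc_mon big_cat /= mulrzAr mulrzAl -mulrzA mulrC.
Qed.

(** Normalisation merges equal words but keeps those whose coefficient has become 0, so the test
    asks for zero coefficients and not for an empty list. *)
Lemma nc_ringP e1 e2 : all (fun t => t.1 == 0) (nc_norm (NcAdd e1 (NcOpp e2))) ->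
  nc_eval e1 = nc_eval e2.
Proof.
move=> H; apply/eqP; rewrite -subr_eq0 -[_ - _]/(nc_eval (NcAdd e1 (NcOpp e2))) -nc_normE.
rewrite /nc_sum big1_seq // => t /andP[_ tp].
by have /allP /(_ t tp) /eqP -> := H; rewrite mulr0z.
Qed.

End NoncommutativeRing.

Ltac nc_index x l :=
  match l with
  | ?y :: _ => let _ := match constr:(Set) with _ => unify x y end in constr:(O)
  | _ :: ?l' => let n := nc_index x l' in constr:(S n)
  end.

Ltac nc_mem x l :=
  match l with
  | ?y :: _ => let _ := match constr:(Set) with _ => unify x y end in constr:(true)
  | _ :: ?l' => nc_mem x l'
  | _ => constr:(false)
  end.

Ltac nc_atoms t l :=
  lazymatch t with
  | Algebra.add ?a ?b => let l1 := nc_atoms a l in nc_atoms b l1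
  | GRing.mul ?a ?b => let l1 := nc_atoms a l in nc_atoms b l1
  | Algebra.opp ?a => nc_atoms a l
  | Algebra.zero => l
  | GRing.one _ => l
  | _ => let b := nc_mem t l in
         lazymatch b with true => l | false => constr:(t :: l) end
  end.

Ltac nc_reify t l :=
  lazymatch t with
  | Algebra.add ?a ?b => let x := nc_reify a l in let y := nc_reify b l in constr:(NcAdd x y)
  | GRing.mul ?a ?b => let x := nc_reify a l in let y := nc_reify b l in constr:(NcMul x y)
  | Algebra.opp ?a => let x := nc_reify a l in constr:(NcOpp x)
  | Algebra.zero => constr:(NcZero)
  | GRing.one _ => constr:(NcOne)
  | _ => let n := nc_index t l in constr:(NcVar n)
  end.

(* [ring] only handles commutative rings. *)
Ltac ncring :=
  lazymatch goal with
  | |- @eq ?T ?a ?b =>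
    let l0 := constr:(@nil T) in
    let l1 := nc_atoms a l0 in
    let l2 := nc_atoms b l1 in
    let e1 := nc_reify a l2 in
    let e2 := nc_reify b l2 in
    refine (@nc_ringP _ l2 e1 e2 _); vm_compute; reflexivity
  end.

(** * Abstract algebra of the number operators *)

Section CourantAlgebra.
Variables (A : pzRingType) (X : zmodType) (T : zmodType) (I : finType).
Variables (cl : {additive X -> A}) (d : A) (br : X -> X -> X) (pr : T -> X -> X).
Variables (u v : T -> I -> X).
Implicit Types (l m : T) (x y : X).

Definition comm (a b : A) : A := a * b - b * a.
Definition lie (x : X) : A := d * cl x + cl x * d.
Definition number (l : T) : A := \sum_a cl (u l a) * cl (v l a).

Hypothesis brE : forall x y, comm (lie x) (cl y) = cl (br x y).
Hypothesis pr_u : forall l a, pr (- l) (u l a) = u l a.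
Hypothesis pr_v : forall l a, pr l (v l a) = v l a.
Hypothesis numberE : forall l x, comm (number l) (cl x) = cl (pr (- l) x - pr l x).
Hypothesis pr_other : forall l m x, pr l x = x -> l != m -> pr m x = 0.
Hypothesis cl_anti : forall l m x y, pr l x = x -> pr m y = y -> l + m != 0 ->
  cl x * cl y = - (cl y * cl x).
Hypothesis br_anti : forall l m x y, pr l x = x -> pr m y = y -> l + m != 0 ->
  br x y = - br y x.
(** The component of the commutator of [lie w] with [number l] that lies in L_(-l) times L_l
    vanishes. It is an instance of pi (D pi) pi = 0, established in [canonical_metric]. *)
Hypothesis canonical : forall l w, \sum_a (cl (pr (- l) (br w (u l a))) * cl (v l a)
    + cl (u l a) * cl (pr l (br w (v l a)))) = 0.
Hypothesis pr_additive : forall l, zmod_morphism (pr l).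
Hypothesis pr_idem : forall l x, pr l (pr l x) = pr l x.

Hypothesis integrable_br : forall l m x y, pr l x = x -> pr m y = y -> l + m != 0 ->
  br x y = pr l (br x y) + (if l == m then 0 else pr m (br x y)).
(* Stands for the differential of the locally constant function trace (pr l). *)
Hypothesis canonical_exact : forall l, l != 0 -> \sum_a \sum_b cl (u l a) *
   cl ((br (v l a) (u l b) + br (u l b) (v l a))
       - pr l (br (v l a) (u l b) + br (u l b) (v l a))
       - pr (- l) (br (v l a) (u l b) + br (u l b) (v l a))) * cl (v l b) = 0.

Lemma prN l x : pr l (- x) = - pr l x.
Proof.
have p0 : pr l 0 = 0 by have := pr_additive l 0 0; rewrite !subrr.
by have := pr_additive l 0 x; rewrite p0 !sub0r.
Qed.

Lemma prD l x y : pr l (x + y) = pr l x + pr l y.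
Proof. by have := pr_additive l x (- y); rewrite opprK prN opprK. Qed.

Definition lie_number (m : T) (x : X) : A := comm (lie x) (number m).

Lemma commMr (a b b' : A) : comm a (b * b') = comm a b * b' + b * comm a b'.
Proof. rewrite /comm; ncring. Qed.
Lemma commMl (a a' b : A) : comm (a * a') b = a * comm a' b + comm a b * a'.
Proof. rewrite /comm; ncring. Qed.
Lemma commDl (a a' b : A) : comm (a + a') b = comm a b + comm a' b.
Proof. rewrite /comm; ncring. Qed.
Lemma commDr (a b b' : A) : comm a (b + b') = comm a b + comm a b'.
Proof. rewrite /comm; ncring. Qed.
Lemma commNr (a b : A) : comm a (- b) = - comm a b.
Proof. rewrite /comm; ncring. Qed.
Lemma comm_sumr J (r : seq J) (P : pred J) (a : A) (F : J -> A) :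
  comm a (\sum_(j <- r | P j) F j) = \sum_(j <- r | P j) comm a (F j).
Proof. by rewrite /comm mulr_sumr mulr_suml sumrB. Qed.
Lemma comm_suml J (r : seq J) (P : pred J) (a : A) (F : J -> A) :
  comm (\sum_(j <- r | P j) F j) a = \sum_(j <- r | P j) comm (F j) a.
Proof. by rewrite /comm mulr_sumr mulr_suml sumrB. Qed.
Lemma commC (a b : A) : comm a b = - comm b a.
Proof. rewrite /comm; ncring. Qed.

Lemma lie_numberE m x : lie_number m x =
  \sum_b (cl (u m b) * cl (br x (v m b)) + cl (br x (u m b)) * cl (v m b)).
Proof.
by rewrite /lie_number comm_sumr; apply: eq_bigr => b _; rewrite commMr !brE addrC.
Qed.

Lemma number_u l a : comm (number l) (cl (u l a)) = cl (u l a) - cl (pr l (u l a)).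
Proof. by rewrite numberE pr_u raddfB. Qed.

Lemma neq_oppr l : l + l != 0 -> - l != l.
Proof. by apply: contraNneq => E; rewrite -{1}E addNr. Qed.

Lemma number_uE l a : l + l != 0 -> comm (number l) (cl (u l a)) = cl (u l a).
Proof.
by move=> l2; rewrite number_u (pr_other (pr_u l a) (neq_oppr l2)) raddf0 subr0.
Qed.

Lemma number_vE l a : l + l != 0 -> comm (number l) (cl (v l a)) = - cl (v l a).
Proof.
move=> l2; have ll : l != - l by rewrite eq_sym neq_oppr.
by rewrite numberE pr_v (pr_other (pr_v l a) ll) sub0r raddfN.
Qed.

Lemma number_comm_other l m x : pr l x = x -> l != m -> l != - m ->
  comm (number m) (cl x) = 0.
Proof. by move=> lx lm lm'; rewrite numberE !(pr_other lx) // subrr raddf0. Qed.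

Lemma numberd l : comm (number l) d = \sum_a (cl (u l a) * lie (v l a) - lie (u l a) * cl (v l a)).
Proof. by rewrite comm_suml; apply: eq_bigr => a _; rewrite /comm /lie; ncring. Qed.

(** Integrability leaves the brackets of x with the frame of L_m and L_(-m) only two components
    each; those in L_m and L_(-m) add up to [canonical] and disappear. *)
Lemma lie_number_other l m x : pr l x = x -> l + m != 0 -> l != m ->
  lie_number m x = \sum_b (cl (u m b) * cl (pr l (br x (v m b))) + cl (pr l (br x (u m b))) * cl (v m b)).
Proof.
move=> lx lm0 lm; rewrite lie_numberE.
have E b : cl (u m b) * cl (br x (v m b)) + cl (br x (u m b)) * cl (v m b) =
  (cl (u m b) * cl (pr l (br x (v m b))) + cl (pr l (br x (u m b))) * cl (v m b))
  + (cl (pr (- m) (br x (u m b))) * cl (v m b) + cl (u m b) * cl (pr m (br x (v m b)))).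
  rewrite {1}(integrable_br lx (pr_v m b)) // (negbTE lm).
  rewrite {1}(integrable_br lx (pr_u m b)); last by rewrite subr_eq0.
  have -> : (l == - m) = false by apply/negbTE; rewrite -addr_eq0.
  by rewrite !raddfD /=; ncring.
by rewrite (eq_bigr _ (fun b _ => E b)) big_split /= canonical addr0.
Qed.

Lemma number_number_d l m : l + l != 0 -> m + m != 0 -> l != m -> l + m != 0 ->
  comm (number m) (comm (number l) d) = 0.
Proof.
move=> l2 m2 lm lm0.
have lm' : l != - m by rewrite -addr_eq0.
have ml : - l != m by rewrite eqr_oppLR.
have ml' : - l != - m by rewrite (inj_eq oppr_inj).
have E a : comm (number m) (cl (u l a) * lie (v l a) - lie (u l a) * cl (v l a)) =
   - (cl (u l a) * lie_number m (v l a)) + lie_number m (u l a) * cl (v l a).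
  rewrite commDr commNr !commMr (number_comm_other (pr_u l a)) // (number_comm_other (pr_v l a)) //.
  by rewrite /lie_number !(commC (lie _)); ncring.
rewrite numberd comm_sumr (eq_bigr _ (fun a _ => E a)).
have Kv a := lie_number_other (pr_v l a) lm0 lm.
have Ku a : lie_number m (u l a) = _ := lie_number_other (pr_u l a) _ _.
(* The four kinds of terms are paired by the factor they share, the u of m here and the v of m in
   P24. For fixed b each sum over a is then [canonical l], for that very vector as w. *)
pose P13 a b := - (cl (u l a) * cl (u m b) * cl (pr l (br (v l a) (v m b)))) + cl (u m b) * cl (pr (- l) (br (u l a) (v m b))) * cl (v l a).
pose P24 a b := - (cl (u l a) * cl (pr l (br (v l a) (u m b))) * cl (v m b)) + cl (pr (- l) (br (u l a) (u m b))) * cl (v m b) * cl (v l a).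
transitivity (\sum_a \sum_b (P13 a b + P24 a b)).
  apply: eq_bigr => a _; rewrite Kv Ku //; last by rewrite addrC subr_eq0 eq_sym.
  rewrite mulr_sumr mulr_suml -sumrN -big_split; apply: eq_bigr => b _ /=.
  by rewrite /P13 /P24; ncring.
rewrite exchange_big big1 // => b _; rewrite big_split /=.
have -> : \sum_a P13 a b = - (cl (u m b) * \sum_a (cl (pr (- l) (br (v m b) (u l a))) * cl (v l a)
    + cl (u l a) * cl (pr l (br (v m b) (v l a))))).
  rewrite mulr_sumr -sumrN; apply: eq_bigr => a _; rewrite /P13.
  rewrite (br_anti (pr_v l a) (pr_v m b)) // (br_anti (pr_u l a) (pr_v m b)); last by rewrite addrC subr_eq0 eq_sym.
  rewrite !prN !raddfN /=.
  have -> : cl (u l a) * cl (u m b) = - (cl (u m b) * cl (u l a)).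
    by apply: (cl_anti (pr_u l a) (pr_u m b)); rewrite -opprD oppr_eq0.
  ncring.
have -> : \sum_a P24 a b = (\sum_a (cl (pr (- l) (br (u m b) (u l a))) * cl (v l a)
    + cl (u l a) * cl (pr l (br (u m b) (v l a))))) * cl (v m b).
  rewrite mulr_suml; apply: eq_bigr => a _; rewrite /P24.
  rewrite (br_anti (pr_v l a) (pr_u m b)) ?subr_eq0 // (br_anti (pr_u l a) (pr_u m b)); last by rewrite -opprD oppr_eq0.
  rewrite !prN !raddfN /= -!mulrA.
  have -> : cl (v m b) * cl (v l a) = - (cl (v l a) * cl (v m b)).
    by apply: (cl_anti (pr_v m b) (pr_v l a)); rewrite addrC.
  ncring.
by rewrite !canonical mulr0 mul0r oppr0 addr0.
Qed.

Lemma sumrD J (r : seq J) (F G : J -> A) :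
  \sum_(j <- r) F j + \sum_(j <- r) G j = \sum_(j <- r) (F j + G j).
Proof. by rewrite big_split. Qed.

(** Integrability puts [v_a, v_b] into L_l, and [canonical] trades the terms containing it for the
    L_(-l) component of [v_a, u_b]. *)
Lemma lie_number_v l a : l + l != 0 -> lie_number l (v l a) =
  \sum_b cl (br (v l a) (u l b) - pr (- l) (br (v l a) (u l b))) * cl (v l b).
Proof.
move=> l2; rewrite lie_numberE.
rewrite -[RHS]addr0 -[X in _ = _ + X](canonical l (v l a)) sumrD; apply: eq_bigr => b _ /=.
rewrite {1}(integrable_br (pr_v l a) (pr_v l b)) // eqxx addr0 raddfB /=; ncring.
Qed.

Lemma lie_number_u l a : l + l != 0 -> lie_number l (u l a) =
  \sum_b cl (u l b) * cl (br (u l a) (v l b) - pr l (br (u l a) (v l b))).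
Proof.
move=> l2; rewrite lie_numberE.
rewrite -[RHS]addr0 -[X in _ = _ + X](canonical l (u l a)) sumrD; apply: eq_bigr => b _ /=.
rewrite {1}(integrable_br (pr_u l a) (pr_u l b)); last by rewrite -opprD oppr_eq0.
by rewrite eqxx addr0 raddfB /=; ncring.
Qed.

(** By [numberd], ad_l d is [uLv l - Luv l]. Both summands are eigenvectors of ad_l, for 1 and -1,
    up to the Clifford cubics [cub1] and [cub2]. *)
Definition uLv l : A := \sum_a cl (u l a) * lie (v l a).
Definition Luv l : A := \sum_a lie (u l a) * cl (v l a).
Definition cub1 l : A := \sum_a \sum_b cl (u l a) *
   cl (br (v l a) (u l b) - pr (- l) (br (v l a) (u l b))) * cl (v l b).
Definition cub2 l : A := \sum_a \sum_b cl (u l a) *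
   cl (br (u l b) (v l a) - pr l (br (u l b) (v l a))) * cl (v l b).

Lemma number_uLv l : l + l != 0 -> comm (number l) (uLv l) = uLv l - cub1 l.
Proof.
move=> l2; rewrite comm_sumr /uLv /cub1 -sumrB; apply: eq_bigr => a _.
rewrite commMr number_uE // (commC _ (lie _)) -/(lie_number _ _) lie_number_v //.
rewrite mulrN mulr_sumr; congr (_ - _); apply: eq_bigr => b _; exact: mulrA.
Qed.

Lemma number_Luv l : l + l != 0 -> comm (number l) (Luv l) = - Luv l - cub2 l.
Proof.
move=> l2; rewrite comm_sumr /Luv /cub2 exchange_big -sumrN -sumrB; apply: eq_bigr => a _.
rewrite commMr number_vE // (commC _ (lie _)) -/(lie_number _ _) lie_number_u //.
by rewrite mulrN mulNr mulr_suml addrC.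
Qed.

Lemma number_uxv l a b x : l + l != 0 -> comm (number l) (cl (u l a) * cl x * cl (v l b)) =
  cl (u l a) * cl (pr (- l) x - pr l x) * cl (v l b).
Proof. by move=> l2; rewrite !commMr number_uE // number_vE // numberE; ncring. Qed.

Lemma number_sq_d l : l + l != 0 ->
  comm (number l) (comm (number l) d) = uLv l + Luv l - cub1 l + cub2 l.
Proof.
move=> l2; rewrite numberd sumrB -/(uLv l) -/(Luv l) commDr commNr number_uLv // number_Luv //.
ncring.
Qed.

(** The cubic errors must cancel. Applying ad_l keeps only the L_l part of the middle factor of
    [cub1] and the L_(-l) part of that of [cub2]; [canonical_exact] says that these parts together
    make up all of [cub1 + cub2]. *)
Lemma number_cube_d l : l != 0 -> l + l != 0 ->
  comm (number l) (comm (number l) (comm (number l) d)) = comm (number l) d.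
Proof.
move=> l0 l2; rewrite number_sq_d // !commDr commNr number_uLv // number_Luv //.
rewrite numberd sumrB -/(uLv l) -/(Luv l).
have ll : l != - l by rewrite eq_sym neq_oppr.
have E1 : comm (number l) (cub1 l) = - \sum_a \sum_b cl (u l a) * cl (pr l (br (v l a) (u l b))) * cl (v l b).
  rewrite comm_sumr -sumrN; apply: eq_bigr => a _; rewrite comm_sumr -sumrN; apply: eq_bigr => b _.
  rewrite number_uxv // !prD !prN pr_idem subrr (pr_other (pr_idem (- l) _)) ?neq_oppr //.
  by rewrite subr0 sub0r raddfN /=; ncring.
have E2 : comm (number l) (cub2 l) = \sum_a \sum_b cl (u l a) * cl (pr (- l) (br (u l b) (v l a))) * cl (v l b).
  rewrite comm_sumr; apply: eq_bigr => a _; rewrite comm_sumr; apply: eq_bigr => b _.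
  rewrite number_uxv // !prD !prN pr_idem subrr (pr_other (pr_idem l _)) //.
  by rewrite !subr0.
rewrite E1 E2.
have C0 := canonical_exact l0.
have C1 : cub1 l + cub2 l = (\sum_a \sum_b cl (u l a) * cl (pr l (br (v l a) (u l b))) * cl (v l b))
   + \sum_a \sum_b cl (u l a) * cl (pr (- l) (br (u l b) (v l a))) * cl (v l b).
  rewrite -[RHS]add0r -[X in _ = X + _]C0 !sumrD; apply: eq_bigr => a _ /=; rewrite !sumrD; apply: eq_bigr => b _ /=.
  by rewrite !prD !raddfB !raddfD /=; ncring.
transitivity (uLv l - Luv l - (cub1 l + cub2 l) + ((\sum_a \sum_b cl (u l a) * cl (pr l (br (v l a) (u l b))) * cl (v l b))
   + \sum_a \sum_b cl (u l a) * cl (pr (- l) (br (u l b) (v l a))) * cl (v l b))); first by ncring.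
by rewrite C1 subrK.
Qed.

Inductive cubic : A -> Prop :=
| Cubic0 : cubic 0
| CubicD x y z w : cubic w -> cubic (cl x * cl y * cl z + w).

Lemma cubic_add a b : cubic a -> cubic b -> cubic (a + b).
Proof. by move=> ca cb; elim: ca => [|x y z w _ IH]; rewrite ?add0r // -addrA; constructor. Qed.

Lemma cubic_mul x y z : cubic (cl x * cl y * cl z).
Proof. by rewrite -[_ * _]addr0; do 2!constructor. Qed.

Lemma cubic_opp a : cubic a -> cubic (- a).
Proof.
elim=> [|x y z w _ IH]; rewrite ?oppr0; first by constructor.
by rewrite opprD -!mulNr -raddfN; constructor.
Qed.

Lemma cubic_sum J (r : seq J) (F : J -> A) : (forall j, cubic (F j)) -> cubic (\sum_(j <- r) F j).
Proof.
move=> H; elim: r => [|j r IH]; rewrite ?big_nil ?big_cons; first by constructor.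
exact: cubic_add.
Qed.

Lemma derivation_cubic (D : A -> A) (x x' y y' z z' : A) :
  (forall a b, D (a + b) = D a + D b) -> (forall a b, D (a * b) = D a * b + a * D b) ->
  D x = x' -> D x' = x -> D y = y' -> D y' = y -> D z = z' -> D z' = z ->
  D (D (D (D (x * y * z)))) + (x * y * z) *+ 9 = D (D (x * y * z)) *+ 10.
Proof.
move=> DD DM x1 x2 y1 y2 z1 z2.
by rewrite !(DM, DD, x1, x2, y1, y2, z1, z2) !(mulrSr, mulr0n); ncring.
Qed.

Lemma quartic_add (D : A -> A) a b : (forall a b, D (a + b) = D a + D b) ->
  D (D (D (D (a + b)))) - D (D (a + b)) *+ 10 + (a + b) *+ 9 =
  (D (D (D (D a))) - D (D a) *+ 10 + a *+ 9) + (D (D (D (D b))) - D (D b) *+ 10 + b *+ 9).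
Proof. by move=> DD; rewrite !DD !mulrnDl; ncring. Qed.

(* On cubics [comm G] has only the eigenvalues 1, -1, 3, -3, the roots of
   x^4 - 10 x^2 + 9. *)
Lemma cubic_parity (G a : A) (tau : X -> X) : (forall x, comm G (cl x) = cl (tau x)) ->
  (forall x, tau (tau x) = x) -> cubic a -> comm G a = 0 -> a *+ 9 = 0.
Proof.
move=> Gx tt ca Ga.
suff : comm G (comm G (comm G (comm G a))) - comm G (comm G a) *+ 10 + a *+ 9 = 0.
  have z : comm G 0 = 0 by rewrite /comm mulr0 mul0r subrr.
  by rewrite Ga !z mul0rn subrr add0r.
elim: ca => [|x y z w _ IH]; first by rewrite /comm !(mulr0, mul0r, subrr, mul0rn, addr0).
have E : comm G (comm G (comm G (comm G (cl x * cl y * cl z)))) + (cl x * cl y * cl z) *+ 9 =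
    comm G (comm G (cl x * cl y * cl z)) *+ 10.
  have Gt x' : comm G (cl (tau x')) = cl x' by rewrite Gx tt.
  exact: (derivation_cubic (commDr G) (commMr G) (Gx x) (Gt x) (Gx y) (Gt y) (Gx z) (Gt z)).
by rewrite (quartic_add _ _ (commDr G)) IH addr0 addrAC E subrr.
Qed.

Section Decomposition.
Variables (e f : I -> X) (Lam : seq T) (pos : pred T).
Hypothesis uE : forall l a, u l a = pr (- l) (e a).
Hypothesis d_eL : \sum_a cl (e a) * lie (f a) = d.
Hypothesis d_Lf : \sum_a lie (e a) * cl (f a) = d.
Hypothesis number_e : forall l, number l = \sum_a cl (e a) * cl (v l a).
Hypothesis cubic_f : forall l, cubic (\sum_a cl (u l a) * lie (v l a) - \sum_a cl (u l a) * lie (f a)).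
Hypothesis cubic_e : forall l, cubic (\sum_a cl (u l a) * lie (v l a) - \sum_a cl (e a) * lie (v l a)).
Hypothesis vE : forall l a, v l a = pr l (f a).
Hypothesis uniqL : uniq Lam.
Hypothesis oppL : forall l, (- l \in Lam) = (l \in Lam).
Hypothesis pr_total : forall x, \sum_(l <- Lam) pr l x = x.
Hypothesis number_central : forall l, comm (number l + number (- l)) d = 0.
Hypothesis double_neq0 : forall l, l != 0 -> l + l != 0.
Hypothesis torsion_free : forall (a : A) (k : int), k != 0 -> a *~ k = 0 -> a = 0.
Hypothesis posN : forall l, l != 0 -> pos (- l) = ~~ pos l.

Local Notation ad l z := (comm (number l) z).

Lemma perm_oppL : perm_eq [seq - l | l <- Lam] Lam.
Proof.
apply: uniq_perm => //; first by rewrite map_inj_uniq //; exact: oppr_inj.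
move=> l; rewrite -(opprK l) (mem_map (@oppr_inj T)) !opprK; by rewrite oppL.
Qed.

Lemma sum_oppL (F : T -> A) : \sum_(l <- Lam) F (- l) = \sum_(l <- Lam) F l.
Proof. by rewrite -[RHS](perm_big _ perm_oppL) big_map. Qed.

Lemma jacobi (a b c : A) : comm a (comm b c) = comm (comm a b) c + comm b (comm a c).
Proof. rewrite /comm; ncring. Qed.

(** N_l raises L_(-l) and lowers L_l, and N_(-l) does the opposite. Once the sum also commutes with
    d, [ad_opp] lets N_(-l) act as -N_l on d and its iterated commutators. *)
Lemma number_opp_cl l x : comm (number l + number (- l)) (cl x) = 0.
Proof. by rewrite commDl !numberE -raddfD opprK addrA subrK subrr raddf0. Qed.

Lemma number_opp_number l m : comm (number l + number (- l)) (number m) = 0.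
Proof.
by rewrite comm_sumr big1 // => a _; rewrite commMr !number_opp_cl mul0r mulr0 addr0.
Qed.

Lemma comm0r a : comm a 0 = 0. Proof. by rewrite /comm mul0r mulr0 subrr. Qed.
Lemma comm0l a : comm 0 a = 0. Proof. by rewrite /comm mul0r mulr0 subrr. Qed.

Lemma ad_opp l z : comm (number l + number (- l)) z = 0 -> ad (- l) z = - ad l z.
Proof. by rewrite commDl => /eqP; rewrite addrC addr_eq0 => /eqP. Qed.

Lemma central_ad l m z : comm (number l + number (- l)) z = 0 ->
  comm (number l + number (- l)) (ad m z) = 0.
Proof. by move=> H; rewrite jacobi number_opp_number H comm0r comm0l addr0. Qed.

Lemma number_number l m : l != m -> l != - m -> l + l != 0 -> comm (number m) (number l) = 0.
Proof.
move=> lm lm' l2; rewrite comm_sumr big1 // => a _; rewrite commMr.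
rewrite (number_comm_other (pr_v l a)) // (number_comm_other (pr_u l a)) ?mul0r ?mulr0 ?addr0 //.
  by rewrite eqr_oppLR.
by rewrite (inj_eq oppr_inj).
Qed.

(* [A] is only a ring, so the halves in the definition of delta are avoided. *)
Definition twice_delta l : A := ad l (ad l d) + ad l d.
Definition twice_delta0 : A := d *+ 2 - \sum_(l <- Lam | l != 0) twice_delta l.

Lemma twice_delta_self l : l != 0 -> ad l (twice_delta l) = twice_delta l.
Proof. by move=> l0; rewrite commDr number_cube_d ?double_neq0 // addrC. Qed.

Lemma twice_delta_other l m : l != 0 -> m != 0 -> m != l -> m != - l -> ad m (twice_delta l) = 0.
Proof.
move=> l0 m0 ml ml'; have lm : l != m by rewrite eq_sym.
have lm0 : l + m != 0 by rewrite addrC addr_eq0.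
have lm' : l != - m by rewrite -addr_eq0.
have H : ad m (ad l d) = 0 by apply: number_number_d => //; exact: double_neq0.
rewrite commDr H addr0 jacobi H comm0r addr0.
by rewrite (number_number lm lm' (double_neq0 l0)) comm0l.
Qed.

Lemma twice_delta_opp l : l != 0 -> ad l (twice_delta (- l)) = ad l d - ad l (ad l d).
Proof.
move=> l0; have c0 := number_central l; have c1 := central_ad l c0.
have E1 : ad (- l) d = - ad l d by exact: ad_opp.
have E2 : twice_delta (- l) = ad l (ad l d) - ad l d.
  by rewrite /twice_delta E1 commNr (ad_opp c1) opprK.
by rewrite E2 commDr commNr number_cube_d ?double_neq0.
Qed.

(** Among the labels only m and -m contribute: with ad_m^3 d = ad_m d they give (ad_m^2 + ad_m) d
    and (ad_m - ad_m^2) d, together 2 ad_m d, which cancels the contribution of 2 d. *)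
Lemma twice_delta0_comm m : m \in Lam -> m != 0 -> ad m twice_delta0 = 0.
Proof.
move=> mL m0; rewrite commDr commNr comm_sumr.
have mm : - m != m by rewrite neq_oppr // double_neq0.
have mN0 : - m != 0 by rewrite oppr_eq0.
rewrite big_mkcond (bigD1_seq m) //= m0 twice_delta_self //.
rewrite big_mkcond (bigD1_seq (- m)) //=; last by rewrite oppL.
rewrite mm mN0 twice_delta_opp // big1_seq ?addr0; last first.
  move=> l /andP[lm _]; case: ifP => // lm2; case: ifP => // l0; apply: twice_delta_other => //.
    by rewrite eq_sym lm2.
  by rewrite -eqr_oppLR eq_sym.
by rewrite mulr2n commDr /twice_delta; ncring.
Qed.

(** Up to cubics ad_l^2 d is [uLv l + Luv l]. Computing ad_l d once from N = sum of u_a v_a and once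
    from N = sum of e_a v_a expresses [Luv l] through [uLv l], and the hypotheses on cubics then
    remove one of the two projections in each sum. The result is linear in the projections, ready to
    be summed over l. *)
Lemma ad2_cubic l : l != 0 -> cubic (\sum_a cl (u l a) * lie (f a) + \sum_a lie (e a) * cl (v l a) - ad l (ad l d)).
Proof.
move=> l0; rewrite number_sq_d ?double_neq0 //.
have E1 : uLv l - Luv l = \sum_a cl (e a) * lie (v l a) - \sum_a lie (e a) * cl (v l a).
  rewrite /uLv /Luv -sumrB -numberd number_e comm_suml -sumrB; apply: eq_bigr => a _.
  by rewrite /comm /lie; ncring.
have c1 : cubic (cub1 l) by apply: cubic_sum => a; apply: cubic_sum => b; exact: cubic_mul.
have c2 : cubic (cub2 l) by apply: cubic_sum => a; apply: cubic_sum => b; exact: cubic_mul.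
have cf := cubic_f l; have ce := cubic_e l.
rewrite -/(uLv l) in cf ce.
have := cubic_add (cubic_add (cubic_opp cf) (cubic_opp ce)) (cubic_add c1 (cubic_opp c2)).
set P := \sum_a cl (u l a) * lie (f a) in cf *.
set Q := \sum_a cl (e a) * lie (v l a) in ce E1 *.
set S := \sum_a lie (e a) * cl (v l a) in E1 *.
have -> : Luv l = uLv l - Q + S by rewrite -[S]opprK -[in RHS](addrK (- S) Q) -E1; ncring.
by congr cubic; ncring.
Qed.

(** The projections add up to the identity, so summing [ad2_cubic] over all labels turns the main
    terms into the two frame expressions of d. This makes the difference D of the two sides a cubic,
    and [cubic_parity] applies to it. *)
Lemma sum_ad2 : 0 \notin Lam -> d *+ 2 = \sum_(l <- Lam) ad l (ad l d).
Proof.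
move=> L0; have lamN0 l : l \in Lam -> l != 0 by apply: contraTneq => ->.
pose D := d *+ 2 - \sum_(l <- Lam) ad l (ad l d).
have cD : cubic D.
  have -> : D = \sum_(l <- Lam) (\sum_a cl (u l a) * lie (f a) + \sum_a lie (e a) * cl (v l a) - ad l (ad l d)).
    rewrite sumrB /D; congr (_ - _); have -> : d *+ 2 = \sum_a cl (e a) * lie (f a) + \sum_a lie (e a) * cl (f a).
      by rewrite d_eL d_Lf mulr2n.
    rewrite big_split /=; congr (_ + _).
      rewrite exchange_big; apply: eq_bigr => a _; rewrite -mulr_suml; congr (_ * _).
      rewrite -raddf_sum; congr (cl _); rewrite -[LHS]pr_total -(perm_big _ perm_oppL) big_map.
      by apply: eq_bigr => l _; rewrite uE.
    rewrite exchange_big; apply: eq_bigr => a _; rewrite -mulr_sumr; congr (_ * _).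
    by rewrite -raddf_sum; congr (cl _); rewrite -[LHS]pr_total; apply: eq_bigr => l _; rewrite vE.
  rewrite big_seq; elim/big_ind: _ => [|x y cx cy|l lL]; [by constructor|exact: cubic_add|].
  by apply: ad2_cubic; exact: lamN0.
pose G := \sum_(l <- Lam | pos l) number l.
(* The action of G on vectors: -1 on L_l for positive l and 1 on the others. As 0 is no label this
   covers all vectors, and tau is an involution. *)
pose tau x := \sum_(l <- Lam | pos l) (pr (- l) x - pr l x).
have GD : comm G D = 0.
  rewrite comm_suml big_seq_cond big1 // => m /andP[mL _].
  have m0 := lamN0 m mL.
  rewrite commDr commNr comm_sumr.
  have mm : - m != m by rewrite neq_oppr // double_neq0.
  rewrite (bigD1_seq m) //= big_mkcond (bigD1_seq (- m)) //=; last by rewrite oppL.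
  rewrite mm big1_seq ?addr0; last first.
    move=> l /andP[lm lL]; case: ifP => // lm2; have l0 := lamN0 l lL.
    have lm0 : l + m != 0 by rewrite addr_eq0.
    have H : ad m (ad l d) = 0 by apply: number_number_d => //; exact: double_neq0.
    by rewrite jacobi H comm0r addr0 (number_number lm2 lm (double_neq0 l0)) comm0l.
  have c0 := number_central m; have c1 := central_ad m c0.
  have -> : ad (- m) (ad (- m) d) = ad m (ad m d) by rewrite (ad_opp c0) commNr (ad_opp c1) opprK.
  by rewrite number_cube_d ?double_neq0 // mulr2n commDr; ncring.
have Gx x : comm G (cl x) = cl (tau x).
  by rewrite comm_suml raddf_sum; apply: eq_bigr => l _; rewrite numberE.
have tauE l x : l \in Lam -> tau (pr l x) = if pos l then - pr l x else pr l x.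
  move=> lL; have l0 := lamN0 l lL.
  have lml : - l != l by rewrite neq_oppr // double_neq0.
  rewrite /tau big_mkcond; case: ifP => pl.
    rewrite (bigD1_seq l) //= pl pr_idem (pr_other (pr_idem l x)) 1?eq_sym // sub0r.
    rewrite big1_seq ?addr0 // => m /andP[ml mL]; case: ifP => // pm.
    rewrite !(pr_other (pr_idem l x)) ?subrr 1?eq_sym //.
    by apply: contraTneq pl => <-; rewrite posN ?negbK ?pm //; exact: lamN0.
  rewrite (bigD1_seq (- l)) ?oppL //= posN // pl /= opprK pr_idem (pr_other (pr_idem l x)) 1?eq_sym // subr0.
  rewrite big1_seq ?addr0 // => m /andP[ml mL]; case: ifP => // pm.
  rewrite !(pr_other (pr_idem l x)) ?subrr //; first by apply: contraFneq pl => ->.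
  by rewrite -eqr_oppLR eq_sym.
have tauD x y : tau (x + y) = tau x + tau y.
  by rewrite /tau -big_split; apply: eq_bigr => l _ /=; rewrite !prD opprD addrACA.
have tau0 : tau 0 = 0 by apply: (addIr (tau 0)); rewrite -tauD !add0r.
have tauN x : tau (- x) = - tau x by apply: (addIr (tau x)); rewrite -tauD !addNr.
have tt x : tau (tau x) = x.
  rewrite -{1}(pr_total x) -[RHS]pr_total.
  have tsum (r : seq T) (F : T -> X) (Q : pred T) : tau (\sum_(l <- r | Q l) F l) = \sum_(l <- r | Q l) tau (F l).
    by elim: r => [|l r IH]; rewrite ?big_nil // !big_cons; case: ifP; rewrite ?tauD IH.
  rewrite !tsum; apply: eq_big_seq => l lL; rewrite tauE //; case: ifP => pl; rewrite ?tauN tauE // pl //.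
  by rewrite opprK.
have D9 := cubic_parity Gx tt cD GD.
have D0 : D = 0 by apply: (torsion_free (k := 9)) => //; rewrite -pmulrn.
by apply/eqP; rewrite -subr_eq0 -/D D0.
Qed.

Lemma twice_delta0_eq0 : 0 \notin Lam -> twice_delta0 = 0.
Proof.
move=> L0; rewrite /twice_delta0 (sum_ad2 L0).
(* The labels l and -l contribute opposite terms; reindexing by the sign shows that twice the sum is
   0. *)
have S0 : \sum_(l <- Lam) ad l d = 0.
  apply: (torsion_free (k := 2)) => //; rewrite -pmulrn mulr2n -{1}sum_oppL -big_split.
  rewrite big1 // => l _ /=; rewrite ad_opp ?addNr //; exact: number_central.
have -> : \sum_(l <- Lam | l != 0) twice_delta l = \sum_(l <- Lam) twice_delta l.
  rewrite big_seq_cond [RHS]big_seq; apply: eq_bigl => l; rewrite andbC.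
  by case: eqP => //= ->; rewrite (negbTE L0).
have -> : \sum_(l <- Lam) twice_delta l = \sum_(l <- Lam) ad l (ad l d) + \sum_(l <- Lam) ad l d.
  by rewrite sumrD.
by rewrite S0 addr0 subrr.
Qed.

End Decomposition.

End CourantAlgebra.

(** * Sums of commutator eigenvectors and the weight argument *)

Section EigenSum.
Variables (A : pzRingType) (N : A).
Implicit Types (a b : A).
Hypothesis torsion_free : forall (a : A) (k : int), k != 0 -> a *~ k = 0 -> a = 0.

Definition ad_prod (ks : seq int) (a : A) : A := foldr (fun k b => comm N b - b *~ k) a ks.

Lemma comm_mulz a b (k : int) : comm a (b *~ k) = comm a b *~ k.
Proof. by rewrite /comm mulrzBl mulrzAl mulrzAr. Qed.

Lemma ad_prodD ks a b : ad_prod ks (a + b) = ad_prod ks a + ad_prod ks b.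
Proof.
elim: ks => //= k ks ->; rewrite commDr mulrzDl opprD addrACA //.
Qed.

Lemma ad_prod0 ks : ad_prod ks 0 = 0.
Proof. by apply: (addIr (ad_prod ks 0)); rewrite -ad_prodD !add0r. Qed.

Lemma ad_prod_eigen ks a (k : int) : comm N a = a *~ k ->
  ad_prod ks a = a *~ \prod_(j <- ks) (k - j).
Proof.
move=> Na; elim: ks => [|j ks IH] /=; first by rewrite big_nil mulr1z.
by rewrite IH comm_mulz Na big_cons -!mulrzA -mulrzBr; congr (_ *~ _); ring.
Qed.

(** The product of all ad N - k_j kills every summand, while on the whole sum, which has weight 0,
    it acts as the product of the integers -k_j. Hence a nonzero integer multiple of the sum
    vanishes; no inversion is involved. *)
Lemma eigen_sum0 (J : Type) (r : seq J) (F : J -> A) (k : J -> int) :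
  (forall j, comm N (F j) = F j *~ k j) -> (forall j, k j != 0) ->
  comm N (\sum_(j <- r) F j) = 0 -> \sum_(j <- r) F j = 0.
Proof.
move=> NF k0 Ns; set s := \sum_(j <- r) F j in Ns *.
pose ks := [seq k j | j <- r].
have E1 : ad_prod ks s = s *~ \prod_(i <- ks) (0 - i).
  by apply: ad_prod_eigen; rewrite mulr0z.
have E2 : ad_prod ks s = 0.
  have H r' : all (fun j => k j \in ks) r' -> ad_prod ks (\sum_(j <- r') F j) = 0; last first.
    by apply: H; rewrite -(all_map k (mem ks)); apply/allP.
  elim: r' => [|j r' IH] /=; first by rewrite big_nil ad_prod0.
  move=> /andP[jk jr].
  rewrite big_cons ad_prodD (IH jr) addr0.
  rewrite (ad_prod_eigen _ (NF j)).
  have : \prod_(i <- ks) (k j - i) = 0.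
    apply/eqP; rewrite prodf_seq_eq0; apply/hasP; exists (k j) => //.
    by rewrite subrr eqxx.
  by move=> ->; rewrite mulr0z.
apply: (torsion_free (k := \prod_(i <- ks) (0 - i))); last by rewrite -E1.
rewrite prodf_seq_neq0 /ks all_map; elim: (r) => //= j r' ->.
by rewrite andbT sub0r oppr_eq0 k0.
Qed.

End EigenSum.

Section WeightArgument.
Variables (A : pzRingType) (N : A).
Implicit Types (a b x y t dl : A).
Hypothesis torsion_free : forall (a : A) (k : int), k != 0 -> a *~ k = 0 -> a = 0.

(** With d for dl this is twice the inner product of the Dorfman bracket [x, y] with t. It is
    additive in dl, so d can be replaced by pieces that are not differentials, and ad N acts on it
    as a derivation in all four arguments. *)
Definition triple dl x y t : A :=
  comm (dl * x + x * dl) y * t + t * comm (dl * x + x * dl) y.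

Lemma tripleD a b x y t : triple (a + b) x y t = triple a x y t + triple b x y t.
Proof. rewrite /triple /comm; ncring. Qed.

Lemma triple0 x y t : triple 0 x y t = 0.
Proof. rewrite /triple /comm; ncring. Qed.

Lemma triple_sum (J : Type) (r : seq J) (F : J -> A) x y t :
  triple (\sum_(j <- r) F j) x y t = \sum_(j <- r) triple (F j) x y t.
Proof. by elim: r => [|j r IH]; rewrite ?big_nil ?triple0 // !big_cons tripleD IH. Qed.

Lemma comm_triple a x y t : comm N (triple a x y t) =
  triple (comm N a) x y t + triple a (comm N x) y t + triple a x (comm N y) t + triple a x y (comm N t).
Proof. rewrite /triple /comm; ncring. Qed.

Lemma triple_mulz (k1 k2 k3 k4 : int) a x y t :
  triple (a *~ k1) x y t + triple a (x *~ k2) y t + triple a x (y *~ k3) t + triple a x y (t *~ k4) =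
  triple a x y t *~ (k1 + k2 + k3 + k4).
Proof.
have -> : triple (a *~ k1) x y t = triple a x y t *~ k1.
  by rewrite /triple /comm mulrzAl mulrzAr -mulrzDl mulrzAl mulrzAr -mulrzBl mulrzAl mulrzAr -mulrzDl.
have -> : triple a (x *~ k2) y t = triple a x y t *~ k2.
  by rewrite /triple /comm mulrzAl mulrzAr -mulrzDl mulrzAl mulrzAr -mulrzBl mulrzAl mulrzAr -mulrzDl.
have -> : triple a x (y *~ k3) t = triple a x y t *~ k3.
  by rewrite /triple /comm mulrzAl mulrzAr -mulrzBl mulrzAl mulrzAr -mulrzDl.
have -> : triple a x y (t *~ k4) = triple a x y t *~ k4.
  by rewrite /triple /comm mulrzAl mulrzAr -mulrzDl.
by rewrite !mulrzDr.
Qed.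

Lemma weight_eq0 (J : Type) (r : seq J) (F : J -> A) (k : J -> int) (k2 k3 k4 : int) x y t :
  (forall j, comm N (F j) = F j *~ k j) -> comm N x = x *~ k2 -> comm N y = y *~ k3 ->
  comm N t = t *~ k4 -> (forall j, k j + k2 + k3 + k4 != 0) ->
  comm N (triple (\sum_(j <- r) F j) x y t) = 0 -> triple (\sum_(j <- r) F j) x y t = 0.
Proof.
move=> NF Nx Ny Nt k0; rewrite triple_sum.
apply: (eigen_sum0 torsion_free (k := fun j => k j + k2 + k3 + k4)) => // j.
by rewrite comm_triple NF Nx Ny Nt triple_mulz.
Qed.

End WeightArgument.

(** * Dual frames and orthogonal projections *)

Section MetricFrame.
Variables (A : pzRingType) (X : zmodType) (T : zmodType) (I : finType).
Variables (cl : {additive X -> A}) (pr : T -> X -> X).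
Implicit Types (l m : T) (x y z : X) (a b : I) (c : A) (e f : I -> X).

Definition pairing x y : A := cl x * cl y + cl y * cl x.

Hypothesis pairing_comm : forall x y z, pairing x y * cl z = cl z * pairing x y.
Hypothesis pr_additive : forall l, zmod_morphism (pr l).
Hypothesis pr_idem : forall l x, pr l (pr l x) = pr l x.
Hypothesis pr_ortho : forall l m x, l != m -> pr l (pr m x) = 0.
Hypothesis pr_adj : forall l x y, pairing (pr l x) y = pairing x (pr (- l) y).

Definition metric_frame e f :=
  (forall x, cl x = \sum_a pairing x (f a) * cl (e a)) /\
  (forall x, cl x = \sum_a pairing x (e a) * cl (f a)).

(** The projected vectors generate L_(-l) but are linearly dependent in general. They serve in place
    of a local basis, so no rank enters. *)
Definition frame_u e l (a : I) := pr (- l) (e a).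
Definition frame_v f l (a : I) := pr l (f a).

Lemma pairingC x y : pairing x y = pairing y x.
Proof. exact: addrC. Qed.

Lemma pairing0 x : pairing x 0 = 0.
Proof. by rewrite /pairing raddf0 mulr0 mul0r addr0. Qed.

Lemma cl_anticomm l m x y : pr l x = x -> pr m y = y -> l + m != 0 ->
  cl x * cl y = - (cl y * cl x).
Proof.
move=> lx my lm; apply/eqP; rewrite -addr_eq0; apply/eqP.
rewrite -/(pairing x y) -lx pr_adj -my pr_ortho ?pairing0 //.
by apply: contraNneq lm => <-; rewrite addrC addNr.
Qed.

Lemma pr_other_label l m x : pr l x = x -> l != m -> pr m x = 0.
Proof. by move=> <- lm; rewrite pr_ortho // eq_sym. Qed.

Lemma pairing_lin_r (J : finType) (c : J -> A) (t : J -> X) x y :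
  (forall j, c j * cl y = cl y * c j) ->
  cl x = \sum_j c j * cl (t j) -> pairing x y = \sum_j c j * pairing (t j) y.
Proof.
move=> cC xE; rewrite /pairing xE mulr_suml mulr_sumr -big_split.
by apply: eq_bigr => j _; rewrite /= mulrDr !mulrA cC.
Qed.

Section OneFrame.
Variables (e f : I -> X).
Hypothesis fr : metric_frame e f.
Variable l : T.
Local Notation u := (frame_u e l).
Local Notation v := (frame_v f l).

Lemma pr_frame_u a : pr (- l) (u a) = u a. Proof. exact: pr_idem. Qed.
Lemma pr_frame_v a : pr l (v a) = v a. Proof. exact: pr_idem. Qed.

Lemma pairing_v x a : pairing x (v a) = pairing (pr (- l) x) (f a).
Proof. by rewrite pr_adj opprK. Qed.

Lemma pairing_u x a : pairing (u a) x = pairing (e a) (pr l x).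
Proof. by rewrite pr_adj opprK. Qed.

(** Expanding u_a in the full frame produces the pairings of e_a with v_b; summed over a they
    reconstruct the pairing of x with v_b, where the projection can be moved onto x and does
    nothing. *)
Lemma frame_ue x : pr (- l) x = x -> \sum_a pairing x (f a) * cl (u a) = cl x.
Proof.
case: fr => fe _ lx; rewrite [RHS]fe.
transitivity (\sum_a \sum_b pairing x (f a) * pairing (e a) (v b) * cl (e b)).
  apply: eq_bigr => a _; rewrite (fe (u a)) mulr_sumr; apply: eq_bigr => b _.
  by rewrite mulrA pairing_u.
rewrite exchange_big; apply: eq_bigr => b _; rewrite -mulr_suml; congr (_ * _).
by rewrite -(@pairing_lin_r _ _ _ x) // pairing_v lx.
Qed.

Lemma frame_uE x : pr (- l) x = x -> \sum_a pairing x (v a) * cl (u a) = cl x.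
Proof.
by move=> lx; rewrite -[RHS]frame_ue //; apply: eq_bigr => a _; rewrite pairing_v lx.
Qed.

Lemma frame_vf y : pr l y = y -> \sum_a pairing y (e a) * cl (v a) = cl y.
Proof.
case: fr => _ ff ly; rewrite [RHS]ff.
transitivity (\sum_a \sum_b pairing y (e a) * pairing (f a) (u b) * cl (f b)).
  apply: eq_bigr => a _; rewrite (ff (v a)) mulr_sumr; apply: eq_bigr => b _.
  by rewrite mulrA pr_adj.
rewrite exchange_big; apply: eq_bigr => b _; rewrite -mulr_suml; congr (_ * _).
by rewrite -(@pairing_lin_r _ _ _ y) // pairingC pairing_u ly pairingC.
Qed.

Lemma frame_vE y : pr l y = y -> \sum_a pairing (u a) y * cl (v a) = cl y.
Proof.
by move=> ly; rewrite -[RHS]frame_vf //; apply: eq_bigr => a _; rewrite pairing_u ly pairingC.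
Qed.

Lemma frame_pr_u x : \sum_a pairing x (v a) * cl (u a) = cl (pr (- l) x).
Proof.
rewrite -[RHS]frame_uE ?pr_idem //; apply: eq_bigr => a _; congr (_ * _).
by rewrite !pairing_v pr_idem.
Qed.

Lemma frame_pr_v x : \sum_a pairing (u a) x * cl (v a) = cl (pr l x).
Proof.
rewrite -[RHS]frame_vE ?pr_idem //; apply: eq_bigr => a _; congr (_ * _).
by rewrite !pairing_u pr_idem.
Qed.

Lemma number_metric x : comm (\sum_a cl (u a) * cl (v a)) (cl x) = cl (pr (- l) x - pr l x).
Proof.
rewrite comm_suml raddfB /= -frame_pr_u -frame_pr_v -sumrB; apply: eq_bigr => a _.
rewrite pairing_comm; rewrite /pairing /comm; ncring.
Qed.

Lemma number_e_metric : \sum_a cl (u a) * cl (v a) = \sum_a cl (e a) * cl (v a).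
Proof.
transitivity (\sum_a \sum_k cl (e a) * pairing (u k) (f a) * cl (v k)); last first.
  apply: eq_bigr => a _; rewrite -[in RHS](frame_vE (pr_frame_v a)) mulr_sumr.
  by apply: eq_bigr => k _; rewrite mulrA pairing_v pr_frame_u.
rewrite exchange_big; apply: eq_bigr => k _; rewrite -mulr_suml; congr (_ * _).
case: fr => fe _; rewrite [LHS]fe; apply: eq_bigr => a _; exact: pairing_comm.
Qed.

End OneFrame.

(** Expansion of one frame in the other. This allows N_l to be defined through charts, and the frame
    to be exchanged with its dual. *)
Lemma number_frame_indep e f e' f' l : metric_frame e f -> metric_frame e' f' ->
  \sum_a cl (frame_u e l a) * cl (frame_v f l a) = \sum_a cl (frame_u e' l a) * cl (frame_v f' l a).
Proof.
move=> fr fr'.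
transitivity (\sum_a \sum_k cl (frame_u e' l a) * pairing (frame_u e l k) (frame_v f' l a) * cl (frame_v f l k)); last first.
  apply: eq_bigr => a _; rewrite -[in RHS](frame_vE fr (pr_idem l _)) mulr_sumr.
  by apply: eq_bigr => k _; rewrite mulrA.
rewrite exchange_big; apply: eq_bigr => k _; rewrite -mulr_suml; congr (_ * _).
rewrite -[LHS](frame_uE fr' (pr_idem (- l) _)); apply: eq_bigr => a _; exact: pairing_comm.
Qed.

Lemma metric_frame_sym e f : metric_frame e f -> metric_frame f e.
Proof. by case. Qed.

Section Derived.
Variables (d : A) (br : X -> X -> X) (e f : I -> X).
Hypothesis brE : forall x y, comm (lie cl d x) (cl y) = cl (br x y).
Hypothesis fr : metric_frame e f.
Hypothesis cl_inj : injective cl.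
Local Notation L := (lie cl d).

Lemma comm_lie_pairing w x y : comm (L w) (pairing x y) = pairing (br w x) y + pairing x (br w y).
Proof.
rewrite /pairing commDr !commMr !brE; ncring.
Qed.

Lemma pairing_exact x y : cl (br x y + br y x) = comm d (pairing x y).
Proof. by rewrite raddfD /= -!brE /pairing /lie /comm; ncring. Qed.

Lemma br_anticomm l m x y : pr l x = x -> pr m y = y -> l + m != 0 -> br x y = - br y x.
Proof.
move=> lx my lm; apply/eqP; rewrite -addr_eq0; apply/eqP; apply: cl_inj.
rewrite pairing_exact raddf0 /pairing (cl_anticomm lx my lm) addNr.
by rewrite /comm mulr0 mul0r subrr.
Qed.

Definition central c := forall z, c * cl z = cl z * c.

Lemma central_pairing x y : central (pairing x y).
Proof. by move=> z; exact: pairing_comm. Qed.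

Lemma central_comm_pairing c x y : central c -> c * pairing x y = pairing x y * c.
Proof. by move=> cc; rewrite /pairing mulrDr mulrDl !mulrA !cc -!mulrA !cc !mulrA. Qed.

Lemma central_lie w x y : central (comm (L w) (pairing x y)).
Proof. by move=> z; rewrite comm_lie_pairing mulrDl mulrDr !pairing_comm. Qed.

(** Pairings stand for functions. The condition says that the commutator with D sends them to
    elements commuting with functions, which is what matrix identities with such entries require. *)
Definition preserving (D : A) := forall x y z t, comm D (pairing x y) * pairing z t = pairing z t * comm D (pairing x y).

Lemma preserving_lie w : preserving (L w).
Proof. by move=> x y z t; apply: central_comm_pairing; exact: central_lie. Qed.

Lemma preserving_d : preserving d.
Proof. by move=> x y z t; rewrite -pairing_exact pairing_comm. Qed.

Section FixedLabel.
Variable l : T.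
Local Notation u := (frame_u e l).
Local Notation v := (frame_v f l).

(* The matrix of the projection pr (- l) in the frame e. *)
Definition pmat a b := pairing (u a) (v b).

Lemma pmat_u a : cl (u a) = \sum_k pmat a k * cl (u k).
Proof. by rewrite frame_uE //; exact: pr_idem. Qed.

Lemma pmat_v b : cl (v b) = \sum_k pmat k b * cl (v k).
Proof. by rewrite frame_vE //; exact: pr_idem. Qed.

Lemma pmat_idem a b : \sum_k pmat a k * pmat k b = pmat a b.
Proof. by rewrite -(pairing_lin_r _ (pmat_u a)) // => k; exact: pairing_comm. Qed.

Lemma pmat_derivation (D : A) a b :
  comm D (pmat a b) = \sum_k comm D (pmat a k) * pmat k b + \sum_k pmat a k * comm D (pmat k b).
Proof.
by rewrite -{1}pmat_idem comm_sumr -big_split; apply: eq_bigr => k _; exact: commMr.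
Qed.

(* [pmat] is idempotent, so m (D m) m = 0 for a derivation D. *)
Lemma pmat_sandwich_left (D : A) a b :
  \sum_k \sum_j pmat a k * comm D (pmat k j) * pmat j b = 0.
Proof.
have : \sum_k pmat a k * comm D (pmat k b) =
    \sum_k \sum_j pmat a k * comm D (pmat k j) * pmat j b + \sum_k pmat a k * comm D (pmat k b).
  have E k : pmat a k * comm D (pmat k b) = \sum_j pmat a k * comm D (pmat k j) * pmat j b +
      \sum_j pmat a k * (pmat k j * comm D (pmat j b)).
    rewrite {1}pmat_derivation mulrDr !mulr_sumr; congr (_ + _).
    by apply: eq_bigr => j _; exact: mulrA.
  rewrite {1}(eq_bigr _ (fun k _ => E k)) big_split /=; congr (_ + _).
  rewrite exchange_big; apply: eq_bigr => j _ /=.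
  by rewrite -(pmat_idem a j) mulr_suml; apply: eq_bigr => k _; exact: mulrA.
by move=> /eqP; rewrite -[X in X == _]add0r (inj_eq (addIr _)) eq_sym => /eqP.
Qed.

(** Expanding u_a and v_b through the matrix puts one more factor [pmat] on each side of its
    derivative, so that [pmat_sandwich_left] applies. The element g leaves room for a Clifford
    factor in the middle. *)
Lemma pmat_sandwich (D g : A) : preserving D ->
  (forall x y, g * pairing x y = pairing x y * g) ->
  \sum_a \sum_b cl (u a) * comm D (pmat b a) * g * cl (v b) = 0.
Proof.
move=> DP gP.
have E a b : cl (u a) * comm D (pmat b a) * g * cl (v b) =
    \sum_i \sum_j cl (u i) * (pmat j b * comm D (pmat b a) * pmat a i) * g * cl (v j).
  rewrite {1}pmat_u {1}pmat_v !mulr_suml; apply: eq_bigr => i _.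
  rewrite mulr_sumr; apply: eq_bigr => j _.
  rewrite /pmat (pairing_comm _ _ (u i)) !mulrA; congr (_ * _).
  rewrite -!mulrA; congr (_ * _).
  rewrite gP !mulrA; congr (_ * _); rewrite -mulrA DP -[RHS]mulrA DP !mulrA; congr (_ * _).
  exact: (central_comm_pairing _ _ (central_pairing _ _)).
under eq_bigr => a _ do under eq_bigr => b _ do rewrite E.
under eq_bigr => a _ do rewrite exchange_big.
rewrite exchange_big big1 // => i _.
under eq_bigr => a _ do rewrite exchange_big.
rewrite exchange_big big1 // => j _ /=.
rewrite exchange_big /=.
under eq_bigr => b _ do rewrite -!mulr_suml -mulr_sumr.
by rewrite -!mulr_suml -mulr_sumr pmat_sandwich_left mulr0 !mul0r.
Qed.

(** Written in components, the two halves are the two terms of the Leibniz rule for the pairing of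
    u_a with v_b under [lie w], hence together a sandwich with D = [lie w]. *)
Lemma canonical_metric w : \sum_a (cl (pr (- l) (br w (u a))) * cl (v a)
    + cl (u a) * cl (pr l (br w (v a)))) = 0.
Proof.
have P1 x y : 1 * pairing x y = pairing x y * 1 by rewrite mul1r mulr1.
rewrite -[RHS](pmat_sandwich (preserving_lie w) P1) big_split /=.
have E1 a : cl (pr (- l) (br w (u a))) * cl (v a) = \sum_k cl (u k) * pairing (br w (u a)) (v k) * cl (v a).
  by rewrite -(frame_pr_u fr) mulr_suml; apply: eq_bigr => k _; rewrite pairing_comm.
have E2 a : cl (u a) * cl (pr l (br w (v a))) = \sum_k cl (u a) * pairing (u k) (br w (v a)) * cl (v k).
  by rewrite -(frame_pr_v fr) mulr_sumr; apply: eq_bigr => k _; rewrite mulrA.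
rewrite (eq_bigr _ (fun a _ => E1 a)) (eq_bigr _ (fun a _ => E2 a)) exchange_big -big_split /=.
apply: eq_bigr => a _; rewrite -big_split; apply: eq_bigr => b _ /=.
by rewrite mulr1 /pmat comm_lie_pairing [X in _ = X * _]mulrDr [RHS]mulrDl.
Qed.

Lemma pairing_br x y w : pairing (br x y + br y x) w = comm (L w) (pairing x y).
Proof.
rewrite {1}/pairing pairing_exact /lie.
have C := central_pairing x y w.
rewrite /comm; transitivity (d * (pairing x y * cl w) - pairing x y * d * cl w + cl w * d * pairing x y - (cl w * pairing x y) * d).
  ncring.
by rewrite {1}C -[X in _ - X * d]C; ncring.
Qed.

(** The symmetrised bracket is the commutator of d with the pairing, so the first term is a sandwich
    with D = d. By [pairing_br] the components of its projections are derivatives of [pmat] along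
    the frame vectors, so the two projected terms are sandwiches with [lie (u k)] and [lie (v k)],
    with a Clifford factor as g. *)
Lemma canonical_exact_metric : \sum_a \sum_b cl (u a) *
   cl ((br (v a) (u b) + br (u b) (v a))
       - pr l (br (v a) (u b) + br (u b) (v a))
       - pr (- l) (br (v a) (u b) + br (u b) (v a))) * cl (v b) = 0.
Proof.
have P1 x y : 1 * pairing x y = pairing x y * 1 by rewrite mul1r mulr1.
have Pc z x y : cl z * pairing x y = pairing x y * cl z by rewrite pairing_comm.
pose S D g := \sum_a \sum_b cl (u a) * comm D (pmat b a) * g * cl (v b).
transitivity (S d 1 - \sum_k S (L (u k)) (cl (v k)) - \sum_k S (L (v k)) (cl (u k))); last first.
  rewrite {1}/S pmat_sandwich //; last exact: preserving_d.
  rewrite big1 => [|k _]; last by apply: pmat_sandwich => //; exact: preserving_lie.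
  rewrite big1 => [|k _]; last by apply: pmat_sandwich => //; exact: preserving_lie.
  by rewrite !subr0.
have E a b : cl (u a) *
   cl ((br (v a) (u b) + br (u b) (v a))
       - pr l (br (v a) (u b) + br (u b) (v a))
       - pr (- l) (br (v a) (u b) + br (u b) (v a))) * cl (v b) =
   cl (u a) * comm d (pmat b a) * 1 * cl (v b)
   - \sum_k cl (u a) * comm (L (u k)) (pmat b a) * cl (v k) * cl (v b)
   - \sum_k cl (u a) * comm (L (v k)) (pmat b a) * cl (u k) * cl (v b).
  rewrite !raddfB /= -(frame_pr_u fr l (_ + _)) -(frame_pr_v fr l (_ + _)) pairing_exact (pairingC (v a)) -/(pmat b a).
  rewrite mulr1 !mulrBr !mulrBl; congr (_ - _ - _).
    rewrite mulr_sumr mulr_suml; apply: eq_bigr => k _.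
    by rewrite (pairingC (u k)) pairing_br mulrA /pmat (pairingC (v a)).
  rewrite mulr_sumr mulr_suml; apply: eq_bigr => k _.
  by rewrite pairing_br mulrA /pmat (pairingC (v a)).
rewrite (eq_bigr _ (fun a _ => eq_bigr _ (fun b _ => E a b))).
rewrite /S; under eq_bigr => a _ do rewrite !sumrB.
rewrite !sumrB; congr (_ - _ - _).
  rewrite [RHS]exchange_big; apply: eq_bigr => a _ /=; exact: exchange_big.
rewrite [RHS]exchange_big; apply: eq_bigr => a _ /=; exact: exchange_big.
Qed.

(** The trace of an idempotent is locally constant: d (tr m) = 2 tr (m dm), and tr (m dm) = tr (m dm
    m) by idempotence and cyclicity, which is 0 by the sandwich identity. Cyclicity is available
    because the entries and their derivatives commute. *)
Lemma trace_pmat_closed : comm d (\sum_a pmat a a) = 0.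
Proof.
have tr0 : \sum_a \sum_k pmat a k * comm d (pmat k a) = 0.
  transitivity (\sum_a \sum_j \sum_k pmat j k * comm d (pmat k a) * pmat a j).
    under [RHS]eq_bigr => a _ do rewrite exchange_big.
    apply: eq_bigr => a _ /=; apply: eq_bigr => k _.
    rewrite -{1}pmat_idem mulr_suml; apply: eq_bigr => j _.
    rewrite -[RHS]mulrA preserving_d mulrA; congr (_ * _).
    exact: (central_comm_pairing _ _ (central_pairing _ _)).
  rewrite exchange_big big1 // => j _ /=; rewrite exchange_big; exact: pmat_sandwich_left.
rewrite comm_sumr (eq_bigr _ (fun a _ => pmat_derivation d a a)) big_split /= tr0 addr0.
rewrite -[RHS]tr0 exchange_big; apply: eq_bigr => k _; apply: eq_bigr => a _.
by rewrite preserving_d.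
Qed.

(** v_k has the same coefficients along the f_a as along the v_a, so the combinations of the f_a -
    v_a with coefficients from [pmat] vanish. After u_a is expanded, moving these coefficients
    inside [lie] leaves only the terms in which d hits a coefficient, and by [pairing_exact] such a
    derivative is a vector. *)
Lemma cubic_f_metric : cubic cl (\sum_a cl (u a) * L (v a) - \sum_a cl (u a) * L (f a)).
Proof.
have -> : \sum_a cl (u a) * L (v a) - \sum_a cl (u a) * L (f a) = - \sum_a cl (u a) * L (f a - v a).
  by rewrite -sumrB -sumrN; apply: eq_bigr => a _; rewrite /lie raddfB /=; ncring.
apply: cubic_opp.
have -> : \sum_a cl (u a) * L (f a - v a) =
    \sum_k \sum_a - (cl (u k) * cl (br (u a) (v k) + br (v k) (u a)) * cl (f a - v a)).
  transitivity (\sum_k cl (u k) * \sum_a pmat a k * L (f a - v a)).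
    under [RHS]eq_bigr => k _ do rewrite mulr_sumr.
    rewrite exchange_big; apply: eq_bigr => a _ /=; rewrite {1}pmat_u mulr_suml.
    by apply: eq_bigr => k _; rewrite /pmat pairing_comm -mulrA.
  apply: eq_bigr => k _.
  have g0 : \sum_a pmat a k * cl (f a - v a) = 0.
    rewrite (eq_bigr (fun a => pmat a k * cl (f a) - pmat a k * cl (v a))); last first.
      by move=> a _; rewrite raddfB mulrBr.
    rewrite sumrB -pmat_v; apply/eqP; rewrite subr_eq0; apply/eqP.
    case: fr => _ ff; rewrite [RHS]ff; apply: eq_bigr => a _.
    by rewrite /pmat pairing_u pr_frame_v pairingC.
  have -> : \sum_a pmat a k * L (f a - v a) =
      d * (\sum_a pmat a k * cl (f a - v a)) + (\sum_a pmat a k * cl (f a - v a)) * d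
      - \sum_a comm d (pmat a k) * cl (f a - v a).
    rewrite mulr_sumr mulr_suml -big_split -sumrB; apply: eq_bigr => a _ /=.
    rewrite /lie /comm; ncring.
  rewrite g0 mulr0 mul0r add0r sub0r mulrN mulr_sumr sumrN; congr (- _).
  by apply: eq_bigr => a _; rewrite pairing_exact mulrA.
by apply: cubic_sum => k; apply: cubic_sum => a; apply: cubic_opp; exact: cubic_mul.
Qed.

Lemma cubic_e_metric : cubic cl (\sum_a cl (u a) * L (v a) - \sum_a cl (e a) * L (v a)).
Proof.
have -> : \sum_a cl (u a) * L (v a) - \sum_a cl (e a) * L (v a) = \sum_a cl (u a - e a) * L (v a).
  by rewrite -sumrB; apply: eq_bigr => a _; rewrite raddfB mulrBl.
have -> : \sum_a cl (u a - e a) * L (v a) =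
    \sum_k \sum_a cl (u a - e a) * cl (br (u k) (v a) + br (v a) (u k)) * cl (v k).
  have E a : cl (u a - e a) * L (v a) = \sum_k (cl (u a - e a) * comm d (pmat k a) * cl (v k)
      + cl (u a - e a) * pmat k a * L (v k)).
    rewrite /lie {1 2}pmat_v mulr_sumr mulr_suml -big_split mulr_sumr; apply: eq_bigr => k _ /=.
    rewrite /comm /lie; ncring.
  rewrite (eq_bigr _ (fun a _ => E a)) exchange_big; apply: eq_bigr => k _ /=.
  rewrite big_split /= -[RHS]addr0; congr (_ + _).
    by apply: eq_bigr => a _; rewrite pairing_exact.
  rewrite -mulr_suml (_ : \sum_a _ = 0) ?mul0r //.
  rewrite (eq_bigr (fun a => pmat k a * cl (u a) - pmat k a * cl (e a))); last first.
    by move=> a _; rewrite -pairing_comm raddfB mulrBr.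
  rewrite sumrB -pmat_u; apply/eqP; rewrite subr_eq0; apply/eqP.
  case: fr => fe _; rewrite [LHS]fe; apply: eq_bigr => a _.
  by rewrite /pmat pairing_v pr_frame_u.
by apply: cubic_sum => k; apply: cubic_sum => a; exact: cubic_mul.
Qed.

End FixedLabel.

(** Computing N_(-l) in the exchanged frame reverses the factors, so N_l + N_(-l) is the sum of the
    anticommutators of u_a and v_a, the trace of the projection matrix. *)
Lemma number_central_metric l :
  comm (number cl (frame_u e) (frame_v f) l + number cl (frame_u e) (frame_v f) (- l)) d = 0.
Proof.
have -> : number cl (frame_u e) (frame_v f) (- l) = \sum_a cl (frame_v f l a) * cl (frame_u e l a).
  rewrite /number (number_frame_indep (- l) fr (metric_frame_sym fr)).
  by apply: eq_bigr => a _; rewrite /frame_u /frame_v opprK.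
by rewrite /number -big_split /= commC trace_pmat_closed oppr0.
Qed.

End Derived.

End MetricFrame.

(** * The ring of additive endomorphisms *)

Section Endomorphisms.
Variable W : zmodType.

(** Additive maps are enough, since the identities above have integer coefficients; linearity over
    scalars or functions is expressed, where it matters, by commutation with other elements of the
    ring. *)
Record endo := Endo { endo_fun :> W -> W; endo_additive : zmod_morphism endo_fun }.

HB.instance Definition _ := gen_eqMixin endo.
HB.instance Definition _ := gen_choiceMixin endo.

Lemma endo_eq (f g : endo) : (forall w, f w = g w) -> f = g.
Proof.
case: f g => f fP [g gP] /= fg; have E : f = g by apply: funext.
by rewrite E in fP *; congr Endo; exact: Prop_irrelevance.
Qed.

Fact endo_add_subproof (f g : endo) : zmod_morphism (fun w => f w + g w).
Proof. by move=> x y /=; rewrite !endo_additive opprD addrACA. Qed.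
Fact endo_opp_subproof (f : endo) : zmod_morphism (fun w => - f w).
Proof. by move=> x y /=; rewrite !endo_additive opprD. Qed.
Fact endo_zero_subproof : zmod_morphism (fun _ : W => 0 : W).
Proof. by move=> x y /=; rewrite subrr. Qed.
Fact endo_mul_subproof (f g : endo) : zmod_morphism (fun w => f (g w)).
Proof. by move=> x y /=; rewrite !endo_additive. Qed.
Fact endo_one_subproof : zmod_morphism (fun w : W => w).
Proof. by []. Qed.

Fact endo_addA : associative (fun f g => Endo (endo_add_subproof f g)).
Proof. by move=> f g h; apply: endo_eq => w /=; exact: addrA. Qed.
Fact endo_addC : commutative (fun f g => Endo (endo_add_subproof f g)).
Proof. by move=> f g; apply: endo_eq => w /=; exact: addrC. Qed.
Fact endo_add0 : left_id (Endo endo_zero_subproof) (fun f g => Endo (endo_add_subproof f g)).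
Proof. by move=> f; apply: endo_eq => w /=; exact: add0r. Qed.
Fact endo_addN : left_inverse (Endo endo_zero_subproof) (fun f => Endo (endo_opp_subproof f))
  (fun f g => Endo (endo_add_subproof f g)).
Proof. by move=> f; apply: endo_eq => w /=; exact: addNr. Qed.

HB.instance Definition _ := GRing.isZmodule.Build endo endo_addA endo_addC endo_add0 endo_addN.

Lemma endo0 (f : endo) : f 0 = 0.
Proof. by have := endo_additive f 0 0; rewrite !subrr. Qed.
Lemma endoB (f : endo) x y : f (x - y) = f x - f y.
Proof. exact: endo_additive. Qed.
Lemma endoN (f : endo) x : f (- x) = - f x.
Proof. by rewrite -sub0r endoB endo0 sub0r. Qed.
Lemma endoD (f : endo) x y : f (x + y) = f x + f y.
Proof. by rewrite -[y]opprK endoB !endoN opprK. Qed.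

Fact endo_mulA : associative (fun f g => Endo (endo_mul_subproof f g)).
Proof. by move=> f g h; apply: endo_eq. Qed.
Fact endo_mul1 : left_id (Endo endo_one_subproof) (fun f g => Endo (endo_mul_subproof f g)).
Proof. by move=> f; apply: endo_eq. Qed.
Fact endo_mulr1 : right_id (Endo endo_one_subproof) (fun f g => Endo (endo_mul_subproof f g)).
Proof. by move=> f; apply: endo_eq. Qed.
Fact endo_mulDl : left_distributive (fun f g => Endo (endo_mul_subproof f g)) +%R.
Proof. by move=> f g h; apply: endo_eq. Qed.
Fact endo_mulDr : right_distributive (fun f g => Endo (endo_mul_subproof f g)) +%R.
Proof. by move=> f g h; apply: endo_eq => w; exact: endoD. Qed.

HB.instance Definition _ := GRing.Zmodule_isPzRing.Build endo
  endo_mulA endo_mul1 endo_mulr1 endo_mulDl endo_mulDr.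

Lemma endoDE (f g : endo) w : (f + g) w = f w + g w. Proof. by []. Qed.
Lemma endoNE (f : endo) w : (- f) w = - f w. Proof. by []. Qed.
Lemma endoBE (f g : endo) w : (f - g) w = f w - g w. Proof. by []. Qed.
Lemma endoME (f g : endo) w : (f * g) w = f (g w). Proof. by []. Qed.
Lemma endo0E w : (0 : endo) w = 0. Proof. by []. Qed.
Lemma endo1E w : (1 : endo) w = w. Proof. by []. Qed.

Lemma endo_sumE (J : Type) (r : seq J) (P : pred J) (F : J -> endo) w :
  (\sum_(j <- r | P j) F j) w = \sum_(j <- r | P j) F j w.
Proof. by elim/big_rec2: _ => // j x f _ <-. Qed.

Lemma endoMn (f : endo) k w : f (w *+ k) = f w *+ k.
Proof. by elim: k => [|k IH]; rewrite ?mulr0n ?endo0 // !mulrS endoD IH. Qed.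

Lemma endoMz (f : endo) (k : int) w : f (w *~ k) = f w *~ k.
Proof. by case: k => k; rewrite ?NegzE -?pmulrn ?nmulrn ?endoN endoMn. Qed.

Lemma endoMzE (f : endo) (k : int) w : (f *~ k) w = f w *~ k.
Proof.
have M m : (f *+ m) w = f w *+ m by elim: m => // m IH; rewrite !mulrS endoDE IH.
by case: k => k; rewrite ?NegzE -?pmulrn ?nmulrn ?endoNE M.
Qed.

Lemma endo_torsion_free : (forall (w : W) (k : int), k != 0 -> w *~ k = 0 -> w = 0) ->
  forall (f : endo) (k : int), k != 0 -> f *~ k = 0 -> f = 0.
Proof.
by move=> tf f k k0 fk; apply: endo_eq => w; apply: (tf _ k k0); rewrite -endoMzE fk.
Qed.

End Endomorphisms.

(** * A polynomial annihilating the number operator *)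

Section FallingFactorial.
Variables (A : pzRingType) (N : A).

(** The product (N - c) (N - c - 1) ... (N - c - m + 1), peeled from the left; [falling_last] peels
    the last factor instead. *)
Fixpoint falling (m : nat) (c : int) : A :=
  if m is m'.+1 then (N - c%:~R) * falling m' (c + 1) else 1.

Lemma falling_shift m c (w : A) : N * w = w * (N - 1) -> falling m c * w = w * falling m (c + 1).
Proof.
move=> Nw; elim: m c => [|m IH] c; first by rewrite mul1r mulr1.
rewrite /= -mulrA IH !mulrA; congr (_ * _).
rewrite mulrBl Nw -(commr_int w c) -mulrBr; congr (_ * _).
by rewrite intrD opprD -[1%:~R]/1 addrAC addrA.
Qed.

Lemma falling_last m c : falling m.+1 c = (N - (c + m%:Z)%:~R) * falling m c.
Proof.
elim: m c => [|m IH] c; first by rewrite /= !addr0.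
rewrite [LHS]/= -/(falling m.+1 (c + 1)) IH [falling m.+1 c]/= !mulrA -addrA -[1 + m%:Z]/(m.+1%:Z).
congr (_ * _).
rewrite !mulrBl !mulrBr (commr_int N c) -(commr_int N (c + m.+1%:Z)) (commr_int (c%:~R) _).
ncring.
Qed.

Variables (I : finType) (u v : I -> A).
Hypothesis NE : N = \sum_a u a * v a.
Hypothesis Nv : forall a, N * v a = v a * (N - 1).
Hypothesis v_anti : forall a b, v a * v b = - (v b * v a).
Hypothesis torsion_free : forall (a : A) (k : int), k != 0 -> a *~ k = 0 -> a = 0.

Lemma v_square a : v a * v a = 0.
Proof.
apply: (@torsion_free _ (1 + 1)) => //.
by rewrite mulrzDr mulr1z {1}v_anti addNr.
Qed.

Lemma v_mem_prod a (s : seq I) : a \in s -> v a * \prod_(b <- s) v b = 0.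
Proof.
elim: s => // b s IH; rewrite inE big_cons mulrA => /orP[/eqP <-|/IH {}IH].
  by rewrite v_square mul0r.
by rewrite v_anti mulNr -mulrA IH mulr0 oppr0.
Qed.

Lemma v_prod_eq0 (s : seq I) : (#|I| < size s)%N -> \prod_(b <- s) v b = 0.
Proof.
move=> sI; have : ~~ uniq s.
  by apply: contraL sI => /card_uniqP <-; rewrite -leqNgt max_card.
elim: s {sI} => // a s IH /=; rewrite negb_and negbK big_cons => /orP[/v_mem_prod //|/IH ->].
exact: mulr0.
Qed.

(** Normal ordering: each factor N contributes one more v, which moves to the right while shifting
    the remaining falling factorial. Once there are more v than indices, one repeats and the
    anticommuting product vanishes. Starting with no v, this yields [falling_eq0]. *)
Lemma falling_prod_eq0 m (s : seq I) : (#|I| < m + size s)%N -> falling m 0 * \prod_(b <- s) v b = 0.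
Proof.
elim: m s => [|m IH] s ms; first by rewrite v_prod_eq0 ?mulr0.
have -> : falling m.+1 0 = \sum_a u a * falling m 0 * v a.
  rewrite /= subr0 {1}NE mulr_suml; apply: eq_bigr => a _.
  by rewrite -mulrA -[X in falling m X]add0r -falling_shift // mulrA.
rewrite mulr_suml big1 // => a _.
have := IH (a :: s); rewrite big_cons /= addnS => H.
by rewrite -!mulrA H ?mulr0.
Qed.

Lemma falling_eq0 : falling #|I|.+1 0 = 0.
Proof. by have := @falling_prod_eq0 #|I|.+1 [::]; rewrite big_nil mulr1 addn0 => ->. Qed.

End FallingFactorial.

Section EigenDecomposition.
Variables (W : zmodType) (N : endo W).
Hypothesis torsion_free : forall (w : W) (k : int), k != 0 -> w *~ k = 0 -> w = 0.

Lemma falling_eigen m c (k : int) w : N w = w *~ k -> 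
  exists2 j : int, falling N m c w = w *~ j & (k < c -> j != 0) /\ (k = (c + m%:Z)%R -> j != 0).
Proof.
move=> Nw; elim: m c => [|m IH] c; first by exists 1.
have [j E [j0 j1]] := IH (c + 1).
have Ec : (N - c%:~R) w = w *~ (k - c).
  by rewrite endoBE Nw endoMzE mulrzBr.
exists ((k - c) * j).
  by rewrite -[falling N m.+1 c]/((N - c%:~R) * falling N m (c + 1)) endoME E endoMz Ec mulrzA.
split=> kc; rewrite mulf_neq0 //.
- by rewrite subr_eq0 lt_eqF.
- by apply: j0; apply: lt_trans kc _; rewrite ltrDl.
- by rewrite kc addrC addKr.
- by apply: j1; rewrite kc -addrA.
Qed.

Variable m : nat.
Hypothesis Nm : falling N m 0 = 0.

Lemma no_negative_eigenvector (k : int) w : k < 0 -> N w = w *~ k -> w = 0.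
Proof.
move=> k0 Nw; have [j E [j0 _]] := falling_eigen m 0 Nw.
by apply: (torsion_free (j0 k0)); rewrite -E Nm.
Qed.

(** Stands for the decomposition of w into eigenvectors of N, which would involve division. The
    induction lowers the length of the falling factorial that kills w, after passing to an integer
    multiple of w. *)
Lemma additive_eigen_eq0 (W' : zmodType) (g : W -> W') : zmod_morphism g ->
  (forall (w : W') (k : int), k != 0 -> w *~ k = 0 -> w = 0) ->
  (forall (r : nat) w, N w = w *+ r -> g w = 0) -> forall w, g w = 0.
Proof.
move=> gB tf' gN.
have g0 : g 0 = 0 by have := gB 0 0; rewrite !subrr.
have gMn w k : g (w *+ k) = g w *+ k.
  have gD x y : g (x + y) = g x + g y.
    by have := gB x (- y); have := gB 0 y; rewrite opprK !sub0r g0 sub0r => ->; rewrite opprK.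
  by elim: k => [|k IH]; rewrite ?mulr0n // !mulrS gD IH.
have gMz w (k : int) : g (w *~ k) = g w *~ k.
  case: k => k; first by rewrite -!pmulrn gMn.
  by rewrite NegzE -!nmulrn -[in LHS]sub0r gB g0 sub0r gMn.
suff H j w : falling N j 0 w = 0 -> g w = 0 by move=> w; apply: (H m); rewrite Nm.
elim: j w => [|j IH] w; first by rewrite /= => ->.
rewrite falling_last add0r endoME endoBE endoMzE endo1E => /eqP; rewrite subr_eq0 => /eqP Nz.
(* z is an eigenvector for the eigenvalue j, and the shorter product multiplies it by a nonzero
   integer i. So that product kills i w - z, and g kills z. *)
set z := falling N j 0 w in Nz.
have [i E [_ i1]] := falling_eigen j 0 Nz.
have gz : g z = 0 by apply: (gN j); rewrite Nz pmulrn.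
have i0 : i != 0 by apply: i1; rewrite add0r.
apply: (tf' _ i) => //; rewrite -gMz.
have /IH : falling N j 0 (w *~ i - z) = 0 by rewrite endoB endoMz E subrr.
by rewrite gB gz subr0.
Qed.

End EigenDecomposition.

(** * Spectral projections *)

Section ProjectionPolynomials.
Variables (F : closedFieldType) (P : {poly F}).
Hypothesis mP : P \is monic.
Implicit Types (l m : F) (Q : {poly F}).

Definition poly_roots : seq F := undup (sval (closed_field_poly_normal P)).

Let P0 : P != 0. Proof. exact: monic_neq0 mP. Qed.

Lemma poly_factor : P = \prod_(l <- poly_roots) ('X - l%:P) ^+ mup l P.
Proof.
rewrite /poly_roots; case: (closed_field_poly_normal P) => r /= E.
have {}E : P = \prod_(z <- r) ('X - z%:P) by rewrite {1}E (monicP mP) scale1r.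
rewrite {1}E -prodr_undup_exp_count; apply: eq_bigr => l _.
by rewrite E mu_prod_XsubC.
Qed.

Lemma poly_roots_uniq : uniq poly_roots. Proof. exact: undup_uniq. Qed.

Lemma mem_poly_roots l : (l \in poly_roots) = root P l.
Proof.
rewrite /poly_roots; case: (closed_field_poly_normal P) => r /= E.
by rewrite mem_undup E (monicP mP) scale1r root_prod_XsubC.
Qed.

Lemma coprime_XsubC_exp l m (i j : nat) : l != m -> coprimep (('X - l%:P) ^+ i) (('X - m%:P) ^+ j).
Proof.
by move=> lm; apply: coprimep_expl; apply: coprimep_expr; apply: coprimep_XsubC2; rewrite subr_eq0 eq_sym.
Qed.

Lemma dvdp_poly_factor Q : (forall l, l \in poly_roots -> ('X - l%:P) ^+ mup l P %| Q) -> P %| Q.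
Proof.
rewrite {2}poly_factor; have := poly_roots_uniq.
elim: poly_roots => [|l r IH] /=; first by rewrite big_nil dvd1p.
move=> /andP[lr ur] H; rewrite big_cons Gauss_dvdp.
  rewrite H ?mem_head //= IH // => m mr; apply: H.
  by rewrite inE mr orbT.
elim: r lr {IH ur H} => [|m r IH]; first by rewrite big_nil coprimep1.
rewrite inE negb_or => /andP[lm lr]; rewrite big_cons coprimepMr IH // andbT.
exact: coprime_XsubC_exp.
Qed.

(** Chinese remainder theorem. The power A_l of X - l dividing P is coprime to P / A_l, and a Bezout
    relation gives a multiple of P / A_l that is 1 modulo A_l. *)
Lemma projection_polynomials : exists pi : F -> {poly F},
  [/\ forall l, l \notin poly_roots -> pi l = 0,
      forall l, P %| ('X - l%:P) ^+ mup l P * pi l,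
      forall l, l \in poly_roots -> ('X - l%:P) ^+ mup l P %| pi l - 1,
      forall l m, l != m -> P %| pi l * pi m
    & P %| \sum_(l <- poly_roots) pi l - 1].
Proof.
pose A l := ('X - l%:P) ^+ mup l P.
have AP l : A l %| P by rewrite -mup_geq.
pose Q l := P %/ A l.
have QA l : Q l * A l = P by rewrite divpK.
have AQ l m : l != m -> A m %| Q l.
  move=> lm; have := AP m; rewrite -(QA l) Gauss_dvdpl //.
  by apply: coprime_XsubC_exp; rewrite eq_sym.
have cop l : coprimep (A l) (Q l).
  apply: coprimep_expl; rewrite coprimep_sym coprimep_XsubC.
  apply/negP => rt.
  have : A l * ('X - l%:P) %| P.
    by rewrite -(QA l) mulrC dvdp_mul // dvdp_XsubCl.
  by rewrite -exprSr -mup_geq // ltnn.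
pose uv l := sval (cid (Bezout_eq1_coprimepP _ _ (cop l))).
have uvE l : (uv l).1 * A l + (uv l).2 * Q l = 1 by rewrite /uv; case: cid.
(* The value 0 at labels that are not roots lets later statements range over all labels. *)
pose pi l := if l \in poly_roots then (uv l).2 * Q l else 0.
have piA l : P %| A l * pi l.
  rewrite /pi; case: ifP => _; last by rewrite mulr0 dvdp0.
  by rewrite mulrCA [A l * _]mulrC QA dvdp_mull.
have pi1 l : l \in poly_roots -> A l %| pi l - 1.
  by move=> lr; rewrite /pi lr -(uvE l) opprD addrCA subrr addr0 -mulNr dvdp_mull.
have Api l m : l != m -> A m %| pi l.
  move=> lm; rewrite /pi; case: ifP => _; last by rewrite dvdp0.
  by apply: dvdp_mull; exact: AQ.
exists pi; split=> //.
- by move=> l; rewrite /pi => /negbTE ->.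
- move=> l m lm; rewrite {2}/pi; case: ifP => _; last by rewrite mulr0 dvdp0.
  have /dvdpP [q ->] := Api l m lm.
  have -> : q * A m * ((uv m).2 * Q m) = (Q m * A m) * (q * (uv m).2) by ring.
  by rewrite QA dvdp_mulr.
apply: dvdp_poly_factor => l lr.
rewrite (bigD1_seq l) //= ?poly_roots_uniq // addrAC dvdp_addr ?pi1 //.
by elim/big_ind: _ => [|x y dx dy|m ml]; [exact: dvdp0|exact: dvdp_add|exact: Api].
Qed.

End ProjectionPolynomials.

Section PolynomialCalculus.
Variables (K : fieldType) (W : lmodType K) (f : W -> W).
Hypothesis lf : linear f.
Implicit Types (Q : {poly K}) (x y : W).

Definition pev Q x : W := \sum_(i < size Q) Q`_i *: iter i f x.

Lemma iter_linear i : linear (iter i f).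
Proof. by elim: i => [c x y|i IH c x y] //; rewrite !iterS IH lf. Qed.

Lemma pev_linear Q : linear (pev Q).
Proof.
move=> c x y; rewrite /pev scaler_sumr -big_split; apply: eq_bigr => i _ /=.
by rewrite iter_linear scalerDr !scalerA mulrC.
Qed.

Lemma pev_at0 Q : pev Q 0 = 0.
Proof. by have := pev_linear Q (-1) 0 0; rewrite scaler0 addr0 scaleN1r addNr. Qed.

Lemma pev_wide N Q x : (size Q <= N)%N -> pev Q x = \sum_(i < N) Q`_i *: iter i f x.
Proof.
move=> QN; rewrite /pev (big_ord_widen N (fun i => Q`_i *: iter i f x)) // big_mkcond /=.
by apply: eq_bigr => i _; case: ltnP => // Qi; rewrite nth_default // scale0r.
Qed.

Lemma pevD Q Q' x : pev (Q + Q') x = pev Q x + pev Q' x.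
Proof.
pose N := maxn (size Q) (size Q').
rewrite !(@pev_wide N) ?leq_maxl ?leq_maxr //; last by rewrite (leq_trans (size_polyD _ _)).
by rewrite -big_split; apply: eq_bigr => i _ /=; rewrite coefD scalerDl.
Qed.

Lemma pevZ c Q x : pev (c *: Q) x = c *: pev Q x.
Proof.
rewrite [pev (c *: Q) x](@pev_wide (size Q)) ?size_scale_leq // /pev scaler_sumr.
by apply: eq_bigr => i _; rewrite coefZ scalerA.
Qed.

Lemma pev0 x : pev 0 x = 0. Proof. by rewrite -(scale0r 0) pevZ scale0r. Qed.

Lemma pevN Q x : pev (- Q) x = - pev Q x.
Proof. by rewrite -[- Q]scaleN1r pevZ scaleN1r. Qed.

Lemma pevC c x : pev c%:P x = c *: x.
Proof. by rewrite (@pev_wide 1) ?size_polyC_leq1 // big_ord1 coefC. Qed.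

Lemma pev1 x : pev 1 x = x. Proof. by rewrite pevC scale1r. Qed.

Lemma pev_sum (I : Type) (r : seq I) (G : I -> {poly K}) x :
  pev (\sum_(i <- r) G i) x = \sum_(i <- r) pev (G i) x.
Proof. by elim: r => [|i r IH]; rewrite ?big_nil ?pev0 // !big_cons pevD IH. Qed.

Lemma pevMX Q x : pev (Q * 'X) x = pev Q (f x).
Proof.
rewrite (@pev_wide (size Q).+1) ?size_polyMX_leq //.
  rewrite big_ord_recl coefMX eqxx scale0r add0r /pev; apply: eq_bigr => i _.
  by rewrite lift0 coefMX iterSr.
by have [->|Q0] := eqVneq Q 0; rewrite ?mul0r ?size_poly0 // size_mulX.
Qed.

Lemma pevM Q Q' x : pev (Q * Q') x = pev Q (pev Q' x).
Proof.
have pl := pev_linear.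
rewrite mulrC; elim/poly_ind: Q' x => [|Q' c IH] x.
  by rewrite mul0r !pev0 pev_at0.
rewrite mulrDl mulrAC !pevD !pevMX IH mul_polyC pevZ pevC.
have := pl Q c x (pev Q' (f x)); rewrite addrC => <-.
by rewrite addrC.
Qed.

Lemma pev_XsubC_exp (l : K) m x : pev (('X - l%:P) ^+ m) x = iter m (fun y => f y - l *: y) x.
Proof.
elim: m x => [|m IH] x; first by rewrite expr0 pev1.
rewrite exprS pevM IH /= pevD pevN pevC; congr (_ - _).
by rewrite -[X in pev X _]mul1r pevMX pev1.
Qed.

Lemma pev_eigen Q (a : K) x : f x = a *: x -> pev Q x = Q.[a] *: x.
Proof.
move=> fx; rewrite horner_coef scaler_suml; apply: eq_bigr => i _.
rewrite -scalerA; congr (_ *: _).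
have f_scale c y : f (c *: y) = c *: f y.
  have f0 : f 0 = 0 by have := lf (-1) 0 0; rewrite scaler0 addr0 scaleN1r addNr.
  by have := lf c y 0; rewrite !addr0 f0 addr0.
by elim: (i : nat) => [|j IH] /=; rewrite ?expr0 ?scale1r // IH f_scale fx scalerA -exprSr.
Qed.

Lemma pev_dvd P Q x : (forall y, pev P y = 0) -> P %| Q -> pev Q x = 0.
Proof. by move=> PK /dvdpP [q ->]; rewrite mulrC pevM PK. Qed.

Lemma nilpotent_eigenvector (l : K) m x : x <> 0 -> iter m (fun y => f y - l *: y) x = 0 ->
  exists2 y, y <> 0 & f y = l *: y.
Proof.
elim: m x => [|m IH] x x0; first by move=> /= H.
rewrite iterSr => H; have [E|E] := pselect (f x - l *: x = 0); last exact: IH H.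
by exists x => //; apply/eqP; rewrite -subr_eq0 E.
Qed.

End PolynomialCalculus.

Section SpectralProjections.
Variables (K : closedFieldType) (W : lmodType K) (f : W -> W) (P : {poly K}) (pi : K -> {poly K}).
Hypothesis lf : linear f.
Hypothesis mP : P \is monic.
Hypothesis fP : forall x, pev f P x = 0.
Hypothesis pi_out : forall l, l \notin poly_roots P -> pi l = 0.
Hypothesis pi_nil : forall l, P %| ('X - l%:P) ^+ mup l P * pi l.
Hypothesis pi_one : forall l, l \in poly_roots P -> ('X - l%:P) ^+ mup l P %| pi l - 1.
Hypothesis pi_ortho : forall l m, l != m -> P %| pi l * pi m.
Hypothesis pi_sum : P %| \sum_(l <- poly_roots P) pi l - 1.
Implicit Types (l m : K) (x y : W).

Local Notation proj l := (pev f (pi l)).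

Lemma proj_ortho l m x : l != m -> proj l (proj m x) = 0.
Proof. by move=> lm; rewrite -pevM //; apply: (pev_dvd lf _ fP); exact: pi_ortho. Qed.

Lemma proj_idem l x : proj l (proj l x) = proj l x.
Proof.
have [lr|lr] := boolP (l \in poly_roots P); last by rewrite pi_out // !pev0.
apply/eqP; rewrite -subr_eq0 -pevM // -pevN -pevD //; apply/eqP; apply: (pev_dvd lf _ fP).
rewrite -[X in _ - X]mulr1 -mulrBr; have /dvdpP [q ->] := pi_one lr.
by rewrite mulrCA dvdp_mull // mulrC.
Qed.

Lemma proj_total x : \sum_(l <- poly_roots P) proj l x = x.
Proof.
apply/eqP; rewrite -subr_eq0 -pev_sum -[X in _ - X](pev1 f) -pevN -pevD //; apply/eqP.
exact: (pev_dvd lf _ fP).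
Qed.

Lemma projP l x : iter (mup l P) (fun y => f y - l *: y) x = 0 <-> proj l x = x.
Proof.
rewrite -pev_XsubC_exp //; split=> [H|<-]; last first.
  by rewrite -pevM //; apply: (pev_dvd lf _ fP).
have [lr|lr] := boolP (l \in poly_roots P).
  apply/eqP; rewrite -subr_eq0 -[X in _ - X](pev1 f) -pevN -pevD //; apply/eqP.
  have /dvdpP [q ->] := pi_one lr; by rewrite pevM // H pev_at0.
(* At a label that is no root the multiplicity is 0, the iterate is the identity, and x = 0. *)
move: H; rewrite mupNroot -?mem_poly_roots // expr0 pev1 => ->.
by rewrite pi_out // pev0.
Qed.

Lemma eigen_proj l x : f x = l *: x -> proj l x = x.
Proof.
move=> fx; have [lr|lr] := boolP (l \in poly_roots P).
  rewrite (pev_eigen lf _ fx); have /dvdpP [q E] := pi_one lr.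
  have m0 : (0 < mup l P)%N by rewrite -XsubC_dvd ?(monic_neq0 mP) // dvdp_XsubCl -mem_poly_roots.
  have : (pi l - 1).[l] = 0.
    by rewrite E hornerM horner_exp hornerXsubC subrr expr0n eqn0Ngt m0 mulr0.
  by rewrite hornerD hornerN hornerC => /eqP; rewrite subr_eq0 => /eqP ->; rewrite scale1r.
have := fP x; rewrite (pev_eigen lf _ fx) => /eqP; rewrite scaler_eq0.
rewrite mem_poly_roots // in lr; rewrite (negbTE (lr : P.[l] != 0)) /= => /eqP ->.
exact: pev_at0.
Qed.

Lemma proj_neq0_eigen l x : proj l x <> 0 -> exists2 y, y <> 0 & f y = l *: y.
Proof. by move=> H; apply: (nilpotent_eigenvector (m := mup l P) H); apply/projP; exact: proj_idem. Qed.

Section Adjoint.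
Variable B : W -> W -> K.
Hypothesis Bl : forall c x x' y, B (c *: x + x') y = c * B x y + B x' y.
Hypothesis Br : forall c x y y', B x (c *: y + y') = c * B x y + B x y'.
Hypothesis Bskew : forall x y, B (f x) y = - B x (f y).

Lemma B0l y : B 0 y = 0.
Proof. by have := Bl (-1) 0 0 y; rewrite scaler0 addr0 mulN1r addNr. Qed.
Lemma B0r x : B x 0 = 0.
Proof. by have := Br (-1) x 0 0; rewrite scaler0 addr0 mulN1r addNr. Qed.
Lemma B_suml (r : seq K) (F : K -> W) y : B (\sum_(i <- r) F i) y = \sum_(i <- r) B (F i) y.
Proof.
elim: r => [|i r IH]; rewrite ?big_nil ?B0l // !big_cons -IH.
by have := Bl 1 (F i) (\sum_(j <- r) F j) y; rewrite scale1r mul1r.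
Qed.
Lemma B_sumr (r : seq K) (F : K -> W) x : B x (\sum_(i <- r) F i) = \sum_(i <- r) B x (F i).
Proof.
elim: r => [|i r IH]; rewrite ?big_nil ?B0r // !big_cons -IH.
by have := Br 1 x (F i) (\sum_(j <- r) F j); rewrite scale1r mul1r.
Qed.

(** Skewness carries (f + m)^k across B to (f - m)^k up to sign, and this kills the image of the
    projection to m. On the image of the projection to l, (f + m)^k is invertible because l and -m
    differ. *)
Lemma B_proj_ortho l m x y : l + m != 0 -> B (proj l x) (proj m y) = 0.
Proof.
move=> lm; pose k := mup m P; set x' := proj l x; set y' := proj m y.
have yk : pev f (('X - m%:P) ^+ k) y' = 0.
  by rewrite pev_XsubC_exp //; apply/projP; exact: proj_idem.
have xk : pev f (('X - l%:P) ^+ mup l P) x' = 0.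
  by rewrite pev_XsubC_exp //; apply/projP; exact: proj_idem.
have adj j z w : B (pev f (('X + m%:P) ^+ j) z) w = (-1) ^+ j * B z (pev f (('X - m%:P) ^+ j) w).
  elim: j z w => [|j IH] z w; first by rewrite !expr0 !pev1 mul1r.
  have XE (c : K) u : pev f ('X + c%:P) u = c *: u + f u.
    by rewrite pevD pevC -[X in pev f X u]mul1r pevMX pev1 addrC.
  rewrite exprSr pevM // IH XE Bl Bskew exprSr mulrN1 mulNr -mulrN; congr (_ * _).
  rewrite exprS pevM // -polyCN XE.
  have := Br (- m) z (pev f (('X - m%:P) ^+ j) w) (f (pev f (('X - m%:P) ^+ j) w)).
  by rewrite !polyCN => ->; rewrite mulNr opprD opprK.
have : coprimep (('X - l%:P) ^+ mup l P) (('X + m%:P) ^+ k).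
  by rewrite -[m%:P]opprK -(polyCN m); apply: coprime_XsubC_exp; rewrite -addr_eq0.
move=> /Bezout_eq1_coprimepP [[a b] /= ab].
have -> : x' = pev f (('X + m%:P) ^+ k) (pev f b x').
  rewrite -(pevM lf) mulrC -[LHS](pev1 f) -ab pevD (pevM lf a) xk.
  by rewrite pev_at0 // add0r.
by rewrite adj yk B0r mulr0.
Qed.

Lemma B_proj_adj l x y : B (proj l x) y = B x (proj (- l) y).
Proof.
have E1 : B (proj l x) y = B (proj l x) (proj (- l) y).
  rewrite -{1}(proj_total y) B_sumr.
  have [lr|lr] := boolP (- l \in poly_roots P); last first.
    rewrite (pi_out lr) pev0 B0r big1_seq // => m /andP[_ mr].
    by rewrite B_proj_ortho // addrC addr_eq0; apply: contraNneq lr => <-.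
  rewrite (bigD1_seq (- l)) ?poly_roots_uniq //= big1 ?addr0 // => m ml.
  by rewrite B_proj_ortho // addrC addr_eq0.
have E2 : B x (proj (- l) y) = B (proj l x) (proj (- l) y).
  rewrite -{1}(proj_total x) B_suml.
  have [lr|lr] := boolP (l \in poly_roots P); last first.
    rewrite (pi_out lr) pev0 B0l big1_seq // => m /andP[_ mr].
    by rewrite B_proj_ortho // subr_eq0; apply: contraNneq lr => <-.
  rewrite (bigD1_seq l) ?poly_roots_uniq //= big1 ?addr0 // => m ml.
  by rewrite B_proj_ortho // subr_eq0.
by rewrite E1 E2.
Qed.

End Adjoint.

End SpectralProjections.

(** * Local sections *)

Section SectionSpaces.
Variables (T : Type) (E : T -> zmodType).

Record section_space := SectionSpace {
  in_space :> (forall p, E p) -> Prop;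
  space0 : in_space (fun _ => 0);
  spaceD : forall x y, in_space x -> in_space y -> in_space (fun p => x p + y p);
  spaceN : forall x, in_space x -> in_space (fun p => - x p)
}.

Variable Q : section_space.

Record sect := Sect { sect_val :> forall p, E p; sect_in : Q sect_val }.

HB.instance Definition _ := gen_eqMixin sect.
HB.instance Definition _ := gen_choiceMixin sect.

Lemma sect_eq (x y : sect) : (forall p, x p = y p) -> x = y.
Proof.
case: x y => x xQ [y yQ] /= xy; have xyE : x = y by apply: functional_extensionality_dep.
by rewrite xyE in xQ *; congr Sect; exact: Prop_irrelevance.
Qed.

Definition sect_add (x y : sect) := Sect (spaceD (sect_in x) (sect_in y)).
Definition sect_opp (x : sect) := Sect (spaceN (sect_in x)).
Definition sect_zero := Sect (space0 Q).

Fact sect_addA : associative sect_add.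
Proof. by move=> x y z; apply: sect_eq => p; exact: addrA. Qed.
Fact sect_addC : commutative sect_add.
Proof. by move=> x y; apply: sect_eq => p; exact: addrC. Qed.
Fact sect_add0 : left_id sect_zero sect_add.
Proof. by move=> x; apply: sect_eq => p; exact: add0r. Qed.
Fact sect_addN : left_inverse sect_zero sect_opp sect_add.
Proof. by move=> x; apply: sect_eq => p; exact: addNr. Qed.

HB.instance Definition _ := GRing.isZmodule.Build sect sect_addA sect_addC sect_add0 sect_addN.

Lemma sectDE (x y : sect) p : (x + y) p = x p + y p. Proof. by []. Qed.
Lemma sectBE (x y : sect) p : (x - y) p = x p - y p. Proof. by []. Qed.
Lemma sect0E p : (0 : sect) p = 0. Proof. by []. Qed.
Lemma sect_sumE (J : Type) (r : seq J) (F : J -> sect) p :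
  (\sum_(j <- r) F j) p = \sum_(j <- r) F j p.
Proof. by elim/big_rec2: _ => // j x y _ <-. Qed.

End SectionSpaces.

(** Local sections are represented by global ones vanishing outside V, so that agreeing on V means
    being equal. *)
Definition cut (T : Type) (E : T -> zmodType) (V : set T) (x : forall p, E p) : forall p, E p :=
  fun p => if `[< V p >] then x p else 0.

Lemma cut_in (T : Type) (E : T -> zmodType) (V : set T) (x : forall p, E p) p : V p -> cut V x p = x p.
Proof. by move=> Vp; rewrite /cut asboolT. Qed.

Lemma cut_out (T : Type) (E : T -> zmodType) (V : set T) (x : forall p, E p) p : ~ V p -> cut V x p = 0.
Proof. by move=> Vp; rewrite /cut asboolF. Qed.

(** * Clifford action, d and bracket over a chart domain *)

Section RealOperators.
Variables (R : realType) (n : nat) (M : smooth_manifold R n) (c : chart R n M).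
Hypothesis hc : atlas c.
Variable V : set M.
Hypotheses (oV : open V) (Vc : V `<=` chart_dom c).
Implicit Types (p q : M).

Fact form_space0 : smooth_form V (fun _ : M => 0) /\ (forall p, ~ V p -> (0 : forms_at p) = 0).
Proof. by split=> //; exact: smooth_form_0. Qed.
Fact form_spaceD (w w' : form M) :
  smooth_form V w /\ (forall p, ~ V p -> w p = 0) -> smooth_form V w' /\ (forall p, ~ V p -> w' p = 0) ->
  smooth_form V (fun p => w p + w' p) /\ (forall p, ~ V p -> w p + w' p = 0).
Proof.
move=> [sw w0] [sw' w0']; split; first exact: smooth_form_D.
by move=> p Vp; rewrite w0 // w0' // addr0.
Qed.
Fact form_spaceN (w : form M) : smooth_form V w /\ (forall p, ~ V p -> w p = 0) ->
  smooth_form V (fun p => - w p) /\ (forall p, ~ V p -> - w p = 0).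
Proof.
move=> [sw w0]; split; last by move=> p Vp; rewrite w0 // oppr0.
by apply: smooth_form_ext (smooth_form_Z (-1) oV sw) => q _; rewrite scaleN1r.
Qed.
Definition form_space : section_space (fun p : M => forms_at p) :=
  SectionSpace form_space0 form_spaceD form_spaceN.

Fact gfield_space0 : smooth_gfield V (fun _ : M => 0) /\ (forall p, ~ V p -> (0 : gtan p) = 0).
Proof. by split=> //; exact: smooth_gfield_0. Qed.
Fact gfield_spaceD (w w' : gfield M) :
  smooth_gfield V w /\ (forall p, ~ V p -> w p = 0) -> smooth_gfield V w' /\ (forall p, ~ V p -> w' p = 0) ->
  smooth_gfield V (fun p => w p + w' p) /\ (forall p, ~ V p -> w p + w' p = 0).
Proof.
move=> [sw w0] [sw' w0']; split; first exact: smooth_gfield_D.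
by move=> p Vp; rewrite w0 // w0' // addr0.
Qed.
Fact gfield_spaceN (w : gfield M) : smooth_gfield V w /\ (forall p, ~ V p -> w p = 0) ->
  smooth_gfield V (fun p => - w p) /\ (forall p, ~ V p -> - w p = 0).
Proof.
move=> [sw w0]; split; last by move=> p Vp; rewrite w0 // oppr0.
by apply: (smooth_gfield_ext oV _ (smooth_gfield_Z (-1) oV sw)) => q _; rewrite scaleN1r.
Qed.
Definition gfield_space : section_space (fun p : M => gtan p) :=
  SectionSpace gfield_space0 gfield_spaceD gfield_spaceN.

Definition local_forms : zmodType := sect form_space.
Definition local_gfields : zmodType := sect gfield_space.
Implicit Types (w : local_forms) (x y : local_gfields).

Lemma local_form_smooth w : smooth_form V w. Proof. by case: (sect_in w). Qed.
Lemma local_gfield_smooth x : smooth_gfield V x. Proof. by case: (sect_in x). Qed.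
Lemma local_form_out w p : ~ V p -> w p = 0. Proof. by case: (sect_in w) => _; apply. Qed.
Lemma local_gfield_out x p : ~ V p -> x p = 0. Proof. by case: (sect_in x) => _; apply. Qed.

Fact cut_form_subproof (w : form M) : smooth_form V w -> form_space (cut (E := fun p : M => forms_at p) V w).
Proof.
move=> sw; split; last by move=> p; exact: cut_out.
by apply: smooth_form_ext sw => p Vp; rewrite cut_in.
Qed.
Definition cut_form (w : form M) (sw : smooth_form V w) : local_forms := Sect (cut_form_subproof sw).

Fact cut_gfield_subproof (x : gfield M) : smooth_gfield V x -> gfield_space (cut (E := fun p : M => gtan p) V x).
Proof.
move=> sx; split; last by move=> p; exact: cut_out.
by apply: (smooth_gfield_ext oV _ sx) => p Vp; rewrite cut_in.
Qed.
Definition cut_gfield (x : gfield M) (sx : smooth_gfield V x) : local_gfields := Sect (cut_gfield_subproof sx).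

Lemma local_form_eq w w' : (forall p, V p -> w p = w' p) -> w = w'.
Proof.
move=> H; apply: sect_eq => p; have [Vp|Vp] := pselect (V p); first exact: H.
by rewrite !local_form_out.
Qed.

Lemma local_gfield_eq x y : (forall p, V p -> x p = y p) -> x = y.
Proof.
move=> H; apply: sect_eq => p; have [Vp|Vp] := pselect (V p); first exact: H.
by rewrite !local_gfield_out.
Qed.

Fact op_cl_subproof x w : form_space (fun p => clifford (x p) (w p)).
Proof.
split; first exact: (smooth_clifford oV (local_gfield_smooth x) (local_form_smooth w)).
by move=> p Vp; rewrite local_form_out // clifford0r.
Qed.
Definition op_cl_fun x w : local_forms := Sect (op_cl_subproof x w).
Fact op_cl_zmod x : zmod_morphism (op_cl_fun x).
Proof. by move=> w w'; apply: sect_eq => p /=; rewrite [LHS]cliffordDr cliffordNr. Qed.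
Definition op_cl x : endo local_forms := Endo (op_cl_zmod x).
Fact op_cl_additive : zmod_morphism op_cl.
Proof.
move=> x y; apply: endo_eq => w; apply: sect_eq => p /=.
by rewrite [LHS]cliffordDl cliffordNl.
Qed.
HB.instance Definition _ := GRing.isZmodMorphism.Build local_gfields (endo local_forms) op_cl op_cl_additive.

Lemma smooth_local_d (w : form M) : smooth_form V w -> smooth_form V (exterior_d w).
Proof.
move=> sw; apply: (@smooth_form_ext _ _ _ V (local_d c w)).
  by move=> p Vp; rewrite (exterior_d_local hc oV Vp (Vc Vp) sw).
apply: (@smooth_form_ext _ _ _ V (fun p => \sum_i clifford (chart_dx c i p) (nabla_form c i w p))).
  by move=> p Vp; rewrite local_dE.
apply: smooth_form_sum => // i; apply: smooth_clifford => //; last exact: smooth_nabla_form.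
by apply: (smooth_gfield_sub Vc); exact: smooth_chart_dx.
Qed.

Lemma exterior_d_add (w w' : form M) p : V p -> smooth_form V w -> smooth_form V w' ->
  exterior_d (fun q => w q + w' q) p = exterior_d w p + exterior_d w' p.
Proof.
move=> Vp sw sw'; rewrite !(exterior_d_local hc oV Vp (Vc Vp)) //; last exact: smooth_form_D.
rewrite !local_dE -big_split; apply: eq_bigr => i _ /=.
by rewrite (nabla_form_D hc i oV Vp (Vc Vp)) // cliffordDr.
Qed.

Definition op_d_fun w : local_forms := cut_form (smooth_local_d (local_form_smooth w)).

Lemma op_d_funE w p : V p -> op_d_fun w p = exterior_d w p.
Proof. exact: cut_in. Qed.

Fact op_d_zmod : zmod_morphism op_d_fun.
Proof.
move=> w w'; apply/eqP; rewrite eq_sym subr_eq; apply/eqP; apply: local_form_eq => p Vp.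
rewrite sectDE !op_d_funE // -exterior_d_add //; try exact: local_form_smooth.
by congr (exterior_d _ p); apply: functional_extensionality_dep => q; rewrite sectBE subrK.
Qed.
Definition op_d : endo local_forms := Endo op_d_zmod.

Lemma op_clE x w p : op_cl x w p = clifford (x p) (w p). Proof. by []. Qed.
Lemma op_dE w p : V p -> op_d w p = exterior_d w p. Proof. exact: op_d_funE. Qed.

Lemma op_lieE x w p : V p -> lie op_cl op_d x w p = coord_lie c x w p.
Proof.
move=> Vp; rewrite /lie endoDE sectDE !endoME op_clE !op_dE //.
exact: (anticomm_d hc oV Vp Vc (local_gfield_smooth x) (local_form_smooth w)).
Qed.

Lemma smooth_dorfman (x y : gfield M) : smooth_gfield V x -> smooth_gfield V y -> smooth_gfield V (dorfman x y).
Proof.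
move=> sx sy; apply: (smooth_gfield_ext oV (x := coord_dorfman c x y)).
  by move=> p Vp; rewrite (dorfman_coord hc oV Vp Vc sx sy).
have sdx i : smooth_gfield V (chart_dx c i) by apply: (smooth_gfield_sub Vc); exact: smooth_chart_dx.
have sn i z : smooth_gfield V z -> smooth_gfield V (nabla_g c i z) by exact: smooth_nabla_g.
have sI z t : smooth_gfield V z -> smooth_gfield V t -> smooth_fun V (fun q => 2 * inner (z q) (t q)).
  by move=> sz st; apply: smooth_fun_Z => //; exact: smooth_inner.
apply: smooth_gfield_sum => // i; apply: smooth_gfield_D => //; last first.
  by apply: smooth_gfield_M => //; [apply: sI|apply: sn].
apply: smooth_gfield_B => //; apply: smooth_gfield_M => //; try apply: sI => //; apply: sn => //.
Qed.

Definition op_br x y : local_gfields := cut_gfield (smooth_dorfman (local_gfield_smooth x) (local_gfield_smooth y)).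

Lemma op_brE x y p : V p -> op_br x y p = dorfman x y p.
Proof. exact: cut_in. Qed.

Lemma op_derived_bracket x y : comm (lie op_cl op_d x) (op_cl y) = op_cl (op_br x y).
Proof.
apply: endo_eq => w; apply: local_form_eq => p Vp.
rewrite /comm endoBE sectBE !endoME !op_clE op_brE // !op_lieE //.
rewrite (dorfman_coord hc oV Vp Vc (local_gfield_smooth x) (local_gfield_smooth y)).
by rewrite (coord_dorfman_clifford hc oV Vp Vc (local_gfield_smooth x) (local_gfield_smooth y) (local_form_smooth w)).
Qed.

Lemma op_pairingE x y w p : pairing op_cl x y w p = (2 * inner (x p) (y p)) *: w p.
Proof. by rewrite /pairing endoDE sectDE !endoME !op_clE clifford_rel. Qed.

Lemma op_pairing_comm x y z : pairing op_cl x y * op_cl z = op_cl z * pairing op_cl x y.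
Proof.
apply: endo_eq => w; apply: sect_eq => p.
rewrite (endoME (pairing op_cl x y)) (endoME (op_cl z)).
rewrite (op_pairingE x y (op_cl z w)) (op_clE z (pairing op_cl x y w)) (op_pairingE x y w).
exact: (esym (cliffordZr _ _ _)).
Qed.

End RealOperators.

Section ChartFrames.
Variables (R : realType) (n : nat) (M : smooth_manifold R n) (c : chart R n M).
Hypothesis hc : atlas c.
Implicit Types (p q : M).

Definition frame_index : finType := ('I_n + 'I_n)%type.
Implicit Types (a : frame_index).

Definition flip_index a : frame_index := match a with inl i => inr i | inr i => inl i end.

Lemma sum_frame_index (Z : zmodType) (F : frame_index -> Z) :
  \sum_a F a = \sum_i F (inl i) + \sum_i F (inr i).
Proof. exact: big_sumType. Qed.

Lemma flip_indexK : involutive flip_index. Proof. by case. Qed.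

Definition chart_frame a : gfield M :=
  match a with inl i => chart_dv c i | inr i => chart_dx c i end.
Definition chart_coframe a : gfield M := chart_frame (flip_index a).

Lemma smooth_chart_frame a : smooth_gfield (chart_dom c) (chart_frame a).
Proof. by case: a => i /=; [exact: smooth_chart_dv|exact: smooth_chart_dx]. Qed.

Lemma innerC p (x y : gtan p) : inner x y = inner y x.
Proof. by rewrite /inner addrC. Qed.

Lemma inner_dv p (x : gtan p) i : 2 * inner x (chart_dv c i p) = x.2 (chart_vec c i p).
Proof.
rewrite /inner mulrA mulfV ?mul1r ?pnatr_eq0 //.
have -> : (chart_dv c i p).2 x.1 = 0 by [].
by rewrite addr0.
Qed.

Lemma gtan_eq p (x y : gtan p) : x.1 = y.1 -> x.2 = y.2 -> x = y.
Proof. by case: x y => x1 x2 [y1 y2] /= -> ->. Qed.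

Lemma gtan_decomp p (x : gtan p) : chart_dom c p ->
  x = \sum_a (2 * inner x (chart_coframe a p)) *: chart_frame a p.
Proof.
move=> cp; rewrite big_sumType /=.
have -> : \sum_i (2 * inner x (chart_coframe (inl i) p)) *: chart_dv c i p = ((x.1, 0) : gtan p).
  have E i : (2 * inner x (chart_coframe (inl i) p)) *: chart_dv c i p =
      ((x.1 (chart_coord c i) *: chart_vec c i p, 0) : gtan p).
    rewrite /chart_coframe /= innerC inner_dx //.
    by rewrite /chart_dv; congr (_, _); rewrite /= scaler0.
  rewrite (eq_bigr _ (fun i _ => E i)); apply: gtan_eq; last by rewrite gtan_snd_sum big1.
  by rewrite gtan_fst_sum [RHS](tangent_decomp hc).
have -> : \sum_i (2 * inner x (chart_coframe (inr i) p)) *: chart_dx c i p = ((0, x.2) : gtan p).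
  have E i : (2 * inner x (chart_coframe (inr i) p)) *: chart_dx c i p =
      ((0, x.2 (chart_vec c i p) *: chart_dual c i p) : gtan p).
    rewrite /chart_coframe /= inner_dv.
    by rewrite /chart_dx; congr (_, _); rewrite /= scaler0.
  rewrite (eq_bigr _ (fun i _ => E i)); apply: gtan_eq; first by rewrite gtan_fst_sum big1.
  by rewrite gtan_snd_sum [RHS](dual_decomp hc).
by apply: gtan_eq; rewrite /= ?addr0 ?add0r.
Qed.

Lemma gtan_codecomp p (x : gtan p) : chart_dom c p ->
  x = \sum_a (2 * inner x (chart_frame a p)) *: chart_coframe a p.
Proof.
move=> cp; rewrite {1}(gtan_decomp x cp) (reindex_inj (inv_inj flip_indexK)).
by apply: eq_bigr => a _; rewrite /chart_coframe flip_indexK.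
Qed.

Lemma inner_nondegenerate p (x : gtan p) : chart_dom c p -> (forall y, 2 * inner x y = 0) -> x = 0.
Proof. by move=> cp x0; rewrite (gtan_decomp x cp) big1 // => a _; rewrite x0 scale0r. Qed.

Section UnitForm.
Variables (W : lmodType R).

Fact unit_form_subproof : (fun s : seq W => if s is [::] then 1 else 0 : R^o) \in is_extform (V := W).
Proof.
apply/asboolP; split; last by case.
by move=> [|z s1] a x y s2 /=; rewrite mulr0 addr0.
Qed.

(** The constant function 1, on which a multiplication operator shows its scalar. *)
Definition unit_form : extform W := ExtForm unit_form_subproof.

Lemma unit_form_scale (a : R) : a *: unit_form = 0 -> a = 0.
Proof.
move=> E; have : (a *: unit_form) [::] = 0 by rewrite E.
by rewrite extform_scaleE /= mulr1.
Qed.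

End UnitForm.

Lemma smooth_unit_form (V : set M) : open V -> smooth_form V (fun p => unit_form (tangent p)).
Proof.
move=> oV U s oU UV ss; case: s ss => [|X s] ss /=; exact: smooth_fun_cst.
Qed.

Lemma nabla_g_dx k i p : chart_dom c p -> nabla_g c k (chart_dx c i) p = 0.
Proof.
move=> cp; rewrite /nabla_g /nabla_vec /nabla_dual.
congr (_, _); apply: big1 => j _.
  have -> : (fun q => (chart_dx c i q).1 (chart_coord c j)) = (fun=> 0) by [].
  by rewrite chart_partial_cst scale0r.
rewrite (@chart_partial_near _ _ _ c _ _ (fun=> (j == i)%:R)) ?chart_partial_cst ?scale0r //.
by apply: (open_near_eq (@chart_open_dom _ _ _ c) cp) => q cq; rewrite /= chart_vec_coord.
Qed.

Lemma nabla_g_dv k i p : chart_dom c p -> nabla_g c k (chart_dv c i) p = 0.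
Proof.
move=> cp; rewrite /nabla_g /nabla_vec /nabla_dual.
congr (_, _); apply: big1 => j _; last first.
  have -> : (fun q => (chart_dv c i q).2 (chart_vec c j q)) = (fun=> 0) by [].
  by rewrite chart_partial_cst scale0r.
rewrite (@chart_partial_near _ _ _ c _ _ (fun=> (i == j)%:R)) ?chart_partial_cst ?scale0r //.
by apply: (open_near_eq (@chart_open_dom _ _ _ c) cp) => q cq; rewrite /= chart_vec_coord.
Qed.

Lemma nabla_g_ext U (x y : gfield M) k p : open U -> U p -> chart_dom c p ->
  (forall q, U q -> x q = y q) -> nabla_g c k x p = nabla_g c k y p.
Proof.
move=> oU Up cp xy; rewrite /nabla_g /nabla_vec /nabla_dual.
congr (_, _); apply: eq_bigr => j _; congr (_ *: _); apply: chart_partial_near => //;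
  by apply: (open_near_eq oU Up) => q Uq; rewrite xy.
Qed.

Lemma coord_lie_ext U (x y : gfield M) (w : form M) p : open U -> U p -> chart_dom c p ->
  (forall q, U q -> x q = y q) -> coord_lie c x w p = coord_lie c y w p.
Proof.
move=> oU Up cp xy; apply: eq_bigr => i _.
by rewrite (nabla_g_ext i oU Up cp xy) xy.
Qed.

Lemma coord_lie_dx i (w : form M) p : chart_dom c p -> coord_lie c (chart_dx c i) w p = 0.
Proof.
move=> cp; apply: big1 => k _; rewrite nabla_g_dx // clifford0l clifford0r add0r.
by rewrite inner_dx // (_ : (chart_dx c i p).1 = 0) // scale0r.
Qed.

Lemma coord_lie_dv i (w : form M) p : chart_dom c p ->
  coord_lie c (chart_dv c i) w p = nabla_form c i w p.
Proof.
move=> cp; rewrite /coord_lie (bigD1 i) //= big1 ?addr0.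
  by rewrite nabla_g_dv // clifford0l clifford0r add0r inner_dx // chart_vec_coord // eqxx scale1r.
move=> k ki; rewrite nabla_g_dv // clifford0l clifford0r add0r inner_dx // chart_vec_coord //.
by rewrite eq_sym (negbTE ki) scale0r.
Qed.

End ChartFrames.

Section RealFrames.
Variables (R : realType) (n : nat) (M : smooth_manifold R n) (c : chart R n M).
Hypothesis hc : atlas c.
Variable V : set M.
Hypotheses (oV : open V) (Vc : V `<=` chart_dom c).
Implicit Types (p q : M) (a : frame_index n).
Local Notation X := (local_gfields oV).
Local Notation W := (local_forms oV).
Local Notation cl := (@op_cl _ _ _ _ oV).
Local Notation d := (@op_d _ _ _ _ hc _ oV Vc).

Definition op_frame a : X := cut_gfield oV (smooth_gfield_sub Vc (smooth_chart_frame hc a)).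
Definition op_coframe a : X := op_frame (flip_index a).

Lemma op_frameE a p : V p -> op_frame a p = chart_frame c a p.
Proof. exact: cut_in. Qed.

Lemma op_coframeE a p : V p -> op_coframe a p = chart_coframe c a p.
Proof. exact: op_frameE. Qed.

Lemma op_metric_frame :
  (forall x : X, cl x = \sum_a pairing cl x (op_coframe a) * cl (op_frame a)) /\
  (forall x : X, cl x = \sum_a pairing cl x (op_frame a) * cl (op_coframe a)).
Proof.
split=> x; apply: endo_eq => w; apply: local_form_eq => p Vp; rewrite endo_sumE sect_sumE op_clE.
  rewrite {1}(gtan_decomp hc (x p) (Vc Vp)) clifford_suml; apply: eq_bigr => a _.
  rewrite (endoME (pairing cl x (op_coframe a))) (op_pairingE x _ (cl (op_frame a) w)) op_clE.
  by rewrite cliffordZl op_frameE // op_coframeE.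
rewrite {1}(gtan_codecomp hc (x p) (Vc Vp)) clifford_suml; apply: eq_bigr => a _.
rewrite (endoME (pairing cl x (op_frame a))) (op_pairingE x _ (cl (op_coframe a) w)) op_clE.
by rewrite cliffordZl op_frameE // op_coframeE.
Qed.

(** If z acts by zero, so do its pairings with the coframe; applied to the form 1 they reveal that
    all coefficients of z vanish. *)
Lemma op_cl_inj : injective cl.
Proof.
move=> x y xy; apply/eqP; rewrite -subr_eq0; apply/eqP.
have z0 : (cl : {additive X -> endo W}) (x - y) = 0 by rewrite raddfB /= xy subrr.
move: (x - y) z0 => {xy} z z0; apply: local_gfield_eq => p Vp; rewrite sect0E.
rewrite (gtan_decomp hc (z p) (Vc Vp)) big1 // => a _.
have : pairing cl z (op_coframe a) = 0 by rewrite /pairing z0 mulr0 mul0r addr0.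
move=> /(congr1 (fun f : endo W => f (cut_form oV (smooth_unit_form oV)) p)).
rewrite (op_pairingE z) endo0E sect0E op_coframeE // [cut_form _ _ p](_ : _ = unit_form (tangent p)); last exact: cut_in.
by move=> /unit_form_scale ->; rewrite scale0r.
Qed.

Lemma op_lie_dx i (w : W) p : V p -> lie cl d (op_frame (inr i)) w p = 0.
Proof.
move=> Vp; rewrite op_lieE // -(coord_lie_dx hc i w (Vc Vp)).
by apply: (coord_lie_ext w oV Vp (Vc Vp)) => q Vq; exact: op_frameE.
Qed.

Lemma op_lie_dv i (w : W) p : V p -> lie cl d (op_frame (inl i)) w p = nabla_form c i w p.
Proof.
move=> Vp; rewrite op_lieE // -(coord_lie_dv hc i w (Vc Vp)).
by apply: (coord_lie_ext w oV Vp (Vc Vp)) => q Vq; exact: op_frameE.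
Qed.

Lemma op_d_chart (w : W) p : V p -> d w p = \sum_i clifford (chart_dx c i p) (nabla_form c i w p).
Proof.
by move=> Vp; rewrite op_dE // (exterior_d_local hc oV Vp (Vc Vp) (local_form_smooth w)) local_dE.
Qed.

(** The coordinate frame is parallel, so the anticommutator of d with dx_i vanishes and that with
    the coordinate vector is nabla_i. Half of the sum drops out, the other half is the coordinate
    formula for d. *)
Lemma op_d_eL : \sum_a cl (op_frame a) * lie cl d (op_coframe a) = d.
Proof.
apply: endo_eq => w; apply: local_form_eq => p Vp; rewrite endo_sumE sect_sumE op_d_chart //.
rewrite sum_frame_index big1 ?add0r => [|i _].
  apply: eq_bigr => i _; rewrite (endoME (cl _)) op_clE op_frameE //.
  exact: (congr1 (clifford (chart_dx c i p)) (op_lie_dv i w Vp)).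
rewrite (endoME (cl _)) op_clE; apply: etrans (clifford0r _).
exact: (congr1 (clifford _) (op_lie_dx i w Vp)).
Qed.

Lemma op_d_Lf : \sum_a lie cl d (op_frame a) * cl (op_coframe a) = d.
Proof.
apply: endo_eq => w; apply: local_form_eq => p Vp; rewrite endo_sumE sect_sumE op_d_chart //.
rewrite sum_frame_index [X in _ + X]big1 ?addr0 => [|i _]; last first.
  by rewrite (endoME (lie _ _ _)) (op_lie_dx i (cl _ w) Vp).
apply: eq_bigr => i _; rewrite (endoME (lie _ _ _)) (op_lie_dv i (cl _ w) Vp).
rewrite (nabla_clifford hc i oV Vp Vc (local_gfield_smooth _) (local_form_smooth w)).
by rewrite (nabla_g_ext i oV Vp (Vc Vp) (op_frameE (inr i))) nabla_g_dx ?clifford0l ?add0r ?op_frameE //; exact: Vc.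
Qed.

End RealFrames.

(** * Complexification *)

Section Complexify.
Variables (B A : pzRingType) (phi : {rmorphism B -> A}) (J : A).
Variables (X : zmodType) (cl : {additive X -> B}) (d : B) (br : X -> X -> X).
Hypothesis JC : forall b, J * phi b = phi b * J.
Hypothesis J2 : J * J = -1.
Hypothesis phi_inj : forall a b, phi a + J * phi b = 0 -> a = 0 /\ b = 0.

(** The operator a + i b: [phi] embeds the real operators and J is multiplication by i, commuting
    with them. *)
Definition cphi (a b : B) : A := phi a + J * phi b.

Lemma cphiM a b a' b' : cphi a b * cphi a' b' = cphi (a * a' - b * b') (a * b' + b * a').
Proof.
rewrite /cphi !rmorphB !rmorphD !rmorphM /= mulrDl !mulrDr !mulrA -JC -!mulrA (mulrA (phi b) J) -JC.
rewrite -!mulrA (mulrA J J) J2; ncring.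
Qed.

Lemma cphiD a b a' b' : cphi a b + cphi a' b' = cphi (a + a') (b + b').
Proof. by rewrite /cphi !rmorphD /=; ncring. Qed.

Lemma cphiB a b a' b' : cphi a b - cphi a' b' = cphi (a - a') (b - b').
Proof. by rewrite /cphi !rmorphB /=; ncring. Qed.

Lemma cphi_sum (I : Type) (r : seq I) (F G : I -> B) :
  \sum_(i <- r) cphi (F i) (G i) = cphi (\sum_(i <- r) F i) (\sum_(i <- r) G i).
Proof. by rewrite /cphi big_split /= -mulr_sumr !rmorph_sum. Qed.

Definition ccl (x : X * X) : A := cphi (cl x.1) (cl x.2).
Fact ccl_additive : zmod_morphism ccl.
Proof. by move=> x y; rewrite /ccl cphiB !raddfB. Qed.
HB.instance Definition _ := GRing.isZmodMorphism.Build (X * X)%type A ccl ccl_additive.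

Definition cbr (x y : X * X) : X * X := (br x.1 y.1 - br x.2 y.2, br x.1 y.2 + br x.2 y.1).

Lemma clieE x : lie ccl (phi d) x = cphi (lie cl d x.1) (lie cl d x.2).
Proof.
have E : phi d = cphi d 0 by rewrite /cphi rmorph0 mulr0 addr0.
rewrite /lie E /= /ccl !cphiM cphiD; congr cphi; ncring.
Qed.

Lemma ccommE a b a' b' : comm (cphi a b) (cphi a' b') =
  cphi (comm a a' - comm b b') (comm a b' + comm b a').
Proof. by rewrite /comm !cphiM cphiB; congr cphi; ncring. Qed.

Lemma ccl_derived_bracket :
  (forall x y, comm (lie cl d x) (cl y) = cl (br x y)) ->
  forall x y, comm (lie ccl (phi d) x) (ccl y) = ccl (cbr x y).
Proof.
by move=> brE x y; rewrite clieE /ccl ccommE !brE raddfB raddfD.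
Qed.

Lemma cpairingE x y : pairing ccl x y =
  cphi (pairing cl x.1 y.1 - pairing cl x.2 y.2) (pairing cl x.1 y.2 + pairing cl x.2 y.1).
Proof. by rewrite /pairing /= /ccl !cphiM cphiD; congr cphi; ncring. Qed.

Lemma cpairing_comm :
  (forall x y z, pairing cl x y * cl z = cl z * pairing cl x y) ->
  forall x y z, pairing ccl x y * ccl z = ccl z * pairing ccl x y.
Proof.
move=> H x y z; rewrite cpairingE /ccl !cphiM; congr cphi.
  transitivity (pairing cl x.1 y.1 * cl z.1 - pairing cl x.2 y.2 * cl z.1
    - (pairing cl x.1 y.2 * cl z.2 + pairing cl x.2 y.1 * cl z.2)); first by ncring.
  by rewrite !H; ncring.
transitivity (pairing cl x.1 y.1 * cl z.2 - pairing cl x.2 y.2 * cl z.2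
    + (pairing cl x.1 y.2 * cl z.1 + pairing cl x.2 y.1 * cl z.1)); first by ncring.
by rewrite !H; ncring.
Qed.

Lemma cmetric_frame (I : finType) (e f : I -> X) :
  (forall x, cl x = \sum_a pairing cl x (f a) * cl (e a)) ->
  forall x, ccl x = \sum_a pairing ccl x (f a, 0) * ccl (e a, 0).
Proof.
move=> fe x; rewrite /ccl /= (fe x.1) (fe x.2) -cphi_sum; apply: eq_bigr => a _.
by rewrite cpairingE /= raddf0 /pairing raddf0 !(mulr0, mul0r, addr0, subr0) cphiM !(mulr0, addr0, add0r, subr0).
Qed.

Lemma ccl_inj : injective cl -> injective ccl.
Proof.
move=> ci x y xy; have [|/= z1 z2] := @phi_inj (cl (x - y).1) (cl (x - y).2).
  by apply: etrans (ccl_additive x y) _; rewrite xy subrr.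
have E1 : x.1 = y.1 by apply: ci; apply/eqP; rewrite -subr_eq0 -raddfB /= z1.
have E2 : x.2 = y.2 by apply: ci; apply/eqP; rewrite -subr_eq0 -raddfB /= z2.
by rewrite [x]surjective_pairing [y]surjective_pairing E1 E2.
Qed.

Lemma ccl_sum_lie (I : finType) (e f : I -> X) : \sum_a cl (e a) * lie cl d (f a) = d ->
  \sum_a ccl (e a, 0) * lie ccl (phi d) (f a, 0) = phi d.
Proof.
move=> E; transitivity (cphi d 0); last by rewrite /cphi rmorph0 mulr0 addr0.
have -> : cphi d 0 = \sum_a cphi (cl (e a) * lie cl d (f a)) 0 by rewrite cphi_sum E big1.
apply: eq_bigr => a _.
rewrite clieE /ccl /= /lie raddf0 !(mulr0, mul0r, addr0) cphiM.
by rewrite !(mulr0, mul0r, addr0, subr0).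
Qed.

Lemma lie_sum_ccl (I : finType) (e f : I -> X) : \sum_a lie cl d (e a) * cl (f a) = d ->
  \sum_a lie ccl (phi d) (e a, 0) * ccl (f a, 0) = phi d.
Proof.
move=> E; transitivity (cphi d 0); last by rewrite /cphi rmorph0 mulr0 addr0.
have -> : cphi d 0 = \sum_a cphi (lie cl d (e a) * cl (f a)) 0 by rewrite cphi_sum E big1.
apply: eq_bigr => a _.
rewrite clieE /ccl /= /lie raddf0 !(mulr0, mul0r, addr0) cphiM.
by rewrite !(mulr0, mul0r, addr0, subr0).
Qed.

End Complexify.

Section DiagonalEndomorphisms.
Variable W : zmodType.
Local Notation W2 := (W * W)%type.

Fact diag_endo_subproof (f : endo W) : zmod_morphism (fun w : W2 => (f w.1, f w.2) : W2).
Proof. by move=> x y; rewrite !endoB. Qed.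
Definition diag_endo (f : endo W) : endo W2 := Endo (diag_endo_subproof f).

Fact diag_endo_additive : zmod_morphism diag_endo.
Proof. by move=> f g; apply: endo_eq. Qed.
HB.instance Definition _ := GRing.isZmodMorphism.Build (endo W) (endo W2) diag_endo diag_endo_additive.
Fact diag_endo_multiplicative : monoid_morphism diag_endo.
Proof. by split=> [|f g]; apply: endo_eq => //; case. Qed.
HB.instance Definition _ := GRing.isMonoidMorphism.Build (endo W) (endo W2) diag_endo diag_endo_multiplicative.

Fact rot_endo_subproof : zmod_morphism (fun w : W2 => (- w.2, w.1) : W2).
Proof. by move=> x y; congr (_, _); rewrite /= opprD. Qed.
(** Multiplication by i when the pair (x, y) stands for x + i y. *)
Definition rot_endo : endo W2 := Endo rot_endo_subproof.

Lemma rot_diag f : rot_endo * diag_endo f = diag_endo f * rot_endo.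
Proof. by apply: endo_eq => w; congr (_, _); rewrite /= endoN. Qed.

Lemma rot_rot : rot_endo * rot_endo = -1.
Proof. by apply: endo_eq => -[a b]. Qed.

Lemma diag_rot_inj f g : diag_endo f + rot_endo * diag_endo g = 0 -> f = 0 /\ g = 0.
Proof.
move=> H; have E w : (f w, g w) = (0, 0).
  have := congr1 (fun h : endo W2 => h (w, 0)) H.
  by rewrite endoDE (endoME rot_endo) /= !endo0 /= => -[]; rewrite oppr0 addr0 add0r => -> ->.
by split; apply: endo_eq => w; have [] := E w.
Qed.

End DiagonalEndomorphisms.

Lemma cpx_scaleE (R : realType) (V : lmodType R) (k : R[i]) (w : cpx V) :
  k *: w = (complex.Re k *: w.1 - complex.Im k *: w.2, complex.Re k *: w.2 + complex.Im k *: w.1).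
Proof. by []. Qed.

Section PointOperators.
Variables (R : realType) (n : nat) (M : smooth_manifold R n) (p : M).
Implicit Types (x y : gtan p) (w : forms_at p).
Local Notation W2 := (forms_at p * forms_at p)%type.

Fact pt_cl_subproof x : zmod_morphism (@clifford _ _ _ p x).
Proof. by move=> w w'; rewrite cliffordDr cliffordNr. Qed.
Definition pt_cl x : endo (forms_at p) := Endo (pt_cl_subproof x).
Fact pt_cl_additive : zmod_morphism pt_cl.
Proof.
move=> x y; apply: endo_eq => w.
by apply: etrans (cliffordDl x (- y) w) _; rewrite cliffordNl.
Qed.
HB.instance Definition _ := GRing.isZmodMorphism.Build (gtan p) (endo (forms_at p)) pt_cl pt_cl_additive.

Definition pt_ccl : gtan p * gtan p -> endo W2 :=
  ccl (@diag_endo (forms_at p)) (rot_endo (forms_at p)) pt_cl.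
HB.instance Definition _ := GRing.Additive.copy pt_ccl (ccl (@diag_endo (forms_at p)) (rot_endo (forms_at p)) pt_cl).

(** Twice the complex bilinear extension of [inner], normalised to be the scalar of the Clifford
    relation ([cliffordC_rel]). *)
Definition cinner (x y : cpx (gtan p)) : R[i] :=
  (2 * inner x.1 y.1 - 2 * inner x.2 y.2) +i* (2 * inner x.1 y.2 + 2 * inner x.2 y.1).

Lemma cphi_diagE (W : zmodType) (a b : endo W) (w : W * W) :
  cphi (@diag_endo W) (rot_endo W) a b w = (a w.1 - b w.2, a w.2 + b w.1).
Proof.
rewrite /cphi endoDE (endoME (rot_endo W)).
by congr (_, _).
Qed.

Lemma cphi_diag_sumE (W : zmodType) (a b a' b' : endo W) (w : W * W) :
  cphi (@diag_endo W) (rot_endo W) (a - b) (a' + b') w =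
  (a w.1 - b w.1 - (a' w.2 + b' w.2), a w.2 - b w.2 + (a' w.1 + b' w.1)).
Proof. exact: cphi_diagE. Qed.

Lemma pt_cclE (x : cpx (gtan p)) (w : cpx (forms_at p)) : pt_ccl x w = cliffordC x w.
Proof. exact: cphi_diagE. Qed.

Lemma pt_pairingE x y w : pairing pt_cl x y w = (2 * inner x y) *: w.
Proof. exact: clifford_rel. Qed.

Lemma pt_cpairingE (x y : cpx (gtan p)) (w : cpx (forms_at p)) : pairing pt_ccl x y w = cinner x y *: w.
Proof.
have := cpairingE pt_cl (@rot_diag (forms_at p)) (@rot_rot (forms_at p)) x y.
move=> /(congr1 (fun h : endo W2 => h w)) E; apply: etrans E _.
apply: etrans (cphi_diag_sumE _ _ _ _ _) _.
rewrite (pt_pairingE x.1 y.1 w.1) (pt_pairingE x.2 y.2 w.1) (pt_pairingE x.1 y.2 w.2) (pt_pairingE x.2 y.1 w.2).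
rewrite (pt_pairingE x.1 y.1 w.2) (pt_pairingE x.2 y.2 w.2) (pt_pairingE x.1 y.2 w.1) (pt_pairingE x.2 y.1 w.1).
by rewrite cpx_scaleE -!scalerBl -!scalerDl.
Qed.

Lemma cliffordC_rel (x y : cpx (gtan p)) (w : cpx (forms_at p)) :
  cliffordC x (cliffordC y w) + cliffordC y (cliffordC x w) = cinner x y *: w.
Proof.
rewrite -pt_cpairingE /pairing endoDE (endoME (pt_ccl x)) (endoME (pt_ccl y)).
by rewrite !pt_cclE.
Qed.

Lemma cliffordC_D (x : cpx (gtan p)) (w w' : cpx (forms_at p)) :
  cliffordC x (w + w') = cliffordC x w + cliffordC x w'.
Proof. exact: (endoD (pt_ccl x) w w'). Qed.

Lemma cliffordC_Zr (x : cpx (gtan p)) (k : R[i]) (w : cpx (forms_at p)) :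
  cliffordC x (k *: w) = k *: cliffordC x w.
Proof.
case: k => a b; rewrite !cpx_scaleE /cliffordC /cpx_bilin.
have Z (V : zmodType) (s t u v : V) : s - t - (u + v) = s - u - (t + v).
  by rewrite !opprD !addrA; congr (_ + _); rewrite addrAC.
congr (_, _); rewrite ?cliffordDr ?cliffordNr !cliffordZr.
  by rewrite Z -scalerBr -scalerDr.
by rewrite addrACA -scalerDr -scalerBr.
Qed.

Lemma cliffordC_Zl (x : cpx (gtan p)) (k : R[i]) (w : cpx (forms_at p)) :
  cliffordC (k *: x) w = k *: cliffordC x w.
Proof.
case: k => a b; rewrite !cpx_scaleE /cliffordC /cpx_bilin.
have Z (V : zmodType) (s t u v : V) : s - t - (u + v) = s - u - (v + t).
  by rewrite -!addrA -!opprD (addrC t) -(addrA u).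
have Z' (V : zmodType) (s t u v : V) : s - t + (u + v) = s + u + (v - t).
  by rewrite -!addrA; congr (_ + _); rewrite addrC -addrA.
congr (_, _); rewrite ?cliffordDl ?cliffordNl !cliffordZl.
  by rewrite Z -scalerBr -scalerDr.
by rewrite Z' -scalerDr -scalerBr.
Qed.

Lemma innerDl (x y z : gtan p) : inner (x + y) z = inner x z + inner y z.
Proof.
rewrite /inner [(x + y).2](_ : _ = x.2 + y.2) // [(x + y).1](_ : _ = x.1 + y.1) // dual_addE dualD.
ring.
Qed.

Lemma innerZl (a : R) (x z : gtan p) : inner (a *: x) z = a * inner x z.
Proof.
rewrite /inner [(a *: x).2](_ : _ = a *: x.2) // [(a *: x).1](_ : _ = a *: x.1) // dual_scaleE dualZ.
ring.
Qed.

Lemma innerNl (x z : gtan p) : inner (- x) z = - inner x z.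
Proof. by rewrite -scaleN1r innerZl mulN1r. Qed.

Lemma cinnerC (x y : cpx (gtan p)) : cinner x y = cinner y x.
Proof. by rewrite /cinner !(innerC y.1) !(innerC y.2); congr (_ +i* _); rewrite addrC. Qed.

Lemma cinner_linl (k : R[i]) (x x' y : cpx (gtan p)) : cinner (k *: x + x') y = k * cinner x y + cinner x' y.
Proof.
case: k => a b; apply/eqP; rewrite eq_complex; apply/andP; split; apply/eqP;
  rewrite /cinner /= ?innerDl ?innerNl ?innerZl; ring.
Qed.

Lemma cinner_linr (k : R[i]) (x y y' : cpx (gtan p)) : cinner x (k *: y + y') = k * cinner x y + cinner x y'.
Proof. by rewrite cinnerC cinner_linl !(cinnerC x). Qed.

Lemma cinner0l (y : cpx (gtan p)) : cinner 0 y = 0.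
Proof. by have := cinner_linl (-1) 0 0 y; rewrite scaler0 addr0 mulN1r addNr. Qed.

Lemma cinner_nondegenerate (c : chart R n M) (x : cpx (gtan p)) : atlas c -> chart_dom c p ->
  (forall y : cpx (gtan p), cinner x y = 0) -> x = 0.
Proof.
move=> hc cp x0; have H y : 2 * inner x.1 y = 0 /\ 2 * inner x.2 y = 0.
  have /eqP := x0 ((y, 0) : cpx (gtan p)); rewrite eq_complex /= => /andP[/eqP + /eqP].
  by rewrite !(innerC _ (0 : gtan p)) -(scale0r (0 : gtan p)) !innerZl !mul0r mulr0 subr0 add0r.
rewrite [x]surjective_pairing.
by rewrite (inner_nondegenerate hc cp (fun y => (H y).1)) (inner_nondegenerate hc cp (fun y => (H y).2)).
Qed.

Lemma cpx_frame (c : chart R n M) (x : cpx (gtan p)) : atlas c -> chart_dom c p ->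
  x = \sum_a cinner x ((chart_coframe c a p, 0) : cpx (gtan p)) *: ((chart_frame c a p, 0) : cpx (gtan p)).
Proof.
move=> hc cp.
have E a : cinner x ((chart_coframe c a p, 0) : cpx (gtan p)) *: ((chart_frame c a p, 0) : cpx (gtan p)) =
    ((2 * inner x.1 (chart_coframe c a p)) *: chart_frame c a p,
     (2 * inner x.2 (chart_coframe c a p)) *: chart_frame c a p).
  rewrite /cinner !(innerC _ (0 : gtan p)) -(scale0r (0 : gtan p)) !innerZl !mul0r !mulr0 subr0 add0r.
  by congr (_, _); rewrite /= scale0r scaler0 ?subr0 ?add0r.
rewrite (eq_bigr _ (fun a _ => E a)).
have S (F G : frame_index n -> gtan p) : \sum_a ((F a, G a) : cpx (gtan p)) = (\sum_a F a, \sum_a G a).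
  by elim/big_rec3: _ => // a s t u _ ->.
by rewrite S -(gtan_decomp hc x.1 cp) -(gtan_decomp hc x.2 cp) -surjective_pairing.
Qed.

Lemma pt_pairing_comm (x y z : gtan p * gtan p) :
  pairing pt_ccl x y * pt_ccl z = pt_ccl z * pairing pt_ccl x y.
Proof.
apply: endo_eq => w; rewrite (endoME (pairing pt_ccl x y)) (endoME (pt_ccl z)).
rewrite (pt_cpairingE x y (pt_ccl z w)) (pt_cclE z w) (pt_cclE z (pairing pt_ccl x y w)).
by rewrite (pt_cpairingE x y w) cliffordC_Zr.
Qed.

End PointOperators.

Section ComplexSections.
Variables (R : realType) (n : nat) (M : smooth_manifold R n).
Implicit Types (U V : set M) (x y : cgfield M) (w : cform M).

Lemma smooth_cgfield_D U x y : open U -> smooth_cgfield U x -> smooth_cgfield U y ->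
  smooth_cgfield U (fun p => x p + y p).
Proof. by move=> oU [x1 x2] [y1 y2]; split; exact: smooth_gfield_D. Qed.

Lemma smooth_cgfield_Z U (k : R[i]) x : open U -> smooth_cgfield U x -> smooth_cgfield U (fun p => k *: x p).
Proof.
move=> oU [x1 x2]; split; first by apply: smooth_gfield_B => //; exact: smooth_gfield_Z.
by apply: smooth_gfield_D => //; exact: smooth_gfield_Z.
Qed.

Lemma smooth_cgfield_0 U : open U -> smooth_cgfield U (fun=> 0).
Proof. by move=> oU; split; exact: smooth_gfield_0. Qed.

Lemma smooth_cgfield_ext U x y : open U -> (forall p, U p -> x p = y p) -> smooth_cgfield U x -> smooth_cgfield U y.
Proof.
move=> oU xy [x1 x2]; split; first by apply: (smooth_gfield_ext oU _ x1) => p Up; rewrite xy.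
by apply: (smooth_gfield_ext oU _ x2) => p Up; rewrite xy.
Qed.

Lemma smooth_cgfield_sum U (J : Type) (r : seq J) (F : J -> cgfield M) : open U ->
  (forall j, smooth_cgfield U (F j)) -> smooth_cgfield U (fun p => \sum_(j <- r) F j p).
Proof.
move=> oU sF; elim: r => [|j r IH].
  by apply: (smooth_cgfield_ext oU _ (smooth_cgfield_0 oU)) => p _; rewrite big_nil.
by apply: (smooth_cgfield_ext oU _ (smooth_cgfield_D oU (sF j) IH)) => p _; rewrite big_cons.
Qed.

Lemma smooth_cgfield_sub U V x : V `<=` U -> smooth_cgfield U x -> smooth_cgfield V x.
Proof. by move=> VU [x1 x2]; split; exact: smooth_gfield_sub VU _. Qed.

Lemma smooth_cform_D U w w' : open U -> smooth_cform U w -> smooth_cform U w' -> smooth_cform U (fun p => w p + w' p).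
Proof. by move=> oU [x1 x2] [y1 y2]; split; exact: smooth_form_D. Qed.

Lemma smooth_form_B U (v v' : form M) : open U -> smooth_form U v -> smooth_form U v' -> smooth_form U (fun p => v p - v' p).
Proof.
move=> oU sv sv'; apply: smooth_form_D => //.
by apply: smooth_form_ext (smooth_form_Z (-1) oU sv') => p _; rewrite scaleN1r.
Qed.

Lemma smooth_cform_Z U (k : R[i]) w : open U -> smooth_cform U w -> smooth_cform U (fun p => k *: w p).
Proof.
move=> oU [x1 x2]; split; first by apply: smooth_form_B => //; exact: smooth_form_Z.
by apply: smooth_form_D => //; exact: smooth_form_Z.
Qed.

Lemma smooth_cform_0 U : smooth_cform U (fun=> 0).
Proof. by split; exact: smooth_form_0. Qed.

Lemma smooth_cform_ext U w w' : (forall p, U p -> w p = w' p) -> smooth_cform U w -> smooth_cform U w'.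
Proof.
by move=> ww [w1 w2]; split; [apply: smooth_form_ext w1|apply: smooth_form_ext w2] => p Up; rewrite ww.
Qed.

Lemma smooth_cform_sub U V w : V `<=` U -> smooth_cform U w -> smooth_cform V w.
Proof. by move=> VU [x1 x2]; split; exact: smooth_form_sub VU _. Qed.

Lemma smooth_cform_local U w : (forall p, U p -> exists V, [/\ open V, V p & smooth_cform V w]) -> smooth_cform U w.
Proof.
by move=> H; split; apply: smooth_form_local => p /H [V [oV Vp [w1 w2]]]; exists V.
Qed.

Lemma smooth_cliffordC U x w : open U -> smooth_cgfield U x -> smooth_cform U w -> smooth_cform U (fun p => cliffordC (x p) (w p)).
Proof.
move=> oU [x1 x2] [w1 w2]; split; first by apply: smooth_form_B => //; exact: smooth_clifford.
by apply: smooth_form_D => //; exact: smooth_clifford.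
Qed.

Lemma smooth_cform_sum U (J : Type) (r : seq J) (F : J -> cform M) : open U ->
  (forall j, smooth_cform U (F j)) -> smooth_cform U (fun p => \sum_(j <- r) F j p).
Proof.
move=> oU sF; elim: r => [|j r IH].
  by apply: smooth_cform_ext (smooth_cform_0 U) => p _; rewrite big_nil.
by apply: smooth_cform_ext (smooth_cform_D oU (sF j) IH) => p _; rewrite big_cons.
Qed.

End ComplexSections.

Lemma double_complex_neq0 (R : realType) (l : R[i]) : l != 0 -> l + l != 0.
Proof. by move=> l0; rewrite -mulr2n mulrn_eq0. Qed.

(** * Spectral projections of a generalized polynomial structure *)

Section PolynomialStructure.
Variables (R : realType) (n : nat) (M : smooth_manifold R n) (phi : gendo M) (P : {poly R}).
Hypothesis hphi : gen_poly_structure phi P.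
Implicit Types (p : M) (l m : R[i]).

Definition cpoly : {poly R[i]} := map_poly (real_complex R) P.

Lemma cpoly_monic : cpoly \is monic.
Proof. by case: hphi => _ _ mP _ _; exact: monic_map. Qed.

Definition phiC p : cpx (gtan p) -> cpx (gtan p) := cpx_lin (phi p).

Lemma phiC_linear p : linear (@phiC p).
Proof.
move=> k x y; rewrite /phiC /cpx_lin !cpx_scaleE.
by congr (_, _); rewrite !linearD ?linearN !linearZ.
Qed.

Lemma phiC_cpoly p x : pev (@phiC p) cpoly x = 0.
Proof.
have [_ _ _ _ mp] := hphi; have [_ Pf _] := mp p.
have E i : cpoly`_i *: iter i (@phiC p) x = (P`_i *: iter i (phi p) x.1, P`_i *: iter i (phi p) x.2).
  have -> : iter i (@phiC p) x = (iter i (phi p) x.1, iter i (phi p) x.2).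
    by elim: i => [|i IH]; rewrite -?surjective_pairing // !iterS IH.
  rewrite coef_map cpx_scaleE /=.
  by rewrite !scale0r subr0 addr0.
rewrite /pev size_map_poly.
transitivity (\sum_(i < size P) ((P`_i *: iter i (phi p) x.1, P`_i *: iter i (phi p) x.2) : cpx (gtan p))).
  by apply: eq_bigr => i _; exact: E.
have S (N : nat) (F G : 'I_N -> gtan p) : \sum_a ((F a, G a) : cpx (gtan p)) = (\sum_a F a, \sum_a G a).
  by elim/big_rec3: _ => // a s t u _ ->.
by rewrite S; have := Pf x.1; have := Pf x.2; rewrite /poly_end => -> ->.
Qed.

Lemma phiC_skew p (x y : cpx (gtan p)) : cinner (phiC x) y = - cinner x (phiC y).
Proof.
have [_ sk _ _ _] := hphi.
by apply/eqP; rewrite eq_complex; apply/andP; split; apply/eqP; rewrite /= !sk; ring.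
Qed.

Definition gpi : R[i] -> {poly R[i]} := sval (cid (projection_polynomials cpoly_monic)).

(** One polynomial serves at all points, since P annihilates phi at each of them; the projection
    thus preserves smoothness ([smooth_gproj]). *)
Definition gproj p l (x : cpx (gtan p)) : cpx (gtan p) := pev (@phiC p) (gpi l) x.

Lemma gpiP : [/\ forall l, l \notin poly_roots cpoly -> gpi l = 0,
      forall l, cpoly %| ('X - l%:P) ^+ mup l cpoly * gpi l,
      forall l, l \in poly_roots cpoly -> ('X - l%:P) ^+ mup l cpoly %| gpi l - 1,
      forall l m, l != m -> cpoly %| gpi l * gpi m
    & cpoly %| \sum_(l <- poly_roots cpoly) gpi l - 1].
Proof. exact: (svalP (cid (projection_polynomials cpoly_monic))). Qed.

Lemma gproj_linear p l : linear (@gproj p l).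
Proof. exact: (pev_linear (@phiC_linear p)). Qed.

Lemma gprojD p l (x y : cpx (gtan p)) : gproj l (x + y) = gproj l x + gproj l y.
Proof. by have := gproj_linear l 1 x y; rewrite !scale1r. Qed.

Lemma gprojZ p l (k : R[i]) (x : cpx (gtan p)) : gproj l (k *: x) = k *: gproj l x.
Proof. by have := gproj_linear l k x 0; rewrite !addr0 /gproj (pev_at0 (@phiC_linear p)) addr0. Qed.

Lemma gproj0 p l : gproj l (0 : cpx (gtan p)) = 0.
Proof. exact: (pev_at0 (@phiC_linear p)). Qed.

Lemma gproj_idem p l (x : cpx (gtan p)) : gproj l (gproj l x) = gproj l x.
Proof. by case: gpiP => a b c _ _; exact: (proj_idem (@phiC_linear p) (@phiC_cpoly p)). Qed.

Lemma gproj_ortho p l m (x : cpx (gtan p)) : l != m -> gproj l (gproj m x) = 0.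
Proof. by case: gpiP => _ _ _ o _; exact: (proj_ortho (@phiC_linear p) (@phiC_cpoly p) o). Qed.

Lemma gprojP p l (x : cpx (gtan p)) : geigen phi P l p x <-> gproj l x = x.
Proof. by case: gpiP => a b c _ _; exact: (projP (@phiC_linear p) cpoly_monic (@phiC_cpoly p) a b c l x). Qed.

Lemma gproj_adj p l (x y : cpx (gtan p)) : cinner (gproj l x) y = cinner x (gproj (- l) y).
Proof.
case: gpiP => a b c _ t.
exact: (B_proj_adj (@phiC_linear p) cpoly_monic (@phiC_cpoly p) a b c t (@cinner_linl _ _ _ p) (@cinner_linr _ _ _ p) (@phiC_skew p)).
Qed.

Lemma gproj_eigen p l (x : cpx (gtan p)) : cpx_lin (phi p) x = l *: x -> gproj l x = x.
Proof. by case: gpiP => _ _ c _ _; exact: (eigen_proj (@phiC_linear p) cpoly_monic (@phiC_cpoly p) c). Qed.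

Lemma gproj_spectrum p l (x : cpx (gtan p)) : gproj l x <> 0 -> spectrum phi l.
Proof.
case: gpiP => a b c _ _ /(proj_neq0_eigen (@phiC_linear p) cpoly_monic (@phiC_cpoly p) a b c) [y y0 yl].
by exists p; exists y.
Qed.

(** A finite duplicate-free list of the elements of [spectrum phi]. Filtering makes the two agree
    even on an empty manifold, where no root is an eigenvalue. *)
Definition eigenvalues : seq R[i] := [seq l <- poly_roots cpoly | `[< spectrum phi l >]].

Lemma eigenvalues_uniq : uniq eigenvalues.
Proof. by rewrite filter_uniq // poly_roots_uniq. Qed.

Lemma mem_eigenvalues l : l \in eigenvalues <-> spectrum phi l.
Proof.
rewrite mem_filter; split=> [/andP[/asboolP]//|sl]; rewrite asboolT //=.
case: sl => p [x x0 xl]; have := gproj_eigen xl.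
have [//|lr] := boolP (l \in poly_roots cpoly).
by case: gpiP => a _ _ _ _; rewrite /gproj a // pev0 => E; case: x0.
Qed.

Lemma gproj_notin p l (x : cpx (gtan p)) : l \notin eigenvalues -> gproj l x = 0.
Proof.
by move=> nl; apply: contrapT => /gproj_spectrum /mem_eigenvalues; rewrite (negbTE nl).
Qed.

Lemma gproj_total p (x : cpx (gtan p)) : \sum_(l <- eigenvalues) gproj l x = x.
Proof.
case: gpiP => _ _ _ _ t; rewrite -[RHS](proj_total (@phiC_linear p) (@phiC_cpoly p) t x).
rewrite big_filter big_mkcond; apply: eq_bigr => l _ /=; case: ifP => // /asboolP nl.
by symmetry; apply: contrapT => /gproj_spectrum.
Qed.

(** The adjoint of the projection to m is the projection to -m. If the latter were zero, an
    eigenvector for m would be orthogonal to everything, against nondegeneracy. *)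
Lemma eigenvalues_opp l : (- l \in eigenvalues) = (l \in eigenvalues).
Proof.
have H m : m \in eigenvalues -> - m \in eigenvalues.
  move=> /mem_eigenvalues [p [x x0 xm]]; apply/mem_eigenvalues.
  have xE := gproj_eigen xm.
  have [c hc cp] := atlas_cover p.
  apply: contrapT => nm; apply: x0; apply: (cinner_nondegenerate hc cp) => y.
  have gy : gproj (- m) y = 0 by apply: contrapT => /gproj_spectrum.
  by rewrite -xE gproj_adj gy cinnerC cinner0l.
by apply/idP/idP => /H //; rewrite opprK.
Qed.

Lemma smooth_phiC (U : set M) (x : cgfield M) : open U -> smooth_cgfield U x ->
  smooth_cgfield U (fun p => phiC (x p)).
Proof. by have [sp _ _ _ _] := hphi; move=> oU [x1 x2]; split; exact: sp. Qed.

Lemma smooth_gproj (U : set M) l (x : cgfield M) : open U -> smooth_cgfield U x ->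
  smooth_cgfield U (fun p => gproj l (x p)).
Proof.
move=> oU sx; apply: smooth_cgfield_sum => // i; apply: smooth_cgfield_Z => //.
elim: (i : nat) => [|j IH]; first exact: sx.
exact: (smooth_phiC oU IH).
Qed.

End PolynomialStructure.

(** * The abstract algebra realised on complex local sections *)

Section LocalAlgebra.
Variables (R : realType) (n : nat) (M : smooth_manifold R n) (phi : gendo M) (P : {poly R}).
Hypothesis hphi : gen_poly_structure phi P.
Variable c : chart R n M.
Hypothesis hc : atlas c.
Variable V : set M.
Hypotheses (oV : open V) (Vc : V `<=` chart_dom c).
Implicit Types (p : M) (l m : R[i]).

Definition loc_gfields : zmodType := (local_gfields oV * local_gfields oV)%type.
Definition loc_forms : zmodType := (local_forms oV * local_forms oV)%type.
Implicit Types (x y : loc_gfields) (w : loc_forms).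

Definition gval x : cgfield M := fun p => (x.1 p, x.2 p).
Definition fval w : cform M := fun p => (w.1 p, w.2 p).

Lemma smooth_gval x : smooth_cgfield V (gval x).
Proof. by split; exact: local_gfield_smooth. Qed.

Lemma smooth_fval w : smooth_cform V (fval w).
Proof. by split; exact: local_form_smooth. Qed.

Lemma gval_eq x y : (forall p, V p -> gval x p = gval y p) -> x = y.
Proof.
move=> xy; rewrite [x]surjective_pairing [y]surjective_pairing.
by congr (_, _); apply: local_gfield_eq => p /xy [].
Qed.

Lemma fval_eq w w' : (forall p, V p -> fval w p = fval w' p) -> w = w'.
Proof.
move=> ww; rewrite [w]surjective_pairing [w']surjective_pairing.
by congr (_, _); apply: local_form_eq => p /ww [].
Qed.

Definition cut_cgfield (x : cgfield M) (sx : smooth_cgfield V x) : loc_gfields :=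
  (cut_gfield oV (proj1 sx), cut_gfield oV (proj2 sx)).
Definition cut_cform (w : cform M) (sw : smooth_cform V w) : loc_forms :=
  (cut_form oV (proj1 sw), cut_form oV (proj2 sw)).

Lemma cut_cgfieldE (x : cgfield M) (sx : smooth_cgfield V x) p : V p -> gval (cut_cgfield sx) p = x p.
Proof. by move=> Vp; rewrite [x p]surjective_pairing; congr (_, _); exact: cut_in. Qed.

Lemma cut_cformE (w : cform M) (sw : smooth_cform V w) p : V p -> fval (cut_cform sw) p = w p.
Proof. by move=> Vp; rewrite [w p]surjective_pairing; congr (_, _); exact: cut_in. Qed.

Lemma gvalD x y p : gval (x + y) p = gval x p + gval y p. Proof. by []. Qed.
Lemma gvalN x p : gval (- x) p = - gval x p. Proof. by []. Qed.
Lemma gvalB x y p : gval (x - y) p = gval x p - gval y p. Proof. by []. Qed.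
Lemma gval0 p : gval 0 p = 0. Proof. by []. Qed.
Lemma fvalD w w' p : fval (w + w') p = fval w p + fval w' p. Proof. by []. Qed.
Lemma fvalN w p : fval (- w) p = - fval w p. Proof. by []. Qed.
Lemma fvalB w w' p : fval (w - w') p = fval w p - fval w' p. Proof. by []. Qed.
Lemma fval0 p : fval 0 p = 0. Proof. by []. Qed.
Lemma fval_sum (J : Type) (r : seq J) (Q : pred J) (F : J -> loc_forms) p :
  fval (\sum_(j <- r | Q j) F j) p = \sum_(j <- r | Q j) fval (F j) p.
Proof. by elim/big_rec2: _ => // j t s _ <-. Qed.
Lemma gval_sum (J : Type) (r : seq J) (F : J -> loc_gfields) p :
  gval (\sum_(j <- r) F j) p = \sum_(j <- r) gval (F j) p.
Proof. by elim/big_rec2: _ => // j t s _ <-. Qed.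

Lemma fvalMn w (k : nat) p : fval (w *+ k) p = k%:R *: fval w p.
Proof.
elim: k => [|k IH]; first by rewrite mulr0n scale0r.
by rewrite mulrS fvalD IH -{1}[fval w p]scale1r -scalerDl -[1]/(1%:R) -natrD.
Qed.

Lemma fvalMz w (k : int) p : fval (w *~ k) p = k%:~R *: fval w p.
Proof.
case: k => k; first by rewrite -!pmulrn fvalMn.
by rewrite NegzE mulrNz -pmulrn fvalN fvalMn rmorphN scaleNr.
Qed.

Lemma loc_forms_torsion_free w (k : int) : k != 0 -> w *~ k = 0 -> w = 0.
Proof.
move=> k0 wk; apply: fval_eq => p _; have := fvalMz w k p.
rewrite wk fval0 => /esym /eqP; rewrite scaler_eq0 intr_eq0 (negbTE k0) /= => /eqP ->.
by [].
Qed.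

Local Notation A := (endo loc_forms).

Definition lcl : loc_gfields -> A :=
  ccl (@diag_endo (local_forms oV)) (rot_endo (local_forms oV)) (@op_cl _ _ _ _ oV).
HB.instance Definition _ := GRing.Additive.copy lcl
  (ccl (@diag_endo (local_forms oV)) (rot_endo (local_forms oV)) (@op_cl _ _ _ _ oV)).
Definition ld : A := diag_endo (op_d hc oV Vc).
Definition lbr (x y : loc_gfields) : loc_gfields := cbr (op_br hc Vc) x y.

Lemma lclE x w p : fval (lcl x w) p = cliffordC (gval x p) (fval w p).
Proof. exact: (congr1 (fun v : loc_forms => fval v p) (cphi_diagE (op_cl x.1) (op_cl x.2) w)). Qed.

Lemma ldE w p : V p -> fval (ld w) p = exterior_dC (fval w) p.
Proof. by move=> Vp; congr (_, _); exact: op_dE. Qed.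

Lemma lbrE x y p : V p -> gval (lbr x y) p = dorfmanC (gval x) (gval y) p.
Proof.
move=> Vp; rewrite /gval /lbr /cbr.
have E1 := op_brE hc Vc x.1 y.1 Vp; have E2 := op_brE hc Vc x.2 y.2 Vp.
have E3 := op_brE hc Vc x.1 y.2 Vp; have E4 := op_brE hc Vc x.2 y.1 Vp.
by congr (_, _); rewrite ?sectBE ?sectDE ?E1 ?E2 ?E3 ?E4.
Qed.

Lemma lderived_bracket x y : comm (lie lcl ld x) (lcl y) = lcl (lbr x y).
Proof.
exact: (ccl_derived_bracket (@rot_diag (local_forms oV)) (@rot_rot (local_forms oV)) (op_derived_bracket hc Vc)).
Qed.

Lemma lpairing_comm x y z : pairing lcl x y * lcl z = lcl z * pairing lcl x y.
Proof.
exact: (cpairing_comm (@rot_diag (local_forms oV)) (@rot_rot (local_forms oV)) (op_pairing_comm (oV := oV))).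
Qed.

Lemma lpairingE x y w p : fval (pairing lcl x y w) p = cinner (gval x p) (gval y p) *: fval w p.
Proof.
rewrite /pairing endoDE (endoME (lcl x)) (endoME (lcl y)) fvalD !lclE.
exact: cliffordC_rel.
Qed.

Definition lframe (a : frame_index n) : loc_gfields := (op_frame hc oV Vc a, 0).
Definition lcoframe (a : frame_index n) : loc_gfields := (op_coframe hc oV Vc a, 0).

Lemma lmetric_frame : metric_frame lcl lframe lcoframe.
Proof.
have [fe ff] := op_metric_frame hc oV Vc.
split=> x; first exact: (cmetric_frame (@rot_diag (local_forms oV)) (@rot_rot (local_forms oV)) fe).
exact: (cmetric_frame (@rot_diag (local_forms oV)) (@rot_rot (local_forms oV)) ff).
Qed.

Lemma lcl_inj : injective lcl.
Proof. exact: (ccl_inj (@diag_rot_inj (local_forms oV)) (op_cl_inj hc Vc)). Qed.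

Lemma ld_eL : \sum_a lcl (lframe a) * lie lcl ld (lcoframe a) = ld.
Proof. exact: (ccl_sum_lie (@rot_diag (local_forms oV)) (@rot_rot (local_forms oV)) (op_d_eL hc oV Vc)). Qed.

Lemma ld_Lf : \sum_a lie lcl ld (lframe a) * lcl (lcoframe a) = ld.
Proof. exact: (lie_sum_ccl (@rot_diag (local_forms oV)) (@rot_rot (local_forms oV)) (op_d_Lf hc oV Vc)). Qed.

Definition lpr l x : loc_gfields := cut_cgfield (smooth_gproj hphi l oV (smooth_gval x)).

Lemma lprE l x p : V p -> gval (lpr l x) p = gproj hphi l (gval x p).
Proof. exact: cut_cgfieldE. Qed.

Lemma lpr_additive l : zmod_morphism (lpr l).
Proof.
move=> x y; apply: gval_eq => p Vp; rewrite gvalB (lprE l (x - y) Vp) (lprE l x Vp) (lprE l y Vp) gvalB gprojD; congr (_ + _).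
by rewrite -scaleN1r gprojZ scaleN1r.
Qed.

Lemma lpr_idem l x : lpr l (lpr l x) = lpr l x.
Proof. by apply: gval_eq => p Vp; rewrite (lprE l (lpr l x) Vp) (lprE l x Vp) gproj_idem. Qed.

Lemma lpr_ortho l m x : l != m -> lpr l (lpr m x) = 0.
Proof. by move=> lm; apply: gval_eq => p Vp; rewrite (lprE l (lpr m x) Vp) (lprE m x Vp) gproj_ortho. Qed.

Lemma lpr_adj l x y : pairing lcl (lpr l x) y = pairing lcl x (lpr (- l) y).
Proof.
apply: endo_eq => w; apply: fval_eq => p Vp.
by rewrite (lpairingE (lpr l x) y w) (lpairingE x (lpr (- l) y) w) (lprE l x Vp) (lprE (- l) y Vp) gproj_adj.
Qed.

Lemma lpr_total x : \sum_(l <- eigenvalues phi P) lpr l x = x.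
Proof.
apply: gval_eq => p Vp; rewrite gval_sum -[RHS](gproj_total hphi); apply: eq_bigr => l _.
exact: lprE.
Qed.

Lemma lpr_notin l x : l \notin eigenvalues phi P -> lpr l x = 0.
Proof. by move=> nl; apply: gval_eq => p Vp; rewrite (lprE l x Vp) gproj_notin. Qed.

Lemma lpr_section l x : lpr l x = x <-> is_section (geigen phi P l) V (gval x).
Proof.
split=> [xl|[_ xl]]; first by split=> [|p Vp]; [exact: smooth_gval|apply/(gprojP hphi); rewrite -lprE // xl].
by apply: gval_eq => p Vp; rewrite lprE //; apply/gprojP; exact: xl.
Qed.

Definition lu l a := lpr (- l) (lframe a).
Definition lv l a := lpr l (lcoframe a).
Definition lnum l : A := number lcl lu lv l.

End LocalAlgebra.

(** Lexicographic positivity, chosen only because it selects exactly one number from each pair of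
    nonzero opposite ones. *)
Definition positive_complex (R : realType) (z : R[i]) : bool :=
  (0 < complex.Re z) || ((complex.Re z == 0) && (0 < complex.Im z)).

Lemma positive_complexN (R : realType) (z : R[i]) : z != 0 ->
  positive_complex (- z) = ~~ positive_complex z.
Proof.
case: z => a b; rewrite eq_complex /positive_complex /= !oppr_gt0 oppr_eq0 => ab.
by move: ab; case: (ltgtP a 0) => //= _; case: (ltgtP b 0).
Qed.

Section LocalDecomposition.
Variables (R : realType) (n : nat) (M : smooth_manifold R n) (phi : gendo M) (P : {poly R}).
Hypothesis hphi : gen_poly_structure phi P.
Variable c : chart R n M.
Hypothesis hc : atlas c.
Variable V : set M.
Hypotheses (oV : open V) (Vc : V `<=` chart_dom c).
Implicit Types (p : M) (l m : R[i]) (x y : loc_gfields oV).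
Local Notation cl := (@lcl _ _ _ _ oV).
Local Notation d := (ld hc oV Vc).
Local Notation br := (@lbr _ _ _ _ hc _ oV Vc).
Local Notation pr := (@lpr _ _ _ _ _ hphi _ oV).
Local Notation u := (lu hphi hc oV Vc).
Local Notation v := (lv hphi hc oV Vc).
Local Notation num := (lnum hphi hc oV Vc).

Let pc := @lpairing_comm _ _ _ _ oV.
Let pi2 := @lpr_idem _ _ _ _ _ hphi _ oV.
Let po := @lpr_ortho _ _ _ _ _ hphi _ oV.
Let pa := @lpr_adj _ _ _ _ _ hphi _ oV.
Let fr := lmetric_frame hc oV Vc.
Let brE := @lderived_bracket _ _ _ _ hc _ oV Vc.
Let padd := @lpr_additive _ _ _ _ _ hphi _ oV.

Lemma lnumE l x : comm (num l) (cl x) = cl (pr (- l) x - pr l x).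
Proof. exact: (number_metric pc pi2 pa fr). Qed.

Lemma lbr_anti l m x y : pr l x = x -> pr m y = y -> l + m != 0 -> br x y = - br y x.
Proof. exact: (br_anticomm po pa brE (lcl_inj hc Vc)). Qed.

Lemma lpr_other l m x : pr l x = x -> l != m -> pr m x = 0.
Proof. exact: (pr_other_label po). Qed.

Lemma lcl_anti l m x y : pr l x = x -> pr m y = y -> l + m != 0 -> cl x * cl y = - (cl y * cl x).
Proof. exact: (cl_anticomm po pa). Qed.

Lemma lv_anti l a b : l != 0 -> cl (v l a) * cl (v l b) = - (cl (v l b) * cl (v l a)).
Proof. by move=> l0; apply: (lcl_anti (pi2 _ _) (pi2 _ _)); exact: double_complex_neq0. Qed.

Lemma lnum_v l a : l != 0 -> num l * cl (v l a) = cl (v l a) * (num l - 1).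
Proof.
move=> l0; have := lnumE l (v l a).
have nl : l != - l by rewrite -addr_eq0 double_complex_neq0.
rewrite (lpr_other (pi2 l _) nl) /lv (pi2 l) -/(lv _ _ _ _ _ _) sub0r raddfN /comm => /eqP.
by rewrite subr_eq => /eqP ->; rewrite mulrBr mulr1 addrC.
Qed.

Lemma loc_endo_torsion_free (f : endo (loc_forms oV)) (k : int) : k != 0 -> f *~ k = 0 -> f = 0.
Proof. by apply: endo_torsion_free => w j; exact: loc_forms_torsion_free. Qed.

Lemma lnum_falling l : l != 0 -> falling (num l) #|frame_index n|.+1 0 = 0.
Proof.
move=> l0; apply: (falling_eq0 (u := fun a => cl (u l a)) (v := fun a => cl (v l a))) => //.
- by move=> a; exact: lnum_v.
- by move=> a b; exact: lv_anti.
exact: loc_endo_torsion_free.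
Qed.

Hypothesis integrable : forall mu nu : R[i], spectrum phi mu -> spectrum phi nu ->
    forall (U : set M) (x y : cgfield M), open U ->
      is_section (geigen phi P mu) U x -> is_section (geigen phi P nu) U y ->
    forall p : M, U p -> exists a b : cpx (gtan p),
      [/\ geigen phi P mu p a, geigen phi P nu p b
        & (mu + nu) *: dorfmanC x y p = a + b].

Lemma lbr0l y : br 0 y = 0.
Proof.
apply: (lcl_inj hc Vc); rewrite -(brE 0 y) /lie raddf0 mulr0 mul0r addr0.
by rewrite /comm mul0r mulr0 subrr raddf0.
Qed.

Lemma lbr0r x : br x 0 = 0.
Proof.
by apply: (lcl_inj hc Vc); rewrite -(brE x 0) /comm raddf0 mul0r mulr0 subrr.
Qed.

Lemma lpr0 l : pr l 0 = 0.
Proof. by have := padd l 0 0; rewrite !subrr. Qed.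

Lemma lintegrable l m x y : pr l x = x -> pr m y = y -> l + m != 0 ->
  br x y = pr l (br x y) + (if l == m then 0 else pr m (br x y)).
Proof.
move=> lx my lm.
(* The abstract algebra takes arbitrary labels, whereas [integrable] speaks of eigenvalues; for any
   other label the section is zero. *)
have [lE|lE] := boolP (l \in eigenvalues phi P); last first.
  by rewrite -lx (lpr_notin hphi x lE) lbr0l !lpr0 if_same addr0.
have [mE|mE] := boolP (m \in eigenvalues phi P); last first.
  by rewrite -my (lpr_notin hphi y mE) lbr0r !lpr0 if_same addr0.
have /(mem_eigenvalues hphi) ls := lE; have /(mem_eigenvalues hphi) ms := mE.
have /(lpr_section hphi l x) sx := lx; have /(lpr_section hphi m y) sy := my.
apply: gval_eq => p Vp; have [a [b [/(gprojP hphi) la /(gprojP hphi) mb E]]] := integrable ls ms oV sx sy Vp.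
rewrite gvalD (lprE hphi l (br x y) Vp).
have zE : gval (br x y) p = (l + m)^-1 *: a + (l + m)^-1 *: b.
  by rewrite (lbrE hc Vc x y Vp) -scalerDr -E scalerA mulVf // scale1r.
have la' : gproj hphi l ((l + m)^-1 *: a) = (l + m)^-1 *: a by rewrite gprojZ la.
have mb' : gproj hphi m ((l + m)^-1 *: b) = (l + m)^-1 *: b by rewrite gprojZ mb.
move: (_ *: a) (_ *: b) zE la' mb' => a' b' zE la' mb'.
case: (eqVneq l m) => [lmE|nlm].
  rewrite -lmE in mb'; have -> : gval (0 : loc_gfields oV) p = 0 by [].
  by rewrite addr0 zE gprojD la' mb'.
have nml : m != l by rewrite eq_sym.
have lb : gproj hphi l b' = 0 by rewrite -mb' gproj_ortho.
have ma : gproj hphi m a' = 0 by rewrite -la' gproj_ortho.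
by rewrite (lprE hphi m (br x y) Vp) zE !gprojD la' mb' lb ma addr0 add0r.
Qed.

Lemma ltwice_delta_self l : l != 0 ->
  comm (num l) (twice_delta cl d u v l) = twice_delta cl d u v l.
Proof.
apply: (twice_delta_self brE _ _ lnumE lpr_other _ padd pi2 lintegrable _ (@double_complex_neq0 R)).
- by move=> k a; exact: pi2.
- by move=> k a; exact: pi2.
- exact: (canonical_metric pc pi2 pa brE fr).
by move=> k _; exact: (canonical_exact_metric pc pi2 pa brE fr).
Qed.

Lemma ltwice_delta_other l m : l != 0 -> m != 0 -> m != l -> m != - l ->
  comm (num m) (twice_delta cl d u v l) = 0.
Proof.
apply: (twice_delta_other brE _ _ lnumE lpr_other lcl_anti lbr_anti _ padd lintegrable (@double_complex_neq0 R)).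
- by move=> k a; exact: pi2.
- by move=> k a; exact: pi2.
exact: (canonical_metric pc pi2 pa brE fr).
Qed.

Lemma ltwice_delta0_comm m : m \in eigenvalues phi P -> m != 0 ->
  comm (num m) (twice_delta0 cl d u v (eigenvalues phi P)) = 0.
Proof.
apply: (twice_delta0_comm brE _ _ lnumE lpr_other lcl_anti lbr_anti _ padd pi2 lintegrable _
  (eigenvalues_uniq _ _) (eigenvalues_opp hphi) _ (@double_complex_neq0 R)).
- by move=> k a; exact: pi2.
- by move=> k a; exact: pi2.
- exact: (canonical_metric pc pi2 pa brE fr).
- by move=> k _; exact: (canonical_exact_metric pc pi2 pa brE fr).
exact: (number_central_metric pc pi2 pa brE fr).
Qed.

Lemma ltwice_delta0_eq0 : 0 \notin eigenvalues phi P ->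
  twice_delta0 cl d u v (eigenvalues phi P) = 0.
Proof.
apply: (@twice_delta0_eq0 _ _ _ _ cl d br pr u v brE _ _ lnumE lpr_other lcl_anti lbr_anti _ padd pi2 lintegrable _
  (lframe hc oV Vc) (lcoframe hc oV Vc) _ (@positive_complex R)) => //.
- by move=> k a; exact: pi2.
- by move=> k a; exact: pi2.
- exact: (canonical_metric pc pi2 pa brE fr).
- by move=> k _; exact: (canonical_exact_metric pc pi2 pa brE fr).
- exact: ld_eL.
- exact: ld_Lf.
- exact: (number_e_metric pc pi2 pa fr).
- exact: (cubic_f_metric pc pi2 pa brE fr).
- exact: (cubic_e_metric pc pi2 pa brE fr).
- exact: eigenvalues_uniq.
- exact: eigenvalues_opp.
- exact: lpr_total.
- exact: (number_central_metric pc pi2 pa brE fr).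
- exact: double_complex_neq0.
- exact: loc_endo_torsion_free.
exact: positive_complexN.
Qed.

End LocalDecomposition.

(** * Local operators and degrees *)

Section LocalOperators.
Variables (R : realType) (n : nat) (M : smooth_manifold R n).
Implicit Types (p q : M) (U V : set M).

Lemma nabla_form_ext (c : chart R n M) (hc : atlas c) i U (w w' : form M) p : open U -> U p -> chart_dom c p ->
  smooth_form U w -> smooth_form U w' -> (forall q, U q -> w q = w' q) ->
  nabla_form c i w p = nabla_form c i w' p.
Proof.
move=> oU Up cp sw sw' ww; apply: extform_eq => s.
rewrite (nabla_formE hc i s oU Up cp sw) (nabla_formE hc i s oU Up cp sw').
by apply: chart_partial_near => //; apply: (open_near_eq oU Up) => q Uq; rewrite ww.
Qed.

Lemma exterior_d_ext U (w w' : form M) p : open U -> U p ->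
  smooth_form U w -> smooth_form U w' -> (forall q, U q -> w q = w' q) ->
  exterior_d w p = exterior_d w' p.
Proof.
move=> oU Up sw sw' ww; have [c hc cp] := atlas_cover p.
rewrite (exterior_d_local hc oU Up cp sw) (exterior_d_local hc oU Up cp sw') !local_dE.
by apply: eq_bigr => i _; rewrite (nabla_form_ext hc i oU Up cp sw sw' ww).
Qed.

Lemma exterior_d_lin U (a : R) (w w' : form M) p : open U -> U p ->
  smooth_form U w -> smooth_form U w' ->
  exterior_d (fun q => a *: w q + w' q) p = a *: exterior_d w p + exterior_d w' p.
Proof.
move=> oU Up sw sw'; have [c hc cp] := atlas_cover p.
have saw := smooth_form_Z a oU sw; have ss := smooth_form_D oU saw sw'.
rewrite (exterior_d_local hc oU Up cp sw) (exterior_d_local hc oU Up cp sw') (exterior_d_local hc oU Up cp ss).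
rewrite !local_dE scaler_sumr -big_split; apply: eq_bigr => i _ /=.
rewrite (nabla_form_D hc i oU Up cp saw sw') cliffordDr -cliffordZr; congr (clifford _ _ + _).
apply: extform_eq => s; rewrite extform_scaleE.
rewrite (nabla_formE hc i s oU Up cp sw) (nabla_formE hc i s oU Up cp saw).
rewrite -chart_partialZ //.
exact: (form_const_smooth hc s oU Up cp sw).
Qed.

Lemma smooth_exterior_d U (w : form M) : open U -> smooth_form U w -> smooth_form U (exterior_d w).
Proof.
move=> oU sw; apply: smooth_form_local => p Up; have [c hc cp] := atlas_cover p.
have oV : open (U `&` chart_dom c) by apply: openI => //; exact: chart_open_dom.
exists (U `&` chart_dom c); split=> //.
exact: (smooth_local_d hc oV (@subIsetr _ _ _) (smooth_form_sub (@subIsetl _ _ _) sw)).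
Qed.

(** A single operator acting on all fields of forms whose values over U depend only on the
    restriction to U; it induces a sheaf endomorphism that ignores the open set it is given
    ([local_sheaf_endo]). *)
Definition local_op (D : cform M -> cform M) :=
  [/\ forall U w, open U -> smooth_cform U w -> smooth_cform U (D w),
      forall U (k : R[i]) w e, open U -> smooth_cform U w -> smooth_cform U e -> forall p, U p ->
        D (fun q => k *: w q + e q) p = k *: D w p + D e p
    & forall U w e, open U -> smooth_cform U w -> smooth_cform U e -> (forall p, U p -> w p = e p) ->
        forall p, U p -> D w p = D e p].

Lemma local_op_exterior_d : local_op (@exterior_dC R n M).
Proof.
split=> [U w oU [w1 w2]|U k w e oU [w1 w2] [e1 e2] p Up|U w e oU [w1 w2] [e1 e2] we p Up].
- by split; exact: smooth_exterior_d.
- have lin (a b : R) (s t r : form M) : smooth_form U s -> smooth_form U t -> smooth_form U r ->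
      exterior_d (fun q => a *: s q + b *: t q + r q) p = a *: exterior_d s p + b *: exterior_d t p + exterior_d r p.
    move=> ss st sr; have sbt := smooth_form_Z b oU st.
    have -> : (fun q => a *: s q + b *: t q + r q) = (fun q => a *: s q + (b *: t q + r q)).
      by apply: functional_extensionality_dep => q; rewrite addrA.
    rewrite (exterior_d_lin a oU Up ss (smooth_form_D oU sbt sr)) (exterior_d_lin b oU Up st sr).
    exact: addrA.
  have linB (a b : R) (s t r : form M) : smooth_form U s -> smooth_form U t -> smooth_form U r ->
      exterior_d (fun q => a *: s q - b *: t q + r q) p = a *: exterior_d s p - b *: exterior_d t p + exterior_d r p.
    move=> ss st sr; have -> : (fun q => a *: s q - b *: t q + r q) = (fun q => a *: s q + (- b) *: t q + r q).
      by apply: functional_extensionality_dep => q; rewrite scaleNr.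
    by apply: etrans (lin a (- b) s t r ss st sr) _; rewrite scaleNr.
  rewrite /exterior_dC cpx_scaleE; congr (_, _); last exact: (lin _ _ _ _ _ w2 w1 e2).
  exact: (linB _ _ _ _ _ w1 w2 e1).
congr (_, _); apply: (exterior_d_ext oU Up) => // q Uq; by rewrite we.
Qed.

Lemma local_op_comp D D' : local_op D -> local_op D' -> local_op (fun w => D (D' w)).
Proof.
move=> [s l r] [s' l' r']; split=> [U w oU sw|U k w e oU sw se p Up|U w e oU sw se we p Up].
- by apply: s => //; exact: s'.
- rewrite -(l U) //; try exact: s'.
  apply: (r U) => //; try exact: s'.
  + by apply: s' => //; apply: smooth_cform_D => //; exact: smooth_cform_Z.
  + by apply: smooth_cform_D => //; [apply: smooth_cform_Z => //|]; exact: s'.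
  + by move=> q Uq; rewrite (l' U).
by apply: (r U) => //; try exact: s'; move=> q Uq; exact: (r' U).
Qed.

Lemma local_op_lin (a : R[i]) D D' : local_op D -> local_op D' ->
  local_op (fun w p => a *: D w p + D' w p).
Proof.
move=> [s l r] [s' l' r']; split=> [U w oU sw|U k w e oU sw se p Up|U w e oU sw se we p Up].
- by apply: smooth_cform_D => //; [apply: smooth_cform_Z => //|]; [exact: s|exact: s'].
- rewrite (l U) // (l' U) // !scalerDr !scalerA [a * k]mulrC.
  by rewrite addrACA.
by rewrite (r U _ _ oU sw se we) // (r' U _ _ oU sw se we).
Qed.

Lemma local_op_0 : local_op (fun _ _ => 0).
Proof.
by split=> *; [exact: smooth_cform_0|rewrite scaler0 addr0|].
Qed.

Definition op_comm (D D' : cform M -> cform M) : cform M -> cform M :=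
  fun w p => D (D' w) p - D' (D w) p.

Lemma local_op_ext D D' : (forall w p, D w p = D' w p) -> local_op D -> local_op D'.
Proof.
move=> DD; suff -> : D = D' by [].
by apply: functional_extensionality_dep => w; apply: functional_extensionality_dep => p.
Qed.

Lemma local_op_comm D D' : local_op D -> local_op D' -> local_op (op_comm D D').
Proof.
move=> lD lD'; apply: local_op_ext (local_op_lin (-1) (local_op_comp lD' lD) (local_op_comp lD lD')) => w p.
by rewrite scaleN1r addrC.
Qed.

Lemma local_op_sum (J : Type) (r : seq J) (F : J -> cform M -> cform M) : (forall j, local_op (F j)) ->
  local_op (fun w p => \sum_(j <- r) F j w p).
Proof.
move=> lF; elim: r => [|j r IH].
  by apply: local_op_ext local_op_0 => w p; rewrite big_nil.
by apply: local_op_ext (local_op_lin 1 (lF j) IH) => w p; rewrite big_cons scale1r.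
Qed.

Fact local_op_restrict D : local_op D -> forall U V w e, open U -> open V -> V `<=` U ->
  smooth_cform U w -> smooth_cform V e -> (forall p, V p -> w p = e p) ->
  forall p, V p -> D w p = D e p.
Proof.
move=> [_ _ r] U V w e oU oV VU sw se we p Vp.
by apply: (r V) => //; exact: smooth_cform_sub sw.
Qed.

Definition local_sheaf_endo D (lD : local_op D) : sheaf_endo M :=
  @SheafEndo R n M (fun _ => D) (let: And3 s _ _ := lD in s) (let: And3 _ l _ := lD in l) (local_op_restrict lD).

End LocalOperators.

Section NumberOperator.
Variables (R : realType) (n : nat) (M : smooth_manifold R n) (phi : gendo M) (P : {poly R}).
Hypothesis hphi : gen_poly_structure phi P.
Implicit Types (p q : M) (U V : set M) (l m : R[i]) (c : chart R n M).

Lemma pt_metric_frame c p : atlas c -> chart_dom c p ->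
  metric_frame (@pt_ccl R n M p) (fun a => (chart_frame c a p, 0)) (fun a => (chart_coframe c a p, 0)).
Proof.
move=> hc cp.
have H (e f : frame_index n -> gtan p) :
  (forall x : cpx (gtan p), x = \sum_a cinner x ((f a, 0) : cpx (gtan p)) *: ((e a, 0) : cpx (gtan p))) ->
  forall x : gtan p * gtan p, pt_ccl x = \sum_a pairing (@pt_ccl R n M p) x (f a, 0) * pt_ccl (e a, 0).
  move=> fe x; apply: endo_eq => w; rewrite endo_sumE.
  rewrite {1}(fe x) (raddf_sum (@pt_ccl R n M p)) endo_sumE; apply: eq_bigr => a _.
  rewrite (endoME (pairing _ x _)) (pt_cpairingE x (f a, 0)) !pt_cclE.
  exact: cliffordC_Zl.
split; first exact: (H (fun a => chart_frame c a p) (fun a => chart_coframe c a p) (fun x => cpx_frame x hc cp)).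
apply: (H (fun a => chart_coframe c a p) (fun a => chart_frame c a p)) => x.
rewrite {1}(cpx_frame x hc cp) (reindex_inj (inv_inj (@flip_indexK n))).
by apply: eq_bigr => a _; rewrite /chart_coframe flip_indexK.
Qed.

Definition chart_number c l p (w : cpx (forms_at p)) : cpx (forms_at p) :=
  \sum_a cliffordC (gproj hphi (- l) ((chart_frame c a p, 0) : cpx (gtan p)))
    (cliffordC (gproj hphi l ((chart_coframe c a p, 0) : cpx (gtan p))) w).

Definition chart_at p : chart R n M := s2val (cid2 (atlas_cover p)).
Lemma chart_at_atlas p : atlas (chart_at p). Proof. exact: (s2valP (cid2 (atlas_cover p))). Qed.
Lemma chart_at_dom p : chart_dom (chart_at p) p. Proof. exact: (s2valP' (cid2 (atlas_cover p))). Qed.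

(** The chart is picked separately at each point, with no regularity in p. [number_at_chart]
    replaces it by a chart fixed on a neighbourhood, from which smoothness follows. *)
Definition number_at l p : cpx (forms_at p) -> cpx (forms_at p) := @chart_number (chart_at p) l p.

Lemma number_at_chart c l p (w : cpx (forms_at p)) : atlas c -> chart_dom c p ->
  number_at l w = chart_number c l w.
Proof.
move=> hc cp.
have E c' : chart_number c' l w = (\sum_a pt_ccl (frame_u (@gproj _ _ _ _ _ hphi p) (fun a => (chart_frame c' a p, 0)) l a)
    * pt_ccl (frame_v (@gproj _ _ _ _ _ hphi p) (fun a => (chart_coframe c' a p, 0)) l a)) w.
  rewrite endo_sumE; apply: eq_bigr => a _.
  by rewrite (endoME (pt_ccl _)) !pt_cclE.
have adj k (x y : gtan p * gtan p) : pairing (@pt_ccl R n M p) (gproj hphi k x) y = pairing (@pt_ccl R n M p) x (gproj hphi (- k) y).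
  apply: endo_eq => v.
  by rewrite (pt_cpairingE (gproj hphi k x) y) (pt_cpairingE x (gproj hphi (- k) y)) gproj_adj.
have N := number_frame_indep (@pt_pairing_comm R n M p) (@gproj_idem _ _ _ _ _ hphi p) adj l
  (pt_metric_frame (chart_at_atlas p) (chart_at_dom p)) (pt_metric_frame hc cp).
apply: etrans (E (chart_at p)) _; apply: etrans _ (esym (E c)).
exact: (congr1 (fun f : endo (forms_at p * forms_at p)%type => f w) N).
Qed.

Definition number_op l : cform M -> cform M := fun w p => number_at l (w p).

Lemma number_atD l p (w w' : cpx (forms_at p)) : number_at l (w + w') = number_at l w + number_at l w'.
Proof. by rewrite /number_at /chart_number -big_split; apply: eq_bigr => a _; rewrite !cliffordC_D. Qed.

Lemma number_atZ l p (k : R[i]) (w : cpx (forms_at p)) : number_at l (k *: w) = k *: number_at l w.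
Proof. by rewrite /number_at /chart_number scaler_sumr; apply: eq_bigr => a _; rewrite !cliffordC_Zr. Qed.

Lemma number_at_clifford l p (x : cpx (gtan p)) (w : cpx (forms_at p)) :
  number_at l (cliffordC x w) = cliffordC x (number_at l w) + cliffordC (gproj hphi (- l) x - gproj hphi l x) w.
Proof.
have := number_metric (@pt_pairing_comm R n M p) (@gproj_idem _ _ _ _ _ hphi p) _ (pt_metric_frame (chart_at_atlas p) (chart_at_dom p)) l x.
have adj k (y z : cpx (gtan p)) : pairing (@pt_ccl R n M p) (gproj hphi k y) z = pairing (@pt_ccl R n M p) y (gproj hphi (- k) z).
  apply: endo_eq => v.
  by rewrite (pt_cpairingE (gproj hphi k y) z) (pt_cpairingE y (gproj hphi (- k) z)) gproj_adj.
move=> /(_ adj) /(congr1 (fun f : endo _ => f w)).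
set S := (\sum_a _); have SE (v : cpx (forms_at p)) : S v = number_at l v.
  rewrite endo_sumE; apply: eq_bigr => a _.
  by rewrite (endoME (pt_ccl _)) !pt_cclE.
rewrite /comm endoBE (endoME S) (endoME (pt_ccl x)) !pt_cclE !SE => /eqP.
by rewrite subr_eq addrC => /eqP.
Qed.

Lemma local_op_number l : local_op (number_op l).
Proof.
split=> [U w oU sw|U k w e oU sw se p Up|U w e oU sw se we p Up].
- apply: smooth_cform_local => p Up; have [c hc cp] := atlas_cover p.
  have oV : open (U `&` chart_dom c) by apply: openI => //; exact: chart_open_dom.
  exists (U `&` chart_dom c); split=> //.
  apply: (@smooth_cform_ext _ _ _ _ (fun q => chart_number c l (w q))).
    by move=> q [_ cq]; rewrite -(number_at_chart l (w q) hc cq).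
  have sf (f : gfield M) : smooth_gfield (chart_dom c) f -> smooth_cgfield (U `&` chart_dom c) (fun q => (f q, 0)).
    by move=> sf; split; [apply: smooth_gfield_sub sf => q []|exact: smooth_gfield_0].
  apply: smooth_cform_sum => // a; apply: smooth_cliffordC => //.
    by apply: smooth_gproj => //; apply: sf; exact: smooth_chart_frame.
  apply: smooth_cliffordC => //; last by apply: smooth_cform_sub sw => q [].
  by apply: smooth_gproj => //; apply: sf; exact: smooth_chart_frame.
- by rewrite /number_op number_atD number_atZ.
by rewrite /number_op we.
Qed.

Section Representation.
Variable c : chart R n M.
Hypothesis hc : atlas c.
Variable V : set M.
Hypotheses (oV : open V) (Vc : V `<=` chart_dom c).

(** Carries identities between ring elements over V to operators on global fields of forms.
    Commutators and sums are respected, so the iterated commutators defining the deltas are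
    covered. *)
Definition represents (D : cform M -> cform M) (f : endo (loc_forms oV)) :=
  forall (w : cform M) (w' : loc_forms oV), (forall p, V p -> w p = fval w' p) ->
  forall p, V p -> D w p = fval (f w') p.

Lemma represents_comp D D' f f' : represents D f -> represents D' f' -> represents (fun w => D (D' w)) (f * f').
Proof. by move=> Df Df' w w' ww p Vp; rewrite endoME; apply: Df => // q Vq; exact: Df'. Qed.

Lemma represents_B D D' f f' : represents D f -> represents D' f' -> represents (fun w p => D w p - D' w p) (f - f').
Proof. by move=> Df Df' w w' ww p Vp; rewrite endoBE fvalB (Df w w') // (Df' w w'). Qed.

Lemma represents_D D D' f f' : represents D f -> represents D' f' -> represents (fun w p => D w p + D' w p) (f + f').
Proof. by move=> Df Df' w w' ww p Vp; rewrite endoDE fvalD (Df w w') // (Df' w w'). Qed.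

Lemma represents_comm D D' f f' : represents D f -> represents D' f' -> represents (op_comm D D') (comm f f').
Proof. by move=> Df Df'; apply: represents_B; exact: represents_comp. Qed.

Lemma represents_d : represents (@exterior_dC R n M) (ld hc oV Vc).
Proof.
move=> w w' ww p Vp; rewrite ldE //.
have [_ _ r] := @local_op_exterior_d R n M.
apply: (r V) => //; last exact: smooth_fval.
by apply: smooth_cform_ext (smooth_fval w') => q Vq; rewrite ww.
Qed.

Lemma represents_number l : represents (number_op l) (lnum hphi hc oV Vc l).
Proof.
move=> w w' ww p Vp; rewrite /number_op ww // (number_at_chart l _ hc (Vc Vp)).
rewrite /lnum /number endo_sumE fval_sum; apply: eq_bigr => a _.
rewrite (endoME (lcl _)) (lclE (lu hphi hc oV Vc l a)) (lclE (lv hphi hc oV Vc l a)).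
rewrite (lprE hphi (- l) (lframe hc oV Vc a) Vp) (lprE hphi l (lcoframe hc oV Vc a) Vp).
have -> : gval (lframe hc oV Vc a) p = ((chart_frame c a p, 0) : cpx (gtan p)).
  by congr (_, _); exact: op_frameE.
have -> : gval (lcoframe hc oV Vc a) p = ((chart_coframe c a p, 0) : cpx (gtan p)).
  by congr (_, _); exact: op_coframeE.
by [].
Qed.

End Representation.

End NumberOperator.

(** * Degrees as eigenvalues of the number operator *)

Section GradedPieces.
Variables (R : realType) (n : nat) (M : smooth_manifold R n) (phi : gendo M) (P : {poly R}).
Hypothesis hphi : gen_poly_structure phi P.
Implicit Types (p q : M) (U V : set M) (w : cform M).
Variable l : R[i].
Hypothesis l0 : l != 0.
Local Notation L := (geigen phi P l).
Local Notation L' := (geigen phi P (- l)).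
Local Notation num := (number_at hphi l).

Lemma label_neq_opp : l != - l.
Proof. by rewrite -addr_eq0 double_complex_neq0. Qed.

Lemma number_at_raise p (x : cpx (gtan p)) (e : cpx (forms_at p)) : L' p x ->
  num (cliffordC x e) = cliffordC x (num e) + cliffordC x e.
Proof.
move=> /(gprojP hphi) xE; rewrite number_at_clifford xE.
by rewrite -{3}xE (gproj_ortho hphi _ label_neq_opp) subr0.
Qed.

Lemma number_at_lower p (x : cpx (gtan p)) (e : cpx (forms_at p)) : L p x ->
  num (cliffordC x e) = cliffordC x (num e) - cliffordC x e.
Proof.
move=> /(gprojP hphi) xE; rewrite number_at_clifford xE.
rewrite -{2}xE (gproj_ortho hphi x (_ : - l != l)); last by rewrite eq_sym label_neq_opp.
by rewrite sub0r -scaleN1r cliffordC_Zl scaleN1r.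
Qed.

Lemma number_at_foldr p (s : seq (cgfield M)) (e : cpx (forms_at p)) :
  (forall i, (i < size s)%N -> L' p (nth (fun=> 0) s i p)) -> num e = 0 ->
  num (foldr (fun x : cgfield M => cliffordC (x p)) e s) =
    (size s)%:R *: foldr (fun x : cgfield M => cliffordC (x p)) e s.
Proof.
elim: s => [|x s IH] sL e0; first by rewrite scale0r.
rewrite [foldr _ _ _]/= number_at_raise; last exact: (sL 0).
rewrite IH //; last by move=> i si; exact: (sL i.+1).
by rewrite cliffordC_Zr -{2}[cliffordC _ _]scale1r -scalerDl -[1]/(1%:R) -natrD addn1.
Qed.

Lemma number_at_annihilated V (rho : cform M) p : open V -> V p -> annihilated L V rho -> num (rho p) = 0.
Proof.
move=> oV Vp [_ ann]; have [c hc cp] := atlas_cover p.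
rewrite (number_at_chart hphi l _ hc cp); apply: big1 => a _.
have oW : open (V `&` chart_dom c) by apply: openI => //; exact: chart_open_dom.
have sc : smooth_cgfield (V `&` chart_dom c) (fun q => (chart_coframe c a q, 0)).
  split; last exact: smooth_gfield_0.
  by apply: (smooth_gfield_sub (@subIsetr _ _ _)); exact: smooth_chart_frame.
rewrite (ann _ (fun q => gproj hphi l ((chart_coframe c a q, 0) : cpx (gtan q))) oW) //.
  by rewrite -(scale0r (0 : cpx (forms_at p))) cliffordC_Zr !scale0r.
split; first exact: smooth_gproj.
by move=> q _; apply/(gprojP hphi); exact: gproj_idem.
Qed.

(** Over a chart domain N is killed by N (N - 1) ... (N - 2n), which has no negative root. *)
Lemma number_at_negative V w : open V -> smooth_cform V w ->
  (forall p, V p -> num (w p) = - w p) -> forall p, V p -> w p = 0.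
Proof.
move=> oV sw wN p Vp; have [c hc cp] := atlas_cover p.
have oW : open (V `&` chart_dom c) by apply: openI => //; exact: chart_open_dom.
have Wc : V `&` chart_dom c `<=` chart_dom c by exact: subIsetr.
have sw' := smooth_cform_sub (@subIsetl _ V (chart_dom c)) sw.
pose w' := cut_cform oW sw'.
have w'E q : (V `&` chart_dom c) q -> fval w' q = w q by exact: cut_cformE.
have ww q : (V `&` chart_dom c) q -> w q = fval w' q by move=> /w'E.
rewrite -(w'E p) // (_ : w' = 0) //.
apply: (@no_negative_eigenvector _ (lnum hphi hc oW Wc l) (@loc_forms_torsion_free _ _ _ _ oW)
  _ (lnum_falling hphi hc oW Wc l0) (-1)) => //.
apply: fval_eq => q Wq; rewrite -(represents_number hphi hc Wc l ww Wq) mulrN1z fvalN w'E //.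
by apply: wN; case: Wq.
Qed.

(** One sum valid on all of V, whereas [graded_piece] asks for such a sum near each point only. *)
Definition graded_span (r : nat) V w := exists (N : nat) (s : 'I_N -> r.-tuple (cgfield M)) (rho : 'I_N -> cform M),
  [/\ forall j i, is_section L' V (tnth (s j) i), forall j, annihilated L V (rho j)
    & forall q, V q -> w q = \sum_(j < N) foldr (fun x : cgfield M => cliffordC (x q)) (rho j q) (s j)].

Lemma graded_span_ext r V w w' : (forall q, V q -> w q = w' q) -> graded_span r V w -> graded_span r V w'.
Proof.
move=> ww [N [s [rho [sL ra wE]]]]; exists N, s, rho; split=> // q Vq.
by rewrite -ww // wE.
Qed.

Lemma graded_span0 r V : graded_span r V (fun=> 0).
Proof.
by exists 0%N, (fun=> [tuple of nseq r (fun=> 0)]), (fun _ _ => 0); split=> [[]|[]|q _] //; rewrite big_ord0.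
Qed.

Lemma graded_spanD r V w w' : graded_span r V w -> graded_span r V w' -> graded_span r V (fun q => w q + w' q).
Proof.
move=> [N [s [rho [sL ra wE]]]] [N' [s' [rho' [sL' ra' wE']]]].
exists (N + N')%N, (fun j => match fintype.split j with inl i => s i | inr i => s' i end),
  (fun j => match fintype.split j with inl i => rho i | inr i => rho' i end); split.
- by move=> j i; case: (fintype.split j) => k.
- by move=> j; case: (fintype.split j) => k.
move=> q Vq; rewrite big_split_ord wE // wE' //=; congr (_ + _); apply: eq_bigr => i _.
  by rewrite (unsplitK (inl i : 'I_N + 'I_N')).
by rewrite (unsplitK (inr i : 'I_N + 'I_N')).
Qed.

Lemma graded_span_sum r V (J : Type) (t : seq J) (F : J -> cform M) :
  (forall j, graded_span r V (F j)) -> graded_span r V (fun q => \sum_(j <- t) F j q).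
Proof.
move=> gF; elim: t => [|j t IH].
  by apply: graded_span_ext (graded_span0 r V) => q _; rewrite big_nil.
by apply: graded_span_ext (graded_spanD (gF j) IH) => q _; rewrite big_cons.
Qed.

Lemma foldr_scale (k : R[i]) q (s : seq (cgfield M)) (e : cpx (forms_at q)) :
  foldr (fun x : cgfield M => cliffordC (x q)) (k *: e) s = k *: foldr (fun x : cgfield M => cliffordC (x q)) e s.
Proof. by elim: s => //= x s ->; rewrite cliffordC_Zr. Qed.

Lemma graded_spanZ r V (k : R[i]) w : open V -> graded_span r V w -> graded_span r V (fun q => k *: w q).
Proof.
move=> oV [N [s [rho [sL ra wE]]]]; exists N, s, (fun j q => k *: rho j q); split=> //.
- move=> j; have [sr an] := ra j; split; first exact: smooth_cform_Z.
  by move=> V' x oV' VV sx q Vq; rewrite cliffordC_Zr (an V' x) // scaler0.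
- by move=> q Vq; rewrite wE // scaler_sumr; apply: eq_bigr => j _; rewrite foldr_scale.
Qed.

Lemma graded_span_clifford r V (x : cgfield M) w : is_section L' V x -> graded_span r V w ->
  graded_span r.+1 V (fun q => cliffordC (x q) (w q)).
Proof.
move=> sx [N [s [rho [sL ra wE]]]]; exists N, (fun j => [tuple of x :: s j]), rho; split=> //.
- move=> j i; rewrite (tnth_nth (fun=> 0)) /=; case: i => -[|i] //= ir.
  by have := sL j (Ordinal (ir : (i < r)%N)); rewrite (tnth_nth (fun=> 0)).
move=> q Vq; rewrite wE //.
have C0 : cliffordC (x q) 0 = 0.
  by rewrite -(scale0r (0 : cpx (forms_at q))) cliffordC_Zr !scale0r.
by elim/big_rec2: _ => // j e e' _ <-; rewrite cliffordC_D.
Qed.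

(** For r = 0, an element of L lowers the eigenvalue to -1, so it kills w. For r + 1, w is N w
    divided by r + 1, that is, a combination of the u_a (v_a w), and each v_a w has eigenvalue r. *)
Lemma eigen_graded_span c V : atlas c -> open V -> V `<=` chart_dom c -> forall r w, smooth_cform V w ->
  (forall p, V p -> num (w p) = r%:R *: w p) -> graded_span r V w.
Proof.
move=> hc oV Vc; elim=> [|r IH] w sw wN.
  exists 1%N, (fun=> [tuple]), (fun=> w); split=> [j []//|j|q Vq]; last by rewrite big_ord1.
  split=> // V' x oV' VV [sx xL]; apply: number_at_negative => //.
    by apply: smooth_cliffordC => //; exact: smooth_cform_sub sw.
  move=> p V'p; rewrite number_at_lower; last exact: xL.
  rewrite wN; last exact: VV.
  by rewrite cliffordC_Zr !scale0r sub0r.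
pose u a : cgfield M := fun q => gproj hphi (- l) ((chart_frame c a q, 0) : cpx (gtan q)).
pose v a : cgfield M := fun q => gproj hphi l ((chart_coframe c a q, 0) : cpx (gtan q)).
have sf (f : gfield M) : smooth_gfield (chart_dom c) f -> smooth_cgfield V (fun q => (f q, 0)).
  by move=> sf; split; [exact: smooth_gfield_sub sf|exact: smooth_gfield_0].
have su a : is_section L' V (u a).
  split; last by move=> q _; apply/(gprojP hphi); exact: gproj_idem.
  by apply: smooth_gproj => //; apply: sf; exact: smooth_chart_frame.
have sv a : is_section L V (v a).
  split; last by move=> q _; apply/(gprojP hphi); exact: gproj_idem.
  by apply: smooth_gproj => //; apply: sf; exact: smooth_chart_frame.
have gv a : graded_span r V (fun q => cliffordC (v a q) (w q)).
  apply: IH; first by apply: smooth_cliffordC => //; case: (sv a).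
  move=> p Vp; rewrite number_at_lower; last by case: (sv a) => _; apply.
  rewrite wN // cliffordC_Zr -{2}[cliffordC _ _]scale1r -scalerBl; congr (_ *: _).
  by rewrite -addn1 natrD addrK.
have G : graded_span r.+1 V (fun q => r.+1%:R^-1 *: \sum_a cliffordC (u a q) (cliffordC (v a q) (w q))).
  apply: graded_spanZ => //; apply: graded_span_sum => a; exact: graded_span_clifford.
apply: graded_span_ext G => q Vq.
have -> : \sum_a cliffordC (u a q) (cliffordC (v a q) (w q)) = num (w q).
  by rewrite (number_at_chart hphi l _ hc (Vc _ Vq)).
by rewrite wN // scalerA mulVf ?scale1r // pnatr_eq0.
Qed.

Lemma graded_pieceP (r : nat) U w : open U -> graded_piece L L' r U w <->
  smooth_cform U w /\ forall p, U p -> num (w p) = r%:R *: w p.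
Proof.
move=> oU; split=> [[sw H]|[sw wN]]; split=> // p Up.
  have [V [N [s [rho [[oV Vp VU] [sL ra wE]]]]]] := H p Up.
  rewrite wE // scaler_sumr.
  have nsum (F : 'I_N -> cpx (forms_at p)) : num (\sum_j F j) = \sum_j num (F j).
    have n0 : num (0 : cpx (forms_at p)) = 0.
      by have := number_atZ hphi l 0 (0 : cpx (forms_at p)); rewrite !scale0r.
    by elim/big_rec2: _ => // j e e' _ <-; rewrite number_atD.
  rewrite nsum; apply: eq_bigr => j _; rewrite number_at_foldr ?size_tuple //.
    move=> i ir; have := sL j (Ordinal (ir : (i < r)%N)); rewrite (tnth_nth (fun=> 0)).
    by case=> _; apply.
  exact: number_at_annihilated (ra j).
have [c hc cp] := atlas_cover p.
have oW : open (U `&` chart_dom c) by apply: openI => //; exact: chart_open_dom.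
have [] := @eigen_graded_span c _ hc oW (@subIsetr _ _ _) r w.
- exact: (smooth_cform_sub (@subIsetl _ _ _) sw).
- by move=> q [Uq _]; exact: wN.
move=> N [s [rho H]]; by exists (U `&` chart_dom c), N, s, rho; split.
Qed.

Lemma sheaf_endo_scale (D : sheaf_endo M) U w w' (k : R[i]) : open U -> smooth_cform U w -> smooth_cform U w' ->
  (forall q, U q -> w' q = k *: w q) -> forall p, U p -> D U w' p = k *: D U w p.
Proof.
move=> oU sw sw' ww p Up.
(* [sheaf_op_linear] speaks of k w + e. Writing k w as (k - 1) w + w makes it applicable with e = w,
   so the value at the zero form never appears. *)
have skw : smooth_cform U (fun q => (k - 1) *: w q + w q).
  by apply: smooth_cform_D => //; exact: smooth_cform_Z.
rewrite (sheaf_op_restrict D oU oU _ sw' skw) //; last first.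
  by move=> q Uq; rewrite ww // -{3}[w q]scale1r -scalerDl subrK.
by rewrite (sheaf_op_linear D _ oU sw sw) // -{2}[D U w p]scale1r -scalerDl subrK.
Qed.

Lemma has_degree_number (a : nat) (D : sheaf_endo M) :
  (forall U w, open U -> smooth_cform U w -> forall p, U p ->
     num (D U w p) = D U (number_op hphi l w) p + a%:R *: D U w p) ->
  has_degree L L' a D.
Proof.
move=> H U r w oU /(graded_pieceP r w oU) [sw wN]; apply/graded_pieceP => //.
split; first exact: sheaf_op_smooth.
move=> p Up; rewrite H //.
have [sN _ _] := local_op_number hphi l.
by rewrite (sheaf_endo_scale D oU sw (sN U w oU sw) wN) // -scalerDl -natrD.
Qed.

Section Localise.
Variable c : chart R n M.
Hypothesis hc : atlas c.
Variable V : set M.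
Hypotheses (oV : open V) (Vc : V `<=` chart_dom c).
Variable D : sheaf_endo M.

Definition loc_sheaf_fun (w : loc_forms oV) : loc_forms oV :=
  cut_cform oV (sheaf_op_smooth D oV (smooth_fval w)).

Lemma loc_sheaf_funE (w : loc_forms oV) p : V p -> fval (loc_sheaf_fun w) p = D V (fval w) p.
Proof. exact: cut_cformE. Qed.

Fact loc_sheaf_zmod : zmod_morphism loc_sheaf_fun.
Proof.
move=> w w'; apply/eqP; rewrite eq_sym subr_eq; apply/eqP; apply: fval_eq => p Vp.
rewrite fvalD !loc_sheaf_funE // -[D V (fval (w - w')) p]scale1r.
rewrite -(sheaf_op_linear D 1 oV (smooth_fval _) (smooth_fval _) Vp).
congr (D V _ p); apply: functional_extensionality_dep => q.
by rewrite scale1r -fvalD subrK.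
Qed.
Definition loc_sheaf : endo (loc_forms oV) := Endo loc_sheaf_zmod.

(** The degree only tells what D does on graded pieces, that is, on eigenvectors of N;
    [additive_eigen_eq0] extends the identity from there to all local forms. *)
Lemma has_degree_comm (a : nat) : has_degree L L' a D ->
  comm (lnum hphi hc oV Vc l) loc_sheaf = loc_sheaf *~ a%:Z.
Proof.
move=> hD; apply/eqP; rewrite -subr_eq0; apply/eqP.
set f := (X in X = 0).
have NE (e : loc_forms oV) p : V p -> fval (lnum hphi hc oV Vc l e) p = num (fval e p).
  by move=> Vp; rewrite -(represents_number hphi hc Vc l (w := fval e) (w' := e)).
apply: endo_eq; apply: (@additive_eigen_eq0 _ (lnum hphi hc oV Vc l) _ (lnum_falling hphi hc oV Vc l0) _ f
  (endo_additive f) (@loc_forms_torsion_free _ _ _ _ oV)).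
move=> r w Nw; apply: fval_eq => p Vp.
have wg : graded_piece L L' r V (fval w).
  apply/graded_pieceP => //; split; first exact: smooth_fval.
  by move=> q Vq; rewrite -NE // Nw fvalMn.
have /(graded_pieceP (r + a) _ oV) [_ DN] := hD V r _ oV wg.
rewrite /f endoBE /comm endoBE (endoME (lnum _ _ _ _ _)) (endoME loc_sheaf) endoMzE Nw.
rewrite endoMn !fvalB NE // fvalMn fvalMz !loc_sheaf_funE // DN //.
by rewrite addnC natrD scalerDl addrK subrr.
Qed.

End Localise.

End GradedPieces.

(** * From integrability to the decomposition of d *)

(* Degrees constrain delta_(-l) = b for N_(-l) = N' but not for N_l = N; as
   N + N' commutes with a + b = delta_l + delta_(-l), twice b nevertheless splits
   into parts of weights 1 and -1 for N. *)
Section OppositeLabels.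
Variables (A : pzRingType) (N N' a b : A).
Implicit Types (x y z : A).
Hypothesis Na : comm N a = a.
Hypothesis Nb : comm N' b = b.
Hypothesis tauN : comm (N + N') N = 0.
Hypothesis tauab : comm (N + N') (a + b) = 0.

Local Notation tau := (N + N').
Local Notation c := (comm tau b).

Lemma tau_shift : comm tau c = c *+ 2.
Proof.
have Nb' : comm N b = c - b by rewrite -[X in _ - X]Nb /comm; ncring.
have J : comm tau (comm N (a + b)) = comm N (comm tau (a + b)) + comm (comm tau N) (a + b).
  by rewrite /comm; ncring.
move: J; rewrite tauab tauN [comm N (a + b)]commDr Na Nb'.
have -> : comm N 0 = 0 by rewrite /comm mulr0 mul0r subrr.
have -> : comm 0 (a + b) = 0 by rewrite /comm mulr0 mul0r subrr.
have ta : comm tau a = - c by apply/eqP; rewrite -addr_eq0 -commDr tauab.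
rewrite addr0 commDr commDr commNr ta => /eqP.
by rewrite addrCA -opprD -mulr2n subr_eq0 => /eqP.
Qed.

Lemma opposite_weight_pos : comm N c = c.
Proof.
have Nb' : comm N b = c - b by rewrite -[X in _ - X]Nb /comm; ncring.
have J : comm N c = comm tau (comm N b) - comm (comm tau N) b by rewrite /comm; ncring.
rewrite J Nb' commDr commNr tau_shift tauN mulr2n addrK.
by rewrite /comm mul0r mulr0 subrr subr0.
Qed.

Lemma opposite_weight_neg : comm N (b *+ 2 - c) = - (b *+ 2 - c).
Proof.
have Nb' : comm N b = c - b by rewrite -[X in _ - X]Nb /comm; ncring.
rewrite commDr commNr opposite_weight_pos mulr2n commDr Nb'; ncring.
Qed.

End OppositeLabels.

Section IntegrableDecomposition.
Variables (R : realType) (n : nat) (M : smooth_manifold R n) (phi : gendo M) (P : {poly R}).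
Hypothesis hphi : gen_poly_structure phi P.
Implicit Types (p : M) (U V : set M) (l m : R[i]) (w : cform M).
Local Notation eig := (eigenvalues phi P).
Local Notation nop := (number_op hphi).
Local Notation dC := (@exterior_dC R n M).

Definition tdelta l : cform M -> cform M :=
  fun w p => op_comm (nop l) (op_comm (nop l) dC) w p + op_comm (nop l) dC w p.
Definition tdelta0 : cform M -> cform M :=
  fun w p => dC w p + dC w p - \sum_(l <- eig | l != 0) tdelta l w p.

Lemma local_op_add D D' : local_op D -> local_op D' -> local_op (fun (w : cform M) p => D w p + D' w p).
Proof.
move=> lD lD'; apply: local_op_ext (local_op_lin 1 lD lD') => w p.
by rewrite scale1r.
Qed.

Lemma local_op_tdelta l : local_op (tdelta l).
Proof.
have ln := local_op_number hphi l; have ld := @local_op_exterior_d R n M.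
by apply: local_op_add; repeat apply: local_op_comm.
Qed.

Lemma local_op_tdelta0 : local_op tdelta0.
Proof.
have ld := @local_op_exterior_d R n M.
have ls : local_op (fun (w : cform M) p => \sum_(l <- [seq l <- eig | l != 0]) tdelta l w p).
  by apply: local_op_sum => l; exact: local_op_tdelta.
apply: local_op_ext (local_op_lin (-1) ls (local_op_add ld ld)) => w p.
by rewrite scaleN1r big_filter addrC.
Qed.

Lemma local_op_half D : local_op D -> local_op (fun (w : cform M) p => (2^-1 : R[i]) *: D w p).
Proof. by move=> lD; apply: local_op_ext (local_op_lin 2^-1 lD (@local_op_0 R n M)) => w p; rewrite addr0. Qed.

Definition delta l : sheaf_endo M :=
  if l == 0 then local_sheaf_endo (local_op_half local_op_tdelta0)
  else local_sheaf_endo (local_op_half (local_op_tdelta l)).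

Lemma half_has_degree (m : R[i]) (a : nat) D (lD : local_op D) : m != 0 ->
  (forall (c : chart R n M) (hc : atlas c) V (oV : open V) (Vc : V `<=` chart_dom c),
     exists2 T, represents (oV := oV) D T & comm (lnum hphi hc oV Vc m) T = T *~ a%:Z) ->
  has_degree (geigen phi P m) (geigen phi P (- m)) a (local_sheaf_endo (local_op_half lD)).
Proof.
move=> m0 H; apply: has_degree_number => // U w oU sw p Up /=.
have [c hc cp] := atlas_cover p.
have oV : open (U `&` chart_dom c) by apply: openI => //; exact: chart_open_dom.
have Vc : U `&` chart_dom c `<=` chart_dom c by exact: subIsetr.
have [T DT TE] := H c hc _ oV Vc.
have sw' := smooth_cform_sub (@subIsetl _ U (chart_dom c)) sw.
have ww q : (U `&` chart_dom c) q -> w q = fval (cut_cform oV sw') q by move=> Vq; rewrite cut_cformE.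
have := represents_comm (represents_number hphi hc Vc m) DT ww (conj Up cp).
rewrite TE endoMzE fvalMz -(DT _ _ ww _ (conj Up cp)) => /eqP.
rewrite /op_comm subr_eq => /eqP E.
have -> : number_at hphi m (2^-1 *: D w p) = 2^-1 *: number_at hphi m (D w p) by exact: number_atZ.
rewrite [number_at hphi m (D w p)]E scalerDr addrC; congr (_ + _).
by rewrite !scalerA mulrC.
Qed.

Hypothesis integrable : forall mu nu : R[i], spectrum phi mu -> spectrum phi nu ->
    forall (U : set M) (x y : cgfield M), open U ->
      is_section (geigen phi P mu) U x -> is_section (geigen phi P nu) U y ->
    forall p : M, U p -> exists a b : cpx (gtan p),
      [/\ geigen phi P mu p a, geigen phi P nu p b
        & (mu + nu) *: dorfmanC x y p = a + b].

Section Chart.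
Variables (c : chart R n M) (hc : atlas c) (V : set M) (oV : open V) (Vc : V `<=` chart_dom c).
Local Notation td l := (twice_delta (lcl (oV := oV)) (ld hc oV Vc) (lu hphi hc oV Vc) (lv hphi hc oV Vc) l).
Local Notation td0 := (twice_delta0 (lcl (oV := oV)) (ld hc oV Vc) (lu hphi hc oV Vc) (lv hphi hc oV Vc) eig).

Lemma represents_tdelta l : represents (oV := oV) (tdelta l) (td l).
Proof.
have rn := represents_number hphi hc Vc l; have rd := represents_d hc Vc.
by apply: represents_D; repeat apply: represents_comm.
Qed.

Lemma represents_tdelta0 : represents (oV := oV) tdelta0 td0.
Proof.
have rd := represents_d hc Vc.
apply: represents_B.
  by rewrite mulr2n; exact: represents_D.
move=> w w' ww p Vp; rewrite endo_sumE.
by rewrite fval_sum; apply: eq_bigr => l _; exact: represents_tdelta.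
Qed.

End Chart.

Lemma delta_degree_self l : l != 0 -> has_degree (geigen phi P l) (geigen phi P (- l)) 1 (delta l).
Proof.
move=> l0; rewrite /delta (negbTE l0); apply: half_has_degree => // c hc V oV Vc.
exists (twice_delta (lcl (oV := oV)) (ld hc oV Vc) (lu hphi hc oV Vc) (lv hphi hc oV Vc) l).
  exact: represents_tdelta.
by rewrite mulr1z (ltwice_delta_self hphi hc oV Vc integrable l0).
Qed.

Lemma delta_degree_other l m : m \in eig -> m != 0 -> m != l -> m != - l ->
  has_degree (geigen phi P m) (geigen phi P (- m)) 0 (delta l).
Proof.
move=> mE m0 ml ml'; rewrite /delta; case: eqVneq => [l0|l0]; apply: half_has_degree => // c hc V oV Vc.
  exists (twice_delta0 (lcl (oV := oV)) (ld hc oV Vc) (lu hphi hc oV Vc) (lv hphi hc oV Vc) eig).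
    exact: represents_tdelta0.
  by rewrite mulr0z (ltwice_delta0_comm hphi hc oV Vc integrable mE m0).
exists (twice_delta (lcl (oV := oV)) (ld hc oV Vc) (lu hphi hc oV Vc) (lv hphi hc oV Vc) l).
  exact: represents_tdelta.
by rewrite mulr0z (ltwice_delta_other hphi hc oV Vc integrable l0 m0 ml ml').
Qed.

Lemma tdelta0_eq0 U w p : 0 \notin eig -> open U -> smooth_cform U w -> U p -> tdelta0 w p = 0.
Proof.
move=> nE oU sw Up; have [c hc cp] := atlas_cover p.
have oV : open (U `&` chart_dom c) by apply: openI => //; exact: chart_open_dom.
have Vc : U `&` chart_dom c `<=` chart_dom c by exact: subIsetr.
have sw' := smooth_cform_sub (@subIsetl _ U (chart_dom c)) sw.
have ww q : (U `&` chart_dom c) q -> w q = fval (cut_cform oV sw') q by move=> Vq; rewrite cut_cformE.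
rewrite (represents_tdelta0 hc Vc ww (conj Up cp)).
by rewrite (ltwice_delta0_eq0 hphi hc oV Vc integrable nE).
Qed.

(** The sum runs over the spectrum. If 0 belongs to it, the remainder restores d by definition; if
    not, the remainder is not among the summands and has to vanish. *)
Lemma delta_sum U w p : open U -> smooth_cform U w -> U p ->
  exterior_dC w p = \sum_(lam \in spectrum phi) delta lam U w p.
Proof.
move=> oU sw Up.
have -> : spectrum phi = [set` eig].
  by apply/seteqP; split=> l /= /(mem_eigenvalues hphi).
rewrite -fsbig_seq ?eigenvalues_uniq //.
have E l : delta l U w p = 2^-1 *: (if l == 0 then tdelta0 w p else tdelta l w p).
  by rewrite /delta; case: ifP.
rewrite (eq_bigr _ (fun l _ => E l)) -scaler_sumr.
have -> : \sum_(l <- eig) (if l == 0 then tdelta0 w p else tdelta l w p) = dC w p + dC w p.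
  have [zE|zE] := boolP (0 \in eig).
    rewrite (bigD1_seq 0) ?eigenvalues_uniq //= eqxx.
    rewrite [X in _ + X](eq_bigr (fun l => tdelta l w p)); first by rewrite /tdelta0 subrK.
    by move=> l /negbTE ->.
  have := tdelta0_eq0 zE oU sw Up; rewrite /tdelta0 => /eqP; rewrite subr_eq0 => /eqP ->.
  rewrite [RHS]big_mkcond; apply: eq_big_seq => l lE.
  by rewrite (_ : l == 0 = false) //; apply: contraNF zE => /eqP <-.
rewrite -[dC w p]scale1r -scalerDl scalerA -[1 + 1]/(2%:R).
by rewrite mulVf ?pnatr_eq0.
Qed.

End IntegrableDecomposition.

(** * From the decomposition of d to integrability *)

Section DorfmanLocality.
Variables (R : realType) (n : nat) (M : smooth_manifold R n).
Implicit Types (p : M) (U V : set M).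

Lemma dorfman_ext U (x y x' y' : gfield M) p : open U -> U p ->
  smooth_gfield U x -> smooth_gfield U y -> smooth_gfield U x' -> smooth_gfield U y' ->
  (forall q, U q -> x q = x' q) -> (forall q, U q -> y q = y' q) ->
  dorfman x y p = dorfman x' y' p.
Proof.
move=> oU Up sx sy sx' sy' xx yy; have [c hc cp] := atlas_cover p.
have oV : open (U `&` chart_dom c) by apply: openI => //; exact: chart_open_dom.
have Vc : U `&` chart_dom c `<=` chart_dom c by exact: subIsetr.
have VU : U `&` chart_dom c `<=` U by exact: subIsetl.
have S z : smooth_gfield U z -> smooth_gfield (U `&` chart_dom c) z by exact: smooth_gfield_sub.
rewrite (dorfman_coord hc oV (conj Up cp) Vc (S _ sx) (S _ sy)).
rewrite (dorfman_coord hc oV (conj Up cp) Vc (S _ sx') (S _ sy')).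
apply: eq_bigr => i _.
by rewrite (nabla_g_ext i oU Up cp xx) (nabla_g_ext i oU Up cp yy) (xx p Up) (yy p Up).
Qed.

Lemma dorfmanC_ext U (x y x' y' : cgfield M) p : open U -> U p ->
  smooth_cgfield U x -> smooth_cgfield U y -> smooth_cgfield U x' -> smooth_cgfield U y' ->
  (forall q, U q -> x q = x' q) -> (forall q, U q -> y q = y' q) ->
  dorfmanC x y p = dorfmanC x' y' p.
Proof.
move=> oU Up [x1 x2] [y1 y2] [x1' x2'] [y1' y2'] xx yy.
have e1 q : U q -> (x q).1 = (x' q).1 by move=> /xx ->.
have e2 q : U q -> (x q).2 = (x' q).2 by move=> /xx ->.
have f1 q : U q -> (y q).1 = (y' q).1 by move=> /yy ->.
have f2 q : U q -> (y q).2 = (y' q).2 by move=> /yy ->.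
rewrite /dorfmanC (dorfman_ext oU Up x1 y1 x1' y1' e1 f1) (dorfman_ext oU Up x2 y2 x2' y2' e2 f2).
by rewrite (dorfman_ext oU Up x1 y2 x1' y2' e1 f2) (dorfman_ext oU Up x2 y1 x2' y1' e2 f1).
Qed.

End DorfmanLocality.

Section DecompositionIntegrable.
Variables (R : realType) (n : nat) (M : smooth_manifold R n) (phi : gendo M) (P : {poly R}).
Hypothesis hphi : gen_poly_structure phi P.
Implicit Types (p : M) (U V : set M) (l m : R[i]) (w : cform M).
Local Notation eig := (eigenvalues phi P).

Variable delta : R[i] -> sheaf_endo M.
Hypothesis delta_total : forall (U : set M) (w : cform M), open U -> smooth_cform U w ->
  forall p : M, U p -> exterior_dC w p = \sum_(lam \in spectrum phi) delta lam U w p.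
Hypothesis delta_self : forall lam : R[i], spectrum phi lam -> lam <> 0 ->
  has_degree (geigen phi P lam) (geigen phi P (- lam)) 1 (delta lam).
Hypothesis delta_other : forall lam mu : R[i], spectrum phi lam -> spectrum phi mu ->
  mu <> 0 -> mu <> lam -> mu <> - lam ->
  has_degree (geigen phi P mu) (geigen phi P (- mu)) 0 (delta lam).

Section Chart.
Variables (c : chart R n M) (hc : atlas c) (V : set M) (oV : open V) (Vc : V `<=` chart_dom c).
Implicit Types (x y t : loc_gfields oV).
Local Notation cl := (@lcl _ _ _ _ oV).
Local Notation d := (ld hc oV Vc).
Local Notation br := (@lbr _ _ _ _ hc _ oV Vc).
Local Notation pr := (@lpr _ _ _ _ _ hphi _ oV).
Local Notation num := (lnum hphi hc oV Vc).
Local Notation f l := (loc_sheaf oV (delta l)).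

Lemma loc_delta_sum : \sum_(l <- eig) f l = d.
Proof.
apply: endo_eq => w; apply: fval_eq => p Vp; rewrite ldE // (delta_total oV (smooth_fval w) Vp).
have -> : spectrum phi = [set` eig].
  by apply/seteqP; split=> l /= /(mem_eigenvalues hphi).
rewrite -fsbig_seq ?eigenvalues_uniq // endo_sumE fval_sum.
by apply: eq_bigr => l _; exact: loc_sheaf_funE.
Qed.

Lemma loc_delta_self l : l \in eig -> l != 0 -> comm (num l) (f l) = f l.
Proof.
move=> /(mem_eigenvalues hphi) ls l0.
by rewrite (has_degree_comm hphi l0 hc oV Vc (delta_self ls (elimN eqP l0))) mulr1z.
Qed.

Lemma loc_delta_other l m : l \in eig -> m \in eig -> m != 0 -> m != l -> m != - l -> comm (num m) (f l) = 0.
Proof.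
move=> /(mem_eigenvalues hphi) ls /(mem_eigenvalues hphi) ms m0 ml ml'.
by rewrite (has_degree_comm hphi m0 hc oV Vc (delta_other ls ms (elimN eqP m0) (elimN eqP ml) (elimN eqP ml'))) mulr0z.
Qed.

Lemma lnum_opp_cl l x : comm (num l + num (- l)) (cl x) = 0.
Proof. by rewrite commDl !lnumE opprK -raddfD /= addrA subrK subrr raddf0. Qed.

Lemma lnum_opp_num l m : comm (num l + num (- l)) (num m) = 0.
Proof.
rewrite {3}/lnum /number comm_sumr big1 // => a _.
by rewrite commMr !lnum_opp_cl mul0r mulr0 addr0.
Qed.

Lemma lnum_opp_d l : comm (num l + num (- l)) d = 0.
Proof.
exact: (number_central_metric (@lpairing_comm _ _ _ _ oV) (@lpr_idem _ _ _ _ _ hphi _ oV)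
  (@lpr_adj _ _ _ _ _ hphi _ oV) (@lderived_bracket _ _ _ _ hc _ oV Vc) (lmetric_frame hc oV Vc)).
Qed.

(** N_l + N_(-l) commutes with d and, by the prescribed degrees, with each delta_m for m different
    from l and -l. Removing these from d leaves the two components at l and -l. *)
Lemma lnum_opp_delta l : l \in eig -> l != 0 -> comm (num l + num (- l)) (f l + f (- l)) = 0.
Proof.
move=> lE l0; have lE' : - l \in eig by rewrite eigenvalues_opp.
have ll : - l != l by rewrite eq_sym label_neq_opp.
have := lnum_opp_d l; rewrite -loc_delta_sum comm_sumr (bigD1_seq l) ?eigenvalues_uniq //=.
have uF : uniq [seq i <- eig | i != l] by apply: filter_uniq; exact: eigenvalues_uniq.
have mF : - l \in [seq i <- eig | i != l] by rewrite mem_filter ll lE'.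
rewrite -big_filter (bigD1_seq (- l) mF uF) /=.
rewrite big_seq_cond big1 ?addr0; first by rewrite commDr.
move=> m /andP[]; rewrite mem_filter => /andP[ml mE] ml'.
have N1 : comm (num l) (f m) = 0.
  apply: loc_delta_other => //; first by rewrite eq_sym.
  by rewrite -eqr_oppLR eq_sym.
have N2 : comm (num (- l)) (f m) = 0.
  apply: loc_delta_other => //; first by rewrite oppr_eq0.
    by rewrite eq_sym.
  by rewrite (inj_eq oppr_inj) eq_sym.
by rewrite commDl N1 N2 addr0.
Qed.

(** The two summands, indexed by the boolean, into which twice the component at l is cut so that
    each has a weight for N_S. Only -l in S calls for a genuine splitting, namely that of
    [opposite_weight_pos] and [opposite_weight_neg]. *)
Definition piece (S : seq R[i]) (k : R[i] * bool) : endo (loc_forms oV) :=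
  let: (l, b) := k in
  if - l \in S then
    (if b then comm (num (- l) + num l) (f l) else f l *+ 2 - comm (num (- l) + num l) (f l))
  else if b then 0 else f l *+ 2.

Definition piece_weight (S : seq R[i]) (k : R[i] * bool) : int :=
  let: (l, b) := k in
  if - l \in S then (if b then 1 else -1) else (l \in S)%:Z.

Lemma piece_weight_bound S k : [\/ piece_weight S k = -1, piece_weight S k = 0 | piece_weight S k = 1].
Proof.
by case: k => l [] /=; case: ifP => // _; [exact: Or33| |exact: Or31|]; case: (l \in S); by [exact: Or33|exact: Or32].
Qed.

Lemma piece_sum S l : piece S (l, true) + piece S (l, false) = f l *+ 2.
Proof. by rewrite /piece; case: ifP => _; rewrite ?add0r // addrC subrK. Qed.

Variable S : seq R[i].
Hypotheses (uS : uniq S) (S0 : 0 \notin S) (SE : {subset S <= eig}).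
Hypothesis SN : forall l, l \in S -> - l \notin S.
Local Notation NS := (\sum_(l <- S) num l).

Lemma S_neq0 l : l \in S -> l != 0.
Proof. by move=> lS; apply: contraNneq S0 => <-. Qed.

Lemma comm_NS_other l (g : endo (loc_forms oV)) (h : endo (loc_forms oV)) :
  (forall m, m \in S -> m != l -> comm (num m) g = 0) -> (l \in S -> comm (num l) g = h) ->
  comm NS g = if l \in S then h else 0.
Proof.
move=> H0 H1; rewrite comm_suml; case: ifP => lS.
  rewrite (bigD1_seq l) //= H1 // big_seq_cond big1 ?addr0 // => m /andP[mS ml]; exact: H0.
by rewrite big_seq big1 // => m mS; apply: H0 => //; apply: contraFneq lS => <-.
Qed.

Lemma comm_NS_cl l x : pr l x = x -> - l \notin S -> comm NS (cl x) = cl x *~ (- (l \in S)%:Z).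
Proof.
move=> lx lS; rewrite (@comm_NS_other l _ (- cl x)).
- by case: (l \in S); rewrite ?mulrN1z // mulr0z.
- move=> m mS ml; rewrite lnumE (lpr_other lx (_ : l != m)) ?(lpr_other lx (_ : l != - m)) 1?eq_sym //.
    by rewrite subrr raddf0.
  by rewrite eqr_oppLR; apply: contraNneq lS => <-.
move=> lS'; rewrite lnumE lx (lpr_other lx) ?sub0r ?raddfN //.
by rewrite -addr_eq0 double_complex_neq0 // S_neq0.
Qed.

(** Members of S other than l and -l commute with the component at l, and S contains at most one of
    these two. If it is l, the prescribed degree gives weight 1; if it is -l, the opposite-label
    lemmas give 1 and -1. *)
Lemma comm_NS_piece k : k.1 \in eig -> comm NS (piece S k) = piece S k *~ piece_weight S k.
Proof.
case: k => l b /= lE; case: ifP => lS.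
  have l0 : - l != 0 := S_neq0 lS.
  have mE : - l \in eig by rewrite eigenvalues_opp.
  have ab : comm (num (- l) + num l) (f (- l) + f l) = 0.
    by have := lnum_opp_delta mE l0; rewrite opprK.
  have tN : comm (num (- l) + num l) (num (- l)) = 0.
    by have := lnum_opp_num (- l) (- l); rewrite opprK.
  have l0' : l != 0 by rewrite -oppr_eq0.
  have other m : m \in S -> m != - l -> comm (num m) (f l) = 0.
    move=> mS ml; apply: loc_delta_other => //; [exact: SE|exact: S_neq0|].
    by apply: contraTneq mS => ->; rewrite -[l]opprK SN.
  have other' m : m \in S -> m != - l -> comm (num m) (comm (num (- l) + num l) (f l)) = 0.
    move=> mS ml; have tm : comm (num (- l) + num l) (num m) = 0.
      by have := lnum_opp_num (- l) m; rewrite opprK.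
    transitivity (comm (num (- l) + num l) (comm (num m) (f l)) - comm (comm (num (- l) + num l) (num m)) (f l)).
      rewrite /comm; ncring.
    by rewrite other // tm /comm !(mulr0, mul0r) !subrr.
  case: b.
    rewrite mulr1z (@comm_NS_other (- l) _ (comm (num (- l) + num l) (f l))) ?lS //.
    by move=> _; exact: (opposite_weight_pos (loc_delta_self mE l0) (loc_delta_self lE l0') tN ab).
  rewrite mulrN1z (@comm_NS_other (- l) _ (- (f l *+ 2 - comm (num (- l) + num l) (f l)))) ?lS //.
    move=> m mS ml; transitivity (comm (num m) (f l) *+ 2 - comm (num m) (comm (num (- l) + num l) (f l))).
      by rewrite !mulr2n /comm; ncring.
    by rewrite other // other' // mul0rn subrr.
  by move=> _; exact: (opposite_weight_neg (loc_delta_self mE l0) (loc_delta_self lE l0') tN ab).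
case: b; first by rewrite /comm mulr0 mul0r subrr mul0rz.
rewrite (@comm_NS_other l _ (f l *+ 2)).
- by case: (l \in S); rewrite ?mulr1z ?mulr0z.
- move=> m mS ml; rewrite mulr2n commDr loc_delta_other ?addr0 //; [exact: SE|exact: S_neq0|].
  by apply: contraTneq mS => ->; rewrite lS.
by move=> lS'; rewrite mulr2n commDr loc_delta_self //; exact: S_neq0.
Qed.

Lemma comm_NS_pairing x y : comm NS (pairing cl x y) = 0.
Proof.
rewrite comm_suml big1 // => l _; rewrite /lnum /number comm_suml big1 // => a _.
have C := lpairing_comm x y; rewrite commMl /comm !C !subrr mulr0 mul0r addr0 //.
Qed.

Lemma weight_br_eq0 l m k x y t : pr l x = x -> pr m y = y -> pr k t = t ->
  - l \notin S -> - m \notin S -> - k \notin S ->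
  (1 < (l \in S) + (m \in S) + (k \in S))%N ->
  pairing cl (br x y) t = 0.
Proof.
move=> lx my kt lS mS kS big.
have E : triple d (cl x) (cl y) (cl t) = pairing cl (br x y) t.
  exact: (congr1 (fun z => z * cl t + cl t * z) (lderived_bracket hc Vc x y)).
pose J := [seq (l, b) | l <- eig, b <- [:: true; false]].
have J2 : \sum_(j <- J) piece S j = d *+ 2.
  rewrite /J big_allpairs_dep /= -loc_delta_sum -sumrMnl; apply: eq_bigr => l' _.
  by rewrite !big_cons big_nil addr0 piece_sum.
apply: (@loc_endo_torsion_free _ _ _ _ oV _ (1 + 1)) => //.
rewrite -E mulrzDr mulr1z -tripleD -mulr2n -J2.
(* [weight_eq0] wants a weight for every index, but only the pieces at eigenvalues have one;
   elsewhere they are replaced by 0. *)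
pose F (j : R[i] * bool) := if j.1 \in eig then piece S j else 0.
have -> : \sum_(j <- J) piece S j = \sum_(j <- J) F j.
  apply: eq_big_seq => j /allpairsP [[l' b] /= [lE _ ->]].
  by rewrite /F /= lE.
have Fw j : comm NS (F j) = F j *~ piece_weight S j.
  rewrite /F; case: ifP => [/comm_NS_piece //|_].
  by rewrite /comm mulr0 mul0r subrr mul0rz.
apply: (weight_eq0 (@loc_endo_torsion_free _ _ _ _ oV) Fw (comm_NS_cl lx lS) (comm_NS_cl my mS) (comm_NS_cl kt kS)).
  (* By [big] the three vectors weigh at most -2 together, and a piece weighs at most 1, so the
     total is never 0. *)
  move=> j; have := piece_weight_bound S j.
  by case=> ->; move: big; case: (l \in S); case: (m \in S); case: (k \in S).
have -> : \sum_(j <- J) F j = d *+ 2.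
  rewrite -J2; apply: eq_big_seq => j /allpairsP [[l' b] /= [lE _ ->]].
  by rewrite /F /= lE.
by rewrite mulr2n tripleD E commDr comm_NS_pairing addr0.
Qed.

End Chart.

End DecompositionIntegrable.

Section LocalIntegrability.
Variables (R : realType) (n : nat) (M : smooth_manifold R n) (phi : gendo M) (P : {poly R}).
Hypothesis hphi : gen_poly_structure phi P.
Local Notation eig := (eigenvalues phi P).

Hypothesis lpr_br_eq0 : forall (c : chart R n M) (hc : atlas c) (V : set M) (oV : open V)
  (Vc : V `<=` chart_dom c) (mu nu k : R[i]) (x y : loc_gfields oV),
  mu \in eig -> nu \in eig -> k \in eig -> mu + nu != 0 -> k != mu -> k != nu ->
  lpr hphi mu x = x -> lpr hphi nu y = y -> lpr hphi k (lbr hc Vc x y) = 0.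

Lemma integrable_of_local (mu nu : R[i]) : spectrum phi mu -> spectrum phi nu ->
    forall (U : set M) (x y : cgfield M), open U ->
      is_section (geigen phi P mu) U x -> is_section (geigen phi P nu) U y ->
    forall p : M, U p -> exists a b : cpx (gtan p),
      [/\ geigen phi P mu p a, geigen phi P nu p b
        & (mu + nu) *: dorfmanC x y p = a + b].
Proof.
move=> smu snu U x y oU [sx xL] [sy yL] p Up.
have g0 l : geigen phi P l p 0 by apply/(gprojP hphi); exact: gproj0.
have [mn|mn] := eqVneq (mu + nu) 0.
  by exists 0, 0; split=> //; rewrite mn scale0r addr0.
have [c hc cp] := atlas_cover p.
have oV : open (U `&` chart_dom c) by apply: openI => //; exact: chart_open_dom.
have Vc : U `&` chart_dom c `<=` chart_dom c by exact: subIsetr.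
have sx' := smooth_cgfield_sub (@subIsetl _ U (chart_dom c)) sx.
have sy' := smooth_cgfield_sub (@subIsetl _ U (chart_dom c)) sy.
pose x' := cut_cgfield oV sx'; pose y' := cut_cgfield oV sy'.
have Vp : (U `&` chart_dom c) p by split.
have xx q : (U `&` chart_dom c) q -> x q = gval x' q by move=> Vq; rewrite cut_cgfieldE.
have yy q : (U `&` chart_dom c) q -> y q = gval y' q by move=> Vq; rewrite cut_cgfieldE.
have x'L : lpr hphi mu x' = x'.
  by apply/lpr_section; split=> [|q Vq]; [exact: smooth_gval|rewrite -xx //; apply: xL; case: Vq].
have y'L : lpr hphi nu y' = y'.
  by apply/lpr_section; split=> [|q Vq]; [exact: smooth_gval|rewrite -yy //; apply: yL; case: Vq].
have /(mem_eigenvalues hphi) muE := smu; have /(mem_eigenvalues hphi) nuE := snu.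
have zE : dorfmanC x y p = gval (lbr hc Vc x' y') p.
  by rewrite (lbrE hc Vc x' y' Vp); exact: (dorfmanC_ext oV Vp sx' sy' (smooth_gval _) (smooth_gval _) xx yy).
have z0 k : k \in eig -> k != mu -> k != nu -> gproj hphi k (dorfmanC x y p) = 0.
  move=> kE km kn; rewrite zE -(lprE hphi k (lbr hc Vc x' y') Vp).
  by rewrite (lpr_br_eq0 hc Vc muE nuE kE mn km kn x'L y'L).
have gE l k (z : cpx (gtan p)) : geigen phi P l p (k *: gproj hphi l z).
  by apply/(gprojP hphi); rewrite gprojZ gproj_idem.
exists ((mu + nu) *: gproj hphi mu (dorfmanC x y p)).
(* When the two labels coincide the whole bracket already sits in the first summand and must not be
   counted twice. *)
exists (if mu == nu then 0 else (mu + nu) *: gproj hphi nu (dorfmanC x y p)); split=> //.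
  by case: ifP.
rewrite -{1}(gproj_total hphi (dorfmanC x y p)) (bigD1_seq mu) ?eigenvalues_uniq //= scalerDr; congr (_ + _).
case: eqVneq => [mnE|nmn].
  rewrite big_seq_cond big1 ?scaler0 // => k /andP[kE km].
  by apply: z0 => //; rewrite -mnE.
congr (_ *: _); rewrite -big_filter.
have uF : uniq [seq i <- eig | i != mu] by apply: filter_uniq; exact: eigenvalues_uniq.
have mF : nu \in [seq i <- eig | i != mu] by rewrite mem_filter eq_sym nmn nuE.
rewrite (bigD1_seq nu mF uF) /= big_seq_cond big1 ?addr0 // => k /andP[].
by rewrite mem_filter => /andP[km kE] kn; exact: z0.
Qed.

End LocalIntegrability.

Section DecompositionImpliesIntegrable.
Variables (R : realType) (n : nat) (M : smooth_manifold R n) (phi : gendo M) (P : {poly R}).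
Hypothesis hphi : gen_poly_structure phi P.
Local Notation eig := (eigenvalues phi P).
Variable delta : R[i] -> sheaf_endo M.
Hypothesis delta_total : forall (U : set M) (w : cform M), open U -> smooth_cform U w ->
  forall p : M, U p -> exterior_dC w p = \sum_(lam \in spectrum phi) delta lam U w p.
Hypothesis delta_self : forall lam : R[i], spectrum phi lam -> lam <> 0 ->
  has_degree (geigen phi P lam) (geigen phi P (- lam)) 1 (delta lam).
Hypothesis delta_other : forall lam mu : R[i], spectrum phi lam -> spectrum phi mu ->
  mu <> 0 -> mu <> lam -> mu <> - lam ->
  has_degree (geigen phi P mu) (geigen phi P (- mu)) 0 (delta lam).

Lemma decomposition_lpr_br (c : chart R n M) (hc : atlas c) (V : set M) (oV : open V)
  (Vc : V `<=` chart_dom c) (mu nu k : R[i]) (x y : loc_gfields oV) :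
  mu \in eig -> nu \in eig -> k \in eig -> mu + nu != 0 -> k != mu -> k != nu ->
  lpr hphi mu x = x -> lpr hphi nu y = y -> lpr hphi k (lbr hc Vc x y) = 0.
Proof.
move=> muE nuE kE mn km kn xL yL.
(* The label 0 has no grading and is dropped. The assumptions on mu, nu and k ensure that S never
   contains two opposite labels. *)
pose S := undup [seq l <- [:: mu; nu; - k] | l != 0].
have inS (l : R[i]) : (l \in S) = (l != 0) && [|| l == mu, l == nu | l == - k].
  by rewrite mem_undup mem_filter !inE.
have self (l : R[i]) : - l != 0 -> - l = l -> False.
  rewrite oppr_eq0 => l0 e; have := double_complex_neq0 l0.
  by rewrite -{1}e addNr eqxx.
have muS : - mu \notin S.
  rewrite inS; apply/negP => /andP[m0 /or3P[/eqP/(self _ m0)//|/eqP e|/eqP/oppr_inj e]].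
    by rewrite -e subrr eqxx in mn.
  by rewrite e eqxx in km.
have nuS : - nu \notin S.
  rewrite inS; apply/negP => /andP[m0 /or3P[/eqP e|/eqP/(self _ m0)//|/eqP/oppr_inj e]].
    by rewrite -e addNr eqxx in mn.
  by rewrite e eqxx in kn.
have kS : - - k \notin S.
  rewrite opprK inS; apply/negP => /andP[m0]; rewrite (negbTE km) (negbTE kn) => /eqP e.
  by apply: (self k _ (esym e)); rewrite oppr_eq0.
have uS : uniq S by exact: undup_uniq.
have S0 : 0 \notin S by rewrite inS eqxx.
have SE : {subset S <= eig}.
  by move=> l; rewrite inS => /andP[_ /or3P[]/eqP ->//]; rewrite eigenvalues_opp.
have SN l : l \in S -> - l \notin S.
  by rewrite inS => /andP[_ /or3P[]/eqP ->].
(* At most one of the three labels is 0, because mu + nu is nonzero and k differs from mu and nu.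
   Coinciding labels are counted separately, one for each vector. *)
have card : (1 < (mu \in S) + (nu \in S) + (- k \in S))%N.
  rewrite !inS !eqxx !orbT !andbT oppr_eq0.
  case: (eqVneq mu 0) => [mu0|_]; case: (eqVneq nu 0) => [nu0|_]; case: (eqVneq k 0) => [k0|_] //.
  - by rewrite mu0 nu0 addr0 eqxx in mn.
  - by rewrite mu0 nu0 addr0 eqxx in mn.
  - by rewrite mu0 k0 eqxx in km.
  - by rewrite nu0 k0 eqxx in kn.
(* The projection to k is moved onto t, where it becomes the projection to -k, so it is enough to
   test the bracket against sections of L_(-k). *)
have pair0 t : pairing (lcl (oV := oV)) (lpr hphi k (lbr hc Vc x y)) t = 0.
  rewrite (lpr_adj hphi k (lbr hc Vc x y) t).
  exact: (weight_br_eq0 delta_total delta_self delta_other hc Vc uS S0 SE SN xL yL (lpr_idem hphi (- k) t) muS nuS kS card).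
apply: (lcl_inj hc Vc); rewrite raddf0.
have [fe _] := lmetric_frame hc oV Vc.
by rewrite (fe (lpr hphi k (lbr hc Vc x y))) big1 // => a _; rewrite pair0 mul0r.
Qed.

End DecompositionImpliesIntegrable.

(** * Shifted torsion and integrability *)

Lemma quadratic_scale (K : comNzRingType) (W : lmodType K) (k l m : K) (g : W) :
  k *: (k *: g) + l *: (m *: g) - k *: (l *: g + m *: g) = ((k - l) * (k - m)) *: g.
Proof.
rewrite scalerDr !scalerA -!scalerDl -scalerBl; congr (_ *: _).
ring.
Qed.

Section ShiftedTorsion.
Variables (R : realType) (n : nat) (M : smooth_manifold R n) (phi : gendo M) (P : {poly R}).
Hypothesis hphi : gen_poly_structure phi P.
Local Notation eig := (eigenvalues phi P).
Variable phis : gendo M.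
Hypothesis sphis : smooth_gendo phis.
Hypothesis phis_eigen : forall p lam, spectrum phi lam -> forall x : cpx (gtan p),
  geigen phi P lam p x -> cpx_lin (phis p) x = lam *: x.
Implicit Types (p : M) (l m k : R[i]).

Lemma cpx_lin_linear p (f : {linear gtan p -> gtan p}) : linear (cpx_lin f).
Proof.
move=> k x y; rewrite /cpx_lin !cpx_scaleE.
by congr (_, _); rewrite !linearD ?linearN !linearZ.
Qed.

(** The eigenbundles span, so the action on them determines the endomorphism; in particular the
    semisimple part of phi is unique. *)
Lemma semisimple_partE p (z : cpx (gtan p)) :
  cpx_lin (phis p) z = \sum_(l <- eig) l *: gproj hphi l z.
Proof.
rewrite -{1}(gproj_total hphi z).
have S (r : seq R[i]) (F : R[i] -> cpx (gtan p)) :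
    cpx_lin (phis p) (\sum_(l <- r) F l) = \sum_(l <- r) cpx_lin (phis p) (F l).
  have f0 : cpx_lin (phis p) 0 = 0 by rewrite /cpx_lin !linear0.
  elim: r => [|l r IH]; first by rewrite !big_nil.
  by rewrite !big_cons -IH -[F l in LHS]scale1r cpx_lin_linear scale1r.
rewrite S; apply: eq_big_seq => l /(mem_eigenvalues hphi) lE.
by apply: phis_eigen => //; apply/(gprojP hphi); exact: gproj_idem.
Qed.

Lemma gproj_semisimple p k (z : cpx (gtan p)) : k \in eig ->
  gproj hphi k (cpx_lin (phis p) z) = k *: gproj hphi k z.
Proof.
move=> kE; rewrite semisimple_partE (bigD1_seq k) ?eigenvalues_uniq //=.
rewrite gprojD gprojZ gproj_idem.
have -> : gproj hphi k (\sum_(l <- eig | l != k) l *: gproj hphi l z) = 0.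
  elim/big_rec: _ => [|l s lk IH]; first exact: gproj0.
  by rewrite gprojD IH gprojZ gproj_ortho ?scaler0 ?addr0 // eq_sym.
by rewrite addr0.
Qed.

Section Chart.
Variables (c : chart R n M) (hc : atlas c) (V : set M) (oV : open V) (Vc : V `<=` chart_dom c).
Local Notation X := (loc_gfields oV).
Local Notation br := (@lbr _ _ _ _ hc _ oV Vc).
Local Notation cl := (@lcl _ _ _ _ oV).
Local Notation pr := (@lpr _ _ _ _ _ hphi _ oV).
Implicit Types (x y z : X).

Fact real_psi_subproof (x : local_gfields oV) : gfield_space oV (fun p => phis p (x p)).
Proof.
split; first exact: sphis (local_gfield_smooth x).
by move=> p Vp; rewrite local_gfield_out // linear0.
Qed.
Definition real_psi (x : local_gfields oV) : local_gfields oV := Sect (real_psi_subproof x).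
Definition psi x : X := (real_psi x.1, real_psi x.2).

Lemma psiE x p : gval (psi x) p = cpx_lin (phis p) (gval x p). Proof. by []. Qed.

Lemma psiD x y : psi (x + y) = psi x + psi y.
Proof.
by apply: gval_eq => p _; rewrite psiE; have := cpx_lin_linear (phis p) 1 (gval x p) (gval y p); rewrite !scale1r.
Qed.

Lemma lbrDl x y z : br (x + y) z = br x z + br y z.
Proof.
apply: (lcl_inj hc Vc); rewrite raddfD /= -!(lderived_bracket hc Vc).
have -> : lie cl (ld hc oV Vc) (x + y) = lie cl (ld hc oV Vc) x + lie cl (ld hc oV Vc) y.
  by rewrite /lie raddfD /= mulrDl mulrDr addrACA.
exact: commDl.
Qed.

Lemma lbrDr x y z : br x (y + z) = br x y + br x z.
Proof.
apply: (lcl_inj hc Vc); rewrite raddfD /= -!(lderived_bracket hc Vc) -commDr.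
by congr (comm _ _); rewrite -raddfD.
Qed.

(** Local sections were set up as mere abelian groups; complex scalars come back here, since
    eigenvalues now multiply sections. *)
Definition lscale (k : R[i]) x : X := cut_cgfield oV (smooth_cgfield_Z k oV (smooth_gval x)).
Definition fscale (k : R[i]) (w : loc_forms oV) : loc_forms oV :=
  cut_cform oV (smooth_cform_Z k oV (smooth_fval w)).

Lemma lscaleE k x p : V p -> gval (lscale k x) p = k *: gval x p.
Proof. exact: cut_cgfieldE. Qed.
Lemma fscaleE k w p : V p -> fval (fscale k w) p = k *: fval w p.
Proof. exact: cut_cformE. Qed.

Lemma fscale_zmod k : zmod_morphism (fscale k).
Proof.
move=> w w'; apply: fval_eq => p Vp.
by rewrite (fscaleE k (w - w') Vp) !fvalB (fscaleE k w Vp) (fscaleE k w' Vp) scalerBr.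
Qed.
Definition sc k : endo (loc_forms oV) := Endo (fscale_zmod k).

Lemma lcl_scale k x : cl (lscale k x) = sc k * cl x.
Proof.
apply: endo_eq => w; apply: fval_eq => p Vp; rewrite (endoME (sc k) (cl x)).
by rewrite (fscaleE k (cl x w) Vp) (lclE (lscale k x) w) (lclE x w) (lscaleE k x Vp) cliffordC_Zl.
Qed.

Lemma lcl_sc k x : cl x * sc k = sc k * cl x.
Proof.
apply: endo_eq => w; apply: fval_eq => p Vp; rewrite (endoME (sc k) (cl x)) (endoME (cl x) (sc k)).
rewrite (fscaleE k (cl x w) Vp) (lclE x (fscale k w)) (lclE x w).
by rewrite (fscaleE k w Vp) cliffordC_Zr.
Qed.

Lemma ld_sc k : ld hc oV Vc * sc k = sc k * ld hc oV Vc.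
Proof.
apply: endo_eq => w; apply: fval_eq => p Vp.
rewrite (endoME (sc k) (ld hc oV Vc)) (endoME (ld hc oV Vc) (sc k)).
rewrite (fscaleE k (ld hc oV Vc w) Vp) (ldE hc Vc (fscale k w) Vp) (ldE hc Vc w Vp).
have [_ lin ext] := @local_op_exterior_d R n M.
have s0 := @smooth_cform_0 _ _ M V.
have d0 : exterior_dC (fun q : M => 0 : cpx (forms_at q)) p = 0.
  have := lin V (-1) _ _ oV s0 s0 p Vp.
  rewrite scaleN1r addNr => <-; congr (exterior_dC _ p).
  by apply: functional_extensionality_dep => q; rewrite scaler0 addr0.
have := lin V k _ _ oV (smooth_fval w) s0 p Vp; rewrite d0 addr0 => <-.
apply: (ext V) => //; first exact: smooth_fval.
  by apply: smooth_cform_D => //; apply: smooth_cform_Z => //; exact: smooth_fval.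
by move=> q Vq; rewrite (fscaleE k w Vq) addr0.
Qed.

Lemma comm_sc k x : comm (sc k) (cl x) = 0.
Proof. by rewrite /comm lcl_sc subrr. Qed.

Lemma lbr_scalel k x y : br (lscale k x) y = lscale k (br x y).
Proof.
apply: (lcl_inj hc Vc); rewrite (lcl_scale k (br x y)) -!(lderived_bracket hc Vc).
have -> : lie cl (ld hc oV Vc) (lscale k x) = sc k * lie cl (ld hc oV Vc) x.
  transitivity (ld hc oV Vc * (sc k * cl x) + sc k * cl x * ld hc oV Vc).
    by rewrite -(lcl_scale k x).
  by rewrite mulrA ld_sc /lie; ncring.
by rewrite commMl comm_sc mul0r addr0.
Qed.

Lemma lbr_scaler k x y : br x (lscale k y) = lscale k (br x y).
Proof.
apply: (lcl_inj hc Vc); rewrite (lcl_scale k (br x y)) -!(lderived_bracket hc Vc) (lcl_scale k y).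
rewrite commMr (_ : comm (lie cl (ld hc oV Vc) x) (sc k) = 0) ?mul0r ?add0r //.
have E1 := lcl_sc k x; have E2 := ld_sc k.
transitivity (ld hc oV Vc * (cl x * sc k) + cl x * (ld hc oV Vc * sc k)
  - (sc k * ld hc oV Vc) * cl x - (sc k * cl x) * ld hc oV Vc); first by rewrite /comm /lie; ncring.
rewrite E1 E2; transitivity (ld hc oV Vc * sc k * cl x + cl x * sc k * ld hc oV Vc
  - sc k * ld hc oV Vc * cl x - sc k * cl x * ld hc oV Vc); first by ncring.
by rewrite E1 E2; ncring.
Qed.

Lemma psi_scale k x : psi (lscale k x) = lscale k (psi x).
Proof.
apply: gval_eq => p Vp; rewrite psiE (lscaleE k x Vp) (lscaleE k (psi x) Vp) psiE.
have := cpx_lin_linear (phis p) k (gval x p) 0.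
by rewrite (_ : cpx_lin (phis p) 0 = 0) ?addr0 // /cpx_lin !linear0.
Qed.

Definition torsion x y : X := psi (psi (br x y)) + br (psi x) (psi y) - psi (br (psi x) y + br x (psi y)).
Definition shifted x y : X := torsion (psi x) y + torsion x (psi y).

Lemma sum4_add (Z : zmodType) (a a' b b' e e' d d' : Z) :
  a + a' + (b + b') - (e + e' + (d + d')) = (a + b - (e + d)) + (a' + b' - (e' + d')).
Proof. by rewrite (addrACA a) (addrACA e) (opprD (e + d)) [LHS]addrACA. Qed.

Lemma torsionDl x x' y : torsion (x + x') y = torsion x y + torsion x' y.
Proof. by rewrite /torsion !(psiD, lbrDl) sum4_add. Qed.

Lemma torsionDr x y y' : torsion x (y + y') = torsion x y + torsion x y'.
Proof. by rewrite /torsion !(psiD, lbrDr) sum4_add. Qed.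

Lemma shiftedDl x x' y : shifted (x + x') y = shifted x y + shifted x' y.
Proof. by rewrite /shifted psiD !torsionDl addrACA. Qed.

Lemma shiftedDr x y y' : shifted x (y + y') = shifted x y + shifted x y'.
Proof. by rewrite /shifted psiD !torsionDr addrACA. Qed.

Lemma lscaleD k x y : lscale k (x + y) = lscale k x + lscale k y.
Proof. by apply: gval_eq => p Vp; rewrite gvalD (lscaleE k (x + y) Vp) (lscaleE k x Vp) (lscaleE k y Vp) gvalD scalerDr. Qed.

Lemma lscaleN k x : lscale k (- x) = - lscale k x.
Proof. by apply: gval_eq => p Vp; rewrite gvalN (lscaleE k (- x) Vp) (lscaleE k x Vp) gvalN scalerN. Qed.

Lemma torsion_scalel k x y : torsion (lscale k x) y = lscale k (torsion x y).
Proof. by rewrite /torsion !(psi_scale, lbr_scalel) -!lscaleD psi_scale -lscaleN -lscaleD. Qed.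

Lemma torsion_scaler k x y : torsion x (lscale k y) = lscale k (torsion x y).
Proof. by rewrite /torsion !(psi_scale, lbr_scaler) -!lscaleD psi_scale -lscaleN -lscaleD. Qed.

Lemma shifted_scalel k x y : shifted (lscale k x) y = lscale k (shifted x y).
Proof. by rewrite /shifted psi_scale !torsion_scalel -lscaleD. Qed.

Lemma shifted_scaler k x y : shifted x (lscale k y) = lscale k (shifted x y).
Proof. by rewrite /shifted psi_scale !torsion_scaler -lscaleD. Qed.

Lemma psi_eigen l x : l \in eig -> pr l x = x -> psi x = lscale l x.
Proof.
move=> /(mem_eigenvalues hphi) ls lx; apply: gval_eq => p Vp; rewrite psiE (lscaleE l x Vp).
by apply: phis_eigen => //; apply/(gprojP hphi); rewrite -(lprE hphi l x Vp) lx.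
Qed.

Lemma gproj_shifted l m k x y p : V p -> l \in eig -> m \in eig -> k \in eig ->
  pr l x = x -> pr m y = y ->
  gproj hphi k (gval (shifted x y) p) = ((l + m) * ((k - l) * (k - m))) *: gproj hphi k (gval (br x y) p).
Proof.
move=> Vp lE mE kE lx my.
rewrite /shifted (psi_eigen lE lx) (psi_eigen mE my) torsion_scalel torsion_scaler.
rewrite gvalD (lscaleE l _ Vp) (lscaleE m _ Vp) -scalerDl gprojZ -[RHS]scalerA; congr (_ *: _).
rewrite /torsion (psi_eigen lE lx) (psi_eigen mE my) !(lbr_scalel, lbr_scaler).
move: (br x y) => z.
have [G GE] : {G : X -> cpx (gtan p) | forall e, gproj hphi k (gval e p) = G e} by eexists.
have Gpsi e : G (psi e) = k *: G e by rewrite -!GE psiE gproj_semisimple.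
have GD e e' : G (e + e') = G e + G e' by rewrite -!GE gvalD gprojD.
have GS j e : G (lscale j e) = j *: G e by rewrite -!GE (lscaleE j e Vp) gprojZ.
have GN e : G (- e) = - G e by rewrite -!GE gvalN -scaleN1r gprojZ scaleN1r.
rewrite !GE !(GD, GN, Gpsi, GS).
exact: quadratic_scale.
Qed.

Lemma real_psi0 : real_psi 0 = 0.
Proof. by apply: sect_eq => p; exact: linear0. Qed.

Lemma op_br0l (y : local_gfields oV) : op_br hc Vc 0 y = 0.
Proof.
apply: (op_cl_inj hc Vc); rewrite -(op_derived_bracket hc Vc) /lie raddf0 mulr0 mul0r addr0.
by rewrite /comm mul0r mulr0 subrr; exact: (esym (raddf0 (@op_cl _ _ _ _ oV))).
Qed.

Lemma op_br0r (x : local_gfields oV) : op_br hc Vc x 0 = 0.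
Proof.
apply: (op_cl_inj hc Vc); rewrite -(op_derived_bracket hc Vc).
have -> : op_cl (0 : local_gfields oV) = 0 by exact: (raddf0 (@op_cl _ _ _ _ oV)).
by rewrite /comm mul0r mulr0 subrr.
Qed.

Definition real_torsion (x y : local_gfields oV) : local_gfields oV :=
  real_psi (real_psi (op_br hc Vc x y)) + op_br hc Vc (real_psi x) (real_psi y)
  - real_psi (op_br hc Vc (real_psi x) y + op_br hc Vc x (real_psi y)).

Lemma lbr_real (x y : local_gfields oV) : br (x, 0) (y, 0) = (op_br hc Vc x y, 0).
Proof. by rewrite /lbr /cbr /= !op_br0l op_br0r subr0 addr0. Qed.

Lemma psi_real (x : local_gfields oV) : psi (x, 0) = (real_psi x, 0).
Proof. by rewrite /psi /= real_psi0. Qed.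

Lemma pair_real_add (x y : local_gfields oV) : ((x, 0) : X) + (y, 0) = (x + y, 0).
Proof. by congr (_, _); exact: addr0. Qed.

Lemma pair_real_opp (x : local_gfields oV) : - ((x, 0) : X) = (- x, 0).
Proof. by congr (_, _); exact: oppr0. Qed.

Lemma torsion_real (x y : local_gfields oV) : torsion (x, 0) (y, 0) = (real_torsion x y, 0).
Proof.
rewrite /torsion !psi_real !lbr_real !psi_real !pair_real_add psi_real pair_real_opp.
exact: pair_real_add.
Qed.

Lemma real_torsionE (x y : local_gfields oV) p : V p -> real_torsion x y p = CN_torsion phis x y p.
Proof.
move=> Vp; rewrite /real_torsion sectBE sectDE.
have E1 : real_psi (real_psi (op_br hc Vc x y)) p = phis p (phis p (op_br hc Vc x y p)) by [].
have E2 : real_psi (op_br hc Vc (real_psi x) y + op_br hc Vc x (real_psi y)) p =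
  phis p (op_br hc Vc (real_psi x) y p + op_br hc Vc x (real_psi y) p) by [].
by rewrite E1 E2 (op_brE hc Vc x y Vp) (op_brE hc Vc (real_psi x) (real_psi y) Vp)
  (op_brE hc Vc (real_psi x) y Vp) (op_brE hc Vc x (real_psi y) Vp).
Qed.

Lemma shifted_real (x y : local_gfields oV) : shifted (x, 0) (y, 0) =
  (real_torsion (real_psi x) y + real_torsion x (real_psi y), 0).
Proof. by rewrite /shifted !psi_real !torsion_real; exact: pair_real_add. Qed.

Lemma real_shiftedE (x y : local_gfields oV) p : V p ->
  (real_torsion (real_psi x) y + real_torsion x (real_psi y)) p = shifted_CN_torsion phis x y p.
Proof.
by move=> Vp; rewrite sectDE (real_torsionE (real_psi x) y Vp) (real_torsionE x (real_psi y) Vp).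
Qed.

Lemma loc_gfield_split x : x = (x.1, 0) + lscale 'i (x.2, 0).
Proof.
apply: gval_eq => p Vp; rewrite gvalD (lscaleE 'i (x.2, 0) Vp).
rewrite cpx_scaleE /= !scale0r !scale1r.
by congr (_, _); rewrite /= ?sub0r ?oppr0 ?addr0 ?add0r.
Qed.

(** The hypothesis concerns real sections. The complex shifted torsion is bilinear over complex
    scalars and restricts to the real one, so splitting both arguments into real and imaginary parts
    suffices. *)
Lemma weak_shifted_eq0 x y : weak_gen_Nijenhuis phis -> shifted x y = 0.
Proof.
move=> wN; have R0 (x1 y1 : local_gfields oV) : shifted (x1, 0) (y1, 0) = 0.
  rewrite shifted_real [X in (X, _)](_ : _ = 0) //; apply: local_gfield_eq => p Vp.
  by rewrite real_shiftedE //; apply: (wN V) => //; exact: local_gfield_smooth.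
have sc0 k : lscale k 0 = 0.
  by apply: gval_eq => p Vp; rewrite (lscaleE k 0 Vp) gval0 scaler0.
rewrite (loc_gfield_split x) (loc_gfield_split y) shiftedDl !shiftedDr.
by rewrite !(shifted_scalel, shifted_scaler) !R0 !sc0 !addr0.
Qed.

Lemma weak_lpr_br l m k x y : weak_gen_Nijenhuis phis ->
  l \in eig -> m \in eig -> k \in eig -> l + m != 0 -> k != l -> k != m ->
  pr l x = x -> pr m y = y -> pr k (br x y) = 0.
Proof.
move=> wN lE mE kE lm kl km lx my; apply: gval_eq => p Vp; rewrite (lprE hphi k (br x y) Vp).
have := gproj_shifted Vp lE mE kE lx my; rewrite weak_shifted_eq0 // gval0 gproj0 => /esym /eqP.
rewrite scaler_eq0 !mulf_eq0 (negbTE lm) !subr_eq0 (negbTE kl) (negbTE km) /= => /eqP ->.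
by [].
Qed.

Hypothesis integrable_loc : forall l m x y, pr l x = x -> pr m y = y -> l + m != 0 ->
  br x y = pr l (br x y) + (if l == m then 0 else pr m (br x y)).

(** The k component carries the factor (l + m) (k - l) (k - m). If this is nonzero, integrability
    says that the bracket has no component in L_k. *)
Lemma integrable_shifted_eigen l m x y : l \in eig -> m \in eig ->
  pr l x = x -> pr m y = y -> shifted x y = 0.
Proof.
move=> lE mE lx my; apply: gval_eq => p Vp; rewrite -[LHS](gproj_total hphi) gval0.
rewrite big_seq big1 // => k kE; rewrite (gproj_shifted Vp lE mE kE lx my).
have [->|lm] := eqVneq (l + m) 0; first by rewrite mul0r scale0r.
have [->|kl] := eqVneq k l; first by rewrite subrr mul0r mulr0 scale0r.
have [->|km] := eqVneq k m; first by rewrite subrr !mulr0 scale0r.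
rewrite -(lprE hphi k (br x y) Vp) (integrable_loc lx my lm).
have -> : pr k (pr l (br x y) + (if l == m then 0 else pr m (br x y))) = 0.
  apply: gval_eq => q Vq; rewrite (lprE hphi k _ Vq) gvalD gprojD.
  rewrite (lprE hphi l (br x y) Vq) (gproj_ortho hphi _ kl) add0r.
  case: ifP => _; first exact: gproj0.
  by rewrite (lprE hphi m (br x y) Vq) (gproj_ortho hphi _ km).
by rewrite gval0 scaler0.
Qed.

Lemma integrable_shifted x y : shifted x y = 0.
Proof.
have s0l z : shifted 0 z = 0 by apply: (addrI (shifted 0 z)); rewrite -shiftedDl !addr0.
have s0r z : shifted z 0 = 0 by apply: (addrI (shifted z 0)); rewrite -shiftedDr !addr0.
have sl (r : seq R[i]) (F : R[i] -> X) z : shifted (\sum_(l <- r) F l) z = \sum_(l <- r) shifted (F l) z.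
  by elim: r => [|l r IH]; rewrite ?big_nil // !big_cons shiftedDl IH.
have sr (r : seq R[i]) (F : R[i] -> X) z : shifted z (\sum_(l <- r) F l) = \sum_(l <- r) shifted z (F l).
  by elim: r => [|l r IH]; rewrite ?big_nil // !big_cons shiftedDr IH.
rewrite -(lpr_total hphi x) -(lpr_total hphi y) sl big_seq big1 // => l lE.
rewrite sr big_seq big1 // => m mE; apply: (integrable_shifted_eigen lE mE); exact: lpr_idem.
Qed.

End Chart.

Lemma shifted_CN_torsion_ext U (x y x' y' : gfield M) p : open U -> U p ->
  smooth_gfield U x -> smooth_gfield U y -> smooth_gfield U x' -> smooth_gfield U y' ->
  (forall q, U q -> x q = x' q) -> (forall q, U q -> y q = y' q) ->
  shifted_CN_torsion phis x y p = shifted_CN_torsion phis x' y' p.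
Proof.
move=> oU Up sx sy sx' sy' xx yy.
have S z : smooth_gfield U z -> smooth_gfield U (fun q => phis q (z q)) by exact: sphis.
have E (z z' : gfield M) : (forall q, U q -> z q = z' q) -> forall q, U q -> phis q (z q) = phis q (z' q).
  by move=> zz q Uq; rewrite zz.
have T (z t z' t' : gfield M) : smooth_gfield U z -> smooth_gfield U t -> smooth_gfield U z' -> smooth_gfield U t' ->
    (forall q, U q -> z q = z' q) -> (forall q, U q -> t q = t' q) ->
    CN_torsion phis z t p = CN_torsion phis z' t' p.
  move=> sz st sz' st' zz tt; rewrite /CN_torsion.
  rewrite (dorfman_ext oU Up sz st sz' st' zz tt).
  rewrite (dorfman_ext oU Up (S _ sz) (S _ st) (S _ sz') (S _ st') (E _ _ zz) (E _ _ tt)).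
  rewrite (dorfman_ext oU Up (S _ sz) st (S _ sz') st' (E _ _ zz) tt).
  by rewrite (dorfman_ext oU Up sz (S _ st) sz' (S _ st') zz (E _ _ tt)).
rewrite /shifted_CN_torsion (T _ _ _ _ (S _ sx) sy (S _ sx') sy' (E _ _ xx) yy).
by rewrite (T _ _ _ _ sx (S _ sy) sx' (S _ sy') xx (E _ _ yy)).
Qed.

End ShiftedTorsion.

Lemma iter_semiconj (T : Type) (h f g : T -> T) j y : (forall t, g (h t) = h (f t)) ->
  iter j g (h y) = h (iter j f y).
Proof. by move=> gh; elim: j => // j IH; rewrite !iterS IH gh. Qed.

Lemma mup_conj_real (R : realType) (Q : {poly R[i]}) (l : R[i]) : Q != 0 ->
  map_poly (@conjc R) Q = Q -> mup l^*%C Q = mup l Q.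
Proof.
move=> Q0 QC; have E j k : (j <= mup k^*%C Q)%N = (j <= mup k Q)%N.
  have XE : ('X - k^*%C%:P) ^+ j = map_poly (@conjc R) (('X - k%:P) ^+ j).
    by rewrite rmorphXn /= map_polyXsubC.
  have H1 := mup_geq k^*%C j Q0.
  have H2 := mup_geq k j Q0.
  have H3 := dvdp_map (@conjc R) (('X - k%:P) ^+ j) Q.
  rewrite QC in H3.
  rewrite -XE in H3.
  exact: (etrans H1 (etrans H3 (esym H2))).
have le1 : (mup l^*%C Q <= mup l Q)%N := etrans (esym (E _ l)) (leqnn _).
have le2 : (mup l Q <= mup l^*%C Q)%N := etrans (E _ l) (leqnn _).
exact: (anti_leq (introT andP (conj le1 le2))).
Qed.

(** * Construction of the semisimple part *)

Section SemisimplePart.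
Variables (R : realType) (n : nat) (M : smooth_manifold R n) (phi : gendo M) (P : {poly R}).
Hypothesis hphi : gen_poly_structure phi P.
Local Notation eig := (eigenvalues phi P).
Implicit Types (p : M) (l m k : R[i]).

Definition cpx_conj p (z : cpx (gtan p)) : cpx (gtan p) := (z.1, - z.2).

Lemma cpx_conjK p : involutive (@cpx_conj p).
Proof. by move=> z; rewrite /cpx_conj /= opprK -surjective_pairing. Qed.

Lemma cpx_conjD p (z z' : cpx (gtan p)) : cpx_conj (z + z') = cpx_conj z + cpx_conj z'.
Proof. by congr (_, _); rewrite /= opprD. Qed.

Lemma cpx_conjB p (z z' : cpx (gtan p)) : cpx_conj (z - z') = cpx_conj z - cpx_conj z'.
Proof. by congr (_, _); rewrite /= opprD. Qed.

Lemma cpx_conjZ p k (z : cpx (gtan p)) : cpx_conj (k *: z) = k^*%C *: cpx_conj z.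
Proof.
case: k => a b; rewrite !cpx_scaleE; congr (_, _) => /=.
  by rewrite scalerN scaleNr opprK.
by rewrite opprD scalerN scaleNr.
Qed.

Lemma cpx_conj_sum p (r : seq R[i]) (F : R[i] -> cpx (gtan p)) :
  cpx_conj (\sum_(l <- r) F l) = \sum_(l <- r) cpx_conj (F l).
Proof.
elim: r => [|l r IH]; last by rewrite !big_cons cpx_conjD IH.
by rewrite !big_nil; congr (_, _); exact: oppr0.
Qed.

Lemma cpx_conj_lin p (f : {linear gtan p -> gtan p}) (z : cpx (gtan p)) :
  cpx_conj (cpx_lin f z) = cpx_lin f (cpx_conj z).
Proof. by rewrite /cpx_conj /cpx_lin /= linearN. Qed.

Lemma mup_conj l : mup l^*%C (cpoly P) = mup l (cpoly P).
Proof.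
apply: mup_conj_real; first exact: monic_neq0 (cpoly_monic hphi).
by rewrite /cpoly -map_poly_comp; apply: eq_map_poly => a /=; rewrite /conjc /= oppr0.
Qed.

Lemma geigen_conj p l (z : cpx (gtan p)) : geigen phi P l p z -> geigen phi P l^*%C p (cpx_conj z).
Proof.
rewrite /geigen /= -/(cpoly P) mup_conj => zl.
rewrite (@iter_semiconj _ (@cpx_conj p) (fun y => cpx_lin (phi p) y - l *: y)); first by rewrite zl; congr (_, _); exact: oppr0.
by move=> t; rewrite (cpx_conjB (cpx_lin (phi p) t)) (cpx_conj_lin (phi p) t) (cpx_conjZ l t).
Qed.

(** P is real, so l and its conjugate have equal multiplicities and conjugation maps one generalized
    eigenspace onto the other. The claim is then checked on each component of z. *)
Lemma gproj_conj p l (z : cpx (gtan p)) : gproj hphi l^*%C (cpx_conj z) = cpx_conj (gproj hphi l z).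
Proof.
have G k : gproj hphi k^*%C (cpx_conj (gproj hphi k z)) = cpx_conj (gproj hphi k z).
  by apply/gprojP; apply: geigen_conj; apply/(gprojP hphi); exact: gproj_idem.
rewrite -{1}(gproj_total hphi z) cpx_conj_sum.
have S (r : seq R[i]) (F : R[i] -> cpx (gtan p)) : gproj hphi l^*%C (\sum_(k <- r) F k) = \sum_(k <- r) gproj hphi l^*%C (F k).
  by elim: r => [|k r IH]; rewrite ?big_nil ?gproj0 // !big_cons gprojD IH.
have O k : k != l -> gproj hphi l^*%C (cpx_conj (gproj hphi k z)) = 0.
  move=> kl; rewrite -G gproj_ortho //.
  by apply: contraNneq kl => /(can_inj (@conjcK R)) ->.
rewrite S; have [lE|lE] := boolP (l \in eig).
  by rewrite (bigD1_seq l) ?eigenvalues_uniq //= G big1 ?addr0.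
rewrite (gproj_notin hphi z lE) big_seq big1.
  by congr (_, _); rewrite oppr0.
by move=> k kE; apply: O; apply: contraNneq lE => <-.
Qed.

Lemma eigenvalues_conj l : l \in eig -> l^*%C \in eig.
Proof.
move=> /(mem_eigenvalues hphi) [p [x x0 xl]]; apply/(mem_eigenvalues hphi).
exists p, (cpx_conj x); last first.
  exact: (etrans (esym (cpx_conj_lin (phi p) x)) (etrans (congr1 (@cpx_conj p) xl) (cpx_conjZ l x))).
move=> /(congr1 (@cpx_conj p)); rewrite (cpx_conjK x) => xE; apply: x0; rewrite xE.
by congr (_, _); exact: oppr0.
Qed.

(** The semisimple part over the complex numbers. It commutes with conjugation because the
    eigenvalues are permuted by it, so it comes from the real endomorphism [psi_fun]. *)
Definition cpsi p (z : cpx (gtan p)) : cpx (gtan p) := \sum_(l <- eig) l *: gproj hphi l z.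

Lemma cpsi_linear p : linear (@cpsi p).
Proof.
move=> k x y; rewrite /cpsi scaler_sumr -big_split; apply: eq_bigr => l _ /=.
by rewrite gproj_linear scalerDr !scalerA mulrC.
Qed.

Lemma cpsi_conj p (z : cpx (gtan p)) : cpsi (cpx_conj z) = cpx_conj (cpsi z).
Proof.
rewrite /cpsi cpx_conj_sum.
have pe : perm_eq [seq l^*%C | l <- eig] eig.
  apply: uniq_perm; first by rewrite map_inj_uniq ?eigenvalues_uniq //; exact: (can_inj (@conjcK R)).
    exact: eigenvalues_uniq.
  move=> l; apply/mapP/idP => [[k kE ->]|lE]; first exact: eigenvalues_conj.
  by exists l^*%C; rewrite ?conjcK //; exact: eigenvalues_conj.
rewrite -(perm_big _ pe) big_map; apply: eq_bigr => l _.
by rewrite gproj_conj cpx_conjZ.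
Qed.

Definition psi_fun p (x : gtan p) : gtan p := (cpsi ((x, 0) : cpx (gtan p))).1.

Lemma cpsi_real p (x : gtan p) : cpsi ((x, 0) : cpx (gtan p)) = (psi_fun x, 0).
Proof.
have := cpsi_conj ((x, 0) : cpx (gtan p)).
have -> : cpx_conj ((x, 0) : cpx (gtan p)) = (x, 0) by congr (_, _); exact: oppr0.
rewrite /psi_fun; case: (cpsi _) => a b /= [bb]; congr (_, _).
have : (2 : R) *: b = 0.
  have -> : (2 : R) = 1 + 1 by [].
  by rewrite scalerDl scale1r {1}bb addNr.
by move/eqP; rewrite scaler_eq0 pnatr_eq0 => /eqP.
Qed.

Lemma cpsiE p (z : cpx (gtan p)) : cpsi z = (psi_fun z.1, psi_fun z.2).
Proof.
have -> : z = 'i *: ((z.2, 0) : cpx (gtan p)) + ((z.1, 0) : cpx (gtan p)).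
  rewrite cpx_scaleE /= !scale0r !scale1r [LHS]surjective_pairing.
  by congr (_, _); rewrite /= ?subr0 ?oppr0 ?addr0 ?add0r.
rewrite cpsi_linear !cpsi_real cpx_scaleE /= !scale0r !scale1r.
by congr (_, _); rewrite /= ?subr0 ?oppr0 ?addr0 ?add0r.
Qed.

Fact psi_linear p : linear (@psi_fun p).
Proof.
move=> a x y; have := cpsi_linear (a%:C%C) ((x, 0) : cpx (gtan p)) ((y, 0) : cpx (gtan p)).
have -> : a%:C%C *: ((x, 0) : cpx (gtan p)) + (y, 0) = ((a *: x + y, 0) : cpx (gtan p)).
  rewrite cpx_scaleE /= !scale0r !scaler0.
  by congr (_, _); rewrite /= ?subr0 ?addr0.
rewrite !cpsi_real cpx_scaleE /= !scale0r !scaler0 => -[-> _].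
by rewrite subr0.
Qed.
HB.instance Definition _ p := GRing.isLinear.Build R (gtan p) (gtan p) *:%R (@psi_fun p) (@psi_linear p).

Definition semisimple_part : gendo M := fun p => (@psi_fun p : {linear gtan p -> gtan p}).

Lemma cpx_lin_semisimple_part p (z : cpx (gtan p)) : cpx_lin (semisimple_part p) z = cpsi z.
Proof. by rewrite cpsiE. Qed.

Lemma cpsi_geigen p l (z : cpx (gtan p)) : geigen phi P l p z -> cpsi z = l *: z.
Proof.
move=> /(gprojP hphi) zl; rewrite /cpsi -{1}zl.
have O k : k != l -> gproj hphi k (gproj hphi l z) = 0 by exact: gproj_ortho.
have [lE|lE] := boolP (l \in eig).
  rewrite (bigD1_seq l) ?eigenvalues_uniq //= big1 ?addr0; first by rewrite gproj_idem zl.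
  by move=> k kl; rewrite O // scaler0.
rewrite -[in RHS]zl (gproj_notin hphi z lE) scaler0 big1 // => k _.
by rewrite gproj0 scaler0.
Qed.

Lemma semisimple_partP : is_semisimple_part phi P semisimple_part.
Proof.
have eigE p l (z : cpx (gtan p)) : geigen phi P l p z -> cpx_lin (semisimple_part p) z = l *: z.
  by rewrite cpx_lin_semisimple_part; exact: cpsi_geigen.
split.
- move=> U x oU sx.
  have s : smooth_cgfield U (fun p => cpsi ((x p, 0) : cpx (gtan p))).
    apply: smooth_cgfield_sum => // l; apply: smooth_cgfield_Z => //; apply: smooth_gproj => //.
    by split=> //; exact: smooth_gfield_0.
  by case: s.
- move=> p z; exists (size eig), (fun i => nth 0 eig i), (fun i => gproj hphi (nth 0 eig i) z); split.
    by move=> i; apply: eigE; apply/(gprojP hphi); exact: gproj_idem.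
  by rewrite -{1}(gproj_total hphi z) (big_nth 0) big_mkord.
move=> p l ls z; split; last exact: eigE.
rewrite cpx_lin_semisimple_part => zl; apply/(gprojP hphi).
have lE : l \in eig by apply/(mem_eigenvalues hphi).
have Z k : k \in eig -> k != l -> gproj hphi k z = 0.
  move=> kE kl; have := gproj_semisimple hphi (phis := semisimple_part) (fun q m _ => @eigE q m) z kE.
  rewrite cpx_lin_semisimple_part zl gprojZ => /eqP; rewrite -subr_eq0 -scalerBl scaler_eq0 subr_eq0.
  by rewrite eq_sym (negbTE kl) => /eqP.
rewrite -[RHS](gproj_total hphi z) (bigD1_seq l) ?eigenvalues_uniq //=.
by rewrite big_seq_cond big1 ?addr0 // => k /andP[kE kl]; exact: Z.
Qed.

End SemisimplePart.

(** By [semisimple_partE] and [semisimple_partP] the semisimple part exists and is unique, so the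
    existential in the first clause speaks of that one endomorphism. *)
Theorem theorem70 (R : realType) (n : nat) (M : smooth_manifold R n)
    (phi : gendo M) (P : {poly R}) (hphi : gen_poly_structure phi P) :
  [<->
    exists2 phis : gendo M,
      is_semisimple_part phi P phis & weak_gen_Nijenhuis phis;

    forall mu nu : R[i], spectrum phi mu -> spectrum phi nu ->
    forall (U : set M) (x y : cgfield M), open U ->
      is_section (geigen phi P mu) U x -> is_section (geigen phi P nu) U y ->
    forall p : M, U p -> exists a b : cpx (gtan p),
      [/\ geigen phi P mu p a, geigen phi P nu p b
        & (mu + nu) *: dorfmanC x y p = a + b];

    exists delta : R[i] -> sheaf_endo M,
      [/\ forall (U : set M) (w : cform M), open U -> smooth_cform U w ->
            forall p : M, U p ->
            exterior_dC w p = \sum_(lam \in spectrum phi) delta lam U w p,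
          forall lam : R[i], spectrum phi lam -> lam <> 0 ->
            has_degree (geigen phi P lam) (geigen phi P (- lam)) 1 (delta lam)
        & forall lam mu : R[i], spectrum phi lam -> spectrum phi mu ->
            mu <> 0 -> mu <> lam -> mu <> - lam ->
            has_degree (geigen phi P mu) (geigen phi P (- mu)) 0 (delta lam)]].
Proof.
tfae.
- move=> [phis [sphis _ peig] wN]; apply: (@integrable_of_local _ _ _ _ _ hphi).
  have pE p lam : spectrum phi lam -> forall x : cpx (gtan p), geigen phi P lam p x -> cpx_lin (phis p) x = lam *: x.
    by move=> sl x xl; apply/(peig p lam sl x).
  move=> c hc V oV Vc mu nu k x y muE nuE kE mn km kn mx ny.
  exact: (weak_lpr_br (hphi := hphi) sphis pE hc Vc wN muE nuE kE mn km kn mx ny).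
- move=> integrable; exists (delta hphi); split.
  + by move=> U w oU sw p Up; exact: delta_sum.
  + by move=> lam _ /eqP l0; exact: delta_degree_self.
  move=> lam mu _ /(mem_eigenvalues hphi) muE /eqP m0 /eqP ml /eqP ml'.
  exact: delta_degree_other.
(* The cycle is closed from (3) to (1) by passing through integrability; the semisimple part has to
   be produced here, as (1) asks for its existence. *)
move=> [del [dT dS dO]].
have integrable := @integrable_of_local _ _ _ _ _ hphi (decomposition_lpr_br (hphi := hphi) dT dS dO).
have ssP := semisimple_partP hphi; exists (semisimple_part hphi) => //.
case: ssP => sphis _ peig.
have pE p lam : spectrum phi lam -> forall x : cpx (gtan p), geigen phi P lam p x ->
    cpx_lin (semisimple_part hphi p) x = lam *: x.
  by move=> sl x xl; apply/(peig p lam sl x).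
move=> U x y oU sx sy p Up; have [c hc cp] := atlas_cover p.
have oV : open (U `&` chart_dom c) by apply: openI => //; exact: chart_open_dom.
have Vc : U `&` chart_dom c `<=` chart_dom c by exact: subIsetr.
have Vp : (U `&` chart_dom c) p by split.
have sx' := smooth_gfield_sub (@subIsetl _ U (chart_dom c)) sx.
have sy' := smooth_gfield_sub (@subIsetl _ U (chart_dom c)) sy.
pose x' := cut_gfield oV sx'; pose y' := cut_gfield oV sy'.
have xx q : (U `&` chart_dom c) q -> x q = x' q by move=> Vq; rewrite /x' /= cut_in.
have yy q : (U `&` chart_dom c) q -> y q = y' q by move=> Vq; rewrite /y' /= cut_in.
rewrite (shifted_CN_torsion_ext sphis oV Vp sx' sy' (local_gfield_smooth x') (local_gfield_smooth y') xx yy).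
have := integrable_shifted (hphi := hphi) sphis pE (lintegrable (hphi := hphi) hc Vc integrable) (x', 0) (y', 0).
rewrite shifted_real => /(congr1 (fun z : loc_gfields oV => z.1 p)) E.
exact: (etrans (esym (real_shiftedE sphis hc Vc x' y' Vp)) E).
Qed.
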